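(* Let $(\mathfrak g,H,\mathcal G_g)$ be a four-dimensional generalised Lorentzian Lie algebra such that the commutator ideal $\mathfrak g'=[\mathfrak g,\mathfrak g]$ is non-degenerate. Then $(\mathfrak g,H,\mathcal G_g)$ is generalised Einstein for zero divergence $\delta=0$ if and only if (A) or (B) holds: (A) $\mathfrak g$ is almost Abelian, $H=0$, and there is a codimension one Abelian ideal $\mathfrak n$ of $\mathfrak g$ such that one of the following holds, where in (A1)–(A3) $X\in\mathfrak n^\perp$ with $g(X,X)\in\{-1,1\}$ and $f=\mathrm{ad}_X|_{\mathfrak n}$: (A1) $\mathfrak n$ is positive definite and $f=\mathrm{diag}(L_1(0,a),0)$ for some $a\in\mathbb R$ with respect to an orthonormal basis of $\mathfrak n$; (A2) $\mathfrak n$ is Lorentzian and $f=M_3(\sigma)$ for some $\sigma\in\mathbb R\setminus\{0\}$ with respect to an orthonormal basis $(e_1,e_2,e_3)$ of $\mathfrak n$ with $g(e_1,e_1)=-1$; (A3) $\mathfrak n$ is Lorentzian and $f=\mathrm{diag}\bigl(L_1(\alpha,\sqrt{\alpha^2+a^2/2}),a\bigr)$ for some $(\alpha,a)\in\mathbb R^2\setminus\{(0,0)\}$ with respect to an orthonormal basis $(e_1,e_2,e_3)$ of $\mathfrak n$ with $g(e_1,e_1)=-1$; (A4) $\mathfrak n$ is degenerate and there are a basis $(e_1,e_2,e_3)$ of $\mathfrak n$ and $X\in\mathfrak g$ with $g(e_1,e_1)=g(e_2,e_2)=g(e_3,X)=1$ and all other scalar products among $e_1,e_2,e_3,X$ zero,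 such that $\mathrm{ad}_X|_{\mathfrak n}=\begin{pmatrix}0&-a&0\\ a&0&0\\ b_1&b_2&0\end{pmatrix}$ with respect to $(e_1,e_2,e_3)$ for certain $a,b_1,b_2\in\mathbb R$ with $a\ne0$ or $a=b_1=b_2=0$. (B) One of the following holds: (B1) $\mathfrak g\cong\mathfrak{so}(3)\oplus\mathbb R$, $\mathfrak g'\cong\mathfrak{so}(3)$ is positive definite and there exist $a\in\mathbb R\setminus\{0\}$, $b\in\mathbb R$, $\epsilon\in\{-1,1\}$ and an orthonormal basis $(e_1,\dots,e_4)$ of $\mathfrak g$ such that $(e_1,e_2,e_3)$ is a basis of $\mathfrak g'$, $H=a\,e^{123}$ and, up to anti-symmetry, the only non-zero Lie brackets are $[e_1,e_2]=\epsilon a\,e_3$, $[e_2,e_3]=\epsilon a\,e_1$, $[e_3,e_1]=\epsilon a\,e_2$, $[e_3,e_4]=b\,e_2$, $[e_4,e_2]=b\,e_3$; (B2) $\mathfrak g\cong\mathfrak{so}(2,1)\oplus\mathbb R$, $\mathfrak g'\cong\mathfrak{so}(2,1)$ is Lorentzian and there exist $a\in\mathbb R\setminus\{0\}$, $\epsilon\in\{-1,1\}$ and an orthonormal basis $(e_1,\dots,e_4)$ of $\mathfrak g$ such that $(e_1,e_2,e_3)$ is a basis of $\mathfrak g'$ with $g(e_1,e_1)=-1$, $H=a\,e^{123}$ and, up to anti-symmetry, the only non-zero Lie brackets are $[e_1,e_2]=\epsilon a\,e_3$, $[e_2,e_3]=-\epsilon a\,e_1$, $[e_3,e_1]=\epsilon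 a\,e_2$ together with exactly one of: ($\alpha$) $[e_4,e_2]=b\,e_3$, $[e_4,e_3]=-b\,e_2$ for some $b\in\mathbb R$; ($\beta$) $[e_4,e_1]=b\,e_2$, $[e_4,e_2]=b\,e_1$ for some $b\in\mathbb R\setminus\{0\}$; ($\gamma$) $[e_4,e_1]=e_2$, $[e_4,e_2]=e_1+e_3$, $[e_4,e_3]=-e_2$. In particular, a four-dimensional Lie algebra $\mathfrak g$ admits a generalised Lorentzian metric $(H,\mathcal G_g)$ with non-degenerate commutator ideal which is generalised Einstein for zero divergence if and only if $\mathfrak g$ is isomorphic to $\mathbb R^4$, $\mathfrak e(2)\oplus\mathbb R$, $\mathfrak e(1,1)\oplus\mathbb R$, $A_{4,6}^{\sqrt2\cos\varphi,\sin\varphi}$ for some $\varphi\in\mathbb R$, $\mathfrak r'_{3,1}\oplus\mathbb R$, $\mathfrak{so}(3)\oplus\mathbb R$ or $\mathfrak{so}(2,1)\oplus\mathbb R$.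
   Context: Let $\mathfrak g$ be a finite-dimensional real Lie algebra. A generalised pseudo-Riemannian metric on $\mathfrak g$ is a pair $(H,\mathcal G_g)$ where $H\in\Lambda^3\mathfrak g^*$ is closed for the Chevalley–Eilenberg differential (normalised by $d\alpha(X,Y)=-\alpha([X,Y])$), $g$ is a non-degenerate symmetric bilinear form on $\mathfrak g$, and $\mathcal G_g$ is the endomorphism of $E=\mathfrak g\oplus\mathfrak g^*$ given by $\mathcal G_g(X+\xi)=\xi^\sharp+X^\flat$, with $X^\flat=g(X,\cdot)$ and $\sharp=\flat^{-1}$; it is Lorentzian if $g$ has signature $(n-1,1)$, $n=\dim\mathfrak g$. Let $E_\pm=\{X\pm X^\flat\mid X\in\mathfrak g\}$ be the $\pm1$-eigenspaces of $\mathcal G_g$ and $\pi_\pm=\frac12(\mathrm{id}\pm\mathcal G_g):E\to E_\pm$. The $H$-twisted Dorfman bracket on $E$ is $[X+\xi,Y+\eta]_H=[X,Y]+d\eta(X,\cdot)-d\xi(Y,\cdot)+H(X,Y,\cdot)$. For $u\in E_+$, $v\in E_-$ put $\Gamma_u=\pi_+\circ[u,\cdot]_H|_{E_-}:E_-\to E_+$ and $\Gamma_v=\pi_-\circ[v,\cdot]_H|_{E_+}:E_+\to E_-$. For a divergence operator $\delta\in E^*$ the generalised Ricci curvatures are, by a known result taken here as definition, $\mathcal{RC}^+(v,u)=-\mathrm{tr}(\Gamma_v\circ\Gamma_u)+\delta(\pi_+[v,u]_H)$ and $\mathcal{RC}^-(u,v)=-\mathrm{tr}(\Gamma_v\circ\Gamma_u)+\delta(\pi_-[u,v]_H)$;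 $(\mathfrak g,H,\mathcal G_g,\delta)$ is generalised Einstein if both vanish identically. For $\delta=0$ this means $\mathrm{tr}(\Gamma_v\circ\Gamma_u)=0$ for all $u\in E_+$, $v\in E_-$. A Lie algebra is almost Abelian if it has a codimension one Abelian ideal. A subspace is (non-)degenerate, positive definite or Lorentzian according to the restriction of $g$; the zero subspace counts as non-degenerate. Matrices act on columns of coordinates ($f(e_j)=\sum_if_{ij}e_i$); diag denotes block-diagonal matrices; $$L_1(\alpha,\beta)=\begin{pmatrix}\alpha&-\beta\\ \beta&\alpha\end{pmatrix},\qquad M_3(\sigma)=\begin{pmatrix}0&0&-1+\sigma\\ 0&0&-1-\sigma\\ -1+\sigma&1+\sigma&0\end{pmatrix}.$$ $e^{123}=e^1\wedge e^2\wedge e^3$, $e^{ij}=e^i\wedge e^j$ in the dual basis. The Lie algebras are specified by $(de^1,de^2,de^3,de^4)$ for a basis of the dual: $\mathfrak e(2)\oplus\mathbb R$: $(e^{23},-e^{13},0,0)$; $\mathfrak e(1,1)\oplus\mathbb R$: $(e^{23},e^{13},0,0)$; $A_{4,6}^{\alpha,\beta}$: $(\alpha e^{14},\beta e^{24}+e^{34},\beta e^{34}-e^{24},0)$; $\mathfrak r'_{3,1}\oplus\mathbb R$: $(e^{14}+e^{24},-e^{14}+e^{24},0,0)$; $\mathbb R^4$ is Abelian. *)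

(* Defs.v *)
From HB Require Import structures.
From mathcomp Require Import all_boot all_order all_algebra.
From mathcomp Require Import ring.
From mathcomp Require Import all_reals trigo.

Set Implicit Arguments.
Unset Strict Implicit.
Unset Printing Implicit Defensive.

Import Order.TTheory GRing.Theory Num.Theory.
Local Open Scope ring_scope.

Definition is_lie_bracket (R : fieldType) (V : vectType R) (br : V -> V -> V) :=
  [/\ forall y, linear (br^~ y),
      forall x, linear (br x),
      forall x, br x x = 0 &
      forall x y z, br x (br y z) + br y (br z x) + br z (br x y) = 0].

Record lieAlgebra (R : fieldType) := LieAlgebra {
  lie_space :> vectType R;
  lie_br : lie_space -> lie_space -> lie_space;
  lie_brP : is_lie_bracket lie_br
}.

Section LieBasics.
Variable R : fieldType.
Implicit Types g h : lieAlgebra R.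

Lemma lie_br_bilinear g :
  bilinear_for (GRing.Scale.Law.clone _ _ *:%R _)
               (GRing.Scale.Law.clone _ _ *:%R _) (@lie_br R g).
Proof. by case: (lie_brP g). Qed.

HB.instance Definition _ g :=
  bilinear_isBilinear.Build R g g g _ _ (@lie_br R g) (lie_br_bilinear g).

Definition lie_iso g h :=
  exists f : {linear g -> h},
    bijective f /\ forall x y, f (lie_br x y) = lie_br (f x) (f y).

Definition lie_subalgebra g (U : {vspace g}) :=
  forall x y, x \in U -> y \in U -> lie_br x y \in U.

Definition lie_ideal g (U : {vspace g}) := forall x y, y \in U -> lie_br x y \in U.

Definition lie_abelian g (U : {vspace g}) :=
  forall x y, x \in U -> y \in U -> lie_br x y = 0.

Definition codim1_abelian_ideal g (n : {vspace g}) :=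
  [/\ (\dim n).+1 = \dim {:g}, lie_ideal n & lie_abelian n].

Definition almost_abelian g := exists n : {vspace g}, codim1_abelian_ideal n.

(* [g, g], presented by finitely many generators like [prodv] of falgebra;
   [mem_derived] below shows that it contains every bracket. *)
Definition derived g : {vspace g} :=
  <<allpairs (@lie_br R g) (vbasis {:g}) (vbasis {:g})>>%VS.

Lemma mem_derived g (x y : g) : lie_br x y \in derived g.
Proof.
rewrite (coord_vbasis (memvf x)) (coord_vbasis (memvf y)).
rewrite linear_sumlz; apply: memv_suml => i _.
rewrite linear_sumr; apply: memv_suml => j _.
rewrite linearZl_LR linearZr_LR !memvZ //; apply: memv_span.
by apply: allpairs_f; rewrite mem_nth // size_tuple.
Qed.

Lemma derived_subalgebra g : lie_subalgebra (derived g).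
Proof. by move=> x y _ _; apply: mem_derived. Qed.

Section SubLie.
Variables (g : lieAlgebra R) (U : {vspace g}) (subU : lie_subalgebra U).

Definition sub_br (x y : subvs_of U) : subvs_of U :=
  vsproj U (lie_br (vsval x) (vsval y)).

Lemma vsval_sub_br x y : vsval (sub_br x y) = lie_br (vsval x) (vsval y).
Proof. by rewrite vsprojK // subU ?subvsP. Qed.

Lemma sub_brP : is_lie_bracket sub_br.
Proof.
have [_ _ alt jac] := lie_brP g.
split=> [y a x x'|x a y y'|x|x y z].
- by rewrite /sub_br linearP linearDl linearZl_LR linearP.
- by rewrite /sub_br linearP linearDr linearZr_LR linearP.
- by rewrite /sub_br alt linear0.
- by apply: subvs_inj; rewrite !linearD linear0 /= !vsval_sub_br jac.
Qed.

Definition sub_lie := LieAlgebra sub_brP.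
End SubLie.

Definition derived_lie g := sub_lie (@derived_subalgebra g).

Section AbLie.
Variable V : vectType R.
Definition ab_br (_ _ : V) : V := 0.

Lemma ab_brP : is_lie_bracket ab_br.
Proof.
split=> [y a u v|x a u v|x|x y z] //=.
- by rewrite /ab_br scaler0 addr0.
- by rewrite /ab_br scaler0 addr0.
- by rewrite /ab_br !addr0.
Qed.

Definition ab_lie := LieAlgebra ab_brP.
End AbLie.

Section SumLie.
Variables g h : lieAlgebra R.
Definition sum_br (x y : (g * h)%type) : (g * h)%type :=
  (lie_br x.1 y.1, lie_br x.2 y.2).

Lemma sum_brP : is_lie_bracket sum_br.
Proof.
have [_ _ altg jacg] := lie_brP g; have [_ _ alth jach] := lie_brP h.
split=> [y a x x'|x a y y'|x|x y z]; rewrite /sum_br /=.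
- by rewrite !linearDl !linearZl_LR.
- by rewrite !linearDr !linearZr_LR.
- by rewrite altg alth.
- by congr pair; rewrite /= ?jacg ?jach.
Qed.

Definition sum_lie := LieAlgebra sum_brP.
End SumLie.

End LieBasics.

Section Models.
Variable R : fieldType.

Section GlSo.
Variable n : nat.
Definition gl_br (A B : 'M[R]_n) : 'M[R]_n := A *m B - B *m A.

Lemma gl_brP : is_lie_bracket gl_br.
Proof.
split=> [B a A A'|A a B B'|A|A B C]; rewrite /gl_br.
- by rewrite mulmxDl mulmxDr -scalemxAl -scalemxAr scalerBr opprD addrACA.
- by rewrite mulmxDl mulmxDr -scalemxAl -scalemxAr scalerBr opprD addrACA.
- by rewrite subrr.
- rewrite !mulmxBl !mulmxBr !mulmxA !opprB.
  set a := A *m B *m C; set b := A *m C *m B; set c := B *m C *m A.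
  set d := C *m B *m A; set e := B *m A *m C; set f := C *m A *m B.
  by apply/matrixP=> i j; rewrite !mxE; ring.
Qed.

Definition gl_lie := LieAlgebra gl_brP.

Definition so_space (J : 'M[R]_n) : {vspace gl_lie} :=
  lker (linfun (fun A : 'M[R]_n => A^T *m J + J *m A)).

Lemma mem_so J (A : 'M[R]_n) :
  (A \in so_space J) = (A^T *m J + J *m A == 0).
Proof.
have lin : linear (fun A : 'M[R]_n => A^T *m J + J *m A).
  move=> a X Y; rewrite linearP /= mulmxDl mulmxDr -scalemxAl -scalemxAr.
  by rewrite scalerDr addrACA.
pose F := GRing.isLinear.Build _ _ _ _ _ lin.
pose f : {linear 'M[R]_n -> 'M[R]_n} :=
  HB.pack (fun A : 'M[R]_n => A^T *m J + J *m A) F.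
by rewrite memv_ker (lfunE f).
Qed.

Lemma so_subalgebra J : lie_subalgebra (so_space J).
Proof.
move=> A B; rewrite !mem_so => /eqP hA /eqP hB; apply/eqP.
have eA : A^T *m J = - (J *m A) by apply/eqP; rewrite -addr_eq0 hA.
have eB : B^T *m J = - (J *m B) by apply/eqP; rewrite -addr_eq0 hB.
rewrite /= /gl_br linearB /= !trmx_mul mulmxBl mulmxBr -!mulmxA eA eB.
rewrite !mulmxN !mulmxA eA eB !mulNmx !opprK.
by rewrite -!mulmxA -opprB addNr.
Qed.

Definition so_lie J := sub_lie (@so_subalgebra J).
End GlSo.

Definition so3 := so_lie (1%:M : 'M[R]_3).
Definition so21 := so_lie (diag_mx (\row_(i < 3) [:: 1; 1; -1]`_i) : 'M[R]_3).

(* Below, [cd i x] is the i-th coordinate of x, counting from 1, and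
   [ed i j] is e^{ij} = e^i /\ e^j.  As d alpha (x, y) = - alpha [x, y], an
   algebra specified by (de^1, ..., de^4) has the bracket
   [x, y] = - sum_i de^i(x, y) e_i. *)
Definition cd (i : nat) (x : 'rV[R]_4) : R := x 0 (inord i.-1).
Definition ed (i j : nat) (x y : 'rV[R]_4) : R := cd i x * cd j y - cd j x * cd i y.
Definition row4 (a b c d : R) : 'rV[R]_4 := \row_(i < 4) [:: a; b; c; d]`_i.

Lemma cdP i a x y : cd i (a *: x + y) = a * cd i x + cd i y.
Proof. by rewrite /cd !mxE. Qed.

Lemma cdN i x : cd i (- x) = - cd i x.
Proof. by rewrite /cd !mxE. Qed.

Lemma cd_row4 a b c d :
  (cd 1 (row4 a b c d) = a) * (cd 2 (row4 a b c d) = b) *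
  (cd 3 (row4 a b c d) = c) * (cd 4 (row4 a b c d) = d).
Proof. by rewrite /cd !mxE !inordK. Qed.

Definition e2R_br x y : 'rV[R]_4 :=
  - row4 (ed 2 3 x y) (- ed 1 3 x y) 0 0.

Definition e11R_br x y : 'rV[R]_4 :=
  - row4 (ed 2 3 x y) (ed 1 3 x y) 0 0.

Definition A46_br (alpha beta : R) x y : 'rV[R]_4 :=
  - row4 (alpha * ed 1 4 x y) (beta * ed 2 4 x y + ed 3 4 x y)
         (beta * ed 3 4 x y - ed 2 4 x y) 0.

Definition r31R_br x y : 'rV[R]_4 :=
  - row4 (ed 1 4 x y + ed 2 4 x y) (- ed 1 4 x y + ed 2 4 x y) 0 0.

Local Ltac lie4 br :=
  split=> [y a u v|x a u v|x|x y z]; rewrite /br /ed /= ?cdN ?cd_row4 ?cdP;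
  apply/rowP; case; do 4?[case=> //]; move=> ?; rewrite !mxE /=; ring.

Lemma e2R_brP : is_lie_bracket e2R_br. Proof. by lie4 e2R_br. Qed.
Lemma e11R_brP : is_lie_bracket e11R_br. Proof. by lie4 e11R_br. Qed.
Lemma A46_brP alpha beta : is_lie_bracket (A46_br alpha beta).
Proof. by lie4 A46_br. Qed.
Lemma r31R_brP : is_lie_bracket r31R_br. Proof. by lie4 r31R_br. Qed.

Definition e2R := LieAlgebra e2R_brP.
Definition e11R := LieAlgebra e11R_brP.
Definition A46 alpha beta := LieAlgebra (A46_brP alpha beta).
Definition r31R := LieAlgebra r31R_brP.

End Models.

Definition lfun_tr (R : fieldType) (W : vectType R) (f : 'End(W)) : R :=
  \sum_(i < \dim {:W}) coord (vbasis {:W}) i (f (vbasis {:W})`_i).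

Record form3 (R : fieldType) (V : vectType R) := Form3 {
  form3_fun :> V -> V -> V -> R;
  form3_lin1 : forall y z, scalar (fun x => form3_fun x y z);
  form3_lin2 : forall x z, scalar (fun y => form3_fun x y z);
  form3_lin3 : forall x y, scalar (fun z => form3_fun x y z);
  form3_alt12 : forall x z, form3_fun x x z = 0;
  form3_alt23 : forall x z, form3_fun x z z = 0
}.

Section GenMetric.
Variables (R : realType) (g : lieAlgebra R).

Local Notation dual := 'Hom(g, R^o).
Local Notation E := (g * 'Hom(g, R^o))%type.

(* The Chevalley-Eilenberg differential on 1- and 3-forms:
   dw(x_0, ..., x_k) = sum_(i < j) (-1)^(i+j) w([x_i, x_j], ..., no x_i, x_j). *)
Definition ce_d1 (al : dual) (x y : g) : R := - al (lie_br x y).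

Definition ce_d3 (w : form3 g) (x0 x1 x2 x3 : g) : R :=
  - w (lie_br x0 x1) x2 x3 + w (lie_br x0 x2) x1 x3 - w (lie_br x0 x3) x1 x2
  - w (lie_br x1 x2) x0 x3 + w (lie_br x1 x3) x0 x2 - w (lie_br x2 x3) x0 x1.

(* The pair (H, G_g) is stored as (H, g); [gen_op] below is G_g. *)
Record gen_metric := GenMetric {
  gm_H : form3 g;
  gm_g : {symmetric g};
  gm_closed : forall x0 x1 x2 x3, ce_d3 gm_H x0 x1 x2 x3 = 0;
  gm_nondeg : nondegenerate gm_g
}.

Section Curvature.
Variable G : gen_metric.

Definition flat : 'Hom(g, dual) :=
  linfun (fun x : g => linfun (fun y : g => gm_g G x y : R^o)).
Definition sharp : 'Hom(dual, g) := (flat^-1)%VF.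

Lemma flatE x y : flat x y = gm_g G x y.
Proof.
have lin2 x' : linear (fun y : g => gm_g G x' y : R^o).
  by move=> a u v; rewrite linearDr linearZr_LR.
pose f2 x' : {linear g -> R^o} := HB.pack (fun y : g => gm_g G x' y : R^o)
  (GRing.isLinear.Build _ _ _ _ _ (lin2 x')).
have E2 x' z : (linfun (fun y : g => gm_g G x' y : R^o)) z = gm_g G x' z.
  exact: (lfunE (f2 x')).
have lin1 : linear (fun x : g => linfun (fun y : g => gm_g G x y : R^o)).
  move=> a u v; apply/lfunP => z; rewrite add_lfunE scale_lfunE !E2.
  by rewrite linearDl linearZl_LR.
pose f1 : {linear g -> dual} :=
  HB.pack (fun x : g => linfun (fun y : g => gm_g G x y : R^o))
    (GRing.isLinear.Build _ _ _ _ _ lin1).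
by rewrite /flat (lfunE f1) E2.
Qed.

Lemma flatK : cancel flat sharp.
Proof.
apply: lker0_lfunK; rewrite -subv0; apply/subvP => x; rewrite memv_ker => /eqP fx0.
rewrite -(eqP (gm_nondeg G)); apply/mem_orthovP => y _.
by rewrite -flatE fx0 lfunE.
Qed.

Definition gen_op : 'End(E) := linfun (fun u : E => (sharp u.2, flat u.1) : E).

Lemma gen_opE u : gen_op u = (sharp u.2, flat u.1).
Proof.
have lin : linear (fun u : E => (sharp u.2, flat u.1) : E).
  by move=> a v w; rewrite /= !linearP.
pose f : {linear E -> E} := HB.pack (fun u : E => (sharp u.2, flat u.1) : E)
  (GRing.isLinear.Build _ _ _ _ _ lin).
exact: (lfunE f).
Qed.

Definition E_plus : {vspace E} := limg (linfun (fun x : g => (x, flat x) : E)).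
Definition E_minus : {vspace E} := limg (linfun (fun x : g => (x, - flat x) : E)).

Definition pi_plus : 'End(E) := 2^-1 *: (\1%VF + gen_op).
Definition pi_minus : 'End(E) := 2^-1 *: (\1%VF - gen_op).

Definition dorfman (u v : E) : E :=
  (lie_br u.1 v.1,
   linfun (fun z : g =>
     ce_d1 v.2 u.1 z - ce_d1 u.2 v.1 z + gm_H G u.1 v.1 z : R^o)).

Definition Gamma_plus (u : E) : 'Hom(subvs_of E_minus, subvs_of E_plus) :=
  linfun (fun w : subvs_of E_minus =>
    vsproj E_plus (pi_plus (dorfman u (vsval w)))).

Definition Gamma_minus (v : E) : 'Hom(subvs_of E_plus, subvs_of E_minus) :=
  linfun (fun w : subvs_of E_plus =>
    vsproj E_minus (pi_minus (dorfman v (vsval w)))).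

Definition RC_plus (delta : 'Hom(E, R^o)) (v u : E) : R :=
  - lfun_tr (Gamma_minus v \o Gamma_plus u)%VF + delta (pi_plus (dorfman v u)).

Definition RC_minus (delta : 'Hom(E, R^o)) (u v : E) : R :=
  - lfun_tr (Gamma_minus v \o Gamma_plus u)%VF + delta (pi_minus (dorfman u v)).

Definition gen_Einstein (delta : 'Hom(E, R^o)) :=
  forall u v, u \in E_plus -> v \in E_minus ->
    RC_plus delta v u = 0 /\ RC_minus delta u v = 0.

Let q := gm_g G.

Definition nondegenerate_on (U : {vspace g}) := (U :&: orthov q U == 0)%VS.

Definition positive_definite_on (U : {vspace g}) :=
  forall x, x \in U -> x != 0 -> 0 < q x x.

(* g(e_i, e_i) is 1 or -1; the library's [orthonormal] only allows 1. *)
Definition pseudo_orthonormal (s : seq g) :=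
  all (fun x => (q x x == 1) || (q x x == -1)) s
  && pairwise (fun x y => q x y == 0) s.

Definition orthonormal_basis_of (U : {vspace g}) (s : seq g) :=
  basis_of U s && pseudo_orthonormal s.

Definition Lorentzian_on (U : {vspace g}) :=
  exists s : seq g, [/\ orthonormal_basis_of U s,
    count (fun x => q x x == 1) s = (\dim U).-1 &
    count (fun x => q x x == -1) s = 1%N].

Definition Lorentzian := Lorentzian_on {:g}.

End Curvature.
End GenMetric.

Section NormalForms.
Variable R : realType.

Definition mx_of_rows m n (s : seq (seq R)) : 'M[R]_(m, n) :=
  \matrix_(i < m, j < n) (nth [::] s i)`_j.

Definition L1 (alpha beta : R) : 'M[R]_2 :=
  mx_of_rows 2 2 [:: [:: alpha; - beta];
                     [:: beta;  alpha]].

Definition diag_L1 (alpha beta c : R) : 'M[R]_3 :=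
  block_mx (L1 alpha beta) 0 0 (c%:M : 'M[R]_1) : 'M[R]_(2 + 1).

Definition M3 (sigma : R) : 'M[R]_3 :=
  mx_of_rows 3 3 [:: [:: 0;          0;         -1 + sigma];
                     [:: 0;          0;         -1 - sigma];
                     [:: -1 + sigma; 1 + sigma; 0]].

Definition A4mx (a b1 b2 : R) : 'M[R]_3 :=
  mx_of_rows 3 3 [:: [:: 0;  - a; 0];
                     [:: a;  0;   0];
                     [:: b1; b2;  0]].

Variables (g : lieAlgebra R) (G : gen_metric g).
Let q := gm_g G.
Let H := gm_H G.
Let g' := derived g.

(* Columns of coordinates: f(e_j) = sum_i M_ij e_i. *)
Definition acts_by n (f : g -> g) (s : seq g) (M : 'M[R]_n) :=
  forall j : 'I_n, f s`_j = \sum_(i < n) M i j *: s`_i.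

Definition unit_normal_ad (n : {vspace g}) (s : seq g) (M : 'M[R]_3) :=
  exists X : g,
    [/\ X \in orthov q n, q X X = 1 \/ q X X = -1,
        orthonormal_basis_of G n s & acts_by (lie_br X) s M].

Definition case_A1 (n : {vspace g}) :=
  positive_definite_on G n /\
  exists (e1 e2 e3 : g) (a : R),
    unit_normal_ad n [:: e1; e2; e3] (diag_L1 0 a 0).

Definition case_A2 (n : {vspace g}) :=
  Lorentzian_on G n /\
  exists (e1 e2 e3 : g) (sigma : R),
    [/\ sigma != 0, q e1 e1 = -1 &
        unit_normal_ad n [:: e1; e2; e3] (M3 sigma)].

Definition case_A3 (n : {vspace g}) :=
  Lorentzian_on G n /\
  exists (e1 e2 e3 : g) (alpha a : R),
    [/\ (alpha, a) != (0, 0), q e1 e1 = -1 &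
        unit_normal_ad n [:: e1; e2; e3]
          (diag_L1 alpha (Num.sqrt (alpha ^+ 2 + a ^+ 2 / 2)) a)].

Definition case_A4 (n : {vspace g}) :=
  ~ nondegenerate_on G n /\
  exists e1 e2 e3 X : g,
    [/\ basis_of n [:: e1; e2; e3],
        [/\ q e1 e1 = 1, q e2 e2 = 1 & q e3 X = 1],
        [/\ q e1 e2 = 0, q e1 e3 = 0, q e1 X = 0, q e2 e3 = 0 & q e2 X = 0],
        q e3 e3 = 0 /\ q X X = 0 &
        exists a b1 b2 : R,
          (a != 0 \/ [/\ a = 0, b1 = 0 & b2 = 0]) /\
          acts_by (lie_br X) [:: e1; e2; e3] (A4mx a b1 b2)].

Definition case_A :=
  [/\ almost_abelian g,
      forall x y z, H x y z = 0 &
      exists n : {vspace g}, codim1_abelian_ideal n /\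
        [\/ case_A1 n, case_A2 n, case_A3 n | case_A4 n]].

(* [H_is_e123 a e1 e2 e3 e4] says H = a e^{123} = a e^1 /\ e^2 /\ e^3 in the
   basis dual to (e1, e2, e3, e4), normalised by e^{123}(e1, e2, e3) = 1. *)
Definition H_is_e123 (a : R) (e1 e2 e3 e4 : g) :=
  let e := [tuple e1; e2; e3; e4] in
  forall x y z : g,
    H x y z = a * \det (\matrix_(i < 3, j < 3)
      coord e (widen_ord (leqnSn 3) i) [:: x; y; z]`_j).

Definition case_B1 :=
  [/\ lie_iso g (sum_lie (so3 R) (ab_lie R^o)),
      lie_iso (derived_lie g) (so3 R),
      positive_definite_on G g' &
      exists (a b eps : R) (e1 e2 e3 e4 : g),
        [/\ a != 0 /\ (eps = 1 \/ eps = -1),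
            orthonormal_basis_of G {:g} [:: e1; e2; e3; e4],
            basis_of g' [:: e1; e2; e3],
            H_is_e123 a e1 e2 e3 e4 &
            [/\ lie_br e1 e2 = (eps * a) *: e3,
                lie_br e2 e3 = (eps * a) *: e1 &
                lie_br e3 e1 = (eps * a) *: e2] /\
            [/\ lie_br e3 e4 = b *: e2,
                lie_br e4 e2 = b *: e3 &
                lie_br e4 e1 = 0]]].

Definition case_B2_alpha (e1 e2 e3 e4 : g) := exists b : R,
  [/\ lie_br e4 e1 = 0,
      lie_br e4 e2 = b *: e3 &
      lie_br e4 e3 = - b *: e2].

Definition case_B2_beta (e1 e2 e3 e4 : g) := exists b : R, b != 0 /\
  [/\ lie_br e4 e1 = b *: e2,
      lie_br e4 e2 = b *: e1 &
      lie_br e4 e3 = 0].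

Definition case_B2_gamma (e1 e2 e3 e4 : g) :=
  [/\ lie_br e4 e1 = e2,
      lie_br e4 e2 = e1 + e3 &
      lie_br e4 e3 = - e2].

(* No exclusive "or" is needed: [e4, e1] vanishes only in case_B2_alpha, and
   [e4, e3] separates case_B2_beta from case_B2_gamma. *)
Definition case_B2 :=
  [/\ lie_iso g (sum_lie (so21 R) (ab_lie R^o)),
      lie_iso (derived_lie g) (so21 R),
      Lorentzian_on G g' &
      exists (a eps : R) (e1 e2 e3 e4 : g),
        [/\ a != 0 /\ (eps = 1 \/ eps = -1),
            orthonormal_basis_of G {:g} [:: e1; e2; e3; e4] /\ q e1 e1 = -1,
            basis_of g' [:: e1; e2; e3],
            H_is_e123 a e1 e2 e3 e4 &
            [/\ lie_br e1 e2 = (eps * a) *: e3,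
                lie_br e2 e3 = - (eps * a) *: e1 &
                lie_br e3 e1 = (eps * a) *: e2] /\
            [\/ case_B2_alpha e1 e2 e3 e4,
                case_B2_beta e1 e2 e3 e4 |
                case_B2_gamma e1 e2 e3 e4]]].

Definition case_B := case_B1 \/ case_B2.

End NormalForms.

Definition iso_to_listed (R : realType) (g : lieAlgebra R) : Prop :=
  lie_iso g (ab_lie 'rV[R]_4) \/
  lie_iso g (e2R R) \/
  lie_iso g (e11R R) \/
  (exists phi : R, lie_iso g (A46 (Num.sqrt 2 * cos phi) (sin phi))) \/
  lie_iso g (r31R R) \/
  lie_iso g (sum_lie (so3 R) (ab_lie R^o)) \/
  lie_iso g (sum_lie (so21 R) (ab_lie R^o)).

(* Main.v *)
(* Evaluated on a basis f of g, the condition tr(Gamma_v o Gamma_u) = 0 is a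
   system of quadratic equations in the numbers L_ijk = g([f_i, f_j], f_k) and
   H(f_i, f_j, f_k), to be solved together with the Jacobi identity and
   dH = 0. Choose f adapted to g' and its orthogonal complement. If
   dim g' = 4, then g is unimodular and the forms de^k span a four-dimensional
   isotropic subspace of Lambda^2 g^*, where the wedge pairing has signature
   (3, 3): impossible. If dim g' = 2, the trace of ad vanishes on g', so g' is
   Abelian; the equations force H = 0 and that the complement acts on g'
   either by skew endomorphisms or through a single vector, whence (A). If
   dim g' = 3, the bracket of g' is a symmetric endomorphism S composed with
   the cross product of g'; running through the normal forms of S over a
   Euclidean or Minkowski space, the equations leave S = 0, when the same
   normal forms for the symmetric part of ad_X give (A3), or S a multiple of
   the identity, when the complement acts by a skew endomorphism, whose axis
   gives the subcases of (B). *)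
From HB Require Import structures.
Require Import Defs.
From mathcomp Require Import all_boot all_order all_algebra.
From mathcomp Require Import ring lra.
From mathcomp Require Import all_reals trigo.

Set Implicit Arguments.
Unset Strict Implicit.
Unset Printing Implicit Defensive.

Import Order.TTheory GRing.Theory Num.Theory.
Local Open Scope ring_scope.

(** The equations are quadratic in up to 28 unknowns; they become tractable because in a well chosen
    frame each reduction is a factorisation, a sum of squares, or division by a nonzero factor.
    Exchanging the two arguments of the trace amounts to changing the sign of [H], so an
    off-diagonal equation splits into a part even in [H] and a part bilinear in the brackets and
    [H]. Nondegeneracy of g' enters twice: it gives an orthogonal complement, and it forbids a
    nonzero vector of g' orthogonal to all brackets. Most impossible branches end with such a
    vector, for instance the kernel vector of a skew matrix of order three.

    The obstacle is the signature. A timelike direction normal to g' yields an equation that is a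
    sum of squares; a timelike direction inside g' allows symmetric endomorphisms that are not
    diagonalisable and distinguished vectors that are null, so null frames accompany the orthonormal
    ones. The causal character of one vector, the kernel of an action or the axis of a skew
    endomorphism, separates many of the subcases. A derived line is impossible; a vanishing derived
    algebra forces [H = 0] and falls under (A1). *)

(** * The curvature, Jacobi and closedness equations in structure constants *)

Definition sum4 (V : nmodType) (F : nat -> V) : V :=
  F 0%N + F 1%N + F 2%N + F 3%N.

Lemma big_ord4 (V : nmodType) (F : nat -> V) :
  \sum_(i < 4) F i = sum4 F.
Proof. by rewrite !big_ord_recr big_ord0 /= add0r. Qed.

Lemma eq_sum4 (V : nmodType) (F1 F2 : nat -> V) :
  (forall i, (i < 4)%N -> F1 i = F2 i) -> sum4 F1 = sum4 F2.
Proof. by move=> eqF; rewrite /sum4 !eqF. Qed.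

Section EinSum.
Variables (R : nzRingType) (s : nat -> nat) (eps : nat -> R).
Variables (L h : nat -> nat -> nat -> R).

(** For a frame with [q (f i) (f j)] equal to [eps i] if [j = s i] and to zero otherwise, the dual
    basis is [eps i *: f (s i)], and this is four times the trace of [Gamma_v] after [Gamma_u] for
    the lifts [u], [v] of [f x], [f y]. *)
Definition ein x y := sum4 (fun i => sum4 (fun j => eps i * eps j *
  ((L x i j + L x j i + L i j x + h x i j) *
   (L y (s j) (s i) + L y (s i) (s j) + L (s j) (s i) y - h y (s j) (s i))))).

Definition jac i j k l := sum4 (fun m => eps m *
  (L j k (s m) * L i m l + L k i (s m) * L j m l + L i j (s m) * L k m l)).

Definition clo i j k l := sum4 (fun m => eps m *
  (- (L i j (s m) * h m k l) + L i k (s m) * h m j l - L i l (s m) * h m j k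
   - L j k (s m) * h m i l + L j l (s m) * h m i k - L k l (s m) * h m i j)).

(** Since [dH] is a four-form in dimension four, a single component of [clo] expresses
    closedness. *)
Definition einstein_system :=
  [/\ forall i j k, L i j k = - L j i k,
      (forall i j k, h i j k = - h j i k) /\
      (forall i j k, h i j k = - h i k j),
      forall x y, (x < 4)%N -> (y < 4)%N -> ein x y = 0,
      forall i j k l, (i < 4)%N -> (j < 4)%N -> (k < 4)%N -> (l < 4)%N ->
        jac i j k l = 0 &
      clo 0 1 2 3 = 0].
End EinSum.

(* The alternating extensions of the values of L and h at one ordering of each
   set of indices: they turn [ein], [jac] and [clo] into closed polynomials in
   those values by mere computation. *)
Definition alt2 (R : nzRingType) (L : nat -> nat -> nat -> R) i j k :=
  match i, j with
  | 0%N, 1%N => L 0%N 1%N k | 1%N, 0%N => - L 0%N 1%N k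
  | 1%N, 2%N => L 1%N 2%N k | 2%N, 1%N => - L 1%N 2%N k
  | 2%N, 0%N => L 2%N 0%N k | 0%N, 2%N => - L 2%N 0%N k
  | 3%N, 0%N => L 3%N 0%N k | 0%N, 3%N => - L 3%N 0%N k
  | 3%N, 1%N => L 3%N 1%N k | 1%N, 3%N => - L 3%N 1%N k
  | 3%N, 2%N => L 3%N 2%N k | 2%N, 3%N => - L 3%N 2%N k
  | _, _ => 0
  end.

Definition alt3 (R : nzRingType) (h : nat -> nat -> nat -> R) i j k :=
  match i, j, k with
  | 0%N, 1%N, 2%N | 1%N, 2%N, 0%N | 2%N, 0%N, 1%N => h 0%N 1%N 2%N
  | 1%N, 0%N, 2%N | 0%N, 2%N, 1%N | 2%N, 1%N, 0%N => - h 0%N 1%N 2%N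
  | 3%N, 0%N, 1%N | 0%N, 1%N, 3%N | 1%N, 3%N, 0%N => h 3%N 0%N 1%N
  | 0%N, 3%N, 1%N | 3%N, 1%N, 0%N | 1%N, 0%N, 3%N => - h 3%N 0%N 1%N
  | 3%N, 1%N, 2%N | 1%N, 2%N, 3%N | 2%N, 3%N, 1%N => h 3%N 1%N 2%N
  | 1%N, 3%N, 2%N | 3%N, 2%N, 1%N | 2%N, 1%N, 3%N => - h 3%N 1%N 2%N
  | 3%N, 2%N, 0%N | 2%N, 0%N, 3%N | 0%N, 3%N, 2%N => h 3%N 2%N 0%N
  | 2%N, 3%N, 0%N | 3%N, 0%N, 2%N | 0%N, 2%N, 3%N => - h 3%N 2%N 0%N
  | _, _, _ => 0
  end.

Section Alternating.
Variables (R : realFieldType) (L h : nat -> nat -> nat -> R).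

Lemma alt2E i j k : (forall i j k, L i j k = - L j i k) ->
  (i < 4)%N -> (j < 4)%N -> L i j k = alt2 L i j k.
Proof.
move=> LC; have Lii a b : L a a b = 0 by have := LC a a b; lra.
by case: i => [|[|[|[|//]]]] _; case: j => [|[|[|[|//]]]] _ //=; rewrite LC.
Qed.

Lemma alt3E i j k : (forall i j k, h i j k = - h j i k) ->
  (forall i j k, h i j k = - h i k j) ->
  (i < 4)%N -> (j < 4)%N -> (k < 4)%N -> h i j k = alt3 h i j k.
Proof.
move=> h12 h23.
have hiij a b : h a a b = 0 by have := h12 a a b; lra.
have hijj a b : h a b b = 0 by have := h23 a b b; lra.
have hiji a b : h a b a = 0 by rewrite h12 hijj oppr0.
have rot a b c : h a b c = h b c a by rewrite h12 h23 opprK.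
case: i => [|[|[|[|//]]]] _; case: j => [|[|[|[|//]]]] _;
  case: k => [|[|[|[|//]]]] _ /=; rewrite ?hiij ?hijj ?hiji //.
all: try exact: rot.
all: try by rewrite rot rot.
all: try by rewrite h12.
all: try by rewrite h12 rot.
Qed.
End Alternating.

Lemma system_alt (R : realFieldType) s eps (L h : nat -> nat -> nat -> R) :
  einstein_system s eps L h -> (forall i, (i < 4)%N -> (s i < 4)%N) ->
  [/\ forall i j k, L i j k = - L j i k,
      forall x y, (x < 4)%N -> (y < 4)%N ->
        ein s eps (alt2 L) (alt3 h) x y = 0,
      forall i j k l, (i < 4)%N -> (j < 4)%N -> (k < 4)%N -> (l < 4)%N ->
        jac s eps (alt2 L) i j k l = 0 &
      clo s eps (alt2 L) (alt3 h) 0 1 2 3 = 0].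
Proof.
case=> LC [h12 h23] E J C s4; split=> // [x y x4 y4 | i j k l i4 j4 k4 l4 |].
- rewrite -[RHS](E x y) //.
  apply: eq_sum4 => i i4; apply: eq_sum4 => j j4.
  by rewrite -!alt2E -?alt3E ?s4.
- rewrite -[RHS](J i j k l) //.
  by apply: eq_sum4 => m m4; rewrite -!alt2E ?s4.
rewrite -[RHS]C.
by apply: eq_sum4 => m m4; rewrite -!alt2E -?alt3E ?s4.
Qed.

Definition eps4 (R : nzRingType) (a b c d : R) i := [:: a; b; c; d]`_i.
(** The pairing of a null frame: [f 0] and [f 2] are null with product one, while [f 1] and [f 3]
    are unit vectors orthogonal to the rest. *)
Definition swap02 i : nat := nth 0%N [:: 2; 1; 0; 3] i.

(** * The Einstein system for a derived algebra of dimension three *)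

Lemma mul0I (R : idomainType) (a b : R) : a != 0 -> a * b = 0 -> b = 0.
Proof. by move=> a0 /eqP; rewrite mulf_eq0 (negPf a0) => /eqP. Qed.

Lemma mulBI (R : idomainType) (a b c : R) : a != 0 -> a * b = a * c -> b = c.
Proof. by move=> a0; apply: mulfI. Qed.

Lemma sqr0I (R : idomainType) (a : R) : a ^+ 2 = 0 -> a = 0.
Proof. by move=> /eqP; rewrite sqrf_eq0 => /eqP. Qed.

Tactic Notation "lra_from" ne_hyp_list(l) := clear -l; lra.

(** Here [x], [y], [z] are, up to sign, the eigenvalues of the endomorphism behind the bracket of
    g'; [a] is [H] on g', the [b]s are the components of [H(f_3, ., .)], and [m] is the action of
    the normal [f_3] with lowered indices. In the proofs [e] names a curvature equation, with a
    final [a] for its part odd in [H], and [j] a Jacobi component. One nonzero eigenvalue leads to a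
    contradiction between squares, two contradict [span], and three must coincide. *)
Lemma diagonal_Lorentz_algebra (R : realFieldType)
    (x y z a b0 b1 b2 m00 m01 m02 m10 m11 m12 m20 m21 m22 : R) :
  a ^+ 2 + b1 ^+ 2 + b2 ^+ 2 + m01 ^+ 2 + m02 ^+ 2 - m10 ^+ 2 - m20 ^+ 2 - x ^+
    2 - 2 * y * z + y ^+ 2 + z ^+ 2 = 0 ->
  - (a ^+ 2) + b0 ^+ 2 - b2 ^+ 2 + m01 ^+ 2 - m10 ^+ 2 + m12 ^+ 2 - m21 ^+ 2 +
    2 * x * z - x ^+ 2 + y ^+ 2 - z ^+ 2 = 0 ->
  - (a ^+ 2) + b0 ^+ 2 - b1 ^+ 2 + m02 ^+ 2 - m12 ^+ 2 - m20 ^+ 2 + m21 ^+ 2 +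
    2 * x * y - x ^+ 2 - y ^+ 2 + z ^+ 2 = 0 ->
  a * b0 - m12 * y + m12 * z - m21 * y + m21 * z = 0 ->
  b0 * x = 0 ->
  - (a * b1) - m02 * x + m02 * z - m20 * x + m20 * z = 0 ->
  - (b1 * y) = 0 ->
  - (a * b2) + m01 * x - m01 * y + m10 * x - m10 * y = 0 ->
  - (b2 * z) = 0 ->
  - (b0 * m20) - b1 * m21 - b2 * m00 + b2 * m11 = 0 ->
  b0 * m11 + b0 * m22 + b1 * m01 + b2 * m02 = 0 ->
  b0 * m10 + b1 * m00 - b1 * m22 + b2 * m12 = 0 ->
  m02 * x + m20 * z = 0 ->
  m12 * y + m21 * z = 0 ->
  m00 * z - m11 * z + m22 * z = 0 ->
  - (m01 * x) - m10 * y = 0 ->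
  - (m00 * y) - m11 * y + m22 * y = 0 ->
  - (m00 * x) - m11 * x - m22 * x = 0 ->
  - (a * m00) + a * m11 + a * m22 = 0 ->
  (forall t0 t1 t2,
    t2 * z = 0 ->
    t0 * x = 0 ->
    t1 * y = 0 ->
    m00 * t0 + m01 * t1 + m02 * t2 = 0 ->
    m10 * t0 + m11 * t1 + m12 * t2 = 0 ->
    m20 * t0 + m21 * t1 + m22 * t2 = 0 ->
    [/\ t0 = 0, t1 = 0 & t2 = 0]) ->
  [/\ x = 0, y = 0 & z = 0] \/
  [/\ x != 0, y = x /\ z = x, a ^+ 2 = x ^+ 2, [/\ b0 = 0, b1 = 0 & b2 = 0] &
    [/\ m00 = 0, m11 = 0, m22 = 0 & [/\ m10 = - m01, m20 = - m02 & m21 = - m12]]].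
Proof.
move=> e00 e11 e22 e03 e03a e13 e13a e23 e23a e01a e12a e02a j0130 j0131 j0132 j0230 j0231 j1230 clo span.
have [z0 | z0] := eqVneq z 0; have [y0 | y0] := eqVneq y 0;
  have [x0 | x0] := eqVneq x 0; subst=> //.
- by left.
- exfalso; have b00 : b0 = 0 by apply: (mul0I x0); lra_from e03a.
  have x2 : 0 < x ^+ 2 by rewrite exprn_even_gt0.
  have := sqr_ge0 a; have := sqr_ge0 b1; have := sqr_ge0 b2.
  by rewrite b00 in e11 e22; lra_from e00 e11 e22 x2.
- exfalso; have y2 : 0 < y ^+ 2 by rewrite exprn_even_gt0.
  have b10 : b1 = 0 by apply: (mul0I y0); lra_from e13a.
  have m120 : m12 = 0 by apply: (mul0I y0); lra_from j0131.
  have m100 : m10 = 0 by apply: (mul0I y0); lra_from j0230.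
  have m22E : m22 = m00 + m11 by apply: (mulBI y0); lra_from j0231.
  subst; have [a0 | a0] := eqVneq a 0.
    have m210 : m21 = 0 by apply: (mul0I y0); rewrite a0 in e03; lra_from e03.
    have m010 : m01 = 0 by apply: (mul0I y0); rewrite a0 in e23; lra_from e23.
    by subst; lra_from e00 e11 e22 y2.
  have m110 : m11 = 0 by apply: (mul0I a0); lra_from clo.
  (* The vector with components [b] spans the kernel of [H(f_3, ., .)] on g'; the mixed equations
     now say that it is orthogonal to all brackets. *)
  subst; have [|||||| b00 _ b20] := span b0 0 b2;
    rewrite ?(mulr0, mul0r, addr0, mulr1) //; try lra_from e01a;
    try lra_from e12a; try lra_from e02a.
  by have := sqr_ge0 a; subst; lra_from e00 e11 e22 y2.
(* With two nonzero eigenvalues the Jacobi identity confines all brackets to the image of the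
   bracket of g', so the remaining frame vector is orthogonal to them. *)
- exfalso; have [||||||_ _ /eqP] := span 0 0 1; rewrite ?oner_eq0 //;
    rewrite ?(mulr0, mul0r, add0r, mul1r) //.
  + by apply: (mul0I x0); lra_from j0130.
  + by apply: (mul0I y0); lra_from j0131.
  have jx : m00 + m11 + m22 = 0 by apply: (mul0I x0); lra_from j1230.
  have jy : m00 + m11 - m22 = 0 by apply: (mul0I y0); lra_from j0231.
  by lra_from jx jy.
- exfalso; have z2 : 0 < z ^+ 2 by rewrite exprn_even_gt0.
  have b20 : b2 = 0 by apply: (mul0I z0); lra_from e23a.
  have m200 : m20 = 0 by apply: (mul0I z0); lra_from j0130.
  have m210 : m21 = 0 by apply: (mul0I z0); lra_from j0131.
  have m11E : m11 = m00 + m22 by apply: (mulBI z0); lra_from j0132.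
  subst; have [a0 | a0] := eqVneq a 0.
    have m120 : m12 = 0 by apply: (mul0I z0); rewrite a0 in e03; lra_from e03.
    have m020 : m02 = 0 by apply: (mul0I z0); rewrite a0 in e13; lra_from e13.
    by subst; lra_from e00 e11 e22 z2.
  have m220 : m22 = 0 by apply: (mul0I a0); lra_from clo.
  subst; have [|||||| b00 b10 _] := span b0 b1 0;
    rewrite ?(mulr0, mul0r, addr0, mulr1) //; try lra_from e01a;
    try lra_from e12a; try lra_from e02a.
  by have := sqr_ge0 a; subst; lra_from e00 e11 e22 z2.
- exfalso; have [||||||_ /eqP] := span 0 1 0; rewrite ?oner_eq0 //;
    rewrite ?(mulr0, mul0r, addr0, add0r, mul1r) //.
  + by apply: (mul0I x0); lra_from j0230.
  + have jx : m00 + m11 + m22 = 0 by apply: (mul0I x0); lra_from j1230.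
    have jz : m00 - m11 + m22 = 0 by apply: (mul0I z0); lra_from j0132.
    by lra_from jx jz.
  by apply: (mul0I z0); lra_from j0131.
- exfalso; have [||||||/eqP] := span 1 0 0; rewrite ?oner_eq0 //;
    rewrite ?(mulr0, mul0r, addr0, add0r, mul1r) //.
  + have jy : m00 + m11 - m22 = 0 by apply: (mul0I y0); lra_from j0231.
    have jz : m00 - m11 + m22 = 0 by apply: (mul0I z0); lra_from j0132.
    by lra_from jy jz.
  + by apply: (mul0I y0); lra_from j0230.
  by apply: (mul0I z0); lra_from j0130.
have b00 : b0 = 0 by apply: (mul0I x0); lra_from e03a.
have b10 : b1 = 0 by apply: (mul0I y0); lra_from e13a.
have b20 : b2 = 0 by apply: (mul0I z0); lra_from e23a.
have j1 : m00 - m11 + m22 = 0 by apply: (mul0I z0); lra_from j0132.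
have j2 : m00 + m11 - m22 = 0 by apply: (mul0I y0); lra_from j0231.
have j3 : m00 + m11 + m22 = 0 by apply: (mul0I x0); lra_from j1230.
subst.
(* Skewness follows from the Jacobi identity when the two eigenvalues agree and from the curvature
   equation when they differ; likewise for the next two pairs. *)
have s02 : m20 = - m02.
  have [zx | zx] := eqVneq z x.
    by apply: (mulBI z0); subst; lra_from j0130.
  rewrite -subr_eq0 in zx; apply/eqP; rewrite -subr_eq0; apply/eqP.
  by apply: (mul0I zx); lra_from e13.
have s01 : m10 = - m01.
  have [yx | yx] := eqVneq y x.
    by apply: (mulBI y0); subst; lra_from j0230.
  rewrite -subr_eq0 in yx; apply/eqP; rewrite -subr_eq0; apply/eqP.
  by apply: (mul0I yx); lra_from e23.
have s12 : m21 = - m12.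
  have [yz | yz] := eqVneq y z.
    by apply: (mulBI y0); subst; lra_from j0131.
  rewrite -subr_eq0 in yz; apply/eqP; rewrite -subr_eq0; apply/eqP.
  by apply: (mul0I yz); lra_from e03.
subst.
(* The sums [e00 + e11] and [e00 + e22] factor, up to 2, as [(y - x) * (y + x - z)] and
   [(z - x) * (z + x - y)]. *)
have yx : y = x.
  have [-> // | yx] := eqVneq y x; rewrite -subr_eq0 in yx.
  have zE : z = x + y.
    apply/esym/eqP; rewrite -subr_eq0; apply/eqP.
    by apply: (mul0I yx); lra_from e00 e11.
  by case/eqP: x0; apply: (mul0I y0); subst; lra_from e00 e22.
subst; have zx : z = x.
  apply/eqP; rewrite -subr_eq0; apply/eqP.
  by apply: (mul0I z0); lra_from e00 e22.
by right; subst; split=> //; [lra_from e00 | split=> //; lra_from j1 j2 j3].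
Qed.

(** The normal is timelike, so [e33] is a sum of squares: it kills [H(f_3, ., .)] and the symmetric
    part of the action at once. What remains are the three diagonal equations for [x], [y], [z],
    [a]; an Abelian g' is excluded because the action would be skew of odd order, hence singular. *)
Lemma diagonal_Riemann_algebra (R : realFieldType)
    (x y z a b0 b1 b2 m00 m01 m02 m10 m11 m12 m20 m21 m22 : R) :
  a ^+ 2 - b1 ^+ 2 - b2 ^+ 2 - m01 ^+ 2 - m02 ^+ 2 + m10 ^+ 2 + m20 ^+ 2 - x ^+
    2 - 2 * y * z + y ^+ 2 + z ^+ 2 = 0 ->
  a ^+ 2 - b0 ^+ 2 - b2 ^+ 2 + m01 ^+ 2 - m10 ^+ 2 - m12 ^+ 2 + m21 ^+ 2 - 2 *
    x * z + x ^+ 2 - y ^+ 2 + z ^+ 2 = 0 ->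
  a ^+ 2 - b0 ^+ 2 - b1 ^+ 2 + m02 ^+ 2 + m12 ^+ 2 - m20 ^+ 2 - m21 ^+ 2 - 2 *
    x * y + x ^+ 2 + y ^+ 2 - z ^+ 2 = 0 ->
  b0 ^+ 2 + b1 ^+ 2 + b2 ^+ 2 + 2 * m00 ^+ 2 + 2 * m01 * m10 + m01 ^+ 2 + 2 *
    m02 * m20 + m02 ^+ 2 + m10 ^+ 2 + 2 * m11 ^+ 2 + 2 * m12 * m21 + m12 ^+ 2 +
    m20 ^+ 2 + m21 ^+ 2 + 2 * m22 ^+ 2 = 0 ->
  m02 * x + m20 * z = 0 ->
  m12 * y + m21 * z = 0 ->
  - (m01 * x) - m10 * y = 0 ->
  (forall t0 t1 t2,
    t2 * z = 0 ->
    t0 * x = 0 ->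
    t1 * y = 0 ->
    m00 * t0 + m01 * t1 + m02 * t2 = 0 ->
    m10 * t0 + m11 * t1 + m12 * t2 = 0 ->
    m20 * t0 + m21 * t1 + m22 * t2 = 0 ->
    [/\ t0 = 0, t1 = 0 & t2 = 0]) ->
  [/\ x != 0, y = x /\ z = x, a ^+ 2 = x ^+ 2, [/\ b0 = 0, b1 = 0 & b2 = 0] &
    [/\ m00 = 0, m11 = 0, m22 = 0 &
        [/\ m10 = - m01, m20 = - m02 & m21 = - m12]]].
Proof.
move=> e00 e11 e22 e33 j0130 j0131 j0230 span.
have squares : b0 ^+ 2 + b1 ^+ 2 + b2 ^+ 2 + m00 ^+ 2 + m11 ^+ 2 + m22 ^+ 2 +
    (m01 + m10) ^+ 2 + (m02 + m20) ^+ 2 + (m12 + m21) ^+ 2 <= 0.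
  by have := sqr_ge0 m00; have := sqr_ge0 m11; have := sqr_ge0 m22;
    clear -e33; lra.
have zero (t : R) : t ^+ 2 <= 0 -> t = 0.
  by move=> t0; apply: sqr0I; have := sqr_ge0 t; clear -t0; lra.
have [p0 p1 p2] := And3 (sqr_ge0 b0) (sqr_ge0 b1) (sqr_ge0 b2).
have [p3 p4 p5] := And3 (sqr_ge0 m00) (sqr_ge0 m11) (sqr_ge0 m22).
have [p6 p7 p8] := And3 (sqr_ge0 (m01 + m10)) (sqr_ge0 (m02 + m20))
  (sqr_ge0 (m12 + m21)).
have b00 : b0 = 0 by apply: zero; clear -squares p0 p1 p2 p3 p4 p5 p6 p7 p8; lra.
have b10 : b1 = 0 by apply: zero; clear -squares p0 p1 p2 p3 p4 p5 p6 p7 p8; lra.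
have b20 : b2 = 0 by apply: zero; clear -squares p0 p1 p2 p3 p4 p5 p6 p7 p8; lra.
have m000 : m00 = 0.
  by apply: zero; clear -squares p0 p1 p2 p3 p4 p5 p6 p7 p8; lra.
have m110 : m11 = 0.
  by apply: zero; clear -squares p0 p1 p2 p3 p4 p5 p6 p7 p8; lra.
have m220 : m22 = 0.
  by apply: zero; clear -squares p0 p1 p2 p3 p4 p5 p6 p7 p8; lra.
have s01 : m10 = - m01.
  apply/eqP; rewrite -addr_eq0 addrC; apply/eqP.
  by apply: zero; clear -squares p0 p1 p2 p3 p4 p5 p6 p7 p8; lra.
have s02 : m20 = - m02.
  apply/eqP; rewrite -addr_eq0 addrC; apply/eqP.
  by apply: zero; clear -squares p0 p1 p2 p3 p4 p5 p6 p7 p8; lra.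
have s12 : m21 = - m12.
  apply/eqP; rewrite -addr_eq0 addrC; apply/eqP.
  by apply: zero; clear -squares p0 p1 p2 p3 p4 p5 p6 p7 p8; lra.
clear squares e33 p0 p1 p2 p3 p4 p5 p6 p7 p8; subst.
have yx : (y - x) * (y + x - z) = 0 by lra_from e00 e11.
have zx : (z - x) * (z + x - y) = 0 by lra_from e00 e22.
have [x0 | x0] := eqVneq x 0.
  exfalso; subst; have [y0 | y0] := eqVneq y 0.
    have z0 : z = 0 by subst; apply: sqr0I; lra_from zx.
    (* The kernel vector of a skew matrix of order three. If it vanishes then so does the matrix,
       and every vector is orthogonal to all brackets. *)
    subst; have [|||||| u0 u1 u2] := span m12 (- m02) m01; rewrite ?mulr0 //;
      try (clear; lra).
    have m020 : m02 = 0 by apply: oppr_inj; rewrite u1 oppr0.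
    by subst; have [||||||/eqP] := span 1 0 0; rewrite ?oner_eq0 //;
      clear; lra.
  have zy : z = y by apply/eqP; rewrite eq_sym -subr_eq0; apply/eqP;
    apply: (mul0I y0); lra_from yx.
  subst; have m010 : m01 = 0 by apply: (mul0I y0); lra_from j0230.
  have m020 : m02 = 0 by apply: (mul0I y0); lra_from j0130.
  by subst; have [||||||/eqP] := span 1 0 0; rewrite ?oner_eq0 //; clear; lra.
move/eqP: yx; rewrite mulf_eq0 => /orP[] /eqP yx; last first.
  have zE : z = x + y by clear -yx; lra.
  have y0 : y = 0 by apply: (mul0I x0); subst; clear -zx; lra.
  exfalso; subst; have m010 : m01 = 0 by apply: (mul0I x0); lra_from j0230.
  have m120 : m12 = 0 by apply: (mul0I x0); lra_from j0131.
  by subst; have [||||||_ /eqP] := span 0 1 0; rewrite ?oner_eq0 //; clear; lra.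
have yE : y = x by clear -yx; lra.
clear yx; subst.
have zxz : (z - x) * z = 0 by clear -zx; lra.
move/eqP: zxz; rewrite mulf_eq0 => /orP[] /eqP zE.
  have {}zE : z = x by clear -zE; lra.
  by subst; split=> //; clear -e00; lra.
exfalso; subst; have m020 : m02 = 0 by apply: (mul0I x0); lra_from j0130.
have m120 : m12 = 0 by apply: (mul0I x0); lra_from j0131.
by subst; have [||||||_ _ /eqP] := span 0 0 1; rewrite ?oner_eq0 //; clear; lra.
Qed.

(** A pair of nonreal eigenvalues with real part given by [A] and imaginary part by [B], and a real
    one given by [l]. The products with [A] and [B] in the proof are multiplications by a conjugate
    complex number, whose norm is positive. If [l = 0], the vector [f_2] is orthogonal to all
    brackets; otherwise [m] vanishes, [l = 2 * A], and [e00], [e22] leave a vanishing sum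
    [A ^+ 2 + B ^+ 2]. *)
Lemma complex_algebra (R : realFieldType)
    (l A B a b0 b1 b2 m00 m01 m02 m10 m11 m12 m20 m21 m22 : R) :
  B != 0 ->
  - (2 * A * l) + a ^+ 2 + b1 ^+ 2 + b2 ^+ 2 + l ^+ 2 + m01 ^+ 2 + m02 ^+ 2 -
    m10 ^+ 2 - m20 ^+ 2 = 0 ->
  - (4 * A * B) + 2 * B * l - b0 * b1 + m00 * m01 - m00 * m10 + m01 * m11 + m02
    * m12 - m10 * m11 - m20 * m21 = 0 ->
  4 * B ^+ 2 - a ^+ 2 + b0 ^+ 2 - b1 ^+ 2 + l ^+ 2 + m02 ^+ 2 - m12 ^+ 2 - m20
    ^+ 2 + m21 ^+ 2 = 0 ->
  - (A * m12) - A * m21 - B * m02 - B * m20 + a * b0 + l * m12 + l * m21 = 0 ->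
  A * b0 + B * b1 = 0 ->
  - (A * m02) - A * m20 + B * m12 + B * m21 - a * b1 + l * m02 + l * m20 = 0 ->
  - (A * b1) + B * b0 = 0 ->
  - (2 * B * m00) - 2 * B * m11 - a * b2 = 0 ->
  - (b2 * l) = 0 ->
  A * m02 - B * m12 + l * m20 = 0 ->
  A * m12 + B * m02 + l * m21 = 0 ->
  l * m00 - l * m11 + l * m22 = 0 ->
  - (A * m01) - A * m10 - B * m22 = 0 ->
  - (A * m00) - A * m11 + A * m22 - 2 * B * m01 = 0 ->
  - (A * m00) - A * m11 - A * m22 + 2 * B * m10 = 0 ->
  (forall t0 t1 t2,
    l * t2 = 0 ->
    A * t0 + B * t1 = 0 ->
    A * t1 - B * t0 = 0 ->
    m00 * t0 + m01 * t1 + m02 * t2 = 0 ->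
    m10 * t0 + m11 * t1 + m12 * t2 = 0 ->
    m20 * t0 + m21 * t1 + m22 * t2 = 0 ->
    [/\ t0 = 0, t1 = 0 & t2 = 0]) ->
  False.
Proof.
move=> B0 e00 e01 e22 e03 e03a e13 e13a e23 e23a j0130 j0131 j0132 j0230 j0231
  j1230 span.
have AB : 0 < A ^+ 2 + B ^+ 2.
  by rewrite ltr_wpDl ?sqr_ge0 // exprn_even_gt0.
have AB0 := lt0r_neq0 AB.
have [l0 | l0] := eqVneq l 0.
  subst; have m020 : m02 = 0.
    by apply: (mul0I AB0); move/(congr1 ( *%R A)): (j0130);
      move/(congr1 ( *%R B)): (j0131); clear; lra.
  have m120 : m12 = 0.
    by apply: (mul0I B0); subst; lra_from j0130.
  have m220 : m22 = 0.
    have j : B * (m01 + m10) = A * m22 by lra_from j0231 j1230.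
    by apply: (mul0I AB0); move/(congr1 ( *%R A)): (j);
      move/(congr1 ( *%R B)): (j0230); clear; lra.
  by subst; have [||||||_ _ /eqP] := span 0 0 1; rewrite ?oner_eq0 //; clear; lra.
have b00 : b0 = 0.
  by apply: (mul0I AB0); move/(congr1 ( *%R A)): (e03a);
    move/(congr1 ( *%R B)): (e13a); clear; lra.
have b10 : b1 = 0 by apply: (mul0I B0); subst; lra_from e03a.
have b20 : b2 = 0 by apply: (mul0I l0); lra_from e23a.
have m11E : m11 = - m00 by apply: (mulBI B0); subst; lra_from e23.
have m22E : m22 = - 2 * m00 by apply: (mulBI l0); subst; lra_from j0132.
have m10E : m10 = m01 by apply: (mulBI B0); subst; lra_from j0231 j1230.
clear e03a e13a e23a e23 j0132.
have m000 : m00 = 0.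
  by apply: (mul0I AB0); subst; move/(congr1 ( *%R A)): (j0231);
    move/(congr1 ( *%R B)): (j0230); clear; lra.
have m010 : m01 = 0 by apply: (mul0I B0); subst; lra_from j0231.
have lAB : 0 < (l - A) ^+ 2 + B ^+ 2.
  by rewrite ltr_wpDl ?sqr_ge0 // exprn_even_gt0.
have lAB0 := lt0r_neq0 lAB.
subst.
have s12 : m21 = - m12.
  apply/eqP; rewrite -addr_eq0 addrC; apply/eqP; apply: (mul0I lAB0).
  by move/(congr1 ( *%R (l - A))): (e03); move/(congr1 ( *%R B)): (e13);
    clear; lra.
have s02 : m20 = - m02.
  by apply: (mulBI B0); subst; lra_from e03.
subst.
have m020 : m02 = 0.
  apply: (mul0I lAB0).
  by move/(congr1 ( *%R (l - A))): (j0130); move/(congr1 ( *%R B)): (j0131);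
    clear; lra.
have m120 : m12 = 0 by apply: (mul0I B0); subst; lra_from j0130.
subst; have lE : l = 2 * A by apply: (mulBI B0); lra_from e01.
have B2 : 0 < B ^+ 2 by rewrite exprn_even_gt0.
by subst; have := sqr_ge0 A; clear -B2 e00 e22; lra.
Qed.

(** A Jordan block of size two, with nilpotent part [r], eigenvalue [l] on the null direction and
    remaining eigenvalue [u]. If [l] or [u] vanishes, a frame vector is orthogonal to all brackets;
    otherwise [l = u] and the equations combine to [r * (u ^+ 2 + 2 * m02 ^+ 2) = 0]. *)
Lemma null_algebra1 (R : realFieldType)
    (l u r a b0 b1 b2 m00 m01 m02 m10 m11 m12 m20 m21 m22 : R) :
  r != 0 ->
  - (a ^+ 2) - b0 * b2 - b1 ^+ 2 + 2 * l * u + m01 * m21 - m10 * m12 - u ^+ 2 =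
    0 ->
  - (a * b2) + l * m01 + l * m10 - m01 * u - m10 * u = 0 ->
  - (b2 * l) = 0 ->
  - (a ^+ 2) - 2 * b0 * b2 - 2 * m01 * m21 + 2 * m10 * m12 + u ^+ 2 = 0 ->
  - (a * b1) + 2 * m00 * r = 0 ->
  - (b1 * u) = 0 ->
  b0 ^+ 2 + 4 * l * r - 2 * m02 * m22 - m12 ^+ 2 + 2 * m20 * m22 + m21 ^+ 2 - 2
    * r * u = 0 ->
  - (a * b0) - l * m12 - l * m21 - m01 * r - m10 * r + m12 * u + m21 * u = 0 ->
  - (b0 * l) - b2 * r = 0 ->
  - (2 * b0 * b2) - b1 ^+ 2 + 4 * m00 * m22 + 2 * m01 * m12 + 2 * m01 * m21 + 2
    * m02 * m20 + m02 ^+ 2 + 2 * m10 * m12 + 2 * m10 * m21 + 2 * m11 ^+ 2 + m20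
    ^+ 2 = 0 ->
  2 * l * m00 = 0 ->
  l * m01 + m10 * u = 0 ->
  - (l * m11) + m00 * r = 0 ->
  - (l * m01) - m10 * u = 0 ->
  m02 * u - m11 * u + m20 * u = 0 ->
  - (l * m21) - m01 * r - m12 * u = 0 ->
  - (l * m11) + m00 * r = 0 ->
  2 * l * m22 + m02 * r - m11 * r - m20 * r = 0 ->
  (forall t0 t1 t2,
    l * t2 = 0 ->
    l * t0 + r * t2 = 0 ->
    t1 * u = 0 ->
    m00 * t0 + m01 * t1 + m02 * t2 = 0 ->
    m10 * t0 + m11 * t1 + m12 * t2 = 0 ->
    m20 * t0 + m21 * t1 + m22 * t2 = 0 ->
    [/\ t0 = 0, t1 = 0 & t2 = 0]) ->
  False.
Proof.
move=> r0 e02 e03 e03a e11 e13 e13a e22 e23 e23a e33 j0130 j0131 j0132 j0230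
  j0231 j0232 j1230 j1232 span.
have [l0 | l0] := eqVneq l 0; have [u0 | u0] := eqVneq u 0; subst.
- have m000 : m00 = 0 by apply: (mul0I r0); lra_from j0132.
  have m010 : m01 = 0 by apply: (mul0I r0); lra_from j0232.
  have m02E : m02 = m11 + m20 by apply: (mulBI r0); lra_from j1232.
  have b20 : b2 = 0 by apply: (mul0I r0); lra_from e23a.
  subst; have a2 : a ^+ 2 + b1 ^+ 2 + a ^+ 2 / 2 = 0 by lra_from e02 e11.
  have a0 : a = 0.
    by apply: sqr0I; have := sqr_ge0 a; have := sqr_ge0 b1; clear -a2; lra.
  have b10 : b1 = 0.
    by apply: sqr0I; have := sqr_ge0 a; have := sqr_ge0 b1; clear -a2; lra.
  have m100 : m10 = 0 by apply: (mul0I r0); subst; lra_from e23.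
  have m11sq : (m11 + 2 * m20) ^+ 2 + 2 * m11 ^+ 2 = 0.
    by subst; lra_from e33.
  have m110 : m11 = 0.
    apply: sqr0I; have := sqr_ge0 m11; have := sqr_ge0 (m11 + 2 * m20).
    by clear -m11sq; lra.
  have m200 : m20 = 0.
    by apply: sqr0I; subst; lra_from m11sq.
  by subst; have [||||||/eqP] := span 1 0 0; rewrite ?oner_eq0 //; clear; lra.
- have m000 : m00 = 0 by apply: (mul0I r0); lra_from j0132.
  have m100 : m10 = 0 by apply: (mul0I u0); lra_from j0131.
  have m02E : m02 = m11 + m20 by apply: (mulBI r0); lra_from j1232.
  have m02F : m02 = m11 - m20 by apply: (mulBI u0); lra_from j0231.
  have m200 : m20 = 0 by lra_from m02E m02F.
  by subst; have [||||||/eqP] := span 1 0 0; rewrite ?oner_eq0 //; clear; lra.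
- have m000 : m00 = 0 by apply: (mul0I l0); lra_from j0130.
  have m010 : m01 = 0 by apply: (mul0I l0); lra_from j0131.
  have m110 : m11 = 0 by apply: (mul0I l0); subst; lra_from j1230.
  have m210 : m21 = 0 by apply: (mul0I l0); subst; lra_from j0232.
  by subst; have [||||||_ /eqP] := span 0 1 0; rewrite ?oner_eq0 //; clear; lra.
have b20 : b2 = 0 by apply: (mul0I l0); lra_from e03a.
have b10 : b1 = 0 by apply: (mul0I u0); lra_from e13a.
have b00 : b0 = 0 by apply: (mul0I l0); subst; lra_from e23a.
have m000 : m00 = 0 by apply: (mul0I l0); lra_from j0130.
have m110 : m11 = 0 by apply: (mul0I l0); subst; lra_from j1230.
have m20E : m20 = - m02 by apply: (mulBI u0); subst; lra_from j0231.
have m10E : m10 = - m01.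
  have [lu | lu] := eqVneq l u.
    by apply: (mulBI u0); subst; lra_from j0131.
  rewrite -subr_eq0 in lu; apply/eqP; rewrite -addr_eq0 addrC; apply/eqP.
  by apply: (mul0I lu); subst; lra_from e03.
subst; have [lu | lu] := eqVneq l u; last first.
  rewrite -subr_eq0 in lu.
  have m010 : m01 = 0 by apply: (mul0I lu); lra_from j0131.
  by case/eqP: u0; apply: (mul0I lu); subst; lra_from e02 e11.
subst; have t0 : m01 * (m21 + m12) = 0 by lra_from e02 e11.
have lt0 : u * (m21 + m12) = - (r * m01) by lra_from j0232.
have m010 : m01 = 0.
  apply: sqr0I; apply: (mul0I r0); move/(congr1 ( *%R m01)): (lt0).
  by move/(congr1 ( *%R u)): (t0); clear; lra.
have m21E : m21 = - m12.
  by apply: (mulBI u0); subst; lra_from lt0.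
have m02E : r * m02 = - (u * m22) by subst; lra_from j1232.
have : r * (u ^+ 2 + 2 * m02 ^+ 2) = 0.
  subst; move/(congr1 ( *%R m02)): (m02E); move/(congr1 ( *%R u)): (e22).
  by clear; lra.
have u2 : 0 < u ^+ 2 by rewrite exprn_even_gt0.
by move/(mul0I r0); have := sqr_ge0 m02; clear -u2; lra.
Qed.

(** A Jordan block of size three with eigenvalue [l] and nilpotent part [q]. If [l = 0], the vector
    [f_0] is orthogonal to all brackets; otherwise the equations combine to
    [q * (2 * l ^+ 2 + m20 ^+ 2) = 0]. *)
Lemma null_algebra2 (R : realFieldType)
    (l q r a b0 b1 b2 m00 m01 m02 m10 m11 m12 m20 m21 m22 : R) :
  q != 0 ->
  - (a ^+ 2) - b0 * b2 - b1 ^+ 2 + l ^+ 2 + m01 * m21 - m10 * m12 = 0 ->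
  - (b2 * l) = 0 ->
  - (a ^+ 2) - 2 * b0 * b2 + l ^+ 2 - 2 * m01 * m21 + 2 * m10 * m12 = 0 ->
  b0 * b1 + 2 * l * q - m01 * m22 - m02 * m21 + m10 * m22 - m11 * m12 + m11 *
    m21 + m12 * m20 = 0 ->
  - (b1 * l) - b2 * q = 0 ->
  - (a * b0) - m01 * r + m02 * q - m10 * r - 2 * m11 * q + m20 * q = 0 ->
  - (b0 * l) - b1 * q - b2 * r = 0 ->
  2 * l * m00 = 0 ->
  l * m01 + l * m10 + m00 * q = 0 ->
  - (l * m11) + m00 * r + m10 * q = 0 ->
  l * m02 - l * m11 + l * m20 - 2 * m01 * q = 0 ->
  l * m12 + l * m21 + m01 * r - m20 * q = 0 ->
  (forall t0 t1 t2,
    l * t2 = 0 ->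
    l * t0 + q * t1 + r * t2 = 0 ->
    l * t1 + q * t2 = 0 ->
    m00 * t0 + m01 * t1 + m02 * t2 = 0 ->
    m10 * t0 + m11 * t1 + m12 * t2 = 0 ->
    m20 * t0 + m21 * t1 + m22 * t2 = 0 ->
    [/\ t0 = 0, t1 = 0 & t2 = 0]) ->
  False.
Proof.
move=> q0 e02 e03a e11 e12 e13a e23 e23a j0130 j0131 j0132 j0231 j1231 span.
have [l0 | l0] := eqVneq l 0; subst.
  have m000 : m00 = 0 by apply: (mul0I q0); lra_from j0131.
  have m100 : m10 = 0 by apply: (mul0I q0); subst; lra_from j0132.
  have m010 : m01 = 0 by apply: (mul0I q0); subst; lra_from j0231.
  have m200 : m20 = 0 by apply: (mul0I q0); subst; lra_from j1231.
  by subst; have [||||||/eqP] := span 1 0 0; rewrite ?oner_eq0 //; clear; lra.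
have b20 : b2 = 0 by apply: (mul0I l0); lra_from e03a.
have b10 : b1 = 0 by apply: (mul0I l0); subst; lra_from e13a.
have b00 : b0 = 0 by apply: (mul0I l0); subst; lra_from e23a.
have m000 : m00 = 0 by apply: (mul0I l0); lra_from j0130.
have m10E : m10 = - m01 by apply: (mulBI l0); subst; lra_from j0131.
have m02E : m02 + m20 = 2 * m11 by apply: (mulBI q0); subst; lra_from e23.
have m02F : m02 = 2 * m11 - m20 by clear -m02E; lra.
clear m02E; subst.
have lm11 : l * m11 = - (q * m01) by lra_from j0132.
have m010 : m01 = 0 by apply: (mul0I q0); lra_from j0231 lm11.
have m110 : m11 = 0 by apply: (mul0I l0); subst; lra_from lm11.
subst; have lm : l * (m12 + m21) = q * m20 by lra_from j1231.
have : q * (2 * l ^+ 2 + m20 ^+ 2) = 0.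
  move/(congr1 ( *%R m20)): (lm); move/(congr1 ( *%R l)): (e12).
  by clear; lra.
have l2 : 0 < l ^+ 2 by rewrite exprn_even_gt0.
by move/(mul0I q0); have := sqr_ge0 m20; clear -l2; lra.
Qed.

(** On an Abelian g' the two-form [H(f_3, ., .)] cannot have a null kernel: the equations remove the
    products of all brackets with the kernel vector [f_2]. *)
Lemma abelian_null_algebra (R : realFieldType)
    (a b2 m00 m01 m02 m10 m11 m12 m20 m21 m22 : R) :
  b2 != 0 ->
  b2 * m11 + b2 * m20 = 0 ->
  b2 * m12 = 0 ->
  - (b2 * m22) = 0 ->
  - (a * b2) = 0 ->
  - (2 * m02 * m22) - m12 ^+ 2 + 2 * m20 * m22 + m21 ^+ 2 = 0 ->
  4 * m00 * m22 + 2 * m01 * m12 + 2 * m01 * m21 + 2 * m02 * m20 + m02 ^+ 2 + 2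
    * m10 * m12 + 2 * m10 * m21 + 2 * m11 ^+ 2 + m20 ^+ 2 = 0 ->
  (forall t0 t1 t2,
    m00 * t0 + m01 * t1 + m02 * t2 = 0 ->
    m10 * t0 + m11 * t1 + m12 * t2 = 0 ->
    m20 * t0 + m21 * t1 + m22 * t2 = 0 ->
    [/\ t0 = 0, t1 = 0 & t2 = 0]) ->
  False.
Proof.
move=> b20 e01a e02a e12a e03 e22 e33 span.
have a0 : a = 0 by apply: (mul0I b20); lra_from e03.
have m120 : m12 = 0 by apply: (mul0I b20); lra_from e02a.
have m220 : m22 = 0 by apply: (mul0I b20); lra_from e12a.
have m20E : m20 = - m11 by apply: (mulBI b20); lra_from e01a.
have m210 : m21 = 0 by apply: sqr0I; subst; lra_from e22.
have sq : (m02 - m11) ^+ 2 + 2 * m11 ^+ 2 = 0 by subst; lra_from e33.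
have m110 : m11 = 0.
  apply: sqr0I; have := sqr_ge0 m11; have := sqr_ge0 (m02 - m11).
  by clear -sq; lra.
have m020 : m02 = 0 by apply: sqr0I; subst; lra_from sq.
by subst; have [|||_ _ /eqP] := span 0 0 1; rewrite ?oner_eq0 //; clear; lra.
Qed.

(** The action cancels from [e00 - e11 - e22], which ties [a ^+ 2] to the norm of the vector [b];
    the off-diagonal equations give [a * b = 0]. The conclusion says that [b], the kernel of
    [H(f_3, ., .)] when nonzero, is null. *)
Lemma abelian_H_algebra (R : realFieldType)
    (a b0 b1 b2 m00 m01 m02 m10 m11 m12 m20 m21 m22 : R) :
  a ^+ 2 + b1 ^+ 2 + b2 ^+ 2 + m01 ^+ 2 + m02 ^+ 2 - m10 ^+ 2 - m20 ^+ 2 = 0 ->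
  - (a ^+ 2) + b0 ^+ 2 - b2 ^+ 2 + m01 ^+ 2 - m10 ^+ 2 + m12 ^+ 2 - m21 ^+ 2 =
    0 ->
  - (a ^+ 2) + b0 ^+ 2 - b1 ^+ 2 + m02 ^+ 2 - m12 ^+ 2 - m20 ^+ 2 + m21 ^+ 2 =
    0 ->
  a * b0 = 0 ->
  - (a * b1) = 0 ->
  - (a * b2) = 0 ->
  (forall t0 t1 t2,
    m00 * t0 + m01 * t1 + m02 * t2 = 0 ->
    m10 * t0 + m11 * t1 + m12 * t2 = 0 ->
    m20 * t0 + m21 * t1 + m22 * t2 = 0 ->
    [/\ t0 = 0, t1 = 0 & t2 = 0]) ->
  a = 0 /\ b0 ^+ 2 = b1 ^+ 2 + b2 ^+ 2.
Proof.
move=> e00 e11 e22 e03 e13 e23 span.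
have b2E : 3 * a ^+ 2 = 2 * (b0 ^+ 2 - b1 ^+ 2 - b2 ^+ 2).
  by lra_from e00 e11 e22.
suff a0 : a = 0 by split=> //; subst; lra_from b2E.
have [// | a0] := eqVneq a 0.
have b00 : b0 = 0 by apply: (mul0I a0); lra_from e03.
have b10 : b1 = 0 by apply: (mul0I a0); lra_from e13.
have b20 : b2 = 0 by apply: (mul0I a0); lra_from e23.
by apply: sqr0I; subst; lra_from b2E.
Qed.

Lemma abelian_diagonal_algebra (R : realFieldType)
    ( m00 m01 m02 m10 m11 m12 m20 m21 m22 : R) :
  m10 = - m01 -> m20 = - m02 -> m21 = - m12 ->
  2 * m00 ^+ 2 - 2 * m01 * m10 - m01 ^+ 2 - 2 * m02 * m20 - m02 ^+ 2 - m10 ^+ 2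
    + 2 * m11 ^+ 2 + 2 * m12 * m21 + m12 ^+ 2 - m20 ^+ 2 + m21 ^+ 2 + 2 * m22
    ^+ 2 = 0 ->
  (forall t0 t1 t2,
    m00 * t0 + m01 * t1 + m02 * t2 = 0 ->
    m10 * t0 + m11 * t1 + m12 * t2 = 0 ->
    m20 * t0 + m21 * t1 + m22 * t2 = 0 ->
    [/\ t0 = 0, t1 = 0 & t2 = 0]) ->
  False.
Proof.
move=> s01 s02 s12 e33 span.
have sq : m00 ^+ 2 + m11 ^+ 2 + m22 ^+ 2 = 0.
  by subst; lra_from e33.
have [p0 p1 p2] := And3 (sqr_ge0 m00) (sqr_ge0 m11) (sqr_ge0 m22).
have m000 : m00 = 0 by apply: sqr0I; lra_from sq p0 p1 p2.
have m110 : m11 = 0 by apply: sqr0I; lra_from sq p0 p1 p2.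
have m220 : m22 = 0 by apply: sqr0I; lra_from sq p0 p1 p2.
subst; have [||| u0 u1 u2] := span m12 (- m02) m01; rewrite ?mulr0 //;
  try (clear; lra).
have m020 : m02 = 0 by apply: oppr_inj; rewrite u1 oppr0.
by subst; have [|||/eqP] := span 1 0 0; rewrite ?oner_eq0 //; clear; lra.
Qed.

(** The equations [e02] and [e12] are a homogeneous linear system for [m02] and [m12] with
    determinant [(m00 + m22) ^+ 2 + m01 ^+ 2], up to sign. The last identity of the conclusion, left
    over from [e33], is the square root in (A3). *)
Lemma abelian_complex_algebra (R : realFieldType)
    ( m00 m01 m02 m10 m11 m12 m20 m21 m22 : R) :
  m11 = - m00 -> m20 = - m02 -> m21 = - m12 -> m10 != - m01 ->
  m01 ^+ 2 + m02 ^+ 2 - m10 ^+ 2 - m20 ^+ 2 = 0 ->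
  m00 * m02 - m00 * m20 + m01 * m21 + m02 * m22 - m10 * m12 - m20 * m22 = 0 ->
  m01 * m02 - m10 * m20 - m11 * m12 + m11 * m21 + m12 * m22 - m21 * m22 = 0 ->
  2 * m00 ^+ 2 - 2 * m01 * m10 - m01 ^+ 2 - 2 * m02 * m20 - m02 ^+ 2 - m10 ^+ 2
    + 2 * m11 ^+ 2 + 2 * m12 * m21 + m12 ^+ 2 - m20 ^+ 2 + m21 ^+ 2 + 2 * m22
    ^+ 2 = 0 ->
  (forall t0 t1 t2,
    m00 * t0 + m01 * t1 + m02 * t2 = 0 ->
    m10 * t0 + m11 * t1 + m12 * t2 = 0 ->
    m20 * t0 + m21 * t1 + m22 * t2 = 0 ->
    [/\ t0 = 0, t1 = 0 & t2 = 0]) ->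
  [/\ m02 = 0, m12 = 0, m10 = m01 & m01 ^+ 2 = m00 ^+ 2 + m22 ^+ 2 / 2].
Proof.
move=> s11 s02 s12 s01 e00 e02 e12 e33 span.
subst; rewrite -subr_eq0 in s01.
have m10E : m10 = m01.
  have : (m01 + m10) * (m01 - m10) = 0 by lra_from e00.
  move/eqP; rewrite mulf_eq0 => /orP[] /eqP k; last by lra_from k.
  by case/eqP: s01; lra_from k.
have m010 : m01 != 0.
  by apply: contra_neq s01 => k; rewrite m10E k opprK addr0.
subst.
have sq : 0 < (m00 + m22) ^+ 2 + m01 ^+ 2.
  by rewrite ltr_wpDl ?sqr_ge0 // exprn_even_gt0.
have sq0 := lt0r_neq0 sq.
have m020 : m02 = 0.
  apply: (mul0I sq0); move/(congr1 ( *%R (m00 + m22))): (e02).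
  by move/(congr1 ( *%R m01)): (e12); clear; lra.
have m120 : m12 = 0 by apply: (mul0I m010); subst; lra_from e02.
by subst; split=> //; lra_from e33.
Qed.

(** The first two hypotheses say that [f_0] is a null eigenvector of the symmetric part of the
    action. The equations then make the action skew, hence singular, or make all brackets orthogonal
    to [f_0]. *)
Lemma abelian_null_ad_algebra (R : realFieldType)
    ( m00 m01 m02 m10 m11 m12 m20 m21 m22 : R) :
  m00 = 0 -> m10 = - m01 ->
  m01 * m21 - m10 * m12 = 0 ->
  - (m01 * m22) - m02 * m21 + m10 * m22 - m11 * m12 + m11 * m21 + m12 * m20 = 0
    ->
  - (2 * m02 * m22) - m12 ^+ 2 + 2 * m20 * m22 + m21 ^+ 2 = 0 ->
  4 * m00 * m22 + 2 * m01 * m12 + 2 * m01 * m21 + 2 * m02 * m20 + m02 ^+ 2 + 2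
    * m10 * m12 + 2 * m10 * m21 + 2 * m11 ^+ 2 + m20 ^+ 2 = 0 ->
  (forall t0 t1 t2,
    m00 * t0 + m01 * t1 + m02 * t2 = 0 ->
    m10 * t0 + m11 * t1 + m12 * t2 = 0 ->
    m20 * t0 + m21 * t1 + m22 * t2 = 0 ->
    [/\ t0 = 0, t1 = 0 & t2 = 0]) ->
  False.
Proof.
move=> m000 s01 e02 e12 e22 e33 span.
subst; have sq : (m02 + m20) ^+ 2 + 2 * m11 ^+ 2 = 0 by lra_from e33.
have m110 : m11 = 0.
  apply: sqr0I; have := sqr_ge0 m11; have := sqr_ge0 (m02 + m20).
  by clear -sq; lra.
have s02 : m20 = - m02.
  apply/eqP; rewrite -addr_eq0 addrC; apply/eqP; apply: sqr0I.
  by subst; lra_from sq.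
subst; have [m010 | m010] := eqVneq m01 0.
  subst; have [m020 | m020] := eqVneq m02 0.
    by subst; have [|||/eqP] := span 1 0 0; rewrite ?oner_eq0 //; clear; lra.
  have m21E : m21 = - m12 by apply: (mulBI m020); lra_from e12.
  have m220 : m22 = 0 by apply: (mul0I m020); subst; lra_from e22.
  subst; have [|||_ /eqP] := span m12 (- m02) 0; try (clear; lra).
  by rewrite oppr_eq0 (negPf m020).
have m21E : m21 = - m12 by apply: (mulBI m010); lra_from e02.
have m220 : m22 = 0 by apply: (mul0I m010); subst; lra_from e12.
subst; have [|||_ _ /eqP] := span m12 (- m02) m01; try (clear; lra).
by rewrite (negPf m010).
Qed.

(** * The Einstein system for a derived algebra of dimension two *)

Lemma sqr_le0 (R : realFieldType) (t : R) : t ^+ 2 <= 0 -> t = 0.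
Proof. by move=> t0; apply: sqr0I; have := sqr_ge0 t; lra. Qed.

Lemma parallel_vec2 (R : fieldType) (a b c d : R) : (a != 0) || (b != 0) ->
  a * d = b * c -> exists k, c = k * a /\ d = k * b.
Proof.
case: (eqVneq a 0) => [-> /= b0 | a0 _] e.
  exists (d / b); rewrite divfK // mulr0; split=> //.
  by apply: (mul0I b0); rewrite -e mul0r.
exists (c / a); rewrite divfK //; split=> //; apply: (mulBI a0).
by rewrite e mulrA mulrCA divff // mulr1 mulrC.
Qed.

(** In the lemmas on derived planes, [p] and [s] are the actions of [f_2] and [f_3] with lowered
    indices, [c] gives the bracket of [f_3] with [f_2], [n2], [n3] are the components of [H] with
    two arguments in the plane and [x0], [x1] those with one. Here [f_3] is timelike and [e33] is a
    sum of squares; once its terms vanish, so is [e22]. *)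
Lemma plane_Riemann_algebra (R : realFieldType)
    (c0 c1 n2 n3 x0 x1 p00 p01 p10 p11 s00 s01 s10 s11 : R) :
  - (c0 ^+ 2) - c1 ^+ 2 + n2 ^+ 2 + 2 * p00 ^+ 2 + 2 * p01 * p10 + p01 ^+ 2 +
    p10 ^+ 2 + 2 * p11 ^+ 2 - x0 ^+ 2 - x1 ^+ 2 = 0 ->
  c0 ^+ 2 + c1 ^+ 2 + n3 ^+ 2 + 2 * s00 ^+ 2 + 2 * s01 * s10 + s01 ^+ 2 + s10
    ^+ 2 + 2 * s11 ^+ 2 + x0 ^+ 2 + x1 ^+ 2 = 0 ->
  [/\ [/\ c0 = 0 & c1 = 0], [/\ n2 = 0, n3 = 0, x0 = 0 & x1 = 0],
      [/\ p00 = 0, p11 = 0 & p10 = - p01] &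
      [/\ s00 = 0, s11 = 0 & s10 = - s01]].
Proof.
move=> e22 e33.
have [q0 q1 q2] := And3 (sqr_ge0 c0) (sqr_ge0 c1) (sqr_ge0 n3).
have [q3 q4 q5] := And3 (sqr_ge0 x0) (sqr_ge0 x1) (sqr_ge0 s00).
have [q6 q7] := conj (sqr_ge0 s11) (sqr_ge0 (s01 + s10)).
have c00 : c0 = 0 by apply: sqr_le0; clear -e33 q0 q1 q2 q3 q4 q5 q6 q7; lra.
have c10 : c1 = 0 by apply: sqr_le0; clear -e33 q0 q1 q2 q3 q4 q5 q6 q7; lra.
have n30 : n3 = 0 by apply: sqr_le0; clear -e33 q0 q1 q2 q3 q4 q5 q6 q7; lra.
have x00 : x0 = 0 by apply: sqr_le0; clear -e33 q0 q1 q2 q3 q4 q5 q6 q7; lra.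
have x10 : x1 = 0 by apply: sqr_le0; clear -e33 q0 q1 q2 q3 q4 q5 q6 q7; lra.
have s000 : s00 = 0 by apply: sqr_le0; clear -e33 q0 q1 q2 q3 q4 q5 q6 q7; lra.
have s110 : s11 = 0 by apply: sqr_le0; clear -e33 q0 q1 q2 q3 q4 q5 q6 q7; lra.
have s01E : s01 + s10 = 0.
  by apply: sqr_le0; clear -e33 q0 q1 q2 q3 q4 q5 q6 q7; lra.
clear q0 q1 q2 q3 q4 q5 q6 q7 e33; subst.
have [q0 q1 q2] := And3 (sqr_ge0 n2) (sqr_ge0 p00) (sqr_ge0 p11).
have q3 := sqr_ge0 (p01 + p10).
have n20 : n2 = 0 by apply: sqr_le0; clear -e22 q0 q1 q2 q3; lra.
have p000 : p00 = 0 by apply: sqr_le0; clear -e22 q0 q1 q2 q3; lra.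
have p110 : p11 = 0 by apply: sqr_le0; clear -e22 q0 q1 q2 q3; lra.
have p01E : p01 + p10 = 0 by apply: sqr_le0; clear -e22 q0 q1 q2 q3; lra.
by split; split=> //; [clear -p01E | clear -s01E]; lra.
Qed.

Lemma plane_timelike_algebra (R : realFieldType)
    (c0 c1 n2 n3 x0 p00 p01 p10 p11 s00 s01 s10 s11 : R) :
  x0 != 0 ->
  - (c0 ^+ 2) + n2 ^+ 2 + n3 ^+ 2 + p01 ^+ 2 - p10 ^+ 2 + s01 ^+ 2 - s10 ^+ 2 +
    x0 ^+ 2 = 0 ->
  s00 * x0 = 0 ->
  - (p00 * x0) = 0 ->
  - (c1 ^+ 2) - n2 ^+ 2 - n3 ^+ 2 + p01 ^+ 2 - p10 ^+ 2 + s01 ^+ 2 - s10 ^+ 2 =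
    0 ->
  s01 * x0 = 0 ->
  - (p01 * x0) = 0 ->
  - (c0 ^+ 2) + c1 ^+ 2 - n2 ^+ 2 + 2 * p00 ^+ 2 - 2 * p01 * p10 - p01 ^+ 2 -
    p10 ^+ 2 + 2 * p11 ^+ 2 - x0 ^+ 2 = 0 ->
  - (n2 * n3) + 2 * p00 * s00 - p01 * s01 - p01 * s10 - p10 * s01 - p10 * s10 +
    2 * p11 * s11 = 0 ->
  - (c0 ^+ 2) + c1 ^+ 2 - n3 ^+ 2 + 2 * s00 ^+ 2 - 2 * s01 * s10 - s01 ^+ 2 -
    s10 ^+ 2 + 2 * s11 ^+ 2 - x0 ^+ 2 = 0 ->
  False.
Proof.
move=> x00 e00 e02a e03a e11 e12a e13a e22 e23 e33.
have s000 : s00 = 0 by apply: (mul0I x00); lra_from e02a.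
have p000 : p00 = 0 by apply: (mul0I x00); lra_from e03a.
have s010 : s01 = 0 by apply: (mul0I x00); lra_from e12a.
have p010 : p01 = 0 by apply: (mul0I x00); lra_from e13a.
subst; have [q0 q1 q2] := And3 (sqr_ge0 c1) (sqr_ge0 n2) (sqr_ge0 n3).
have [q3 q4] := conj (sqr_ge0 p10) (sqr_ge0 s10).
have c10 : c1 = 0 by apply: sqr_le0; clear -e11 q0 q1 q2 q3 q4; lra.
have n20 : n2 = 0 by apply: sqr_le0; clear -e11 q0 q1 q2 q3 q4; lra.
have n30 : n3 = 0 by apply: sqr_le0; clear -e11 q0 q1 q2 q3 q4; lra.
have p100 : p10 = 0 by apply: sqr_le0; clear -e11 q0 q1 q2 q3 q4; lra.
have s100 : s10 = 0 by apply: sqr_le0; clear -e11 q0 q1 q2 q3 q4; lra.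
subst; have p11E : p11 ^+ 2 = x0 ^+ 2 by lra_from e00 e22.
have s11E : s11 ^+ 2 = x0 ^+ 2 by lra_from e00 e33.
have : (p11 * s11) ^+ 2 = 0 by have -> : p11 * s11 = 0; [lra_from e23 | ring].
by rewrite exprMn p11E s11E; apply/eqP; rewrite mulf_neq0 // expf_neq0.
Qed.

(** The mixed equations remove the second rows of [p] and [s]; then closedness and the Jacobi
    identity make the pairs [(n2, n3)] and [(p01, s01)] multiples [al] and [be] of [(p00, s00)], and
    only a few scalars remain. *)
Lemma plane_spacelike_algebra (R : realFieldType)
    (c0 c1 n2 n3 x1 p00 p01 p10 p11 s00 s01 s10 s11 : R) :
  x1 != 0 ->
  - (c0 ^+ 2) + n2 ^+ 2 + n3 ^+ 2 + p01 ^+ 2 - p10 ^+ 2 + s01 ^+ 2 - s10 ^+ 2 =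
    0 ->
  - (c0 * c1) + p00 * p01 - p00 * p10 + p01 * p11 - p10 * p11 + s00 * s01 - s00
    * s10 + s01 * s11 - s10 * s11 = 0 ->
  - (c0 * x1) - n2 * p00 + n2 * p11 - n3 * s00 + n3 * s11 = 0 ->
  - (c0 * s00) + c1 * s01 - n3 * x1 = 0 ->
  s10 * x1 = 0 ->
  c0 * p00 - c1 * p01 + n2 * x1 = 0 ->
  - (p10 * x1) = 0 ->
  - (c1 ^+ 2) - n2 ^+ 2 - n3 ^+ 2 + p01 ^+ 2 - p10 ^+ 2 + s01 ^+ 2 - s10 ^+ 2 +
    x1 ^+ 2 = 0 ->
  s11 * x1 = 0 ->
  - (p11 * x1) = 0 ->
  - (c0 ^+ 2) + c1 ^+ 2 - n2 ^+ 2 + 2 * p00 ^+ 2 - 2 * p01 * p10 - p01 ^+ 2 -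
    p10 ^+ 2 + 2 * p11 ^+ 2 + x1 ^+ 2 = 0 ->
  - (n2 * n3) + 2 * p00 * s00 - p01 * s01 - p01 * s10 - p10 * s01 - p10 * s10 +
    2 * p11 * s11 = 0 ->
  - (c0 ^+ 2) + c1 ^+ 2 - n3 ^+ 2 + 2 * s00 ^+ 2 - 2 * s01 * s10 - s01 ^+ 2 -
    s10 ^+ 2 + 2 * s11 ^+ 2 + x1 ^+ 2 = 0 ->
  p00 * s01 - p01 * s00 - p01 * s11 + p11 * s01 = 0 ->
  - (n2 * s00) + n2 * s11 + n3 * p00 - n3 * p11 = 0 ->
  False.
Proof.
move=> x10 e00 e01 e01a e02 e02a e03 e03a e11 e12a e13a e22 e23 e33 j0231 clo.
have s100 : s10 = 0 by apply: (mul0I x10); lra_from e02a.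
have p100 : p10 = 0 by apply: (mul0I x10); lra_from e03a.
have s110 : s11 = 0 by apply: (mul0I x10); lra_from e12a.
have p110 : p11 = 0 by apply: (mul0I x10); lra_from e13a.
have x12 : 0 < x1 ^+ 2 by rewrite exprn_even_gt0.
subst; have c1E : c1 ^+ 2 = c0 ^+ 2 - 2 * (n2 ^+ 2 + n3 ^+ 2) + x1 ^+ 2.
  by lra_from e00 e11.
have [|ps] := boolP ((p00 != 0) || (s00 != 0)); last first.
  have [p000 s000] : p00 = 0 /\ s00 = 0.
    by move: ps; rewrite negb_or !negbK => /andP[/eqP ? /eqP ?].
  subst; have c00 : c0 = 0 by apply: (mul0I x10); lra_from e01a.
  subst; have [q0 q1] := conj (sqr_ge0 p01) (sqr_ge0 s01).
  have [q2 q3] := conj (sqr_ge0 n2) (sqr_ge0 n3).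
  have q4 := sqr_ge0 c1.
  by clear -c1E e00 q0 q1 q2 q3 q4 e22 e33 x12; lra.
move=> ps.
have [|al [n2E n3E]] := @parallel_vec2 _ p00 s00 n2 n3 ps; first by lra_from clo.
have [|be [p01E s01E]] := @parallel_vec2 _ p00 s00 p01 s01 ps.
  by lra_from j0231.
have P0 : 0 < p00 ^+ 2 + s00 ^+ 2.
  case/orP: ps => [p0 | s0]; first by rewrite ltr_pwDl ?sqr_ge0 // exprn_even_gt0.
  by rewrite ltr_wpDl ?sqr_ge0 // exprn_even_gt0.
have P00 := lt0r_neq0 P0.
subst; set P := p00 ^+ 2 + s00 ^+ 2 in P0 P00.
pose k := - c0 ^+ 2 + c1 ^+ 2 + x1 ^+ 2.
pose u := - al ^+ 2 + 2 - be ^+ 2.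
have k22 : k + u * p00 ^+ 2 = 0 by rewrite /k /u; lra_from e22.
have k33 : k + u * s00 ^+ 2 = 0 by rewrite /k /u; lra_from e33.
have k23 : u * (p00 * s00) = 0 by rewrite /u; lra_from e23.
(* The three equations above say that [k] times the identity of order two plus [u] times a matrix of
   rank one is zero. *)
have k0 : k = 0.
  have : (u * P) * k = 0.
    rewrite /P; have : (k + u * p00 ^+ 2) * (u * s00 ^+ 2) =
       k * (u * s00 ^+ 2) + (u * (p00 * s00)) ^+ 2 by ring.
    have : (k + u * s00 ^+ 2) * (u * p00 ^+ 2) =
       k * (u * p00 ^+ 2) + (u * (p00 * s00)) ^+ 2 by ring.
    by rewrite k22 k33 k23; clear; lra.
  move/eqP; rewrite mulf_eq0 => /orP[/eqP uP|/eqP //].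
  by move: uP; rewrite /P; clear -k22 k33; lra.
have x1E : x1 ^+ 2 = al ^+ 2 * P.
  by move: k0; rewrite /k /P; clear -c1E; lra.
have c0E : 2 * P = c0 ^+ 2.
  by move: k0; rewrite /k /P; clear -c1E e00 e22 e33; lra.
have c0x1 : c0 * x1 = - al * P by rewrite /P; lra_from e01a.
have : (c0 * x1) ^+ 2 = al ^+ 2 * P ^+ 2 by rewrite c0x1; ring.
rewrite exprMn -c0E x1E => e.
have al0 : al ^+ 2 * P ^+ 2 = 0 by clear -e; lra.
have : x1 ^+ 2 * P = 0 by rewrite x1E; clear -al0; lra.
by apply/eqP; rewrite mulf_neq0 // expf_neq0.
Qed.

(** The mixed equations make each row of [p] and [s] proportional to the other; the squares of [c0],
    [c1] and their product then force [n2 = n3 = 0], and the null vector with components [(de, 1)]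
    is orthogonal to all brackets. *)
Lemma plane_null_algebra (R : realFieldType)
    (c0 c1 n2 n3 x0 x1 p00 p01 p10 p11 s00 s01 s10 s11 : R) :
  x0 != 0 -> forall de : R, de = 1 \/ de = - 1 -> x1 = de * x0 ->
  - (c0 ^+ 2) + n2 ^+ 2 + n3 ^+ 2 + p01 ^+ 2 - p10 ^+ 2 + s01 ^+ 2 - s10 ^+ 2 +
    x0 ^+ 2 = 0 ->
  - (c0 * c1) + p00 * p01 - p00 * p10 + p01 * p11 - p10 * p11 + s00 * s01 - s00
    * s10 + s01 * s11 - s10 * s11 - x0 * x1 = 0 ->
  - (c0 * s00) + c1 * s01 - n3 * x1 = 0 ->
  s00 * x0 + s10 * x1 = 0 ->
  c0 * p00 - c1 * p01 + n2 * x1 = 0 ->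
  - (p00 * x0) - p10 * x1 = 0 ->
  - (c1 ^+ 2) - n2 ^+ 2 - n3 ^+ 2 + p01 ^+ 2 - p10 ^+ 2 + s01 ^+ 2 - s10 ^+ 2 +
    x1 ^+ 2 = 0 ->
  s01 * x0 + s11 * x1 = 0 ->
  - (p01 * x0) - p11 * x1 = 0 ->
  - (c0 ^+ 2) + c1 ^+ 2 - n2 ^+ 2 + 2 * p00 ^+ 2 - 2 * p01 * p10 - p01 ^+ 2 -
    p10 ^+ 2 + 2 * p11 ^+ 2 - x0 ^+ 2 + x1 ^+ 2 = 0 ->
  - (c0 ^+ 2) + c1 ^+ 2 - n3 ^+ 2 + 2 * s00 ^+ 2 - 2 * s01 * s10 - s01 ^+ 2 -
    s10 ^+ 2 + 2 * s11 ^+ 2 - x0 ^+ 2 + x1 ^+ 2 = 0 ->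
  (forall t0 t1,
    p00 * t0 + p01 * t1 = 0 ->
    p10 * t0 + p11 * t1 = 0 ->
    s00 * t0 + s01 * t1 = 0 ->
    s10 * t0 + s11 * t1 = 0 ->
    c0 * t0 + c1 * t1 = 0 ->
    t0 = 0 /\ t1 = 0) ->
  False.
Proof.
move=> x00 de deE x1E e00 e01 e02 e02a e03 e03a e11 e12a e13a e22 e33 span.
have d2 : de ^+ 2 = 1 by case: deE => ->; ring.
have s00E : s00 = - de * s10 by apply: (mulBI x00); subst; lra_from e02a.
have p00E : p00 = - de * p10 by apply: (mulBI x00); subst; lra_from e03a.
have s01E : s01 = - de * s11 by apply: (mulBI x00); subst; lra_from e12a.
have p01E : p01 = - de * p11 by apply: (mulBI x00); subst; lra_from e13a.
have x02 : 0 < x0 ^+ 2 by rewrite exprn_even_gt0.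
pose K := p11 ^+ 2 + s11 ^+ 2 - p10 ^+ 2 - s10 ^+ 2 + x0 ^+ 2.
pose N := n2 ^+ 2 + n3 ^+ 2.
have c0E : c0 ^+ 2 = K + N.
  by rewrite /K /N; case: deE => deE; subst; lra_from e00.
have c1E : c1 ^+ 2 = K - N.
  by rewrite /K /N; case: deE => deE; subst; lra_from e11.
have c01 : c0 * c1 = - de * K.
  by rewrite /K; case: deE => deE; subst; lra_from e01.
have N0 : N = 0.
  apply: sqr0I; have : (c0 * c1) ^+ 2 = K ^+ 2 by rewrite c01 exprMn sqrrN d2 mul1r.
  by rewrite exprMn c0E c1E => e; clear -e; lra.
have [q2 q3] := conj (sqr_ge0 n2) (sqr_ge0 n3).
have n20 : n2 = 0 by apply: sqr_le0; move: N0; rewrite /N; clear -q2 q3; lra.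
have n30 : n3 = 0 by apply: sqr_le0; move: N0; rewrite /N; clear -q2 q3; lra.
have p11E : p11 = - de * p10.
  apply/eqP; rewrite mulNr -addr_eq0; apply/eqP; apply: sqr0I.
  move: c0E c1E; rewrite N0 => c0E c1E.
  by case: deE => deE; subst; lra_from e22 c0E c1E.
have s11E : s11 = - de * s10.
  apply/eqP; rewrite mulNr -addr_eq0; apply/eqP; apply: sqr0I.
  move: c0E c1E; rewrite N0 => c0E c1E.
  by case: deE => deE; subst; lra_from e33 c0E c1E.
have KE : K = x0 ^+ 2.
  by rewrite /K p11E s11E; case: deE => deE; subst; clear; lra.
have dc : de * c0 + c1 = 0.
  apply: sqr0I; have -> : (de * c0 + c1) ^+ 2 =
     de ^+ 2 * c0 ^+ 2 + 2 * de * (c0 * c1) + c1 ^+ 2 by ring.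
  by rewrite c01 c0E c1E N0; case: deE => deE; subst; clear; lra.
have [|||||_ /eqP] := span de 1; last by rewrite oner_eq0.
- by case: deE => deE; subst; clear; lra.
- by case: deE => deE; subst; clear; lra.
- by case: deE => deE; subst; clear; lra.
- by case: deE => deE; subst; clear; lra.
- by case: deE => deE; subst; lra_from dc.
Qed.

(** If [n2] or [n3] were nonzero, each action would have equal diagonal entries and be singular,
    against the signs in [e22] and [e33]. Once they vanish, the vector [(c0, - c1)] is orthogonal to
    all brackets. *)
Lemma plane_closed_algebra (R : realFieldType)
    (c0 c1 n2 n3 p00 p01 p10 p11 s00 s01 s10 s11 : R) :
  - (c0 ^+ 2) + n2 ^+ 2 + n3 ^+ 2 + p01 ^+ 2 - p10 ^+ 2 + s01 ^+ 2 - s10 ^+ 2 =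
    0 ->
  - (n2 * p00) + n2 * p11 - n3 * s00 + n3 * s11 = 0 ->
  - (c0 * s00) + c1 * s01 = 0 ->
  c0 * p00 - c1 * p01 = 0 ->
  - (c1 ^+ 2) - n2 ^+ 2 - n3 ^+ 2 + p01 ^+ 2 - p10 ^+ 2 + s01 ^+ 2 - s10 ^+ 2 =
    0 ->
  - (c0 * s10) + c1 * s11 = 0 ->
  c0 * p10 - c1 * p11 = 0 ->
  - (c0 ^+ 2) + c1 ^+ 2 - n2 ^+ 2 + 2 * p00 ^+ 2 - 2 * p01 * p10 - p01 ^+ 2 -
    p10 ^+ 2 + 2 * p11 ^+ 2 = 0 ->
  - (c0 ^+ 2) + c1 ^+ 2 - n3 ^+ 2 + 2 * s00 ^+ 2 - 2 * s01 * s10 - s01 ^+ 2 -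
    s10 ^+ 2 + 2 * s11 ^+ 2 = 0 ->
  - (n2 * s00) + n2 * s11 + n3 * p00 - n3 * p11 = 0 ->
  (forall t0 t1,
    p00 * t0 + p01 * t1 = 0 ->
    p10 * t0 + p11 * t1 = 0 ->
    s00 * t0 + s01 * t1 = 0 ->
    s10 * t0 + s11 * t1 = 0 ->
    c0 * t0 + c1 * t1 = 0 ->
    t0 = 0 /\ t1 = 0) ->
  [/\ c0 = 0, c1 = 0, n2 = 0 & n3 = 0].
Proof.
move=> e00 e01a e02 e03 e11 e12 e13 e22 e33 clo span.
pose N := n2 ^+ 2 + n3 ^+ 2.
have [q2 q3] := conj (sqr_ge0 n2) (sqr_ge0 n3).
have cE : c0 ^+ 2 - c1 ^+ 2 = 2 * N by rewrite /N; lra_from e00 e11.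
have [N0 | N0] := eqVneq N 0; last first.
  have Np : 0 < N by rewrite lt_def N0 /N; clear -q2 q3; lra.
  have p11E : p00 - p11 = 0.
    apply: (mul0I N0); rewrite /N; move/(congr1 ( *%R n2)): (e01a).
    by move/(congr1 ( *%R n3)): (clo); clear; lra.
  have s11E : s00 - s11 = 0.
    apply: (mul0I N0); rewrite /N; move/(congr1 ( *%R n3)): (e01a).
    by move/(congr1 ( *%R n2)): (clo); clear; lra.
  have c00 : c0 != 0.
    apply: contraTneq Np => c00; move: cE; rewrite c00.
    by have := sqr_ge0 c1; clear; lra.
  have detp : p00 * p11 = p01 * p10.
    apply: (mulBI c00); move/(congr1 ( *%R p11)): (e03).
    by move/(congr1 ( *%R p01)): (e13); clear; lra.
  have dets : s00 * s11 = s01 * s10.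
    apply: (mulBI c00); move/(congr1 ( *%R s11)): (e02).
    by move/(congr1 ( *%R s01)): (e12); clear; lra.
  have [r0 r1] := conj (sqr_ge0 (p01 - p10)) (sqr_ge0 (s01 - s10)).
  have [r2 r3] : p00 = p11 /\ s00 = s11 by clear -p11E s11E; lra.
  by exfalso; move: cE Np; rewrite /N; subst; clear -e22 e33 detp dets r0 r1; lra.
have n20 : n2 = 0 by apply: sqr_le0; move: N0; rewrite /N; clear -q2 q3; lra.
have n30 : n3 = 0 by apply: sqr_le0; move: N0; rewrite /N; clear -q2 q3; lra.
rewrite N0 in cE; have [|||||k0 k1] := span c0 (- c1); last first.
- by split=> //; apply: oppr_inj; rewrite k1 oppr0.
- by lra_from cE.
- by lra_from e12.
- by lra_from e02.
- by lra_from e13.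
- by lra_from e03.
Qed.

(** On symmetric matrices the form [2 * p00 ^+ 2 + 2 * p11 ^+ 2 - (p01 + p10) ^+ 2] has signature
    (2, 1), and the hypotheses make the span of the symmetric parts of [p] and [s] isotropic. It is
    therefore at most a line, so some combination is skew; [u] and [v] are normalised to a rotation
    of the complement. *)
Lemma plane_rotation_algebra (R : rcfType)
    (p00 p01 p10 p11 s00 s01 s10 s11 : R) :
  2 * p00 ^+ 2 - 2 * p01 * p10 - p01 ^+ 2 - p10 ^+ 2 + 2 * p11 ^+ 2 = 0 ->
  2 * p00 * s00 - p01 * s01 - p01 * s10 - p10 * s01 - p10 * s10 + 2 * p11 * s11
    = 0 ->
  2 * s00 ^+ 2 - 2 * s01 * s10 - s01 ^+ 2 - s10 ^+ 2 + 2 * s11 ^+ 2 = 0 ->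
  exists u v, [/\ u ^+ 2 + v ^+ 2 = 1, u * p00 + v * s00 = 0,
    u * p11 + v * s11 = 0 & u * (p01 + p10) + v * (s01 + s10) = 0].
Proof.
move=> e22 e23 e33.
set B := p01 + p10; set C := s01 + s10.
have pE : B ^+ 2 = 2 * (p00 ^+ 2 + p11 ^+ 2) by rewrite /B; lra_from e22.
have sE : C ^+ 2 = 2 * (s00 ^+ 2 + s11 ^+ 2) by rewrite /C; lra_from e33.
have psE : B * C = 2 * (p00 * s00 + p11 * s11) by rewrite /B /C; lra_from e23.
have d1 : p00 * s11 - p11 * s00 = 0.
  apply: sqr0I; have : (B * C) ^+ 2 = B ^+ 2 * C ^+ 2 by ring.
  by rewrite psE pE sE; clear; lra.
have d2 : p00 * C - s00 * B = 0.
  apply: sqr0I; have -> : (p00 * C - s00 * B) ^+ 2 = p00 ^+ 2 * C ^+ 2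
    - 2 * (p00 * s00) * (B * C) + s00 ^+ 2 * B ^+ 2 by ring.
  rewrite pE sE psE; transitivity (2 * (p00 * s11 - p11 * s00) ^+ 2); first by ring.
  by rewrite d1; ring.
have d3 : p11 * C - s11 * B = 0.
  apply: sqr0I; have -> : (p11 * C - s11 * B) ^+ 2 = p11 ^+ 2 * C ^+ 2
    - 2 * (p11 * s11) * (B * C) + s11 ^+ 2 * B ^+ 2 by ring.
  rewrite pE sE psE; transitivity (2 * (p00 * s11 - p11 * s00) ^+ 2); first by ring.
  by rewrite d1; ring.
have [p0 | p0] := boolP ((p00 != 0) || (p11 != 0)); last first.
  move: p0; rewrite negb_or !negbK => /andP[/eqP p000 /eqP p110].
  exists 1, 0; split; [by ring | by rewrite p000; ring | by rewrite p110; ring |].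
  by rewrite mul1r mul0r addr0; apply: sqr0I; rewrite pE p000 p110; ring.
have [be [s00E s11E]] := parallel_vec2 p0 (etrans (subr0_eq d1) erefl).
have CE : C = be * B.
  case/orP: p0 => [p000 | p110].
    by apply: (mulBI p000); rewrite s00E in d2; clear -d2; lra.
  by apply: (mulBI p110); rewrite s11E in d3; clear -d3; lra.
pose r := Num.sqrt (1 + be ^+ 2).
have r2 : r ^+ 2 = 1 + be ^+ 2.
  by rewrite sqr_sqrtr // addr_ge0 // sqr_ge0.
have r0 : r != 0 by rewrite sqrtr_eq0 -ltNge ltr_pwDl // sqr_ge0.
exists (be / r), (- r^-1); rewrite s00E s11E CE; split; try by ring.
rewrite exprMn sqrrN exprVn r2; field.
by rewrite -r2 expf_neq0.
Qed.

Lemma plane_skew_algebra (R : realFieldType)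
    (p01 s00 s01 s10 s11 : R) :
  p01 != 0 ->
  2 * s00 ^+ 2 - 2 * s01 * s10 - s01 ^+ 2 - s10 ^+ 2 + 2 * s11 ^+ 2 = 0 ->
  - (p01 * s01) - p01 * s10 = 0 ->
  - (p01 * s00) - p01 * s11 = 0 ->
  [/\ s00 = 0, s11 = 0 & s10 = - s01].
Proof.
move=> p010 e33 j0230 j0231.
have s10E : s10 = - s01 by apply: (mulBI p010); lra_from j0230.
have s11E : s11 = - s00 by apply: (mulBI p010); lra_from j0231.
subst; have s000 : s00 = 0 by apply: sqr0I; lra_from e33.
by subst; rewrite oppr0.
Qed.

Lemma plane_ad_algebra (R : realFieldType)
    (s00 s01 s10 s11 : R) :
  s01 ^+ 2 - s10 ^+ 2 = 0 ->
  s00 * s01 - s00 * s10 + s01 * s11 - s10 * s11 = 0 ->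
  2 * s00 ^+ 2 - 2 * s01 * s10 - s01 ^+ 2 - s10 ^+ 2 + 2 * s11 ^+ 2 = 0 ->
  (forall t0 t1,
    s00 * t0 + s01 * t1 = 0 ->
    s10 * t0 + s11 * t1 = 0 ->
    t0 = 0 /\ t1 = 0) ->
  [/\ s00 = 0, s11 = 0 & s10 = - s01] \/
  [/\ s10 = s01, s00 ^+ 2 + s11 ^+ 2 = 2 * s01 ^+ 2 & s00 != s11].
Proof.
move=> e00 e01 e33 span.
have : (s01 + s10) * (s01 - s10) = 0 by lra_from e00.
move/eqP; rewrite mulf_eq0 => /orP[] /eqP k.
  left; have s10E : s10 = - s01 by lra_from k.
  subst; have [q0 q1] := conj (sqr_ge0 s00) (sqr_ge0 s11).
  by split=> //; apply: sqr_le0; clear -e33 q0 q1; lra.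
have s10E : s10 = s01 by lra_from k.
subst; right; split=> //; first by lra_from e33.
(* Equal diagonal entries would leave a null vector [f_0 + f_1] or [f_0 - f_1] orthogonal to all
   brackets. *)
apply/eqP => s11E; subst; have : (s11 + s01) * (s11 - s01) = 0.
  by lra_from e33.
move/eqP; rewrite mulf_eq0 => /orP[] /eqP k1.
  have s01E : s01 = - s11 by lra_from k1.
  subst; have [|| _ /eqP] := span 1 1; rewrite ?oner_eq0 //; clear; lra.
have s01E : s01 = s11 by lra_from k1.
subst; have [|| /eqP] := span 1 (- 1); rewrite ?oner_eq0 //; clear; lra.
Qed.

(** * The Einstein system for a derived algebra of dimension at most one *)

Lemma line_spacelike_algebra (R : realFieldType)
    (f1 f2 f3 o1 o2 o3 h z1 z2 z3 : R) :
  o1 ^+ 2 + o2 ^+ 2 - o3 ^+ 2 - z1 ^+ 2 - z2 ^+ 2 + z3 ^+ 2 = 0 ->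
  2 * f1 ^+ 2 - h ^+ 2 - o2 ^+ 2 + o3 ^+ 2 - z2 ^+ 2 + z3 ^+ 2 = 0 ->
  2 * f2 ^+ 2 - h ^+ 2 - o1 ^+ 2 + o3 ^+ 2 - z1 ^+ 2 + z3 ^+ 2 = 0 ->
  2 * f3 ^+ 2 + h ^+ 2 + o1 ^+ 2 + o2 ^+ 2 + z1 ^+ 2 + z2 ^+ 2 = 0 ->
  [/\ f1 = 0, f2 = 0 & f3 = 0] /\ [/\ o1 = 0, o2 = 0 & o3 = 0].
Proof.
move=> e00 e11 e22 e33.
have [q0 q1 q2] := And3 (sqr_ge0 f3) (sqr_ge0 h) (sqr_ge0 o1).
have [q3 q4 q5] := And3 (sqr_ge0 o2) (sqr_ge0 z1) (sqr_ge0 z2).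
have h0 : h = 0 by apply: sqr_le0; clear -e33 q0 q1 q2 q3 q4 q5; lra.
have f30 : f3 = 0 by apply: sqr_le0; clear -e33 q0 q1 q2 q3 q4 q5; lra.
have o10 : o1 = 0 by apply: sqr_le0; clear -e33 q0 q1 q2 q3 q4 q5; lra.
have o20 : o2 = 0 by apply: sqr_le0; clear -e33 q0 q1 q2 q3 q4 q5; lra.
have z10 : z1 = 0 by apply: sqr_le0; clear -e33 q0 q1 q2 q3 q4 q5; lra.
have z20 : z2 = 0 by apply: sqr_le0; clear -e33 q0 q1 q2 q3 q4 q5; lra.
clear q0 q1 q2 q3 q4 q5; subst.
have [q0 q1] := conj (sqr_ge0 f1) (sqr_ge0 f2).
have [q2 q3] := conj (sqr_ge0 o3) (sqr_ge0 z3).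
have f10 : f1 = 0 by apply: sqr_le0; clear -e11 q0 q1 q2 q3; lra.
have f20 : f2 = 0 by apply: sqr_le0; clear -e22 q0 q1 q2 q3; lra.
have o30 : o3 = 0 by apply: sqr_le0; clear -e11 q0 q1 q2 q3; lra.
by [].
Qed.

(** The data are three vectors [f], [o], [z] of the Euclidean complement and a scalar [h]: the
    action on the line, and the duals of the two-forms given by the bracket and by [H(f_0, ., .)].
    The off-diagonal equations with index 0 are [f x o + h z = 0] and [- f x z + h o = 0]; the
    remaining ones say that the sum of the squares of [o] and [z] and twice that of [f], as
    symmetric matrices, is a multiple of the identity. Jacobi and closedness make [o] and [z]
    orthogonal to [f]. *)
Lemma line_timelike_algebra (R : realFieldType)
    (f1 f2 f3 o1 o2 o3 h z1 z2 z3 : R) :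
  - (o1 ^+ 2) - o2 ^+ 2 - o3 ^+ 2 + z1 ^+ 2 + z2 ^+ 2 + z3 ^+ 2 = 0 ->
  f2 * o3 - f3 * o2 + h * z1 = 0 ->
  - (f2 * z3) + f3 * z2 + h * o1 = 0 ->
  - (f1 * o3) + f3 * o1 + h * z2 = 0 ->
  f1 * z3 - f3 * z1 + h * o2 = 0 ->
  f1 * o2 - f2 * o1 + h * z3 = 0 ->
  - (f1 * z2) + f2 * z1 + h * o3 = 0 ->
  2 * f1 ^+ 2 + h ^+ 2 - o2 ^+ 2 - o3 ^+ 2 - z2 ^+ 2 - z3 ^+ 2 = 0 ->
  2 * f1 * f2 + o1 * o2 + z1 * z2 = 0 ->
  2 * f1 * f3 + o1 * o3 + z1 * z3 = 0 ->
  2 * f2 ^+ 2 + h ^+ 2 - o1 ^+ 2 - o3 ^+ 2 - z1 ^+ 2 - z3 ^+ 2 = 0 ->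
  2 * f2 * f3 + o2 * o3 + z2 * z3 = 0 ->
  2 * f3 ^+ 2 + h ^+ 2 - o1 ^+ 2 - o2 ^+ 2 - z1 ^+ 2 - z2 ^+ 2 = 0 ->
  - (f1 * o1) - f2 * o2 - f3 * o3 = 0 ->
  - (f1 * z1) - f2 * z2 - f3 * z3 = 0 ->
  [/\ f1 = 0, f2 = 0 & f3 = 0] /\ [/\ o1 = 0, o2 = 0 & o3 = 0].
Proof.
move=> e00 e01 e01a e02 e02a e03 e03a e11 e12 e13 e22 e23 e33 j1230 clo.
pose F := f1 ^+ 2 + f2 ^+ 2 + f3 ^+ 2; pose O := o1 ^+ 2 + o2 ^+ 2 + o3 ^+ 2.
have [q0 q1 q2] := And3 (sqr_ge0 f1) (sqr_ge0 f2) (sqr_ge0 f3).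
have [q3 q4 q5] := And3 (sqr_ge0 o1) (sqr_ge0 o2) (sqr_ge0 o3).
suff [F0 O0] : F = 0 /\ O = 0.
  rewrite /F in F0; rewrite /O in O0.
  split; split; apply: sqr_le0.
  - by clear -F0 q0 q1 q2; lra.
  - by clear -F0 q0 q1 q2; lra.
  - by clear -F0 q0 q1 q2; lra.
  - by clear -O0 q3 q4 q5; lra.
  - by clear -O0 q3 q4 q5; lra.
  - by clear -O0 q3 q4 q5; lra.
have zO : z1 ^+ 2 + z2 ^+ 2 + z3 ^+ 2 = O by rewrite /O; lra_from e00.
have fo : f1 * o1 + f2 * o2 + f3 * o3 = 0 by lra_from j1230.
have fz : f1 * z1 + f2 * z2 + f3 * z3 = 0 by lra_from clo.
have trE : 2 * F + 3 * h ^+ 2 = 4 * O by rewrite /F /O; lra_from e00 e11 e22 e33.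
(* The symmetric matrix equation evaluated on the vector [f]. *)
have ff : (2 * F + h ^+ 2 - 2 * O) * F = 0.
  have := congr1 ( *%R (f1 * f1)) e11; have := congr1 ( *%R (f2 * f2)) e22.
  have := congr1 ( *%R (f3 * f3)) e33; have := congr1 ( *%R (2 * (f1 * f2))) e12.
  have := congr1 ( *%R (2 * (f1 * f3))) e13.
  have := congr1 ( *%R (2 * (f2 * f3))) e23.
  have := congr1 (fun t => t ^+ 2) fo; have := congr1 (fun t => t ^+ 2) fz.
  have := congr1 ( *%R F) zO; rewrite /F /O; clear; lra.
(* Lagrange's identity for the cross product of the orthogonal vectors [f] and [o]. *)
have hz : h ^+ 2 * O = F * O.
  have e1 : h * z1 = f3 * o2 - f2 * o3 by lra_from e01.
  have e2 : h * z2 = f1 * o3 - f3 * o1 by lra_from e02.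
  have e3 : h * z3 = f2 * o1 - f1 * o2 by lra_from e03.
  transitivity ((h * z1) ^+ 2 + (h * z2) ^+ 2 + (h * z3) ^+ 2).
    by rewrite -zO; ring.
  rewrite e1 e2 e3; have := congr1 (fun t => t ^+ 2) fo; rewrite /F /O.
  by clear; lra.
have [O0 | O0] := eqVneq O 0.
  split=> //; move: trE; rewrite O0; have := sqr_ge0 h; rewrite /F.
  by clear -q0 q1 q2; lra.
have hF : h ^+ 2 = F by apply: (mulBI O0); rewrite mulrC hz mulrC.
have [F0 | F0] := eqVneq F 0.
  by rewrite F0 hF F0 in trE; split=> //; clear -trE; lra.
have : 2 * F + h ^+ 2 - 2 * O = 0 by apply: (mul0I F0); rewrite mulrC.
by rewrite hF in trE *; move=> k; case/eqP: F0; clear -trE k; lra.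
Qed.

Lemma abelian_form_algebra (R : realFieldType)
    (h z1 z2 z3 : R) :
  z1 ^+ 2 + z2 ^+ 2 + z3 ^+ 2 = 0 ->
  h ^+ 2 - z2 ^+ 2 - z3 ^+ 2 = 0 ->
  [/\ h = 0, z1 = 0, z2 = 0 & z3 = 0].
Proof.
move=> e00 e11.
have [q0 q1 q2] := And3 (sqr_ge0 z1) (sqr_ge0 z2) (sqr_ge0 z3).
have q3 := sqr_ge0 h.
have z10 : z1 = 0 by apply: sqr_le0; clear -e00 q0 q1 q2; lra.
have z20 : z2 = 0 by apply: sqr_le0; clear -e00 q0 q1 q2; lra.
have z30 : z3 = 0 by apply: sqr_le0; clear -e00 q0 q1 q2; lra.
by split=> //; apply: sqr_le0; subst; lra_from e11.
Qed.

(** * Perfect algebras of dimension four *)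

Section PerfectDim4.
Variables (R : realFieldType) (L : nat -> nat -> nat -> R).
Local Notation eps := (eps4 (-1) 1 1 1 : nat -> R).

(* The value of de^k /\ de^l on (f_0, f_1, f_2, f_3). *)
Definition wedge k l :=
  L 0%N 1%N k * L 2%N 3%N l + L 2%N 3%N k * L 0%N 1%N l
  - (L 0%N 2%N k * L 1%N 3%N l + L 1%N 3%N k * L 0%N 2%N l)
  + (L 0%N 3%N k * L 1%N 2%N l + L 1%N 2%N k * L 0%N 3%N l).

Hypothesis LC : forall i j k, L i j k = - L j i k.
Hypothesis jacL : forall i j k l, (i < 4)%N -> (j < 4)%N -> (k < 4)%N ->
  (l < 4)%N -> jac id eps L i j k l = 0.
Hypothesis trL : forall i, (i < 4)%N -> sum4 (fun k => eps k * L i k k) = 0.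

Ltac wedge_lra J z :=
  have := J isT isT isT isT; rewrite /jac /wedge /sum4 /eps4 /= !z; lra.

(** The four-form is the differential of [e^k /\ de^l], because [d] squares to zero, and a
    unimodular algebra has no nonzero exact form of top degree. Computationally it is the Jacobi
    identity for the three indices other than [k], after the trace relations. *)
Lemma wedge0 k l : (k < 4)%N -> (l < 4)%N -> wedge k l = 0.
Proof.
have Lii i j : L i i j = 0 by have := LC i i j; lra.
have rules := (Lii, LC 1 0, LC 2 0, LC 3 0, LC 2 1, LC 3 1, LC 3 2).
have t0 : L 0%N 3%N 3%N = - L 0%N 1%N 1%N - L 0%N 2%N 2%N.
  by have := trL (isT : (0 < 4)%N); rewrite /sum4 /eps4 /= !rules; lra.
have t1 : L 1%N 3%N 3%N = - L 0%N 1%N 0%N - L 1%N 2%N 2%N.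
  by have := trL (isT : (1 < 4)%N); rewrite /sum4 /eps4 /= !rules; lra.
have t2 : L 2%N 3%N 3%N = - L 0%N 2%N 0%N + L 1%N 2%N 1%N.
  by have := trL (isT : (2 < 4)%N); rewrite /sum4 /eps4 /= !rules; lra.
have t3 : L 0%N 3%N 0%N = L 1%N 3%N 1%N + L 2%N 3%N 2%N.
  by have := trL (isT : (3 < 4)%N); rewrite /sum4 /eps4 /= !rules; lra.
have rules' := (rules, t0, t1, t2, t3).
have J i j m n (i4 : (i < 4)%N) (j4 : (j < 4)%N) (m4 : (m < 4)%N)
    (n4 : (n < 4)%N) := jacL i4 j4 m4 n4.
case: k => [|[|[|[|//]]]] _; case: l => [|[|[|[|//]]]] _.
- by wedge_lra (J 1 2 3 0)%N rules'.
- by wedge_lra (J 1 2 3 1)%N rules'.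
- by wedge_lra (J 1 2 3 2)%N rules'.
- by wedge_lra (J 1 2 3 3)%N rules'.
- by wedge_lra (J 0 2 3 0)%N rules'.
- by wedge_lra (J 0 2 3 1)%N rules'.
- by wedge_lra (J 0 2 3 2)%N rules'.
- by wedge_lra (J 0 2 3 3)%N rules'.
- by wedge_lra (J 0 1 3 0)%N rules'.
- by wedge_lra (J 0 1 3 1)%N rules'.
- by wedge_lra (J 0 1 3 2)%N rules'.
- by wedge_lra (J 0 1 3 3)%N rules'.
- by wedge_lra (J 0 1 2 0)%N rules'.
- by wedge_lra (J 0 1 2 1)%N rules'.
- by wedge_lra (J 0 1 2 2)%N rules'.
- by wedge_lra (J 0 1 2 3)%N rules'.
Qed.

(* The forms de^k span an isotropic subspace for the wedge pairing
   Λ² x Λ² -> Λ⁴, which has signature (3, 3): they are linearly dependent. *)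
Lemma perfect_dim4 : exists t : nat -> R,
  (exists2 k, (k < 4)%N & t k != 0) /\
  forall i j, (i < 4)%N -> (j < 4)%N -> sum4 (fun k => t k * L i j k) = 0.
Proof.
(* The columns are ordered so that [c] and [c + 3] modulo 6 are complementary pairs; [sg] is the
   sign of their wedge product. *)
pose r (c : nat) : nat * nat :=
  nth (0, 0)%N [:: (0, 1); (0, 2); (0, 3); (2, 3); (1, 3); (1, 2)]%N c.
pose sg (c : nat) : R := [:: 1; -1; 1; 1; -1; 1]`_c.
pose D : 'M[R]_(4, 6) := \matrix_(k, c) L (r c).1 (r c).2 k.
pose DJ : 'M[R]_(4, 6) :=
  \matrix_(k, c) (sg c * L (r ((c + 3) %% 6)%N).1 (r ((c + 3) %% 6)%N).2 k).
have DJD : DJ *m D^T = 0.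
  apply/matrixP => k l; rewrite !mxE -[RHS](wedge0 (ltn_ord k) (ltn_ord l)).
  rewrite !big_ord_recl big_ord0 !mxE /= /wedge /sg /r /=; ring.
have rDJ : \rank DJ = \rank D.
  pose J : 'M[R]_6 := \matrix_(c, c')
    (if (c == (c' + 3) %% 6 :> nat)%N then sg c' else 0).
  have -> : DJ = D *m J.
    apply/matrixP => k c; rewrite !mxE.
    have c6 : ((c + 3) %% 6 < 6)%N by rewrite ltn_mod.
    rewrite (bigD1 (Ordinal c6)) //= !mxE eqxx big1 ?addr0; first by ring.
    by move=> c' c'c; rewrite !mxE ifN ?mulr0 //.
  rewrite mxrankMfree // row_free_unit.
  have JJ : J *m J = 1%:M.
    apply/matrixP => c c'; rewrite !mxE !big_ord_recl big_ord0 !mxE /=.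
    by case: c => [[|[|[|[|[|[|//]]]]]] ?]; case: c' =>
      [[|[|[|[|[|[|//]]]]]] ?]; rewrite /sg /=; ring.
  by have [] := mulmx1_unit JJ.
(* Isotropy bounds twice the rank by 6. *)
have rD : (\rank D < 4)%N.
  rewrite ltnNge; apply/negP => rD.
  have := mulmx0_rank_max DJD; rewrite mxrank_tr rDJ => h.
  by have := leq_trans (leq_add rD rD) h.
have : kermx D != 0 by rewrite -mxrank_eq0 mxrank_ker subn_eq0 -ltnNge.
case/rowV0Pn => u /sub_kermxP uD u0.
exists (fun k => u 0 (inord k)); split.
  have /rV0Pn[k uk] := u0; exists k => //.
  by rewrite inord_val.
move=> i j i4 j4.
have uE c : (c < 6)%N ->
    sum4 (fun k => u 0 (inord k) * L (r c).1 (r c).2 k) = 0.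
  move=> c6; have := congr1 (fun M : 'rV[R]_6 => M 0 (Ordinal c6)) uD.
  rewrite !mxE => <-.
  by rewrite -big_ord4; apply: eq_bigr => k _; rewrite !mxE inord_val.
have sumC m n : sum4 (fun k => u 0 (inord k) * L m n k) =
    - sum4 (fun k => u 0 (inord k) * L n m k).
  by rewrite /sum4 (LC m n 0) (LC m n 1) (LC m n 2) (LC m n 3); ring.
have sum0 m : sum4 (fun k => u 0 (inord k) * L m m k) = 0.
  by have := sumC m m; lra.
case: i i4 => [|[|[|[|//]]]] _; case: j j4 => [|[|[|[|//]]]] _ //.
- exact: uE 0%N isT.
- exact: uE 1%N isT.
- exact: uE 2%N isT.
- by rewrite sumC (uE 0%N isT) oppr0.
- exact: uE 5%N isT.
- exact: uE 4%N isT.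
- by rewrite sumC (uE 1%N isT) oppr0.
- by rewrite sumC (uE 5%N isT) oppr0.
- exact: uE 3%N isT.
- by rewrite sumC (uE 2%N isT) oppr0.
- by rewrite sumC (uE 4%N isT) oppr0.
- by rewrite sumC (uE 3%N isT) oppr0.
Qed.
End PerfectDim4.

(** * The Einstein system in terms of structure constants *)

Ltac expand_system zz := rewrite /ein /jac /clo /sum4 /eps4 /swap02 /= ?zz.
(** Both orders of the arguments are supplied so that [lra] can form the parts even and odd in
    [H]. *)
Ltac ein_lra E zz x y :=
  move: (E x y isT isT) (E y x isT isT); expand_system zz; lra.
Ltac ein_diag_lra E zz x := move: (E x x isT isT); expand_system zz; lra.
Ltac jac_lra J zz i j k l :=
  move: (J i j k l isT isT isT isT); expand_system zz; lra.
Ltac clo_lra C zz := move: C; expand_system zz; lra.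

(** For a frame whose first [k] vectors span g': no nonzero vector of g' is orthogonal to all
    brackets. This is how nondegeneracy of g' reaches the algebraic lemmas. *)
Definition spanning (R : nzRingType) k (L : nat -> nat -> nat -> R) :=
  forall t : nat -> R, (forall i j, (i < 4)%N -> (j < 4)%N ->
    \sum_(l < k) t l * L i j l = 0) -> forall l, (l < k)%N -> t l = 0.

Lemma spanning_pairs (R : realFieldType) k (L : nat -> nat -> nat -> R)
    (t : nat -> R) :
  (forall i j l, L i j l = - L j i l) -> spanning k L ->
  (let e i j := \sum_(l < k) t l * L i j l = 0 in
   [/\ e 0%N 1%N, e 1%N 2%N, e 2%N 0%N & [/\ e 3%N 0%N, e 3%N 1%N & e 3%N 2%N]]) ->
  forall l, (l < k)%N -> t l = 0.
Proof.
move=> LC spanL [t01 t12 t20 [t30 t31 t32]]; apply: spanL => i j i4 j4.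
have Lii m l : L m m l = 0 by have := LC m m l; lra.
have tC m n : \sum_(l < k) t l * L m n l = - \sum_(l < k) t l * L n m l.
  by rewrite -sumrN; apply: eq_bigr => l _; rewrite LC mulrN.
have tii m : \sum_(l < k) t l * L m m l = 0.
  by rewrite big1 // => l _; rewrite Lii mulr0.
by case: i i4 => [|[|[|[|//]]]] _; case: j j4 => [|[|[|[|//]]]] _;
  rewrite ?tii // tC ?(t01, t12, t20, t30, t31, t32) oppr0.
Qed.

Lemma spanning3 (R : realFieldType) (L : nat -> nat -> nat -> R) t0 t1 t2 :
  (forall i j l, L i j l = - L j i l) -> spanning 3 L ->
  (let e i j := t0 * L i j 0%N + t1 * L i j 1%N + t2 * L i j 2%N = 0 in
   [/\ e 0%N 1%N, e 1%N 2%N, e 2%N 0%N & [/\ e 3%N 0%N, e 3%N 1%N & e 3%N 2%N]]) ->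
  [/\ t0 = 0, t1 = 0 & t2 = 0].
Proof.
move=> LC spanL e; have s := @spanning_pairs _ 3 L (fun l => [:: t0; t1; t2]`_l) LC spanL.
have {}s l : (l < 3)%N -> [:: t0; t1; t2]`_l = 0.
  apply: s; case: e => e01 e12 e20 [e30 e31 e32].
  by do ?split; rewrite !big_ord_recl big_ord0 addr0 /= addrA.
by split; [apply: (s 0%N) | apply: (s 1%N) | apply: (s 2%N)].
Qed.

Lemma spanning2 (R : realFieldType) (L : nat -> nat -> nat -> R) t0 t1 :
  (forall i j l, L i j l = - L j i l) -> spanning 2 L ->
  (let e i j := t0 * L i j 0%N + t1 * L i j 1%N = 0 in
   [/\ e 0%N 1%N, e 1%N 2%N, e 2%N 0%N & [/\ e 3%N 0%N, e 3%N 1%N & e 3%N 2%N]]) ->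
  t0 = 0 /\ t1 = 0.
Proof.
move=> LC spanL e; have s := @spanning_pairs _ 2 L (fun l => [:: t0; t1]`_l) LC spanL.
have {}s l : (l < 2)%N -> [:: t0; t1]`_l = 0.
  apply: s; case: e => e01 e12 e20 [e30 e31 e32].
  by do ?split; rewrite !big_ord_recl big_ord0 addr0 /=.
by split; [apply: (s 0%N) | apply: (s 1%N)].
Qed.

Ltac span_lra lem zz := apply: lem => //; do ?split; rewrite ?zz; lra.

Lemma swap02_lt4 i : (i < 4)%N -> (swap02 i < 4)%N.
Proof. by case: i => [|[|[|[|]]]]. Qed.

Lemma diagonal_Lorentz (R : realFieldType) (L h : nat -> nat -> nat -> R) :
  einstein_system id (eps4 (-1) 1 1 1) L h ->
  (forall i j, L i j 3%N = 0) ->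
  L 0%N 1%N 0%N = 0 ->
  L 0%N 1%N 1%N = 0 ->
  L 1%N 2%N 1%N = 0 ->
  L 1%N 2%N 2%N = 0 ->
  L 2%N 0%N 0%N = 0 ->
  L 2%N 0%N 2%N = 0 ->
  spanning 3 L ->
  [/\ L 1%N 2%N 0%N = 0, L 2%N 0%N 1%N = 0 & L 0%N 1%N 2%N = 0] \/
  [/\ L 1%N 2%N 0%N != 0,
      L 2%N 0%N 1%N = L 1%N 2%N 0%N /\ L 0%N 1%N 2%N = L 1%N 2%N 0%N,
      h 0%N 1%N 2%N ^+ 2 = L 1%N 2%N 0%N ^+ 2,
      [/\ h 3%N 1%N 2%N = 0, h 3%N 2%N 0%N = 0 & h 3%N 0%N 1%N = 0] &
      [/\ L 3%N 0%N 0%N = 0, L 3%N 1%N 1%N = 0, L 3%N 2%N 2%N = 0 &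
      [/\ L 3%N 1%N 0%N = - L 3%N 0%N 1%N, L 3%N 2%N 0%N = - L 3%N 0%N 2%N &
          L 3%N 2%N 1%N = - L 3%N 1%N 2%N]]].
Proof.
move=> /system_alt-/(_ (fun _ => id)) [LC E J C] z3 z010 z011 z121 z122 z200 z202 spanL.
have zz := (z3, z010, z011, z121, z122, z200, z202).
apply: (@diagonal_Lorentz_algebra _ (L 1%N 2%N 0%N) (L 2%N 0%N 1%N) (L 0%N 1%N 2%N) (h 0%N 1%N 2%N) (h 3%N 1%N 2%N) (h 3%N 2%N 0%N) (h 3%N 0%N 1%N) (L 3%N 0%N 0%N) (L 3%N 0%N 1%N) (L 3%N 0%N 2%N) (L 3%N 1%N 0%N) (L 3%N 1%N 1%N) (L 3%N 1%N 2%N) (L 3%N 2%N 0%N) (L 3%N 2%N 1%N) (L 3%N 2%N 2%N)) => //.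
- by ein_diag_lra E zz 0%N.
- by ein_diag_lra E zz 1%N.
- by ein_diag_lra E zz 2%N.
- by ein_lra E zz 0%N 3%N.
- by ein_lra E zz 0%N 3%N.
- by ein_lra E zz 1%N 3%N.
- by ein_lra E zz 1%N 3%N.
- by ein_lra E zz 2%N 3%N.
- by ein_lra E zz 2%N 3%N.
- by ein_lra E zz 0%N 1%N.
- by ein_lra E zz 1%N 2%N.
- by ein_lra E zz 0%N 2%N.
- by jac_lra J zz 0%N 1%N 3%N 0%N.
- by jac_lra J zz 0%N 1%N 3%N 1%N.
- by jac_lra J zz 0%N 1%N 3%N 2%N.
- by jac_lra J zz 0%N 2%N 3%N 0%N.
- by jac_lra J zz 0%N 2%N 3%N 1%N.
- by jac_lra J zz 1%N 2%N 3%N 0%N.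
- by clo_lra C zz.
- by move=> t0 t1 t2 *; span_lra (spanning3) zz.
Qed.

Lemma diagonal_Riemann (R : realFieldType) (L h : nat -> nat -> nat -> R) :
  einstein_system id (eps4 1 1 1 (-1)) L h ->
  (forall i j, L i j 3%N = 0) ->
  L 0%N 1%N 0%N = 0 ->
  L 0%N 1%N 1%N = 0 ->
  L 1%N 2%N 1%N = 0 ->
  L 1%N 2%N 2%N = 0 ->
  L 2%N 0%N 0%N = 0 ->
  L 2%N 0%N 2%N = 0 ->
  spanning 3 L ->
  [/\ L 1%N 2%N 0%N != 0,
      L 2%N 0%N 1%N = L 1%N 2%N 0%N /\ L 0%N 1%N 2%N = L 1%N 2%N 0%N,
      h 0%N 1%N 2%N ^+ 2 = L 1%N 2%N 0%N ^+ 2,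
      [/\ h 3%N 1%N 2%N = 0, h 3%N 2%N 0%N = 0 & h 3%N 0%N 1%N = 0] &
      [/\ L 3%N 0%N 0%N = 0, L 3%N 1%N 1%N = 0, L 3%N 2%N 2%N = 0 &
      [/\ L 3%N 1%N 0%N = - L 3%N 0%N 1%N, L 3%N 2%N 0%N = - L 3%N 0%N 2%N &
          L 3%N 2%N 1%N = - L 3%N 1%N 2%N]]].
Proof.
move=> /system_alt-/(_ (fun _ => id)) [LC E J C] z3 z010 z011 z121 z122 z200 z202 spanL.
have zz := (z3, z010, z011, z121, z122, z200, z202).
apply: (@diagonal_Riemann_algebra _ (L 1%N 2%N 0%N) (L 2%N 0%N 1%N) (L 0%N 1%N 2%N) (h 0%N 1%N 2%N) (h 3%N 1%N 2%N) (h 3%N 2%N 0%N) (h 3%N 0%N 1%N) (L 3%N 0%N 0%N) (L 3%N 0%N 1%N) (L 3%N 0%N 2%N) (L 3%N 1%N 0%N) (L 3%N 1%N 1%N) (L 3%N 1%N 2%N) (L 3%N 2%N 0%N) (L 3%N 2%N 1%N) (L 3%N 2%N 2%N)) => //.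
- by ein_diag_lra E zz 0%N.
- by ein_diag_lra E zz 1%N.
- by ein_diag_lra E zz 2%N.
- by ein_diag_lra E zz 3%N.
- by jac_lra J zz 0%N 1%N 3%N 0%N.
- by jac_lra J zz 0%N 1%N 3%N 1%N.
- by jac_lra J zz 0%N 2%N 3%N 0%N.
- by move=> t0 t1 t2 *; span_lra (spanning3) zz.
Qed.

Lemma complex_no_system (R : realFieldType) (L h : nat -> nat -> nat -> R) :
  einstein_system id (eps4 (-1) 1 1 1) L h ->
  (forall i j, L i j 3%N = 0) ->
  L 0%N 1%N 0%N = 0 ->
  L 0%N 1%N 1%N = 0 ->
  L 1%N 2%N 2%N = 0 ->
  L 2%N 0%N 2%N = 0 ->
  L 2%N 0%N 0%N = - L 1%N 2%N 1%N ->
  L 2%N 0%N 1%N = L 1%N 2%N 0%N ->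
  L 1%N 2%N 1%N != 0 ->
  spanning 3 L ->
  False.
Proof.
move=> /system_alt-/(_ (fun _ => id)) [LC E J C] z3 z010 z011 z122 z202 z200 z201 B0 spanL.
have zz := (z3, z010, z011, z122, z202, z200, z201).
apply: (@complex_algebra _ (L 0%N 1%N 2%N) (L 1%N 2%N 0%N) (L 1%N 2%N 1%N) (h 0%N 1%N 2%N) (h 3%N 1%N 2%N) (h 3%N 2%N 0%N) (h 3%N 0%N 1%N) (L 3%N 0%N 0%N) (L 3%N 0%N 1%N) (L 3%N 0%N 2%N) (L 3%N 1%N 0%N) (L 3%N 1%N 1%N) (L 3%N 1%N 2%N) (L 3%N 2%N 0%N) (L 3%N 2%N 1%N) (L 3%N 2%N 2%N)) => //.
- by ein_diag_lra E zz 0%N.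
- by ein_lra E zz 0%N 1%N.
- by ein_diag_lra E zz 2%N.
- by ein_lra E zz 0%N 3%N.
- by ein_lra E zz 0%N 3%N.
- by ein_lra E zz 1%N 3%N.
- by ein_lra E zz 1%N 3%N.
- by ein_lra E zz 2%N 3%N.
- by ein_lra E zz 2%N 3%N.
- by jac_lra J zz 0%N 1%N 3%N 0%N.
- by jac_lra J zz 0%N 1%N 3%N 1%N.
- by jac_lra J zz 0%N 1%N 3%N 2%N.
- by jac_lra J zz 0%N 2%N 3%N 0%N.
- by jac_lra J zz 0%N 2%N 3%N 1%N.
- by jac_lra J zz 1%N 2%N 3%N 0%N.
- by move=> t0 t1 t2 *; span_lra (spanning3) zz.
Qed.

Lemma null_no_system1 (R : realFieldType) (L h : nat -> nat -> nat -> R) :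
  einstein_system swap02 (eps4 1 1 1 1) L h ->
  (forall i j, L i j 3%N = 0) ->
  L 0%N 1%N 0%N = 0 ->
  L 0%N 1%N 1%N = 0 ->
  L 1%N 2%N 1%N = 0 ->
  L 2%N 0%N 0%N = 0 ->
  L 2%N 0%N 2%N = 0 ->
  L 1%N 2%N 0%N = L 0%N 1%N 2%N ->
  L 1%N 2%N 2%N != 0 ->
  spanning 3 L ->
  False.
Proof.
move=> /system_alt-/(_ swap02_lt4) [LC E J C] z3 z010 z011 z121 z200 z202 z120 r0 spanL.
have zz := (z3, z010, z011, z121, z200, z202, z120).
apply: (@null_algebra1 _ (L 0%N 1%N 2%N) (L 2%N 0%N 1%N) (L 1%N 2%N 2%N) (h 0%N 1%N 2%N) (h 3%N 1%N 2%N) (h 3%N 2%N 0%N) (h 3%N 0%N 1%N) (L 3%N 0%N 0%N) (L 3%N 0%N 1%N) (L 3%N 0%N 2%N) (L 3%N 1%N 0%N) (L 3%N 1%N 1%N) (L 3%N 1%N 2%N) (L 3%N 2%N 0%N) (L 3%N 2%N 1%N) (L 3%N 2%N 2%N)) => //.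
- by ein_lra E zz 0%N 2%N.
- by ein_lra E zz 0%N 3%N.
- by ein_lra E zz 0%N 3%N.
- by ein_diag_lra E zz 1%N.
- by ein_lra E zz 1%N 3%N.
- by ein_lra E zz 1%N 3%N.
- by ein_diag_lra E zz 2%N.
- by ein_lra E zz 2%N 3%N.
- by ein_lra E zz 2%N 3%N.
- by ein_diag_lra E zz 3%N.
- by jac_lra J zz 0%N 1%N 3%N 0%N.
- by jac_lra J zz 0%N 1%N 3%N 1%N.
- by jac_lra J zz 0%N 1%N 3%N 2%N.
- by jac_lra J zz 0%N 2%N 3%N 0%N.
- by jac_lra J zz 0%N 2%N 3%N 1%N.
- by jac_lra J zz 0%N 2%N 3%N 2%N.
- by jac_lra J zz 1%N 2%N 3%N 0%N.
- by jac_lra J zz 1%N 2%N 3%N 2%N.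
- by move=> t0 t1 t2 *; span_lra (spanning3) zz.
Qed.

Lemma null_no_system2 (R : realFieldType) (L h : nat -> nat -> nat -> R) :
  einstein_system swap02 (eps4 1 1 1 1) L h ->
  (forall i j, L i j 3%N = 0) ->
  L 0%N 1%N 0%N = 0 ->
  L 0%N 1%N 1%N = 0 ->
  L 2%N 0%N 0%N = 0 ->
  L 1%N 2%N 0%N = L 0%N 1%N 2%N ->
  L 2%N 0%N 1%N = L 0%N 1%N 2%N ->
  L 2%N 0%N 2%N = L 1%N 2%N 1%N ->
  L 1%N 2%N 1%N != 0 ->
  spanning 3 L ->
  False.
Proof.
move=> /system_alt-/(_ swap02_lt4) [LC E J C] z3 z010 z011 z200 z120 z201 z202 q0 spanL.
have zz := (z3, z010, z011, z200, z120, z201, z202).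
apply: (@null_algebra2 _ (L 0%N 1%N 2%N) (L 1%N 2%N 1%N) (L 1%N 2%N 2%N) (h 0%N 1%N 2%N) (h 3%N 1%N 2%N) (h 3%N 2%N 0%N) (h 3%N 0%N 1%N) (L 3%N 0%N 0%N) (L 3%N 0%N 1%N) (L 3%N 0%N 2%N) (L 3%N 1%N 0%N) (L 3%N 1%N 1%N) (L 3%N 1%N 2%N) (L 3%N 2%N 0%N) (L 3%N 2%N 1%N) (L 3%N 2%N 2%N)) => //.
- by ein_lra E zz 0%N 2%N.
- by ein_lra E zz 0%N 3%N.
- by ein_diag_lra E zz 1%N.
- by ein_lra E zz 1%N 2%N.
- by ein_lra E zz 1%N 3%N.
- by ein_lra E zz 2%N 3%N.
- by ein_lra E zz 2%N 3%N.
- by jac_lra J zz 0%N 1%N 3%N 0%N.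
- by jac_lra J zz 0%N 1%N 3%N 1%N.
- by jac_lra J zz 0%N 1%N 3%N 2%N.
- by jac_lra J zz 0%N 2%N 3%N 1%N.
- by jac_lra J zz 1%N 2%N 3%N 1%N.
- by move=> t0 t1 t2 *; span_lra (spanning3) zz.
Qed.

Lemma abelian_null_form (R : realFieldType) (L h : nat -> nat -> nat -> R) :
  einstein_system swap02 (eps4 1 1 1 1) L h ->
  (forall i j, L i j 3%N = 0) ->
  (forall k, L 0%N 1%N k = 0) ->
  (forall k, L 1%N 2%N k = 0) ->
  (forall k, L 2%N 0%N k = 0) ->
  h 3%N 1%N 2%N = 0 ->
  h 3%N 2%N 0%N = 0 ->
  h 3%N 0%N 1%N != 0 ->
  spanning 3 L ->
  False.
Proof.
move=> /system_alt-/(_ swap02_lt4) [LC E J C] z3 z01 z12 z20 zh312 zh320 b20 spanL.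
have zz := (z3, z01, z12, z20, zh312, zh320).
apply: (@abelian_null_algebra _ (h 0%N 1%N 2%N) (h 3%N 0%N 1%N) (L 3%N 0%N 0%N) (L 3%N 0%N 1%N) (L 3%N 0%N 2%N) (L 3%N 1%N 0%N) (L 3%N 1%N 1%N) (L 3%N 1%N 2%N) (L 3%N 2%N 0%N) (L 3%N 2%N 1%N) (L 3%N 2%N 2%N)) => //.
- by ein_lra E zz 0%N 1%N.
- by ein_lra E zz 0%N 2%N.
- by ein_lra E zz 1%N 2%N.
- by ein_lra E zz 0%N 3%N.
- by ein_diag_lra E zz 2%N.
- by ein_diag_lra E zz 3%N.
- by move=> t0 t1 t2 *; span_lra (spanning3) zz.
Qed.

Lemma abelian_form (R : realFieldType) (L h : nat -> nat -> nat -> R) :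
  einstein_system id (eps4 (-1) 1 1 1) L h ->
  (forall i j, L i j 3%N = 0) ->
  (forall k, L 0%N 1%N k = 0) ->
  (forall k, L 1%N 2%N k = 0) ->
  (forall k, L 2%N 0%N k = 0) ->
  spanning 3 L ->
  h 0%N 1%N 2%N = 0 /\
  h 3%N 1%N 2%N ^+ 2 = h 3%N 2%N 0%N ^+ 2 + h 3%N 0%N 1%N ^+ 2.
Proof.
move=> /system_alt-/(_ (fun _ => id)) [LC E J C] z3 z01 z12 z20 spanL.
have zz := (z3, z01, z12, z20).
apply: (@abelian_H_algebra _ (h 0%N 1%N 2%N) (h 3%N 1%N 2%N) (h 3%N 2%N 0%N) (h 3%N 0%N 1%N) (L 3%N 0%N 0%N) (L 3%N 0%N 1%N) (L 3%N 0%N 2%N) (L 3%N 1%N 0%N) (L 3%N 1%N 1%N) (L 3%N 1%N 2%N) (L 3%N 2%N 0%N) (L 3%N 2%N 1%N) (L 3%N 2%N 2%N)) => //.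
- by ein_diag_lra E zz 0%N.
- by ein_diag_lra E zz 1%N.
- by ein_diag_lra E zz 2%N.
- by ein_lra E zz 0%N 3%N.
- by ein_lra E zz 1%N 3%N.
- by ein_lra E zz 2%N 3%N.
- by move=> t0 t1 t2 *; span_lra (spanning3) zz.
Qed.

Lemma abelian_diagonal_ad (R : realFieldType) (L h : nat -> nat -> nat -> R) :
  einstein_system id (eps4 (-1) 1 1 1) L h ->
  (forall i j, L i j 3%N = 0) ->
  (forall k, L 0%N 1%N k = 0) ->
  (forall k, L 1%N 2%N k = 0) ->
  (forall k, L 2%N 0%N k = 0) ->
  h 0%N 1%N 2%N = 0 ->
  h 3%N 1%N 2%N = 0 ->
  h 3%N 2%N 0%N = 0 ->
  h 3%N 0%N 1%N = 0 ->
  L 3%N 1%N 0%N = - L 3%N 0%N 1%N ->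
  L 3%N 2%N 0%N = - L 3%N 0%N 2%N ->
  L 3%N 2%N 1%N = - L 3%N 1%N 2%N ->
  spanning 3 L ->
  False.
Proof.
move=> /system_alt-/(_ (fun _ => id)) [LC E J C] z3 z01 z12 z20 zh012 zh312 zh320 zh301 s01 s02 s12 spanL.
have zz := (z3, z01, z12, z20, zh012, zh312, zh320, zh301).
apply: (@abelian_diagonal_algebra _ (L 3%N 0%N 0%N) (L 3%N 0%N 1%N) (L 3%N 0%N 2%N) (L 3%N 1%N 0%N) (L 3%N 1%N 1%N) (L 3%N 1%N 2%N) (L 3%N 2%N 0%N) (L 3%N 2%N 1%N) (L 3%N 2%N 2%N)) => //.
- by ein_diag_lra E zz 3%N.
- by move=> t0 t1 t2 *; span_lra (spanning3) zz.
Qed.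

Lemma abelian_complex_ad (R : realFieldType) (L h : nat -> nat -> nat -> R) :
  einstein_system id (eps4 (-1) 1 1 1) L h ->
  (forall i j, L i j 3%N = 0) ->
  (forall k, L 0%N 1%N k = 0) ->
  (forall k, L 1%N 2%N k = 0) ->
  (forall k, L 2%N 0%N k = 0) ->
  h 0%N 1%N 2%N = 0 ->
  h 3%N 1%N 2%N = 0 ->
  h 3%N 2%N 0%N = 0 ->
  h 3%N 0%N 1%N = 0 ->
  L 3%N 1%N 1%N = - L 3%N 0%N 0%N ->
  L 3%N 2%N 0%N = - L 3%N 0%N 2%N ->
  L 3%N 2%N 1%N = - L 3%N 1%N 2%N ->
  L 3%N 1%N 0%N != - L 3%N 0%N 1%N ->
  spanning 3 L ->
  [/\ L 3%N 0%N 2%N = 0, L 3%N 1%N 2%N = 0, L 3%N 1%N 0%N = L 3%N 0%N 1%N &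
    L 3%N 0%N 1%N ^+ 2 = L 3%N 0%N 0%N ^+ 2 + L 3%N 2%N 2%N ^+ 2 / 2].
Proof.
move=> /system_alt-/(_ (fun _ => id)) [LC E J C] z3 z01 z12 z20 zh012 zh312 zh320 zh301 s11 s02 s12 s01 spanL.
have zz := (z3, z01, z12, z20, zh012, zh312, zh320, zh301).
apply: (@abelian_complex_algebra _ (L 3%N 0%N 0%N) (L 3%N 0%N 1%N) (L 3%N 0%N 2%N) (L 3%N 1%N 0%N) (L 3%N 1%N 1%N) (L 3%N 1%N 2%N) (L 3%N 2%N 0%N) (L 3%N 2%N 1%N) (L 3%N 2%N 2%N)) => //.
- by ein_diag_lra E zz 0%N.
- by ein_lra E zz 0%N 2%N.
- by ein_lra E zz 1%N 2%N.
- by ein_diag_lra E zz 3%N.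
- by move=> t0 t1 t2 *; span_lra (spanning3) zz.
Qed.

Lemma abelian_null_ad (R : realFieldType) (L h : nat -> nat -> nat -> R) :
  einstein_system swap02 (eps4 1 1 1 1) L h ->
  (forall i j, L i j 3%N = 0) ->
  (forall k, L 0%N 1%N k = 0) ->
  (forall k, L 1%N 2%N k = 0) ->
  (forall k, L 2%N 0%N k = 0) ->
  h 0%N 1%N 2%N = 0 ->
  h 3%N 1%N 2%N = 0 ->
  h 3%N 2%N 0%N = 0 ->
  h 3%N 0%N 1%N = 0 ->
  L 3%N 0%N 0%N = 0 ->
  L 3%N 1%N 0%N = - L 3%N 0%N 1%N ->
  spanning 3 L ->
  False.
Proof.
move=> /system_alt-/(_ swap02_lt4) [LC E J C] z3 z01 z12 z20 zh012 zh312 zh320 zh301 m000 s01 spanL.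
have zz := (z3, z01, z12, z20, zh012, zh312, zh320, zh301).
apply: (@abelian_null_ad_algebra _ (L 3%N 0%N 0%N) (L 3%N 0%N 1%N) (L 3%N 0%N 2%N) (L 3%N 1%N 0%N) (L 3%N 1%N 1%N) (L 3%N 1%N 2%N) (L 3%N 2%N 0%N) (L 3%N 2%N 1%N) (L 3%N 2%N 2%N)) => //.
- by ein_lra E zz 0%N 2%N.
- by ein_lra E zz 1%N 2%N.
- by ein_diag_lra E zz 2%N.
- by ein_diag_lra E zz 3%N.
- by move=> t0 t1 t2 *; span_lra (spanning3) zz.
Qed.

Lemma plane_Riemann (R : realFieldType) (L h : nat -> nat -> nat -> R) :
  einstein_system id (eps4 1 1 1 (-1)) L h ->
  (forall i j, L i j 2%N = 0) ->
  (forall i j, L i j 3%N = 0) ->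
  (forall k, L 0%N 1%N k = 0) ->
  (forall k, L 1%N 2%N k = - L 2%N 1%N k) ->
  [/\ [/\ L 3%N 2%N 0%N = 0 & L 3%N 2%N 1%N = 0],
      [/\ h 0%N 1%N 2%N = 0, h 3%N 0%N 1%N = 0, h 3%N 2%N 0%N = 0 & h 3%N 1%N 2%N = 0],
      [/\ L 2%N 0%N 0%N = 0, L 2%N 1%N 1%N = 0 & L 2%N 1%N 0%N = - L 2%N 0%N 1%N] &
      [/\ L 3%N 0%N 0%N = 0, L 3%N 1%N 1%N = 0 & L 3%N 1%N 0%N = - L 3%N 0%N 1%N]].
Proof.
move=> /system_alt-/(_ (fun _ => id)) [LC E J C] z2 z3 z01 z12.
have zz := (z2, z3, z01, z12).
apply: (@plane_Riemann_algebra _ (L 3%N 2%N 0%N) (L 3%N 2%N 1%N) (h 0%N 1%N 2%N) (h 3%N 0%N 1%N) (h 3%N 2%N 0%N) (h 3%N 1%N 2%N) (L 2%N 0%N 0%N) (L 2%N 0%N 1%N) (L 2%N 1%N 0%N) (L 2%N 1%N 1%N) (L 3%N 0%N 0%N) (L 3%N 0%N 1%N) (L 3%N 1%N 0%N) (L 3%N 1%N 1%N)) => //.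
- by ein_diag_lra E zz 2%N.
- by ein_diag_lra E zz 3%N.
Qed.

Lemma plane_timelike (R : realFieldType) (L h : nat -> nat -> nat -> R) :
  einstein_system id (eps4 (-1) 1 1 1) L h ->
  (forall i j, L i j 2%N = 0) ->
  (forall i j, L i j 3%N = 0) ->
  (forall k, L 0%N 1%N k = 0) ->
  (forall k, L 1%N 2%N k = - L 2%N 1%N k) ->
  h 3%N 1%N 2%N = 0 ->
  h 3%N 2%N 0%N != 0 ->
  False.
Proof.
move=> /system_alt-/(_ (fun _ => id)) [LC E J C] z2 z3 z01 z12 zh312 x00.
have zz := (z2, z3, z01, z12, zh312).
apply: (@plane_timelike_algebra _ (L 3%N 2%N 0%N) (L 3%N 2%N 1%N) (h 0%N 1%N 2%N) (h 3%N 0%N 1%N) (h 3%N 2%N 0%N) (L 2%N 0%N 0%N) (L 2%N 0%N 1%N) (L 2%N 1%N 0%N) (L 2%N 1%N 1%N) (L 3%N 0%N 0%N) (L 3%N 0%N 1%N) (L 3%N 1%N 0%N) (L 3%N 1%N 1%N)) => //.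
- by ein_diag_lra E zz 0%N.
- by ein_lra E zz 0%N 2%N.
- by ein_lra E zz 0%N 3%N.
- by ein_diag_lra E zz 1%N.
- by ein_lra E zz 1%N 2%N.
- by ein_lra E zz 1%N 3%N.
- by ein_diag_lra E zz 2%N.
- by ein_lra E zz 2%N 3%N.
- by ein_diag_lra E zz 3%N.
Qed.

Lemma plane_spacelike (R : realFieldType) (L h : nat -> nat -> nat -> R) :
  einstein_system id (eps4 (-1) 1 1 1) L h ->
  (forall i j, L i j 2%N = 0) ->
  (forall i j, L i j 3%N = 0) ->
  (forall k, L 0%N 1%N k = 0) ->
  (forall k, L 1%N 2%N k = - L 2%N 1%N k) ->
  h 3%N 2%N 0%N = 0 ->
  h 3%N 1%N 2%N != 0 ->
  False.
Proof.
move=> /system_alt-/(_ (fun _ => id)) [LC E J C] z2 z3 z01 z12 zh320 x10.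
have zz := (z2, z3, z01, z12, zh320).
apply: (@plane_spacelike_algebra _ (L 3%N 2%N 0%N) (L 3%N 2%N 1%N) (h 0%N 1%N 2%N) (h 3%N 0%N 1%N) (h 3%N 1%N 2%N) (L 2%N 0%N 0%N) (L 2%N 0%N 1%N) (L 2%N 1%N 0%N) (L 2%N 1%N 1%N) (L 3%N 0%N 0%N) (L 3%N 0%N 1%N) (L 3%N 1%N 0%N) (L 3%N 1%N 1%N)) => //.
- by ein_diag_lra E zz 0%N.
- by ein_lra E zz 0%N 1%N.
- by ein_lra E zz 0%N 1%N.
- by ein_lra E zz 0%N 2%N.
- by ein_lra E zz 0%N 2%N.
- by ein_lra E zz 0%N 3%N.
- by ein_lra E zz 0%N 3%N.
- by ein_diag_lra E zz 1%N.
- by ein_lra E zz 1%N 2%N.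
- by ein_lra E zz 1%N 3%N.
- by ein_diag_lra E zz 2%N.
- by ein_lra E zz 2%N 3%N.
- by ein_diag_lra E zz 3%N.
- by jac_lra J zz 0%N 2%N 3%N 1%N.
- by clo_lra C zz.
Qed.

Lemma plane_null (R : realFieldType) (L h : nat -> nat -> nat -> R) :
  einstein_system id (eps4 (-1) 1 1 1) L h ->
  (forall i j, L i j 2%N = 0) ->
  (forall i j, L i j 3%N = 0) ->
  (forall k, L 0%N 1%N k = 0) ->
  (forall k, L 1%N 2%N k = - L 2%N 1%N k) ->
  h 3%N 2%N 0%N != 0 ->
  spanning 2 L ->
  forall de, de = 1 \/ de = - 1 -> h 3%N 1%N 2%N = de * h 3%N 2%N 0%N -> False.
Proof.
move=> /system_alt-/(_ (fun _ => id)) [LC E J C] z2 z3 z01 z12 x00 spanL de deE x1E.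
have zz := (z2, z3, z01, z12).
apply: (@plane_null_algebra _ (L 3%N 2%N 0%N) (L 3%N 2%N 1%N) (h 0%N 1%N 2%N) (h 3%N 0%N 1%N) (h 3%N 2%N 0%N) (h 3%N 1%N 2%N) (L 2%N 0%N 0%N) (L 2%N 0%N 1%N) (L 2%N 1%N 0%N) (L 2%N 1%N 1%N) (L 3%N 0%N 0%N) (L 3%N 0%N 1%N) (L 3%N 1%N 0%N) (L 3%N 1%N 1%N) x00 de deE x1E) => //.
- by ein_diag_lra E zz 0%N.
- by ein_lra E zz 0%N 1%N.
- by ein_lra E zz 0%N 2%N.
- by ein_lra E zz 0%N 2%N.
- by ein_lra E zz 0%N 3%N.
- by ein_lra E zz 0%N 3%N.
- by ein_diag_lra E zz 1%N.
- by ein_lra E zz 1%N 2%N.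
- by ein_lra E zz 1%N 3%N.
- by ein_diag_lra E zz 2%N.
- by ein_diag_lra E zz 3%N.
- by move=> t0 t1 *; span_lra (spanning2) zz.
Qed.

Lemma plane_closed (R : realFieldType) (L h : nat -> nat -> nat -> R) :
  einstein_system id (eps4 (-1) 1 1 1) L h ->
  (forall i j, L i j 2%N = 0) ->
  (forall i j, L i j 3%N = 0) ->
  (forall k, L 0%N 1%N k = 0) ->
  (forall k, L 1%N 2%N k = - L 2%N 1%N k) ->
  h 3%N 1%N 2%N = 0 ->
  h 3%N 2%N 0%N = 0 ->
  spanning 2 L ->
  [/\ L 3%N 2%N 0%N = 0, L 3%N 2%N 1%N = 0, h 0%N 1%N 2%N = 0 & h 3%N 0%N 1%N = 0].
Proof.
move=> /system_alt-/(_ (fun _ => id)) [LC E J C] z2 z3 z01 z12 zh312 zh320 spanL.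
have zz := (z2, z3, z01, z12, zh312, zh320).
apply: (@plane_closed_algebra _ (L 3%N 2%N 0%N) (L 3%N 2%N 1%N) (h 0%N 1%N 2%N) (h 3%N 0%N 1%N) (L 2%N 0%N 0%N) (L 2%N 0%N 1%N) (L 2%N 1%N 0%N) (L 2%N 1%N 1%N) (L 3%N 0%N 0%N) (L 3%N 0%N 1%N) (L 3%N 1%N 0%N) (L 3%N 1%N 1%N)) => //.
- by ein_diag_lra E zz 0%N.
- by ein_lra E zz 0%N 1%N.
- by ein_lra E zz 0%N 2%N.
- by ein_lra E zz 0%N 3%N.
- by ein_diag_lra E zz 1%N.
- by ein_lra E zz 1%N 2%N.
- by ein_lra E zz 1%N 3%N.
- by ein_diag_lra E zz 2%N.
- by ein_diag_lra E zz 3%N.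
- by clo_lra C zz.
- by move=> t0 t1 *; span_lra (spanning2) zz.
Qed.

Lemma plane_rotation (R : rcfType) (L h : nat -> nat -> nat -> R) :
  einstein_system id (eps4 (-1) 1 1 1) L h ->
  (forall i j, L i j 2%N = 0) ->
  (forall i j, L i j 3%N = 0) ->
  (forall k, L 0%N 1%N k = 0) ->
  (forall k, L 1%N 2%N k = - L 2%N 1%N k) ->
  h 0%N 1%N 2%N = 0 ->
  h 3%N 1%N 2%N = 0 ->
  h 3%N 2%N 0%N = 0 ->
  h 3%N 0%N 1%N = 0 ->
  (forall k, L 3%N 2%N k = 0) ->
  exists u v, [/\ u ^+ 2 + v ^+ 2 = 1, u * L 2%N 0%N 0%N + v * L 3%N 0%N 0%N = 0,
    u * L 2%N 1%N 1%N + v * L 3%N 1%N 1%N = 0 &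
    u * (L 2%N 0%N 1%N + L 2%N 1%N 0%N) + v * (L 3%N 0%N 1%N + L 3%N 1%N 0%N) = 0].
Proof.
move=> /system_alt-/(_ (fun _ => id)) [LC E J C] z2 z3 z01 z12 zh012 zh312 zh320 zh301 z32.
have zz := (z2, z3, z01, z12, zh012, zh312, zh320, zh301, z32).
apply: (@plane_rotation_algebra _ (L 2%N 0%N 0%N) (L 2%N 0%N 1%N) (L 2%N 1%N 0%N) (L 2%N 1%N 1%N) (L 3%N 0%N 0%N) (L 3%N 0%N 1%N) (L 3%N 1%N 0%N) (L 3%N 1%N 1%N)) => //.
- by ein_diag_lra E zz 2%N.
- by ein_lra E zz 2%N 3%N.
- by ein_diag_lra E zz 3%N.
Qed.

Lemma plane_skew (R : realFieldType) (L h : nat -> nat -> nat -> R) :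
  einstein_system id (eps4 (-1) 1 1 1) L h ->
  (forall i j, L i j 2%N = 0) ->
  (forall i j, L i j 3%N = 0) ->
  (forall k, L 0%N 1%N k = 0) ->
  (forall k, L 1%N 2%N k = - L 2%N 1%N k) ->
  h 0%N 1%N 2%N = 0 ->
  h 3%N 1%N 2%N = 0 ->
  h 3%N 2%N 0%N = 0 ->
  h 3%N 0%N 1%N = 0 ->
  (forall k, L 3%N 2%N k = 0) ->
  L 2%N 0%N 0%N = 0 ->
  L 2%N 1%N 1%N = 0 ->
  L 2%N 1%N 0%N = - L 2%N 0%N 1%N ->
  L 2%N 0%N 1%N != 0 ->
  [/\ L 3%N 0%N 0%N = 0, L 3%N 1%N 1%N = 0 & L 3%N 1%N 0%N = - L 3%N 0%N 1%N].
Proof.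
move=> /system_alt-/(_ (fun _ => id)) [LC E J C] z2 z3 z01 z12 zh012 zh312 zh320 zh301 z32 zp00 zp11 zp10 p010.
have zz := (z2, z3, z01, z12, zh012, zh312, zh320, zh301, z32, zp00, zp11, zp10).
apply: (@plane_skew_algebra _ (L 2%N 0%N 1%N) (L 3%N 0%N 0%N) (L 3%N 0%N 1%N) (L 3%N 1%N 0%N) (L 3%N 1%N 1%N)) => //.
- by ein_diag_lra E zz 3%N.
- by jac_lra J zz 0%N 2%N 3%N 0%N.
- by jac_lra J zz 0%N 2%N 3%N 1%N.
Qed.

Lemma plane_ad (R : realFieldType) (L h : nat -> nat -> nat -> R) :
  einstein_system id (eps4 (-1) 1 1 1) L h ->
  (forall i j, L i j 2%N = 0) ->
  (forall i j, L i j 3%N = 0) ->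
  (forall k, L 0%N 1%N k = 0) ->
  (forall k, L 1%N 2%N k = - L 2%N 1%N k) ->
  h 0%N 1%N 2%N = 0 ->
  h 3%N 1%N 2%N = 0 ->
  h 3%N 2%N 0%N = 0 ->
  h 3%N 0%N 1%N = 0 ->
  (forall k, L 3%N 2%N k = 0) ->
  (forall i k, L 2%N i k = 0) ->
  spanning 2 L ->
  [/\ L 3%N 0%N 0%N = 0, L 3%N 1%N 1%N = 0 & L 3%N 1%N 0%N = - L 3%N 0%N 1%N] \/
  [/\ L 3%N 1%N 0%N = L 3%N 0%N 1%N,
      L 3%N 0%N 0%N ^+ 2 + L 3%N 1%N 1%N ^+ 2 = 2 * L 3%N 0%N 1%N ^+ 2 &
      L 3%N 0%N 0%N != L 3%N 1%N 1%N].
Proof.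
move=> /system_alt-/(_ (fun _ => id)) [LC E J C] z2 z3 z01 z12 zh012 zh312 zh320 zh301 z32 z2k spanL.
have zz := (z2, z3, z01, z12, zh012, zh312, zh320, zh301, z32, z2k).
apply: (@plane_ad_algebra _ (L 3%N 0%N 0%N) (L 3%N 0%N 1%N) (L 3%N 1%N 0%N) (L 3%N 1%N 1%N)) => //.
- by ein_diag_lra E zz 0%N.
- by ein_lra E zz 0%N 1%N.
- by ein_diag_lra E zz 3%N.
- by move=> t0 t1 *; span_lra (spanning2) zz.
Qed.

Lemma line_spacelike (R : realFieldType) (L h : nat -> nat -> nat -> R) :
  einstein_system id (eps4 1 1 1 (-1)) L h ->
  (forall i j, L i j 1%N = 0) ->
  (forall i j, L i j 2%N = 0) ->
  (forall i j, L i j 3%N = 0) ->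
  (forall k, L 0%N 1%N k = - L 1%N 0%N k) ->
  (forall k, L 3%N 2%N k = - L 2%N 3%N k) ->
  [/\ L 1%N 0%N 0%N = 0, L 2%N 0%N 0%N = 0 & L 3%N 0%N 0%N = 0] /\
  [/\ L 2%N 3%N 0%N = 0, L 3%N 1%N 0%N = 0 & L 1%N 2%N 0%N = 0].
Proof.
move=> /system_alt-/(_ (fun _ => id)) [LC E J C] z1 z2 z3 zr01 zr32.
have zz := (z1, z2, z3, zr01, zr32).
apply: (@line_spacelike_algebra _ (L 1%N 0%N 0%N) (L 2%N 0%N 0%N) (L 3%N 0%N 0%N) (L 2%N 3%N 0%N) (L 3%N 1%N 0%N) (L 1%N 2%N 0%N) (h 3%N 1%N 2%N) (- (h 3%N 2%N 0%N)) (- (h 3%N 0%N 1%N)) (h 0%N 1%N 2%N)) => //.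
- by ein_diag_lra E zz 0%N.
- by ein_diag_lra E zz 1%N.
- by ein_diag_lra E zz 2%N.
- by ein_diag_lra E zz 3%N.
Qed.

Lemma line_timelike (R : realFieldType) (L h : nat -> nat -> nat -> R) :
  einstein_system id (eps4 (-1) 1 1 1) L h ->
  (forall i j, L i j 1%N = 0) ->
  (forall i j, L i j 2%N = 0) ->
  (forall i j, L i j 3%N = 0) ->
  (forall k, L 0%N 1%N k = - L 1%N 0%N k) ->
  (forall k, L 3%N 2%N k = - L 2%N 3%N k) ->
  [/\ L 1%N 0%N 0%N = 0, L 2%N 0%N 0%N = 0 & L 3%N 0%N 0%N = 0] /\
  [/\ L 2%N 3%N 0%N = 0, L 3%N 1%N 0%N = 0 & L 1%N 2%N 0%N = 0].
Proof.
move=> /system_alt-/(_ (fun _ => id)) [LC E J C] z1 z2 z3 zr01 zr32.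
have zz := (z1, z2, z3, zr01, zr32).
apply: (@line_timelike_algebra _ (L 1%N 0%N 0%N) (L 2%N 0%N 0%N) (L 3%N 0%N 0%N) (L 2%N 3%N 0%N) (L 3%N 1%N 0%N) (L 1%N 2%N 0%N) (h 3%N 1%N 2%N) (- (h 3%N 2%N 0%N)) (- (h 3%N 0%N 1%N)) (h 0%N 1%N 2%N)) => //.
- by ein_diag_lra E zz 0%N.
- by ein_lra E zz 0%N 1%N.
- by ein_lra E zz 0%N 1%N.
- by ein_lra E zz 0%N 2%N.
- by ein_lra E zz 0%N 2%N.
- by ein_lra E zz 0%N 3%N.
- by ein_lra E zz 0%N 3%N.
- by ein_diag_lra E zz 1%N.
- by ein_lra E zz 1%N 2%N.
- by ein_lra E zz 1%N 3%N.
- by ein_diag_lra E zz 2%N.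
- by ein_lra E zz 2%N 3%N.
- by ein_diag_lra E zz 3%N.
- by jac_lra J zz 1%N 2%N 3%N 0%N.
- by clo_lra C zz.
Qed.

Lemma abelian_no_form (R : realFieldType) (L h : nat -> nat -> nat -> R) :
  einstein_system id (eps4 (-1) 1 1 1) L h ->
  (forall i j k, L i j k = 0) ->
  [/\ h 3%N 1%N 2%N = 0, - h 3%N 2%N 0%N = 0, - h 3%N 0%N 1%N = 0 & h 0%N 1%N 2%N = 0].
Proof.
move=> /system_alt-/(_ (fun _ => id)) [LC E J C] zL.
have zz := zL.
apply: (@abelian_form_algebra _ (h 3%N 1%N 2%N) (- (h 3%N 2%N 0%N)) (- (h 3%N 0%N 1%N)) (h 0%N 1%N 2%N)) => //.
- by ein_diag_lra E zz 0%N.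
- by ein_diag_lra E zz 1%N.
Qed.

(** * The trace of the generalised curvature *)

Section BracketBasics.
Variables (R : fieldType) (g : lieAlgebra R).
Implicit Types x y : g.

Lemma brxx x : lie_br x x = 0.
Proof. by have [_ _ alt _] := lie_brP g. Qed.

Lemma brC x y : lie_br x y = - lie_br y x.
Proof.
have := brxx (x + y); rewrite linearDl !linearDr /= !brxx add0r addr0 => /eqP.
by rewrite addr_eq0 => /eqP.
Qed.
End BracketBasics.

Lemma lfun_tr_basis (R : fieldType) (W : vectType R) (f : 'End(W)) n
    (b : n.-tuple W) : basis_of fullv b ->
  lfun_tr f = \sum_(i < n) coord b i (f b`_i).
Proof.
move=> bb; rewrite /lfun_tr.
set c := vbasis _; have bc : basis_of fullv c := vbasisP _.
transitivity (\sum_(i < \dim {:W}) \sum_(j < n)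
    coord b j (c`_i) * coord c i (f b`_j)).
  apply: eq_bigr => i _; rewrite {1}(coord_basis bb (memvf c`_i)).
  by rewrite !linear_sum; apply: eq_bigr => j _; rewrite !linearZ.
rewrite exchange_big; apply: eq_bigr => j _.
rewrite {2}(coord_basis bc (memvf (f b`_j))) linear_sum.
by apply: eq_bigr => i _; rewrite linearZ mulrC.
Qed.

(** The trace is to be taken on the type of vectors of [E_minus]; this moves it to g along the
    parametrisation of that space. *)
Lemma lfun_tr_conj (R : fieldType) (V W : vectType R) (psi : V -> W)
    (psi_lin : linear psi) (psiI : injective psi)
    (dimVW : \dim {:V} = \dim {:W}) (f : 'End(W)) n (b : n.-tuple V)
    (f' : V -> V) :
  (forall x, f (psi x) = psi (f' x)) -> basis_of fullv b ->
  lfun_tr f = \sum_(i < n) coord b i (f' b`_i).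
Proof.
move=> ff' bb.
pose p : {linear V -> W} :=
  HB.pack psi (GRing.isLinear.Build _ _ _ _ _ psi_lin).
pose pL := linfun p.
have pE x : pL x = psi x by rewrite lfunE.
have pI : lker pL = 0%VS.
  apply/eqP/lker0P => x y; rewrite !pE; exact: psiI.
pose c := [tuple pL b`_i | i < n].
have cE (i : 'I_n) : c`_i = psi b`_i.
  by rewrite -pE (nth_map i) ?size_enum_ord // nth_ord_enum.
have ec : c = map_tuple pL b.
  apply: eq_from_tnth => i; rewrite tnth_mktuple tnth_map; congr (pL _).
  by rewrite (tnth_nth 0).
have fc : free c.
  rewrite ec; have := limg_basis_of (f := pL) _ bb.
  by rewrite capfv pI => /(_ erefl) /basis_free.
have bc : basis_of fullv c.
  by rewrite basisEfree fc subvf size_tuple -dimVW (size_basis bb) leqnn.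
rewrite (lfun_tr_basis f bc); apply: eq_bigr => i _.
rewrite cE ff'; set y := f' _.
rewrite {1}(coord_basis bb (memvf y)) -pE linear_sum linear_sum /=.
rewrite (bigD1 i) //= big1 ?addr0 => [|j ji].
  by rewrite linearZ /= pE -cE linearZ /= coord_free // eqxx mulr1.
by rewrite linearZ /= pE -cE linearZ /= coord_free // (negPf ji) mulr0.
Qed.

Section GenOps.
Variables (R : realType) (g : lieAlgebra R) (G : gen_metric g).
Local Notation q := (gm_g G).
Local Notation H := (gm_H G).
Local Notation br := (@lie_br R g).
Local Notation dual := 'Hom(g, R^o).
Local Notation E := (g * 'Hom(g, R^o))%type.

Lemma metricC x y : q x y = q y x.
Proof. by rewrite hermC expr0 mul1r. Qed.

Lemma metricDl x y z : q (x + y) z = q x z + q y z.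
Proof. exact: linearDl. Qed.
Lemma metricNl x z : q (- x) z = - q x z.
Proof. exact: linearNl. Qed.
Lemma metricZl a x z : q (a *: x) z = a * q x z.
Proof. exact: linearZl_LR. Qed.
Lemma metric0l z : q 0 z = 0.
Proof. exact: linear0l. Qed.
Lemma metricDr x y z : q z (x + y) = q z x + q z y.
Proof. exact: linearDr. Qed.
Lemma metricNr x z : q z (- x) = - q z x.
Proof. exact: linearNr. Qed.
Lemma metricZr a x z : q z (a *: x) = a * q z x.
Proof. exact: linearZr_LR. Qed.
Lemma metric0r z : q z 0 = 0.
Proof. exact: linear0r. Qed.

Lemma metric_suml I (r : seq I) (P : pred I) F z :
  q (\sum_(i <- r | P i) F i) z = \sum_(i <- r | P i) q (F i) z.
Proof. exact: linear_sumlz. Qed.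
Lemma metric_sumr I (r : seq I) (P : pred I) F z :
  q z (\sum_(i <- r | P i) F i) = \sum_(i <- r | P i) q z (F i).
Proof. exact: linear_sumr. Qed.

Lemma brDl x y z : br (x + y) z = br x z + br y z.
Proof. exact: linearDl. Qed.
Lemma brNl x z : br (- x) z = - br x z.
Proof. exact: linearNl. Qed.
Lemma brZl a x z : br (a *: x) z = a *: br x z.
Proof. exact: linearZl_LR. Qed.
Lemma br0l z : br 0 z = 0.
Proof. exact: linear0l. Qed.
Lemma brDr x y z : br z (x + y) = br z x + br z y.
Proof. exact: linearDr. Qed.
Lemma brNr x z : br z (- x) = - br z x.
Proof. exact: linearNr. Qed.
Lemma brZr a x z : br z (a *: x) = a *: br z x.
Proof. exact: linearZr_LR. Qed.
Lemma br0r z : br z 0 = 0.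
Proof. exact: linear0r. Qed.

Lemma flat_sharp a : flat G (sharp G a) = a.
Proof.
have flat0 : lker (flat G) == 0%VS.
  by apply/lker0P; exact: can_inj (flatK G).
have : a \in limg (flat G).
  suff -> : limg (flat G) = fullv by rewrite memvf.
  apply/eqP; rewrite -dimv_leqif_eq ?subvf // limg_dim_eq; last first.
    by rewrite capfv; exact/eqP.
  by rewrite !dimvf /dim /= muln1.
by case/memv_imgP => x _ ->; rewrite flatK.
Qed.

Lemma metric_sharp a z : q (sharp G a) z = a z.
Proof. by rewrite -flatE flat_sharp. Qed.

Lemma dualP (al : dual) a x y : al (a *: x + y) = a * al x + al y :> R.
Proof. exact: (linearP al a x y). Qed.

Lemma formP2 a x y y' z : H x (a *: y + y') z = a * H x y z + H x y' z.
Proof. exact: form3_lin2. Qed.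

Lemma formP3 a x y z z' : H x y (a *: z + z') = a * H x y z + H x y z'.
Proof. exact: form3_lin3. Qed.

Lemma dorfman2 u v z : (dorfman G u v).2 z =
  ce_d1 v.2 u.1 z - ce_d1 u.2 v.1 z + H u.1 v.1 z.
Proof.
pose F z : R^o := ce_d1 v.2 u.1 z - ce_d1 u.2 v.1 z + H u.1 v.1 z.
have lin a x y : F (a *: x + y) = a * F x + F y.
  rewrite /F /ce_d1 !brDr !brZr !dualP formP3; ring.
pose f : {linear g -> R^o} := HB.pack F (GRing.isLinear.Build _ _ _ _ _ lin).
exact: (lfunE f).
Qed.

Lemma dorfman_linr u : linear (dorfman G u).
Proof.
move=> a v w; apply/eqP; rewrite xpair_eqE; apply/andP; split; apply/eqP.
  by rewrite /= brDr brZr.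
apply/lfunP => z; rewrite dorfman2.
transitivity (a * (dorfman G u v).2 z + (dorfman G u w).2 z : R); last first.
  by rewrite add_lfunE scale_lfunE.
rewrite !dorfman2 /ce_d1 /= add_lfunE scale_lfunE brDl brZl dualP formP2.
rewrite -[a *: v.2 _]/(a * _); ring.
Qed.

Definition to_plus (x : g) : E := (x, flat G x).
Definition to_minus (x : g) : E := (x, - flat G x).

Lemma to_plus_lin : linear to_plus.
Proof. by move=> a x y; rewrite /to_plus linearP. Qed.

Lemma to_minus_lin : linear to_minus.
Proof.
by move=> a x y; rewrite /to_minus linearP opprD -scalerN.
Qed.

Lemma E_plusP u : reflect (exists x, u = to_plus x) (u \in E_plus G).
Proof.
pose f : {linear g -> E} :=
  HB.pack to_plus (GRing.isLinear.Build R g E _ to_plus to_plus_lin).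
apply: (iffP memv_imgP) => [[x _ ->]|[x ->]]; exists x => //.
- by rewrite (lfunE f).
- by rewrite memvf.
- by rewrite (lfunE f).
Qed.

Lemma E_minusP u : reflect (exists x, u = to_minus x) (u \in E_minus G).
Proof.
pose f : {linear g -> E} :=
  HB.pack to_minus (GRing.isLinear.Build R g E _ to_minus to_minus_lin).
apply: (iffP memv_imgP) => [[x _ ->]|[x ->]]; exists x => //.
- by rewrite (lfunE f).
- by rewrite memvf.
- by rewrite (lfunE f).
Qed.

Definition half_plus (d : E) : g := 2^-1 *: (d.1 + sharp G d.2).
Definition half_minus (d : E) : g := 2^-1 *: (d.1 - sharp G d.2).

Let flatZ a x : flat G (a *: x) = a *: flat G x.
Proof. exact: linearZ. Qed.

Let flatD x y : flat G (x + y) = flat G x + flat G y.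
Proof. exact: linearD. Qed.

Let flatN x : flat G (- x) = - flat G x.
Proof. exact: linearN. Qed.

Lemma pi_plusE d : pi_plus G d = to_plus (half_plus d).
Proof.
rewrite /pi_plus scale_lfunE add_lfunE id_lfunE gen_opE /to_plus.
rewrite flatZ flatD flat_sharp.
by rewrite (addrC (flat _ _)); case: d.
Qed.

Lemma pi_minusE d : pi_minus G d = to_minus (half_minus d).
Proof.
rewrite /pi_minus scale_lfunE add_lfunE opp_lfunE id_lfunE gen_opE.
rewrite /to_minus flatZ flatD flatN flat_sharp.
by rewrite -scalerN opprD opprK (addrC (- _)); case: d.
Qed.

Lemma metric_half_plus d z : q (half_plus d) z = 2^-1 * (q d.1 z + d.2 z).
Proof. by rewrite metricZl metricDl metric_sharp. Qed.

Lemma metric_half_minus d z : q (half_minus d) z = 2^-1 * (q d.1 z - d.2 z).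
Proof. by rewrite metricZl metricDl metricNl metric_sharp. Qed.

End GenOps.

Notation metricE :=
  (metricDl, metricNl, metricZl, metric0l, metricDr, metricNr, metricZr,
   metric0r).
Notation brE := (brDl, brNl, brZl, br0l, brDr, brNr, brZr, br0r).

Section EinsteinFrame.
Variables (R : realType) (g : lieAlgebra R) (G : gen_metric g).
Local Notation q := (gm_g G).
Local Notation H := (gm_H G).
Local Notation br := (@lie_br R g).
Local Notation E := (g * 'Hom(g, R^o))%type.

Lemma half_minus_lin : linear (@half_minus R g G).
Proof.
move=> a u v; rewrite /half_minus /= linearP scalerA mulrC -scalerA -scalerDr.
by congr (_ *: _); rewrite scalerBr opprD addrACA.
Qed.

(** The operators [Gamma_u] and [Gamma_v] read on g through the parametrisations of [E_plus] and
    [E_minus]. *)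
Definition Zplus x w := half_plus G (dorfman G (to_plus G x) (to_minus G w)).
Definition Zminus y p := half_minus G (dorfman G (to_minus G y) (to_plus G p)).

Lemma Zminus_lin y : linear (Zminus y).
Proof.
by move=> a u v; rewrite /Zminus to_plus_lin dorfman_linr half_minus_lin.
Qed.

(** By the Koszul formula [Zplus x w] is minus the derivative of [x] along [w] for the Levi-Civita
    connection shifted by half of [H]; in the next lemma the shift has the opposite sign. *)
Lemma metric_Zplus x w z : q (Zplus x w) z = 2^-1 *
  (q (br x w) z + q (br x z) w + q (br w z) x + H x w z).
Proof.
rewrite metric_half_plus dorfman2 /ce_d1 /= opp_lfunE !flatE opprK.
by rewrite (metricC _ w) (metricC _ x); congr (_ * _); ring.
Qed.

Lemma metric_Zminus y p z : q (Zminus y p) z = 2^-1 *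
  (q (br y p) z + q (br y z) p + q (br p z) y - H y p z).
Proof.
rewrite metric_half_minus dorfman2 /ce_d1 /= opp_lfunE !flatE.
by rewrite (metricC _ p) (metricC _ y); congr (_ * _); ring.
Qed.

Lemma Gamma_plusE x w :
  Gamma_plus G (to_plus G x) (vsproj (E_minus G) (to_minus G w)) =
  vsproj (E_plus G) (to_plus G (Zplus x w)).
Proof.
have lin : linear (fun w : subvs_of (E_minus G) =>
  vsproj (E_plus G) (pi_plus G (dorfman G (to_plus G x) (vsval w)))).
  by move=> a u v; rewrite linearP dorfman_linr !linearP.
pose f : {linear subvs_of (E_minus G) -> subvs_of (E_plus G)} := HB.pack
 (fun w : subvs_of (E_minus G) =>
  vsproj (E_plus G) (pi_plus G (dorfman G (to_plus G x) (vsval w))))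
 (GRing.isLinear.Build _ _ _ _ _ lin).
rewrite /Gamma_plus (lfunE f) /= vsprojK ?pi_plusE //.
by apply/E_minusP; exists w.
Qed.

Lemma Gamma_minusE y p :
  Gamma_minus G (to_minus G y) (vsproj (E_plus G) (to_plus G p)) =
  vsproj (E_minus G) (to_minus G (Zminus y p)).
Proof.
have lin : linear (fun w : subvs_of (E_plus G) =>
  vsproj (E_minus G) (pi_minus G (dorfman G (to_minus G y) (vsval w)))).
  by move=> a u v; rewrite linearP dorfman_linr !linearP.
pose f : {linear subvs_of (E_plus G) -> subvs_of (E_minus G)} := HB.pack
 (fun w : subvs_of (E_plus G) =>
  vsproj (E_minus G) (pi_minus G (dorfman G (to_minus G y) (vsval w))))
 (GRing.isLinear.Build _ _ _ _ _ lin).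
rewrite /Gamma_minus (lfunE f) /= vsprojK ?pi_minusE //.
by apply/E_plusP; exists p.
Qed.

(** Coordinates in [b] are products with [b'], and the intermediate vector is expanded along [b'],
    where coordinates are products with [b]. The factor [4^-1] collects the halves of the two
    projections. *)
Lemma tr_Gamma n (b b' : n.-tuple g) x y :
  basis_of fullv b ->
  (forall i j : 'I_n, q b`_i b'`_j = (i == j)%:R) ->
  lfun_tr (Gamma_minus G (to_minus G y) \o Gamma_plus G (to_plus G x))%VF =
  4^-1 * \sum_(i < n) \sum_(j < n)
    (q (br x b`_i) b`_j + q (br x b`_j) b`_i + q (br b`_i b`_j) x
       + H x b`_i b`_j) *
    (q (br y b'`_j) b'`_i + q (br y b'`_i) b'`_j + q (br b'`_j b'`_i) y
       - H y b'`_j b'`_i).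
Proof.
move=> bb dual_b.
have coordE i z : coord b i z = q z b'`_i.
  rewrite [in RHS](coord_basis bb (memvf z)) metric_suml (bigD1 i) //=.
  rewrite metricZl dual_b eqxx mulr1 big1 ?addr0 // => j ji.
  by rewrite metricZl dual_b (negPf ji) mulr0.
have expand z : z = \sum_(j < n) q z b`_j *: b'`_j.
  apply/eqP; rewrite -subr_eq0 -memv0 -(eqP (gm_nondeg G)).
  apply/mem_orthovP => t _; rewrite [t](coord_basis bb (memvf t)).
  rewrite metric_sumr big1 // => j _; rewrite metricZr metricDl metricNl.
  rewrite metric_suml (bigD1 j) //= metricZl (metricC _ b'`_j).
  rewrite dual_b eqxx mulr1 big1 ?addr0 ?subrr ?mulr0 // => k kj.
  by rewrite metricZl (metricC _ b'`_k) dual_b eq_sym (negPf kj) mulr0.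
pose psi w := vsproj (E_minus G) (to_minus G w).
have psi_lin : linear psi by move=> a u v; rewrite /psi to_minus_lin linearP.
have memM w : to_minus G w \in E_minus G by apply/E_minusP; exists w.
have psiI : injective psi.
  by move=> u v /(congr1 vsval); rewrite /psi !vsprojK // => -[].
have dimE : \dim {:g} = \dim {:subvs_of (E_minus G)}.
  pose f : {linear g -> E} :=
    HB.pack (to_minus G) (GRing.isLinear.Build _ _ _ _ _ (to_minus_lin G)).
  have kerf : lker (linfun f) == 0%VS.
    by apply/lker0P => u v; rewrite !lfunE => -[].
  rewrite [RHS]dimvf -[dim _]/(\dim (E_minus G)) limg_dim_eq //.
  by rewrite capfv; exact/eqP.
rewrite (@lfun_tr_conj _ _ _ psi psi_lin psiI dimE _ _ b
          (fun w => Zminus y (Zplus x w)) _ bb); last first.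
  by move=> w; rewrite comp_lfunE Gamma_plusE Gamma_minusE.
rewrite mulr_sumr; apply: eq_bigr => i _; rewrite coordE.
have -> : Zminus y (Zplus x b`_i) =
    \sum_(j < n) q (Zplus x b`_i) b`_j *: Zminus y b'`_j.
  pose f : {linear g -> g} := HB.pack (Zminus y)
    (GRing.isLinear.Build _ _ _ _ _ (Zminus_lin y)).
  transitivity (f (\sum_(j < n) q (Zplus x b`_i) b`_j *: b'`_j)).
    by rewrite -expand.
  by rewrite linear_sum; apply: eq_bigr => j _; rewrite linearZ.
rewrite metric_suml mulr_sumr; apply: eq_bigr => j _.
by rewrite metricZl metric_Zplus metric_Zminus; field.
Qed.
End EinsteinFrame.

Lemma sum_bilin (R : comNzRingType) n (c : 'I_n -> 'I_n -> R) (X Y : 'I_n -> R)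
    (a b : 'I_n -> 'I_n -> 'I_n -> R) :
  \sum_i \sum_j c i j * ((\sum_k X k * a k i j) * (\sum_l Y l * b l i j)) =
  \sum_k \sum_l X k * Y l * \sum_i \sum_j c i j * (a k i j * b l i j).
Proof.
transitivity (\sum_k \sum_l \sum_i \sum_j
    X k * Y l * (c i j * (a k i j * b l i j))); last first.
  apply: eq_bigr => k _; apply: eq_bigr => l _; rewrite mulr_sumr.
  by apply: eq_bigr => i _; rewrite mulr_sumr.
transitivity (\sum_i \sum_j \sum_k \sum_l
    X k * Y l * (c i j * (a k i j * b l i j))).
  apply: eq_bigr => i _; apply: eq_bigr => j _.
  rewrite big_distrlr mulr_sumr; apply: eq_bigr => k _.
  by rewrite mulr_sumr; apply: eq_bigr => l _ /=; ring.
under eq_bigr => i _ do rewrite exchange_big /=.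
rewrite exchange_big; apply: eq_bigr => k _.
under eq_bigr => i _ do rewrite exchange_big /=.
by rewrite exchange_big.
Qed.

(** * Alternating trilinear forms and frames *)

Section Form3.
Variables (R : fieldType) (V : vectType R) (w : form3 V).

Lemma form3_0l y z : w 0 y z = 0.
Proof. by have := form3_lin1 w y z (-1) 0 0; rewrite scaler0 addr0 mulN1r addNr. Qed.
Lemma form3Dl x x' y z : w (x + x') y z = w x y z + w x' y z.
Proof. by have := form3_lin1 w y z 1 x x'; rewrite scale1r mul1r. Qed.
Lemma form3Zl a x y z : w (a *: x) y z = a * w x y z.
Proof. by have := form3_lin1 w y z a x 0; rewrite !addr0 form3_0l addr0. Qed.
Lemma form3Nl x y z : w (- x) y z = - w x y z.
Proof. by rewrite -scaleN1r form3Zl mulN1r. Qed.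

Lemma form3C12 x y z : w x y z = - w y x z.
Proof.
have := form3_alt12 w (x + y) z; rewrite form3Dl => /eqP.
have D2 u : w u (x + y) z = w u x z + w u y z.
  by have := form3_lin2 w u z 1 x y; rewrite scale1r mul1r.
by rewrite !D2 !form3_alt12 add0r addr0 addr_eq0 => /eqP.
Qed.

Lemma form3C23 x y z : w x y z = - w x z y.
Proof.
have := form3_alt23 w x (y + z).
have D2 u : w x (y + z) u = w x y u + w x z u.
  by have := form3_lin2 w x u 1 y z; rewrite scale1r mul1r.
have D3 u : w x u (y + z) = w x u y + w x u z.
  by have := form3_lin3 w x u 1 y z; rewrite scale1r mul1r.
rewrite D2 !D3 !form3_alt23 add0r addr0 => /eqP.
by rewrite addr_eq0 => /eqP.
Qed.

Lemma form3_0m x z : w x 0 z = 0.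
Proof. by rewrite form3C12 form3_0l oppr0. Qed.
Lemma form3Dm x y y' z : w x (y + y') z = w x y z + w x y' z.
Proof. by rewrite form3C12 form3Dl opprD -!form3C12. Qed.
Lemma form3Zm a x y z : w x (a *: y) z = a * w x y z.
Proof. by rewrite form3C12 form3Zl -mulrN -form3C12. Qed.
Lemma form3Nm x y z : w x (- y) z = - w x y z.
Proof. by rewrite -scaleN1r form3Zm mulN1r. Qed.
Lemma form3_0r x y : w x y 0 = 0.
Proof. by rewrite form3C23 form3_0m oppr0. Qed.
Lemma form3Dr x y z z' : w x y (z + z') = w x y z + w x y z'.
Proof. by rewrite form3C23 form3Dm opprD -!form3C23. Qed.
Lemma form3Zr a x y z : w x y (a *: z) = a * w x y z.
Proof. by rewrite form3C23 form3Zm -mulrN -form3C23. Qed.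
Lemma form3Nr x y z : w x y (- z) = - w x y z.
Proof. by rewrite -scaleN1r form3Zr mulN1r. Qed.

End Form3.
Notation form3E := (form3Dl, form3Zl, form3Nl, form3_0l, form3Dm, form3Zm,
  form3Nm, form3_0m, form3Dr, form3Zr, form3Nr, form3_0r).

Section Frames.
Variables (R : realType) (g : lieAlgebra R).
Hypothesis dim4 : \dim {:g} = 4%N.
Variable G : gen_metric g.
Local Notation q := (gm_g G).
Local Notation H := (gm_H G).
Local Notation br := (@lie_br R g).

Definition gram_type (s : nat -> nat) (eps : nat -> R) :=
  forall i, (i < 4)%N ->
    [/\ (s i < 4)%N, s (s i) = i, eps (s i) = eps i & eps i * eps i = 1].

(** One notion for orthonormal frames, with [s] the identity, and null frames, with [s = swap02].
    Only the values below 4 of [f] matter; sequences indexed by [nat] make the equations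
    computable. *)
Definition frame s eps (f : nat -> g) :=
  gram_type s eps /\ forall i j, (i < 4)%N -> (j < 4)%N ->
    q (f i) (f j) = if j == s i then eps i else 0.

Definition brc (f : nat -> g) i j k : R := q (br (f i) (f j)) (f k).
Definition Hc (f : nat -> g) i j k : R := H (f i) (f j) (f k).

Lemma brcC f i j k : brc f i j k = - brc f j i k.
Proof. by rewrite /brc brC metricNl. Qed.

Lemma Hc12 f i j k : Hc f i j k = - Hc f j i k.
Proof. exact: form3C12. Qed.

Lemma Hc23 f i j k : Hc f i j k = - Hc f i k j.
Proof. exact: form3C23. Qed.

Section OneFrame.
Variables (s : nat -> nat) (eps : nat -> R) (f : nat -> g).
Hypothesis frm : frame s eps f.
Local Notation f' := (fun i => eps i *: f (s i)).

Lemma frame_dual i j : (i < 4)%N -> (j < 4)%N -> q (f i) (f' j) = (i == j)%:R.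
Proof.
case: frm => gt gr i4 j4; have [sj4 ssj esj ee] := gt _ j4.
rewrite metricZr gr //; have [si4 ssi esi _] := gt _ i4.
have -> : (s j == s i) = (i == j) by apply/eqP/eqP => [e|->//]; rewrite -ssi -e.
by case: eqP => [->|]; rewrite ?mulr0.
Qed.

Lemma frame_basis : basis_of {:g} [:: f 0%N; f 1%N; f 2%N; f 3%N].
Proof.
rewrite basisEfree subvf dim4 leqnn !andbT.
pose b := [tuple f 0%N; f 1%N; f 2%N; f 3%N].
have bE (i : 'I_4) : b`_i = f i by case: i; do 4?[case=> //].
apply/(@freeP _ _ _ b) => k k0 i.
have := congr1 (fun x => q x (f' i)) k0; rewrite metric0l metric_suml.
rewrite (bigD1 i) //= metricZl bE frame_dual // eqxx mulr1 big1 ?addr0 //.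
by move=> j ji; rewrite metricZl bE frame_dual // (negPf (ji : (j : nat) != i)) mulr0.
Qed.

Lemma frame_expand x : x = sum4 (fun i => (eps i * q x (f (s i))) *: f i).
Proof.
pose b := [tuple f 0%N; f 1%N; f 2%N; f 3%N].
have bE (i : 'I_4) : b`_i = f i by case: i; do 4?[case=> //].
rewrite {1}(coord_basis (frame_basis : basis_of _ b) (memvf x)) -big_ord4.
apply: eq_bigr => i _; rewrite bE; congr (_ *: _).
rewrite -metricZr {2}(coord_basis (frame_basis : basis_of _ b) (memvf x)).
rewrite metric_suml (bigD1 i) //= metricZl bE frame_dual // eqxx mulr1.
rewrite big1 ?addr0 // => j ji; rewrite metricZl bE frame_dual //.
by rewrite (negPf (ji : (j : nat) != i)) mulr0.
Qed.

Lemma frame_ext x y : (forall i, (i < 4)%N -> q x (f i) = q y (f i)) -> x = y.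
Proof.
move=> xy; rewrite (frame_expand x) (frame_expand y).
by apply: eq_sum4 => i i4; case: frm => /(_ i i4) [si4 _ _ _] _; rewrite xy.
Qed.

Lemma tr_Gamma_frame x y :
  lfun_tr (Gamma_minus G (to_minus G y) \o Gamma_plus G (to_plus G x))%VF =
  4^-1 * sum4 (fun i => sum4 (fun j => eps i * eps j *
  ((q (br x (f i)) (f j) + q (br x (f j)) (f i) + q (br (f i) (f j)) x
     + H x (f i) (f j)) *
   (q (br y (f (s j))) (f (s i)) + q (br y (f (s i))) (f (s j)) +
     q (br (f (s j)) (f (s i))) y - H y (f (s j)) (f (s i)))))).
Proof.
pose b := [tuple f 0%N; f 1%N; f 2%N; f 3%N].
pose b' := [tuple f' 0%N; f' 1%N; f' 2%N; f' 3%N].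
have bE (i : 'I_4) : b`_i = f i by case: i; do 4?[case=> //].
have b'E (i : 'I_4) : b'`_i = f' i by case: i; do 4?[case=> //].
rewrite (@tr_Gamma _ _ _ _ b b') ?frame_basis //; last first.
  by move=> i j; rewrite bE b'E frame_dual.
congr (_ * _); rewrite -big_ord4; apply: eq_bigr => i _.
rewrite -big_ord4; apply: eq_bigr => j _.
rewrite !bE !b'E !(brZr, brZl, metricZr, metricZl).
by rewrite form3Zm form3Zr; ring.
Qed.

(** For zero divergence both curvatures are minus the same trace, which is bilinear in the base
    points of the two arguments and can be tested on frame vectors. *)
Lemma EinsteinP : gen_Einstein G 0 <->
  forall x y, (x < 4)%N -> (y < 4)%N -> ein s eps (brc f) (Hc f) x y = 0.
Proof.
split=> [Ein x y x4 y4 | E0 u v /E_plusP[x ->] /E_minusP[y ->]].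
  have [] := Ein (to_plus G (f x)) (to_minus G (f y)).
  - by apply/E_plusP; exists (f x).
  - by apply/E_minusP; exists (f y).
  rewrite /RC_plus tr_Gamma_frame lfunE /= addr0 => /eqP.
  by rewrite oppr_eq0 mulf_eq0 invr_eq0 pnatr_eq0 => /eqP.
suff tr0 : lfun_tr (Gamma_minus G (to_minus G y) \o
    Gamma_plus G (to_plus G x))%VF = 0.
  by rewrite /RC_plus /RC_minus tr0 !lfunE /= oppr0 addr0.
rewrite tr_Gamma_frame; apply/eqP; rewrite mulf_eq0; apply/orP; right.
pose X i := eps i * q x (f (s i)); pose Y i := eps i * q y (f (s i)).
have xE : x = sum4 (fun i => X i *: f i) by exact: frame_expand.
have yE : y = sum4 (fun i => Y i *: f i) by exact: frame_expand.
pose c (i j : 'I_4) := eps i * eps j.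
pose A (k i j : 'I_4) :=
  brc f k i j + brc f k j i + brc f i j k + Hc f k i j.
pose B (l i j : 'I_4) := brc f l (s j) (s i) + brc f l (s i) (s j) +
  brc f (s j) (s i) l - Hc f l (s j) (s i).
apply/eqP; transitivity (\sum_i \sum_j c i j *
    ((\sum_(k < 4) X k * A k i j) * (\sum_(l < 4) Y l * B l i j))).
  rewrite -big_ord4; apply: eq_bigr => i _; rewrite -big_ord4.
  apply: eq_bigr => j _; rewrite (big_ord4 (fun k => X k * (brc f k i j +
    brc f k j i + brc f i j k + Hc f k i j))) (big_ord4 (fun l => Y l *
    (brc f l (s j) (s i) + brc f l (s i) (s j) + brc f (s j) (s i) l -
     Hc f l (s j) (s i)))).
  rewrite {1 2 3 4}xE {1 2 3 4}yE /sum4 !brE !metricE !form3E /c /brc /Hc; ring.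
rewrite sum_bilin big1 // => k _; rewrite big1 // => l _.
transitivity (X k * Y l * ein s eps (brc f) (Hc f) k l); last first.
  by rewrite E0 // mulr0.
rewrite /ein -big_ord4; congr (_ * _).
by apply: eq_bigr => i _; rewrite -big_ord4.
Qed.

Lemma jacobiE i j k l : (i < 4)%N -> (j < 4)%N -> (k < 4)%N ->
  jac s eps (brc f) i j k l = 0.
Proof.
move=> i4 j4 k4; have [_ _ _ jacobi] := lie_brP g.
have := congr1 (fun x => q x (f l)) (jacobi (f i) (f j) (f k)).
rewrite {1}(frame_expand (br (f j) (f k))) {1}(frame_expand (br (f k) (f i))).
rewrite {1}(frame_expand (br (f i) (f j))) /sum4 !brE !metricE.
by rewrite /jac /sum4 /brc => <-; ring.
Qed.

Lemma closedE i j k l : (i < 4)%N -> (j < 4)%N -> (k < 4)%N ->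
  clo s eps (brc f) (Hc f) i j k l = 0.
Proof.
move=> i4 j4 k4; have := gm_closed G (f i) (f j) (f k) (f l); rewrite /ce_d3.
rewrite {1}(frame_expand (br (f i) (f j))) {1}(frame_expand (br (f i) (f k))).
rewrite {1}(frame_expand (br (f i) (f l))) {1}(frame_expand (br (f j) (f k))).
rewrite {1}(frame_expand (br (f j) (f l))) {1}(frame_expand (br (f k) (f l))).
by rewrite /sum4 !form3E /clo /sum4 /Hc /brc => <-; ring.
Qed.
End OneFrame.
End Frames.

(** * Orthonormal frames *)

Section Geometry.
Variables (R : realType) (g : lieAlgebra R).
Hypothesis dim4 : \dim {:g} = 4%N.
Variable G : gen_metric g.
Local Notation q := (gm_g G).
Local Notation H := (gm_H G).
Local Notation br := (@lie_br R g).

Lemma frame_system s eps f : frame G s eps f -> gen_Einstein G 0 ->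
  einstein_system s eps (brc G f) (Hc G f).
Proof.
move=> frm Ein; split.
- exact: brcC.
- by split; [apply: Hc12 | apply: Hc23].
- exact/(EinsteinP dim4 frm).
- by move=> i j k l i4 j4 k4 _; apply: (jacobiE dim4 frm).
- exact: (closedE dim4 frm).
Qed.

Lemma metric_eq0 x : (forall y, q x y = 0) -> x = 0.
Proof.
move=> x0; apply/eqP; rewrite -memv0 -(eqP (gm_nondeg G)).
by apply/mem_orthovP => y _; apply: x0.
Qed.

Lemma nondegenerateP U : nondegenerate_on G U <->
  forall x, x \in U -> (forall y, y \in U -> q x y = 0) -> x = 0.
Proof.
rewrite /nondegenerate_on -subv0; split=> [/subvP ndU x xU x0 | ndU].
  apply/eqP; rewrite -memv0; apply: ndU; rewrite memv_cap xU.
  by apply/mem_orthovP.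
apply/subvP => x; rewrite memv_cap memv0 => /andP[xU /mem_orthovP x0].
by apply/eqP; apply: ndU.
Qed.

Lemma pseudo_orthonormal_cons e t : pseudo_orthonormal G (e :: t) =
  [&& (q e e == 1) || (q e e == -1), all (fun y => q e y == 0) t &
      pseudo_orthonormal G t].
Proof. by rewrite /pseudo_orthonormal /= -!andbA; congr andb; rewrite andbCA. Qed.

Lemma unit_multiple x : q x x != 0 ->
  exists2 a, a != 0 & (q (a *: x) (a *: x) == 1) || (q (a *: x) (a *: x) == -1).
Proof.
move=> x0; pose r := Num.sqrt `|q x x|.
have r0 : r != 0 by rewrite sqrtr_eq0 -ltNge normr_gt0.
exists r^-1; first by rewrite invr_eq0.
rewrite metricZl metricZr mulrA -invfM -expr2 sqr_sqrtr ?normr_ge0 //.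
have [x1 | x1 | x1] := ltrgtP (q x x) 0; last by rewrite x1 eqxx in x0.
- by rewrite ltr0_norm // invrN mulNr mulVf // eqxx orbT.
by rewrite gtr0_norm // mulVf // eqxx.
Qed.

(** By induction on the dimension: polarisation on a basis yields a vector of nonzero norm, and its
    orthogonal complement in [U] is again nondegenerate. *)
Lemma nondegenerate_orthonormal U : nondegenerate_on G U ->
  exists t, orthonormal_basis_of G U t.
Proof.
elim: (\dim U) {-2}U (erefl (\dim U)) => [|n IHn] {}U dimU ndU.
  exists [::]; rewrite /orthonormal_basis_of /pseudo_orthonormal /= andbT.
  by rewrite basisEdim dimU leqnn span_nil subv0 -dimv_eq0 dimU.
have [x xU x0] : exists2 x, x \in U & q x x != 0.
  have [|none] := boolP [exists i : 'I_(\dim U), [exists j : 'I_(\dim U),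
      q ((vbasis U)`_i + (vbasis U)`_j) ((vbasis U)`_i + (vbasis U)`_j) != 0]].
    case/existsP=> i /existsP[j ij]; exists ((vbasis U)`_i + (vbasis U)`_j) => //.
    by apply: memvD; apply: vbasis_mem; rewrite mem_nth // size_tuple.
  have q0 i j : (i < \dim U)%N -> (j < \dim U)%N ->
      q (vbasis U)`_i (vbasis U)`_j = 0.
    have all0 k l : (k < \dim U)%N -> (l < \dim U)%N ->
        q ((vbasis U)`_k + (vbasis U)`_l) ((vbasis U)`_k + (vbasis U)`_l) = 0.
      move=> kU lU; move/existsPn: none => /(_ (Ordinal kU)) /existsPn.
      by move/(_ (Ordinal lU)); rewrite negbK => /eqP.
    move=> iU jU; have := all0 _ _ iU jU.
    have := all0 _ _ iU iU; have := all0 _ _ jU jU.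
    rewrite !(metricDl, metricDr) (metricC _ (vbasis U)`_j (vbasis U)`_i).
    by lra.
  suff U0 : U = 0%VS by move: dimU; rewrite U0 dimv0.
  apply/eqP; rewrite -subv0; apply/subvP => x xU; rewrite memv0; apply/eqP.
  move/nondegenerateP: ndU; apply=> // y yU.
  rewrite (coord_vbasis xU) (coord_vbasis yU) metric_suml big1 // => i _.
  rewrite metricZl metric_sumr big1 ?mulr0 // => j _.
  by rewrite metricZr q0 ?mulr0.
have [a a0 e1] := unit_multiple x0; set e := a *: x in e1.
have eU : e \in U by apply: memvZ.
have ee : q e e != 0.
  by case/orP: e1 => /eqP ->; rewrite ?oppr_eq0 oner_eq0.
have proj y : y \in U -> y - (q y e / q e e) *: e \in (U :&: orthov q <[e]>)%VS.
  move=> yU; rewrite memv_cap memvB ?memvZ //= mem_orthov1.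
  by rewrite metricDl metricNl metricZl divfK // subrr.
have ndU' : nondegenerate_on G (U :&: orthov q <[e]>).
  apply/nondegenerateP => y; rewrite memv_cap mem_orthov1 => /andP[yU /eqP ye] y0.
  move/nondegenerateP: ndU; apply=> // z zU; have := y0 _ (proj z zU).
  by rewrite metricDr metricNr metricZr ye mulr0 subr0.
have enU : e \notin orthov q U.
  by apply/negP => /mem_orthovP/(_ e eU)/eqP; apply/negP.
have dimU' : \dim (U :&: orthov q <[e]>) = n.
  by rewrite -(eq_dim_orthov1 enU) dimU.
have [t /andP[tb to]] := IHn _ dimU' ndU'.
exists (e :: t); apply/andP; split; last first.
  rewrite pseudo_orthonormal_cons e1 to andbT /=; apply/allP => y yt.
  have : y \in (U :&: orthov q <[e]>)%VS by apply: (basis_mem tb).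
  by rewrite memv_cap mem_orthov1 metricC => /andP[].
have sz : size t = n.
  by rewrite -dimU' -(size_basis (X := in_tuple t) tb).
rewrite basisEfree free_cons (basis_free tb) (span_basis tb) dimU /= sz leqnn.
rewrite !andbT memv_cap eU mem_orthov1 (negPf ee) /= span_cons.
by rewrite subv_add -memvE eU (span_basis tb) capvSl.
Qed.

(** [U] is given by equations, as the orthogonal complement of the frame vectors from index [k] on,
    so that changing the first [k] vectors leaves the condition untouched. *)
Definition spans k (f : nat -> g) (U : {vspace g}) :=
  forall x, x \in U <-> forall i, (k <= i < 4)%N -> q x (f i) = 0.

Lemma orthonormal_frame (f : nat -> g) :
  pseudo_orthonormal G [:: f 0%N; f 1%N; f 2%N; f 3%N] ->
  frame G id (fun i => q (f i) (f i)) f.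
Proof.
rewrite /pseudo_orthonormal /= !andbT => /andP[/and4P[n0 n1 n2 n3]].
case/and3P=> [/and3P[o01 o02 o03] /andP[o12 o13] o23].
have sq y : (q y y == 1) || (q y y == -1) -> q y y * q y y = 1.
  by case/orP=> /eqP ->; rewrite ?mulrNN mulr1.
split=> [i i4 | i j i4 j4].
  by split=> //; apply: sq; case: i i4 => [|[|[|[|//]]]].
rewrite eq_sym; case: i i4 => [|[|[|[|//]]]] _; case: j j4 => [|[|[|[|//]]]] _ //=;
  by apply/eqP; rewrite // metricC.
Qed.

Lemma nondegenerate_frame U : nondegenerate_on G U ->
  exists f, frame G id (fun i => q (f i) (f i)) f /\ spans (\dim U) f U.
Proof.
move=> ndU; have [t /andP[tb to]] := nondegenerate_orthonormal ndU.
have unit_t y : y \in t -> q y y * q y y = 1.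
  move=> yt; case/andP: to => /allP/(_ _ yt) + _.
  by case/orP=> /eqP ->; rewrite ?mulrNN mulr1.
have orth_t i j : (i < size t)%N -> (j < size t)%N -> i != j ->
    q t`_i t`_j = 0.
  case/andP: to => _ /(pairwiseP 0) pt it jt; case: ltngtP => // ij _.
    by apply/eqP; apply: pt.
  by rewrite metricC; apply/eqP; apply: pt.
have split_t y : exists2 z, z \in U & y - z \in orthov q U.
  exists (\sum_(i < size t) (q t`_i t`_i * q y t`_i) *: t`_i).
    by apply: memv_suml => i _; apply/memvZ/(basis_mem tb)/mem_nth.
  apply/mem_orthovP => z zU; rewrite (coord_basis (X := in_tuple t) tb zU).
  rewrite metric_sumr big1 // => i _; rewrite metricZr metricDl metricNl.
  rewrite metric_suml (bigD1 i) //= metricZl mulrAC unit_t ?mem_nth // mul1r.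
  rewrite big1 ?addr0 ?subrr ?mulr0 // => j ji.
  by rewrite metricZl (orth_t _ _ _ _ (ji : (j : nat) != i)) ?mulr0.
have ndW : nondegenerate_on G (orthov q U).
  apply/nondegenerateP => x xW x0; apply: metric_eq0 => y.
  have [z zU yz] := split_t y; rewrite -(subrK z y) metricDr x0 // add0r.
  by move/mem_orthovP: xW; apply.
have [r /andP[rb ro]] := nondegenerate_orthonormal ndW.
have rt x y : x \in t -> y \in r -> q x y = 0.
  move=> xt yr; rewrite metricC; have /mem_orthovP := basis_mem rb yr.
  by apply; apply: (basis_mem tb).
have szt : size t = \dim U by rewrite -(size_basis (X := in_tuple t) tb).
have orth_tr i j : (i < size (t ++ r))%N -> (j < size (t ++ r))%N -> j != i ->
    q (t ++ r)`_j (t ++ r)`_i = 0.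
  rewrite size_cat !nth_cat; case: (ltnP i (size t)) => it itr;
    case: (ltnP j (size t)) => jt jtr ji.
  - exact: orth_t.
  - by rewrite metricC rt // mem_nth // ltn_subLR.
  - by rewrite rt // mem_nth // ltn_subLR.
  have [rij rji] : (j - size t < size r)%N /\ (i - size t < size r)%N.
    by rewrite !ltn_subLR.
  have ne : (j - size t != i - size t)%N by rewrite eqn_sub2rE.
  case/andP: ro => _ /(pairwiseP 0) pr.
  case: (ltngtP (j - size t) (i - size t)) ne => // lt _.
    by apply/eqP; apply: pr.
  by rewrite metricC; apply/eqP; apply: pr.
have freetr : free (t ++ r).
  apply/(@freeP _ _ _ (in_tuple (t ++ r))) => k k0 i /=.
  have unit_tr : q (t ++ r)`_i (t ++ r)`_i != 0.
    have : (t ++ r)`_i \in t ++ r by apply: mem_nth.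
    rewrite mem_cat => /orP[/unit_t|yr].
      by apply: contra_eq_neq => ->; rewrite mulr0 eq_sym oner_eq0.
    case/andP: ro => /allP/(_ _ yr) + _.
    by case/orP=> /eqP ->; rewrite ?oppr_eq0 oner_eq0.
  have := congr1 (fun x => q x (t ++ r)`_i) k0; rewrite metric0l metric_suml.
  rewrite (bigD1 i) //= metricZl big1 ?addr0; last first.
    by move=> j ji; rewrite metricZl orth_tr ?mulr0.
  by move/eqP; rewrite mulf_eq0 (negPf unit_tr) orbF => /eqP.
have spantr : (<<t ++ r>> = fullv)%VS.
  apply/eqP; rewrite eqEsubv subvf /=; apply/subvP => y _.
  have [z zU yz] := split_t y; rewrite -(subrK z y) addrC span_cat.
  by rewrite (span_basis tb) (span_basis rb) memv_add.
have sz4 : size (t ++ r) = 4%N.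
  by move: freetr; rewrite /free spantr dim4 => /eqP <-.
pose f i := (t ++ r)`_i; exists f.
have fE : [:: f 0%N; f 1%N; f 2%N; f 3%N] = t ++ r.
  rewrite /f; by case: (t ++ r) sz4 => [|? [|? [|? [|? []]]]].
split.
  apply: orthonormal_frame; rewrite fE /pseudo_orthonormal all_cat pairwise_cat.
  case/andP: to => -> ->; case/andP: ro => -> ->; rewrite !andbT.
  by apply/allrelP => x y xt yr; rewrite rt.
move=> x; split=> [xU i /andP[ki i4]|x0].
  have : f i \in r.
    rewrite /f nth_cat szt ltnNge ki /=; apply: mem_nth.
    by rewrite ltn_subLR // -szt -size_cat sz4.
  by move=> fr; have /mem_orthovP := basis_mem rb fr; rewrite metricC; apply.
have [z zU xz] := split_t x.
suff -> : x = z by [].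
apply/eqP; rewrite -subr_eq0; apply/eqP.
move/nondegenerateP: ndW; apply=> // y yW.
rewrite metricDl metricNl; have /mem_orthovP/(_ _ zU) := yW.
rewrite (metricC _ y) => ->; rewrite subr0.
rewrite (coord_basis (X := in_tuple r) rb yW) metric_sumr big1 // => i _.
rewrite metricZr -[r`_i](_ : f (\dim U + i)%N = _); last first.
  by rewrite /f nth_cat szt ltnNge leq_addr /= addKn.
by rewrite x0 ?mulr0 // leq_addr -szt -sz4 size_cat ltn_add2l /=.
Qed.

Lemma frame_norm eps f x y : frame G id eps f ->
  q x y = sum4 (fun i => eps i * q x (f i) * q y (f i)).
Proof.
move=> frm; rewrite {1}(frame_expand dim4 frm x) /sum4 !metricDl !metricZl.
by rewrite !(metricC _ (f _) y).
Qed.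

Lemma eq_frame s eps eps' f : (forall i, (i < 4)%N -> eps i = eps' i) ->
  frame G s eps f -> frame G s eps' f.
Proof.
move=> ee [gt gr]; split=> [i i4 | i j i4 j4]; last by rewrite gr // ee.
by have [s4 ssi es e1] := gt i i4; split; rewrite -?ee.
Qed.

Lemma Lorentzian_timelike : Lorentzian G ->
  exists2 v, q v v = -1 & forall x, q x v = 0 -> x != 0 -> 0 < q x x.
Proof.
case=> t [/andP[tb to] _ cm].
have sz : size t = 4%N by rewrite -dim4 -(size_basis (X := in_tuple t) tb).
pose f i := t`_i.
have fE : [:: f 0%N; f 1%N; f 2%N; f 3%N] = t.
  by rewrite /f; case: (t) sz => [|? [|? [|? [|? []]]]].
have frm : frame G id (fun i => q (f i) (f i)) f.
  by apply: orthonormal_frame; rewrite fE.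
rewrite -fE /= in cm; case/andP: to => all1 _.
move: all1; rewrite -fE /= !andbT => /and4P[a0 a1 a2 a3].
have zero x : (forall i, (i < 4)%N -> q x (f i) = 0) -> x = 0.
  by move=> x0; apply: (frame_ext dim4 frm) => i i4; rewrite x0 // metric0l.
have key : exists2 i, (i < 4)%N & q (f i) (f i) = -1 /\
    forall j, (j < 4)%N -> j != i -> q (f j) (f j) = 1.
  move: cm a0 a1 a2 a3.
  case: eqP => e0; case: eqP => e1; case: eqP => e2; case: eqP => e3 // _;
   rewrite ?orbF => /eqP a0 /eqP a1 /eqP a2 /eqP a3.
  all: try by exists 0%N => //; split=> // -[|[|[|[|]]]].
  all: try by exists 1%N => //; split=> // -[|[|[|[|]]]].
  all: try by exists 2%N => //; split=> // -[|[|[|[|]]]].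
  all: try by exists 3%N => //; split=> // -[|[|[|[|]]]].
case: key => k k4 [ek ej]; exists (f k) => // x xk x0.
rewrite (frame_norm _ _ frm) lt_def; apply/andP; split; last first.
  rewrite /sum4 -!mulrA -!expr2.
  have pos i : (i < 4)%N -> 0 <= q (f i) (f i) * q x (f i) ^+ 2.
    move=> i4; have [-> | ik] := eqVneq i k; first by rewrite xk expr0n mulr0.
    by rewrite ej // mul1r sqr_ge0.
  by rewrite !addr_ge0 ?pos.
apply: contra_neq x0 => sum0; apply: zero => i i4.
have [-> // | ik] := eqVneq i k.
have sum0' : \sum_(j < 4) q (f j) (f j) * q x (f j) ^+ 2 = 0.
  rewrite (big_ord4 (fun j => q (f j) (f j) * q x (f j) ^+ 2)) -[RHS]sum0.
  by rewrite /sum4 !expr2 !mulrA.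
have pos (j : 'I_4) : true -> 0 <= q (f j) (f j) * q x (f j) ^+ 2.
  move=> _; have [-> | jk] := eqVneq (j : nat) k; first by rewrite xk expr0n mulr0.
  by rewrite ej // mul1r sqr_ge0.
have := psumr_eq0P pos sum0' (i := Ordinal i4) isT; rewrite /= ej // mul1r.
by move/sqr0I.
Qed.

(** The case of Sylvester's law that is needed: two negative frame vectors would span a negative
    definite plane, which meets the orthogonal complement of a timelike vector, where the metric is
    positive. With no negative vector the metric would be positive. *)
Lemma frame_sign eps f : Lorentzian G -> frame G id eps f ->
  exists2 i, (i < 4)%N & eps i = -1 /\
    forall j, (j < 4)%N -> j != i -> eps j = 1.
Proof.
move=> /Lorentzian_timelike[v vv vpos] frm.
have [gt gr] := frm.
have unit i : (i < 4)%N -> eps i != -1 -> eps i = 1.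
  move=> i4 ei; have [_ _ _ e1] := gt i i4.
  have : (eps i - 1) * (eps i + 1) = eps i * eps i - 1 by ring.
  rewrite e1 subrr => /eqP; rewrite mulf_eq0 subr_eq0 addr_eq0 (negPf ei) orbF => /eqP //.
have two i j : (i < 4)%N -> (j < 4)%N -> i != j -> eps i = -1 -> eps j <> -1.
  move=> i4 j4 ij ei ej.
  have ii : q (f i) (f i) = -1 by rewrite gr //= eqxx.
  have jj : q (f j) (f j) = -1 by rewrite gr //= eqxx.
  have qij : q (f i) (f j) = 0 by rewrite gr //= eq_sym (negPf ij).
  have neg x y : q (x *: f i + y *: f j) v = 0 -> x != 0 -> False.
    move=> xv x0; have norm : q (x *: f i + y *: f j) (x *: f i + y *: f j) =
        - (x ^+ 2) - y ^+ 2.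
      by rewrite !metricE (metricC _ (f j)) ii jj qij; ring.
    have x2 : 0 < x ^+ 2 by rewrite exprn_even_gt0.
    have [w0 | w0] := eqVneq (x *: f i + y *: f j) 0.
      by rewrite w0 metric0l in norm; have := sqr_ge0 y; lra.
    by have := vpos _ xv w0; rewrite norm; have := sqr_ge0 y; lra.
  have [iv | iv] := eqVneq (q (f j) v) 0.
    have qj : q (0 *: f i + 1 *: f j) v = 0 by rewrite !metricE iv; ring.
    have norm : q (0 *: f i + 1 *: f j) (0 *: f i + 1 *: f j) = -1.
      by rewrite !metricE jj qij; ring.
    have [w0 | w0] := eqVneq (0 *: f i + 1 *: f j) 0.
      by rewrite w0 metric0l in norm; lra.
    by have := vpos _ qj w0; rewrite norm; lra.
  by apply: (neg _ (- q (f i) v) _ iv); rewrite !metricE; ring.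
have [|none] := boolP [exists i : 'I_4, eps i == -1].
  case/existsP=> i /eqP ei; exists (i : nat) => //; split=> // j j4 ji.
  by apply: unit => //; apply/eqP; apply: (two i) => //; rewrite eq_sym.
have eps1 i : (i < 4)%N -> eps i = 1.
  move=> i4; apply: unit => //; move/existsPn: none.
  exact: (fun h => h (Ordinal i4)).
have := vv; rewrite (frame_norm _ _ frm) /sum4 !eps1 // !mul1r -!expr2.
have := sqr_ge0 (q v (f 0%N)); have := sqr_ge0 (q v (f 1%N)).
have := sqr_ge0 (q v (f 2%N)); have := sqr_ge0 (q v (f 3%N)).
by lra.
Qed.

Definition transpose (a b i : nat) := if i == a then b else if i == b then a else i.

Lemma transposeK a b : involutive (transpose a b).
Proof.
move=> i; rewrite /transpose; case: (eqVneq i a) => [->|ia].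
  by case: eqP => [->|]; rewrite ?eqxx.
by case: (eqVneq i b) => [->|ib]; rewrite ?eqxx // (negPf ia) (negPf ib).
Qed.

Lemma transpose_frame a b eps f : (a < 4)%N -> (b < 4)%N -> frame G id eps f ->
  frame G id (fun i => eps (transpose a b i)) (fun i => f (transpose a b i)).
Proof.
move=> a4 b4 [gt gr].
have t4 i : (i < 4)%N -> (transpose a b i < 4)%N.
  by rewrite /transpose; case: eqP => // _; case: eqP.
have tI i j : (transpose a b j == transpose a b i) = (j == i).
  exact: (inj_eq (can_inj (transposeK a b))).
split=> [i i4 | i j i4 j4]; first by have [_ _ _ e1] := gt _ (t4 i i4).
by rewrite gr ?t4 // tI.
Qed.

Lemma spans_transpose k a b f U : (a < 4)%N -> (b < 4)%N ->
  (k <= a)%N = (k <= b)%N -> spans k f U ->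
  spans k (fun i => f (transpose a b i)) U.
Proof.
move=> a4 b4 kab fU x; rewrite fU.
have tk i : (k <= i < 4)%N -> (k <= transpose a b i < 4)%N.
  move=> /andP[ki i4]; rewrite /transpose.
  case: eqP ki => [->|_] ki; first by rewrite -kab ki.
  by case: eqP ki => [->|_] ki; rewrite ?kab ki.
split=> x0 i ki; first by apply: x0; apply: tk.
by rewrite -[i](transposeK a b); apply: x0; apply: tk.
Qed.

(** The timelike vector of a frame adapted to [U] is moved by a transposition to index 0 if it lies
    in [U] and to index 3 if it is normal to [U]. *)
Lemma adapted_frame U : Lorentzian G -> nondegenerate_on G U ->
  exists f, spans (\dim U) f U /\
   (frame G id (eps4 (-1) 1 1 1) f /\ (0 < \dim U)%N \/
    frame G id (eps4 1 1 1 (-1)) f /\ (\dim U < 4)%N).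
Proof.
move=> lorG ndU; have [f [frm fU]] := nondegenerate_frame ndU.
have [k k4 [ek ej]] := frame_sign lorG frm.
pose b := if (k < \dim U)%N then 0%N else 3%N.
have b4 : (b < 4)%N by rewrite /b; case: ifP.
have dU4 : (\dim U <= 4)%N by rewrite -dim4 dimvS ?subvf.
exists (fun i => f (transpose k b i)); split.
  apply: spans_transpose => //; rewrite /b; case: (ltnP k) => kU.
    by apply/esym/negbTE; rewrite -ltnNge; apply: leq_ltn_trans kU.
  by apply/esym; rewrite -ltnS; apply: leq_ltn_trans kU k4.
have eE i : (i < 4)%N -> q (f (transpose k b i)) (f (transpose k b i)) =
    if i == b then -1 else 1.
  move=> i4; rewrite /transpose; case: (eqVneq i b) => [->|ib].
    by case: eqP => [->|_]; rewrite ek.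
  by case: eqP => [ik|/eqP ik]; rewrite ej // eq_sym -?ik // eq_sym.
have := transpose_frame k4 b4 frm => frm'.
rewrite /b in eE frm' *; case: (ltnP k (\dim U)) => kU in eE frm' *.
  left; split; last exact: leq_ltn_trans kU.
  by apply: eq_frame frm' => -[|[|[|[|]]]] // i4; rewrite eE.
right; split; last exact: leq_ltn_trans k4.
by apply: eq_frame frm' => -[|[|[|[|]]]] // i4; rewrite eE.
Qed.

End Geometry.

(** * Normal forms of symmetric forms *)

(** With [p], [r] the hyperbolic cosine and sine of a rapidity, the equation prescribes [k] as the
    hyperbolic tangent of twice the rapidity; [t] is the half-argument formula. *)
Lemma boost_param (R : rcfType) (k : R) : k ^+ 2 < 1 ->
  exists p r, p ^+ 2 - r ^+ 2 = 1 /\ 2 * (p * r) = k * (p ^+ 2 + r ^+ 2).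
Proof.
move=> k1; pose s := Num.sqrt (1 - k ^+ 2).
have s2 : s ^+ 2 = 1 - k ^+ 2 by rewrite sqr_sqrtr // subr_ge0 ltW.
have s0 : 0 < s by rewrite sqrtr_gt0 subr_gt0.
have s1 : 1 + s != 0 by rewrite gt_eqF // addr_gt0.
pose t := k / (1 + s).
have t2 : t ^+ 2 = (1 - s) / (1 + s).
  have -> : t ^+ 2 = k ^+ 2 / (1 + s) ^+ 2 by rewrite /t; field.
  have -> : k ^+ 2 = (1 - s) * (1 + s) by have := s2; lra.
  by field.
have t1 : 0 < 1 - t ^+ 2.
  have -> : 1 - t ^+ 2 = 2 * s / (1 + s) by rewrite t2; field.
  by rewrite divr_gt0 ?mulr_gt0 ?addr_gt0.
pose p := (Num.sqrt (1 - t ^+ 2))^-1.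
have p2 : p ^+ 2 * (1 - t ^+ 2) = 1.
  by rewrite exprVn sqr_sqrtr ?ltW // mulVf // lt0r_neq0.
exists p, (t * p); split; first by rewrite -[RHS]p2; ring.
have -> : 2 * (p * (t * p)) = p ^+ 2 * (2 * t) by ring.
have -> : k * (p ^+ 2 + (t * p) ^+ 2) = p ^+ 2 * (k * (1 + t ^+ 2)) by ring.
congr (_ * _); rewrite t2 /t; field.
exact: s1.
Qed.

(** The Jacobi rotation that diagonalises the symmetric matrix with entries [a], [b], [c]; [t] is
    the tangent of its angle, a root of a quadratic equation. *)
Lemma rotation_param (R : rcfType) (a b c : R) :
  exists p r, p ^+ 2 + r ^+ 2 = 1 /\ (p ^+ 2 - r ^+ 2) * b + p * r * (c - a) = 0.
Proof.
have [-> | b0] := eqVneq b 0; first by exists 1, 0; split; ring.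
pose s := Num.sqrt ((a - c) ^+ 2 + 4 * b ^+ 2).
have s2 : s ^+ 2 = (a - c) ^+ 2 + 4 * b ^+ 2.
  by rewrite sqr_sqrtr //; have := sqr_ge0 (a - c); have := sqr_ge0 b; lra.
pose t := (c - a + s) / (2 * b).
have tE : (1 - t ^+ 2) * b + t * (c - a) = 0.
  have -> : (1 - t ^+ 2) * b + t * (c - a) =
     (4 * b ^+ 2 - s ^+ 2 + (a - c) ^+ 2) / (4 * b) by rewrite /t; field.
  have -> : 4 * b ^+ 2 - s ^+ 2 + (a - c) ^+ 2 = 0 by rewrite s2; ring.
  by rewrite mul0r.
have t1 : 0 < 1 + t ^+ 2 by rewrite ltr_pwDl ?sqr_ge0.
pose p := (Num.sqrt (1 + t ^+ 2))^-1.
have p2 : p ^+ 2 * (1 + t ^+ 2) = 1.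
  by rewrite exprVn sqr_sqrtr ?ltW // mulVf // lt0r_neq0.
exists p, (t * p); split; first by rewrite -[RHS]p2; ring.
have -> : (p ^+ 2 - (t * p) ^+ 2) * b + p * (t * p) * (c - a) =
  p ^+ 2 * ((1 - t ^+ 2) * b + t * (c - a)) by ring.
by rewrite tE mulr0.
Qed.

(** The characteristic polynomial is a monic cubic and changes sign between [- A] and [A], where [A]
    dominates the lower coefficients. *)
Lemma real_eigenvalue3 (R : rcfType) (M : 'M[R]_3) :
  exists lam, exists2 v : 'rV[R]_3, v *m M = lam *: v & v != 0.
Proof.
pose p := char_poly M.
have sp : size p = 4%N by rewrite size_char_poly.
have p3 : p`_3 = 1 by have /monicP := char_poly_monic M; rewrite lead_coefE sp.
pose A := 1 + `|p`_0| + `|p`_1| + `|p`_2|.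
have A1 : 1 <= A by rewrite /A -!addrA lerDl !addr_ge0.
have pE x : p.[x] = p`_0 + p`_1 * x + p`_2 * x ^+ 2 + x ^+ 3.
  by rewrite horner_coef sp !big_ord_recr big_ord0 /= p3; ring.
have b0 := ler_norm p`_0; have b1 := ler_norm p`_1; have b2 := ler_norm p`_2.
have c0 := ler_norm (- p`_0); have c1 := ler_norm (- p`_1).
have c2 := ler_norm (- p`_2); rewrite !normrN in c0 c1 c2.
have A2 : A <= A ^+ 2 by rewrite expr2 ler_peMl // (le_trans ler01).
have [n0 n1 n2] : [/\ 0 <= `|p`_0|, 0 <= `|p`_1| & 0 <= `|p`_2|] by [].
have A0 : 0 <= A by apply: le_trans A1.
have bound : `|p`_0| + `|p`_1| * A + `|p`_2| * A ^+ 2 <= A ^+ 3.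
  have -> : A ^+ 3 = (1 + `|p`_0| + `|p`_1| + `|p`_2|) * A ^+ 2.
    by rewrite -[X in X * _]/A; ring.
  have k0 : `|p`_0| <= `|p`_0| * A ^+ 2 by rewrite ler_peMr // (le_trans A1).
  have k1 : `|p`_1| * A <= `|p`_1| * A ^+ 2 by rewrite ler_wpM2l.
  have := sqr_ge0 A; clear -k0 k1; lra.
have [|x _ rx] := @poly_ivt R p (- A) A (ge0_cp A0).2.
  rewrite !pE; apply/andP; split.
    have h1 : - (p`_1 * A) <= `|p`_1| * A by rewrite -mulNr ler_wpM2r.
    have h2 : p`_2 * A ^+ 2 <= `|p`_2| * A ^+ 2 by rewrite ler_wpM2r ?sqr_ge0.
    by clear -h1 h2 b0 bound; lra.
  have h1 : - (p`_1 * A) <= `|p`_1| * A by rewrite -mulNr ler_wpM2r.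
  have h2 : - (p`_2 * A ^+ 2) <= `|p`_2| * A ^+ 2.
    by rewrite -mulNr ler_wpM2r ?sqr_ge0.
  by clear -h1 h2 c0 bound; lra.
have /eigenvalueP[v vM v0] : eigenvalue M x by rewrite eigenvalue_root_char.
by exists x, v.
Qed.

Definition vec4 (V : nmodType) (x y z t : V) i := nth 0 [:: x; y; z; t] i.

Section Moving.
Variables (R : realType) (g : lieAlgebra R).
Variable G : gen_metric g.
Local Notation q := (gm_g G).

Lemma oframe_intro a b c d x y z t :
  [/\ a * a = 1, b * b = 1, c * c = 1 & d * d = 1] ->
  [/\ q x x = a, q y y = b, q z z = c & q t t = d] ->
  [/\ q x y = 0, q x z = 0 & q x t = 0] ->
  [/\ q y z = 0, q y t = 0 & q z t = 0] ->
  frame G id (eps4 a b c d) (vec4 x y z t).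
Proof.
move=> [a1 b1 c1 d1] [xx yy zz tt] [xy xz xt] [yz yt zt].
split=> [[|[|[|[|]]]]|[|[|[|[|]]]] [|[|[|[|]]]]] //= _ _; by rewrite // metricC.
Qed.

Lemma nframe_intro x y z t :
  [/\ q x x = 0, q y y = 1, q z z = 0 & q t t = 1] ->
  [/\ q x y = 0, q x z = 1 & q x t = 0] ->
  [/\ q y z = 0, q y t = 0 & q z t = 0] ->
  frame G swap02 (eps4 1 1 1 1) (vec4 x y z t).
Proof.
move=> [xx yy zz tt] [xy xz xt] [yz yt zt].
split=> [[|[|[|[|]]]]|[|[|[|[|]]]] [|[|[|[|]]]]] //= _; rewrite /eps4 /= ?mulr1 //;
  by move=> _; rewrite // metricC.
Qed.

Lemma oframe_gram a b c d f : frame G id (eps4 a b c d) f ->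
  (q (f 0%N) (f 0%N) = a) * (q (f 1%N) (f 1%N) = b) *
  (q (f 2%N) (f 2%N) = c) * (q (f 3%N) (f 3%N) = d) *
  (q (f 0%N) (f 1%N) = 0) * (q (f 1%N) (f 0%N) = 0) *
  (q (f 0%N) (f 2%N) = 0) * (q (f 2%N) (f 0%N) = 0) *
  (q (f 0%N) (f 3%N) = 0) * (q (f 3%N) (f 0%N) = 0) *
  (q (f 1%N) (f 2%N) = 0) * (q (f 2%N) (f 1%N) = 0) *
  (q (f 1%N) (f 3%N) = 0) * (q (f 3%N) (f 1%N) = 0) *
  (q (f 2%N) (f 3%N) = 0) * (q (f 3%N) (f 2%N) = 0).
Proof. by case=> _ gr; do !split; rewrite gr. Qed.

Lemma nframe_gram f : frame G swap02 (eps4 1 1 1 1) f ->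
  (q (f 0%N) (f 0%N) = 0) * (q (f 1%N) (f 1%N) = 1) *
  (q (f 2%N) (f 2%N) = 0) * (q (f 3%N) (f 3%N) = 1) *
  (q (f 0%N) (f 1%N) = 0) * (q (f 1%N) (f 0%N) = 0) *
  (q (f 0%N) (f 2%N) = 1) * (q (f 2%N) (f 0%N) = 1) *
  (q (f 0%N) (f 3%N) = 0) * (q (f 3%N) (f 0%N) = 0) *
  (q (f 1%N) (f 2%N) = 0) * (q (f 2%N) (f 1%N) = 0) *
  (q (f 1%N) (f 3%N) = 0) * (q (f 3%N) (f 1%N) = 0) *
  (q (f 2%N) (f 3%N) = 0) * (q (f 3%N) (f 2%N) = 0).
Proof. by case=> _ gr; do !split; rewrite gr. Qed.

Lemma reflect_frame s eps f w : frame G s eps f -> q w w != 0 ->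
  frame G s eps (fun j => f j - (2 * q (f j) w / q w w) *: w).
Proof.
move=> [gt gr] w0; split=> // j k j4 k4; rewrite -gr // !metricE.
by rewrite (metricC _ w (f k)); field.
Qed.

(* The reflection mapping f_i to u or to -u. *)
Lemma move_frame s eps f i u : frame G s eps f -> (i < 4)%N ->
  q (f i) (f i) != 0 -> q u u = q (f i) (f i) ->
  exists h, [/\ frame G s eps h, h i = u \/ h i = - u &
    forall j, q (f j) (f i) = 0 -> q (f j) u = 0 -> h j = f j].
Proof.
move=> frm i4 fi0 uu.
have [sg [sg1 sgu]] : exists sg : R, sg * sg = 1 /\ q (f i) (f i) != sg * q (f i) u.
  have [e | ne] := eqVneq (q (f i) (f i)) (1 * q (f i) u); last first.
    by exists 1; rewrite mul1r.
  exists (-1); split; first by rewrite mulrNN mulr1.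
  apply: contra_neq fi0 => e'; move: e'; rewrite e; lra.
pose w := f i - sg *: u.
have ww : q w w = 2 * (q (f i) (f i) - sg * q (f i) u).
  rewrite !metricE uu (metricC _ u).
  transitivity (q (f i) (f i) - 2 * (sg * q (f i) u) + (sg * sg) * q (f i) (f i)).
    by ring.
  by rewrite sg1; ring.
have w0 : q w w != 0.
  by rewrite ww mulf_neq0 ?pnatr_eq0 // subr_eq0.
pose h j := f j - (2 * q (f j) w / q w w) *: w.
exists h; split.
- exact: reflect_frame.
- have -> : h i = sg *: u.
    have fw : 2 * q (f i) w = q w w.
      by rewrite ww !metricE; ring.
    by rewrite /h fw divff // scale1r /w opprB addrC subrK.
  have : (sg - 1) * (sg + 1) = sg * sg - 1 by ring.
  rewrite sg1 subrr => /eqP; rewrite mulf_eq0 subr_eq0 addr_eq0 => /orP[] /eqP ->.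
    by left; rewrite scale1r.
  by right; rewrite scaleN1r.
move=> j ji ju; rewrite /h.
have -> : q (f j) w = 0 by rewrite !metricE ji ju mulr0 subr0.
by rewrite mulr0 mul0r scale0r subr0.
Qed.

Section NormalForm.
Hypothesis dim4 : \dim {:g} = 4%N.
Variable sig : g -> g -> R.
Hypothesis sigC : forall x y, sig x y = sig y x.
Hypothesis sigDl : forall x y z, sig (x + y) z = sig x z + sig y z.
Hypothesis sigZl : forall a x z, sig (a *: x) z = a * sig x z.

Lemma sigDr x y z : sig z (x + y) = sig z x + sig z y.
Proof. by rewrite sigC sigDl !(sigC z). Qed.
Lemma sigZr a x z : sig z (a *: x) = a * sig z x.
Proof. by rewrite sigC sigZl (sigC z). Qed.
Lemma sigNl x z : sig (- x) z = - sig x z.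
Proof. by rewrite -scaleN1r sigZl mulN1r. Qed.
Lemma sigNr x z : sig z (- x) = - sig z x.
Proof. by rewrite sigC sigNl (sigC z). Qed.
Let sigE := (sigDl, sigDr, sigZl, sigZr, sigNl, sigNr).

Definition diagonal_form (h : nat -> g) :=
  [/\ sig (h 0%N) (h 1%N) = 0, sig (h 0%N) (h 2%N) = 0 &
      sig (h 1%N) (h 2%N) = 0].

(** On the Lorentzian plane of [h 0] and [h 1] the associated endomorphism is a real number plus a
    nonzero multiple of a complex structure. *)
Definition complex_form (h : nat -> g) :=
  [/\ sig (h 0%N) (h 2%N) = 0, sig (h 1%N) (h 2%N) = 0,
      sig (h 0%N) (h 0%N) = - sig (h 1%N) (h 1%N) &
      sig (h 0%N) (h 1%N) != 0].

(** In a null frame [h 0] is an eigenvector; the two alternatives are a Jordan block of size two,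
    with [h 1] a further eigenvector, and one of size three. *)
Definition null_form (h : nat -> g) :=
  [/\ sig (h 0%N) (h 0%N) = 0, sig (h 0%N) (h 1%N) = 0 &
    sig (h 1%N) (h 2%N) = 0 /\ sig (h 2%N) (h 2%N) != 0 \/
    sig (h 1%N) (h 1%N) = sig (h 0%N) (h 2%N) /\ sig (h 1%N) (h 2%N) != 0].

(* A symmetric endomorphism of a Lorentzian plane is either diagonalisable, or
   has a non-real eigenvalue, or has a null eigenvector. *)
Lemma boost_form a d f : frame G id (eps4 (-1) 1 a d) f ->
  (exists p r, [/\ p ^+ 2 - r ^+ 2 = 1,
    frame G id (eps4 (-1) 1 a d)
      (vec4 (p *: f 0%N + r *: f 1%N) (r *: f 0%N + p *: f 1%N) (f 2%N) (f 3%N)) &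
    sig (p *: f 0%N + r *: f 1%N) (r *: f 0%N + p *: f 1%N) = 0 \/
    sig (p *: f 0%N + r *: f 1%N) (p *: f 0%N + r *: f 1%N) =
      - sig (r *: f 0%N + p *: f 1%N) (r *: f 0%N + p *: f 1%N) /\
    sig (p *: f 0%N + r *: f 1%N) (r *: f 0%N + p *: f 1%N) != 0]) \/
  (exists de, [/\ de * de = 1, sig (f 0%N) (f 1%N) != 0 &
     sig (f 0%N) (f 0%N) + sig (f 1%N) (f 1%N) =
       - (2 * de * sig (f 0%N) (f 1%N))]).
Proof.
move=> frm; have gr := oframe_gram frm.
have [a1 d1] : a * a = 1 /\ d * d = 1.
  case: frm => gt _; have [_ _ _ a1] := gt 2%N isT.
  by have [_ _ _ d1] := gt 3%N isT.
have boosted p r : p ^+ 2 - r ^+ 2 = 1 -> frame G id (eps4 (-1) 1 a d)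
   (vec4 (p *: f 0%N + r *: f 1%N) (r *: f 0%N + p *: f 1%N) (f 2%N) (f 3%N)).
  move=> pr; apply: oframe_intro; first by rewrite mulrNN mulr1.
  - by split; rewrite ?metricE !gr //; lra.
  - by split; rewrite ?metricE !gr; ring.
  by split; rewrite ?metricE !gr; ring.
set A := sig (f 0%N) (f 0%N); set B := sig (f 0%N) (f 1%N).
set C := sig (f 1%N) (f 1%N).
have e01 p r : sig (p *: f 0%N + r *: f 1%N) (r *: f 0%N + p *: f 1%N) =
    p * r * (A + C) + (p ^+ 2 + r ^+ 2) * B.
  by rewrite !sigE (sigC (f 1%N) (f 0%N)) /A /B /C; ring.
have e00 p r : sig (p *: f 0%N + r *: f 1%N) (p *: f 0%N + r *: f 1%N) +
    sig (r *: f 0%N + p *: f 1%N) (r *: f 0%N + p *: f 1%N) =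
    (p ^+ 2 + r ^+ 2) * (A + C) + 4 * (p * r) * B.
  by rewrite !sigE (sigC (f 1%N) (f 0%N)) /A /B /C; ring.
have [lt | lt | eq] := ltrgtP ((2 * B) ^+ 2) ((A + C) ^+ 2).
- left; have AC0 : A + C != 0.
    apply: contraTneq lt => ->; rewrite expr0n /= -leNgt; exact: sqr_ge0.
  have [|p [r [pr k]]] := @boost_param _ (- (2 * B) / (A + C)).
    by rewrite exprMn sqrrN exprVn ltr_pdivrMr ?mul1r // exprn_even_gt0.
  exists p, r; split=> //; first exact: boosted.
  left; rewrite e01; apply: (mulfI (_ : 2 != 0 :> R)); first by rewrite pnatr_eq0.
  rewrite mulr0 mulrDr !mulrA -(mulrA 2) k; field.
  exact: AC0.
- left; have B0 : B != 0.
    apply: contraTneq lt => ->; rewrite mulr0 expr0n /= -leNgt; exact: sqr_ge0.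
  have [|p [r [pr k]]] := @boost_param _ (- (A + C) / (2 * B)).
    rewrite exprMn sqrrN exprVn ltr_pdivrMr ?mul1r // exprn_even_gt0 //.
    by rewrite mulf_neq0 ?pnatr_eq0.
  exists p, r; split=> //; first exact: boosted.
  right; split.
    apply/eqP; rewrite -addr_eq0 e00; apply/eqP.
    have -> : 4 * (p * r) * B = 2 * (2 * (p * r)) * B by ring.
    by rewrite k; field; exact: B0.
  rewrite e01; apply: contraTneq lt => e.
  have e2 : 2 * (p * r * (A + C) + (p ^+ 2 + r ^+ 2) * B) =
     (p ^+ 2 + r ^+ 2) * (((2 * B) ^+ 2 - (A + C) ^+ 2) / (2 * B)).
    rewrite mulrDr !mulrA -(mulrA 2) k; field; exact: B0.
  have pr0 : 0 < p ^+ 2 + r ^+ 2 by have := sqr_ge0 r; lra.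
  have : ((2 * B) ^+ 2 - (A + C) ^+ 2) / (2 * B) = 0.
    by apply: (mul0I (lt0r_neq0 pr0)); rewrite -e2 e mulr0.
  move/eqP; rewrite mulf_eq0 invr_eq0 mulf_eq0 pnatr_eq0 (negPf B0) /=.
  by rewrite orbF => /eqP D0; rewrite -leNgt; lra.
have [B0 | B0] := eqVneq B 0.
  left; exists 1, 0; split; [by ring | by apply: boosted; ring | left].
  by rewrite e01 B0; ring.
right; have : (2 * B - (A + C)) * (2 * B + (A + C)) = 0.
  by rewrite -[RHS](subrr ((2 * B) ^+ 2)) {2}eq; ring.
move/eqP; rewrite mulf_eq0 => /orP[] /eqP k.
  by exists (-1); split=> //; [ring | lra].
by exists 1; split=> //; [ring | lra].
Qed.

(** In an indefinite metric a symmetric endomorphism may have nonreal eigenvalues, but the space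
    orthogonal to [f 3] has odd dimension three. *)
Lemma form_eigenvector a b c d f : frame G id (eps4 a b c d) f ->
  exists lam u, [/\ u != 0, q u (f 3%N) = 0 &
    forall x, q x (f 3%N) = 0 -> sig u x = lam * q u x].
Proof.
move=> frm; have gr := oframe_gram frm; have [gt _] := frm.
have e2 i : (i < 4)%N -> eps4 a b c d i * eps4 a b c d i = 1.
  by move=> i4; have [] := gt i i4.
pose M := \matrix_(i < 3, j < 3) (eps4 a b c d j * sig (f i) (f j)).
have [lam [v vM v0]] := real_eigenvalue3 M.
pose x i := v 0 (inord i).
pose u := x 0%N *: f 0%N + x 1%N *: f 1%N + x 2%N *: f 2%N.
have uf j : (j < 3)%N -> sig u (f j) = lam * q u (f j).
  move=> j3; have := congr1 (fun N : 'rV[R]_3 => eps4 a b c d j * N 0 (inord j)) vM.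
  rewrite /= !mxE !big_ord_recr big_ord0 /= add0r !mxE /= inordK //.
  have -> : widen_ord (leqnSn 2) (widen_ord (leqnSn 1) ord_max) = inord 0.
    by apply: val_inj; rewrite /= inordK.
  have -> : widen_ord (leqnSn 2) ord_max = inord 1 :> 'I_3.
    by apply: val_inj; rewrite /= inordK.
  have -> : ord_max = inord 2 :> 'I_3 by apply: val_inj; rewrite /= inordK.
  rewrite -!/(x _) => e; rewrite !sigE !metricE; have ej := e2 j (ltnW j3).
  have fj : x 0%N * q (f 0%N) (f j) + x 1%N * q (f 1%N) (f j) +
      x 2%N * q (f 2%N) (f j) = eps4 a b c d j * x j.
    by case: j j3 {e ej} => [|[|[|//]]] _; rewrite !gr /eps4 /=; ring.
  rewrite fj (mulrCA lam) -e !mulrDr !(mulrCA (eps4 a b c d j) (x _)).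
  by rewrite !(mulrA (eps4 a b c d j) (eps4 a b c d j)) ej !mul1r.
exists lam, u; split.
- apply: contra_neq v0 => u0; apply/rowP => i; rewrite mxE.
  have xE j : (j < 3)%N -> x j = eps4 a b c d j * q u (f j).
    move=> j3; rewrite !metricE -[LHS]mul1r -(e2 j (ltnW j3)) -mulrA; congr (_ * _).
    by case: j j3 => [|[|[|//]]] _; rewrite !gr /eps4 /=; ring.
  by have := xE i (ltn_ord i); rewrite u0 metric0l mulr0 /x inord_val.
- by rewrite !metricE !gr; ring.
move=> y y3; rewrite (frame_expand dim4 frm y) /sum4 y3 mulr0 scale0r addr0.
by rewrite !sigDr !sigZr !uf // !metricE; ring.
Qed.

Lemma rotate_form a d f : frame G id (eps4 a 1 1 d) f ->
  sig (f 0%N) (f 1%N) = 0 -> sig (f 0%N) (f 2%N) = 0 ->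
  exists h, [/\ frame G id (eps4 a 1 1 d) h, h 0%N = f 0%N, h 3%N = f 3%N &
    diagonal_form h].
Proof.
move=> frm s01 s02; have gr := oframe_gram frm.
have [a1 d1] : a * a = 1 /\ d * d = 1.
  case: frm => gt _; have [_ _ _ a1] := gt 0%N isT.
  by have [_ _ _ d1] := gt 3%N isT.
have [p [r [pr k]]] := rotation_param (sig (f 1%N) (f 1%N))
  (sig (f 1%N) (f 2%N)) (sig (f 2%N) (f 2%N)).
exists (vec4 (f 0%N) (p *: f 1%N + r *: f 2%N) (- r *: f 1%N + p *: f 2%N) (f 3%N)).
split=> //.
  apply: oframe_intro; first by rewrite mulr1.
  - by split; rewrite ?metricE !gr //; lra.
  - by split; rewrite ?metricE !gr //; lra.
  by split; rewrite ?metricE !gr //; lra.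
split; rewrite /= !sigE ?s01 ?s02; try by ring.
by rewrite (sigC (f 2%N) (f 1%N)); lra.
Qed.

(** A multiple of [u] is [f 0 + w] with [w] a unit spacelike vector, and a reflection carries [f 1]
    to [w] up to sign. The factor [2^-1] in the opposite null vector makes the product of the two
    null vectors one. *)
Lemma null_frame f u : frame G id (eps4 (-1) 1 1 1) f -> u != 0 ->
  q u u = 0 -> q u (f 3%N) = 0 ->
  exists h c, [/\ frame G swap02 (eps4 1 1 1 1) h, h 3%N = f 3%N, c != 0 &
    h 0%N = c *: u].
Proof.
move=> frm u0 uu u3; have gr := oframe_gram frm.
have uE := frame_expand dim4 frm u; rewrite /sum4 u3 mulr0 scale0r addr0 /eps4 /= in uE.
set x0 := _ * q u (f 0%N) in uE; set x1 := _ * q u (f 1%N) in uE.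
set x2 := _ * q u (f 2%N) in uE.
have norm : x1 ^+ 2 + x2 ^+ 2 = x0 ^+ 2.
  by move: uu; rewrite uE !metricE !gr; clear; lra.
have x00 : x0 != 0.
  apply: contra_neq u0 => x00; rewrite x00 expr0n /= in norm.
  have [p1 p2] := conj (sqr_ge0 x1) (sqr_ge0 x2).
  have x10 : x1 = 0 by apply: sqr_le0; lra.
  have x20 : x2 = 0 by apply: sqr_le0; lra.
  by rewrite uE x00 x10 x20 !scale0r !addr0.
pose w := (x1 / x0) *: f 1%N + (x2 / x0) *: f 2%N.
have cu : x0^-1 *: u = f 0%N + w.
  rewrite uE !scalerDr !scalerA mulVf // scale1r -addrA.
  by congr (_ + (_ *: _ + _ *: _)); rewrite mulrC.
have ww : q w w = q (f 1%N) (f 1%N).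
  rewrite !metricE !gr; transitivity ((x1 ^+ 2 + x2 ^+ 2) / x0 ^+ 2).
    by field.
  by rewrite norm divff // expf_neq0.
have [|h [frh hw hfix]] := @move_frame _ _ f 1%N w frm isT _ ww.
  by rewrite gr oner_eq0.
have h0 : h 0%N = f 0%N by apply: hfix; rewrite ?metricE !gr //; ring.
have h3 : h 3%N = f 3%N by apply: hfix; rewrite ?metricE !gr //; ring.
have grh := oframe_gram frh.
have [e [e1 we]] : exists e, e * e = 1 /\ w = e *: h 1%N.
  case: hw => hw; first by exists 1; rewrite mulr1 scale1r.
  by exists (-1); rewrite mulrNN mulr1 scaleN1r hw opprK.
exists (vec4 (h 0%N + e *: h 1%N) (h 2%N) (2^-1 *: (- h 0%N + e *: h 1%N)) (h 3%N)), x0^-1.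
split=> //; last by rewrite cu /= h0 we.
  apply: nframe_intro.
  - by split; rewrite ?metricE !grh //; lra.
  - by split; rewrite ?metricE !grh //; lra.
  by split; rewrite ?metricE !grh //; lra.
by rewrite invr_eq0.
Qed.

(** A reflection moves the spacelike eigenvector to index 2; the three outcomes are those of
    [boost_form] on the Lorentzian plane left over. *)
Lemma spacelike_form f u lam : frame G id (eps4 (-1) 1 1 1) f ->
  q u u = 1 -> q u (f 3%N) = 0 ->
  (forall x, q x (f 3%N) = 0 -> sig u x = lam * q u x) ->
  exists h, h 3%N = f 3%N /\
    [\/ frame G id (eps4 (-1) 1 1 1) h /\ diagonal_form h,
        frame G id (eps4 (-1) 1 1 1) h /\ complex_form h |
        frame G swap02 (eps4 1 1 1 1) h /\ null_form h].
Proof.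
move=> frm uu u3 ulam; have gr := oframe_gram frm.
have [||h [frh hu hfix]] := @move_frame _ _ f 2%N u frm isT.
- by rewrite gr oner_eq0.
- by rewrite gr.
have h3 : h 3%N = f 3%N by apply: hfix; rewrite ?gr // metricC.
have grh := oframe_gram frh.
have h2lam x : q x (h 3%N) = 0 -> q (h 2%N) x = 0 -> sig (h 2%N) x = 0.
  rewrite h3 => x3; case: hu => ->; rewrite ?metricNl => ux.
    by rewrite ulam // ux mulr0.
  by rewrite sigNl ulam // -mulrN ux mulr0.
have s02 : sig (h 0%N) (h 2%N) = 0 by rewrite sigC h2lam ?grh.
have s12 : sig (h 1%N) (h 2%N) = 0 by rewrite sigC h2lam ?grh.
case: (boost_form frh) => [[p [r [pr frk key]]] | [de [de1 s01 s00]]].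
  exists (vec4 (p *: h 0%N + r *: h 1%N) (r *: h 0%N + p *: h 1%N) (h 2%N) (h 3%N)).
  split=> //; case: key => [k | [k1 k2]].
    by apply: Or31; split=> //; split=> //=; rewrite !sigE s02 s12; ring.
  by apply: Or32; split=> //; split=> //=; rewrite !sigE s02 s12; ring.
exists (vec4 (h 0%N + de *: h 1%N) (h 2%N) (2^-1 *: (- h 0%N + de *: h 1%N)) (h 3%N)).
split=> //; apply: Or33; split.
  apply: nframe_intro.
  - by split; rewrite ?metricE !grh //; lra.
  - by split; rewrite ?metricE !grh //; lra.
  by split; rewrite ?metricE !grh //; lra.
have s10 : sig (h 1%N) (h 0%N) = sig (h 0%N) (h 1%N) by rewrite sigC.
have s21 : sig (h 2%N) (h 1%N) = 0 by rewrite sigC.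
have s20 : sig (h 2%N) (h 0%N) = 0 by rewrite sigC.
split=> /=.
- rewrite !sigE s10; transitivity (sig (h 0%N) (h 0%N) + (de * de) * sig (h 1%N) (h 1%N)
    + 2 * de * sig (h 0%N) (h 1%N)); first by ring.
  by rewrite de1 mul1r s00; ring.
- by rewrite !sigE s02 s12; ring.
left; split; first by rewrite !sigE s21 s20; ring.
have -> : sig (2^-1 *: (- h 0%N + de *: h 1%N)) (2^-1 *: (- h 0%N + de *: h 1%N)) =
    - (de * sig (h 0%N) (h 1%N)).
  rewrite !sigE s10.
  transitivity ((sig (h 0%N) (h 0%N) + (de * de) * sig (h 1%N) (h 1%N)) / 4
    - (de * sig (h 0%N) (h 1%N)) / 2); first by field.
  by rewrite de1 mul1r s00; field.
rewrite oppr_eq0 mulf_neq0 //.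
by apply: contra_eq_neq de1 => ->; rewrite mulr0 eq_sym oner_eq0.
Qed.

Lemma unit_vector u : q u u != 0 -> exists c, [/\ c != 0 &
  q (c *: u) (c *: u) = 1 /\ 0 < q u u \/ q (c *: u) (c *: u) = -1 /\ q u u < 0].
Proof.
move=> u0; exists (Num.sqrt `|q u u|)^-1; split.
  by rewrite invr_eq0 sqrtr_eq0 -ltNge normr_gt0.
rewrite metricZl metricZr mulrA -invfM -expr2 sqr_sqrtr ?normr_ge0 //.
have [x1 | x1 | x1] := ltrgtP (q u u) 0; last by rewrite x1 eqxx in u0.
- by right; rewrite ltr0_norm // invrN mulNr mulVf.
by left; rewrite gtr0_norm // mulVf.
Qed.

Lemma scaled_eigenvector lam u c n :
  (forall x, q x n = 0 -> sig u x = lam * q u x) ->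
  forall x, q x n = 0 -> sig (c *: u) x = lam * q (c *: u) x.
Proof. by move=> ul x xn; rewrite sigZl ul // metricZl mulrCA. Qed.

(** An eigenvector with the norm of [f 0] is moved to index 0, and the plane left over is Euclidean,
    where a rotation diagonalises. *)
Lemma aligned_form a d f u lam : frame G id (eps4 a 1 1 d) f ->
  q u u = a -> q u (f 3%N) = 0 ->
  (forall x, q x (f 3%N) = 0 -> sig u x = lam * q u x) ->
  exists h, [/\ frame G id (eps4 a 1 1 d) h, h 3%N = f 3%N & diagonal_form h].
Proof.
move=> frm uu u3 ulam; have gr := oframe_gram frm.
have a0 : a != 0.
  case: frm => gt _; have [_ _ _ a1] := gt 0%N isT.
  by apply: contra_eq_neq a1; rewrite /eps4 /= => ->; rewrite mulr0 eq_sym oner_eq0.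
have [||h [frh hu hfix]] := @move_frame _ _ f 0%N u frm isT.
- by rewrite gr.
- by rewrite gr.
have h3 : h 3%N = f 3%N by apply: hfix; rewrite ?gr // metricC.
have grh := oframe_gram frh.
have h0lam x : q x (h 3%N) = 0 -> q (h 0%N) x = 0 -> sig (h 0%N) x = 0.
  rewrite h3 => x3; case: hu => ->; rewrite ?metricNl => ux.
    by rewrite ulam // ux mulr0.
  by rewrite sigNl ulam // -mulrN ux mulr0.
have [|| k [frk k0 k3 kd]] := rotate_form frh; first by rewrite h0lam ?grh.
  by rewrite h0lam ?grh.
by exists k; split=> //; rewrite k3.
Qed.

Lemma Riemann_normal_form f : frame G id (eps4 1 1 1 (-1)) f ->
  exists h, [/\ frame G id (eps4 1 1 1 (-1)) h, h 3%N = f 3%N & diagonal_form h].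
Proof.
move=> frm; have gr := oframe_gram frm.
have [lam [u [u0 u3 ulam]]] := form_eigenvector frm.
have upos : 0 < q u u.
  rewrite (frame_norm dim4 u u frm) /sum4 u3 mulr0 addr0 /eps4 /= !mul1r -!expr2.
  have [p0 p1 p2] := And3 (sqr_ge0 (q u (f 0%N))) (sqr_ge0 (q u (f 1%N)))
    (sqr_ge0 (q u (f 2%N))).
  rewrite lt_def !addr_ge0 // andbT; apply: contra_neq u0 => e.
  apply: (frame_ext dim4 frm) => -[|[|[|[|//]]]] _; rewrite metric0l //;
    apply: sqr_le0; lra.
have [c [c0 [[c1 _] | [_ neg]]]] := unit_vector (lt0r_neq0 upos); last first.
  by have := lt_trans upos neg; rewrite ltxx.
apply: (aligned_form frm c1); first by rewrite metricZl u3 mulr0.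
exact: scaled_eigenvector ulam.
Qed.

(** The discussion follows the causal character of one eigenvector. For a null one, [mu] is the
    eigenvalue induced on its orthogonal space modulo itself: if it differs from [lam], there is
    also a spacelike eigenvector; if not, the remaining entries decide between Jordan blocks of size
    three, of size two, and a multiple of the metric. *)
Lemma Lorentz_normal_form f : frame G id (eps4 (-1) 1 1 1) f ->
  exists h, h 3%N = f 3%N /\
    [\/ frame G id (eps4 (-1) 1 1 1) h /\ diagonal_form h,
        frame G id (eps4 (-1) 1 1 1) h /\ complex_form h |
        frame G swap02 (eps4 1 1 1 1) h /\ null_form h].
Proof.
move=> frm; have gr := oframe_gram frm.
have [lam [u [u0 u3 ulam]]] := form_eigenvector frm.
have [uu | uu] := eqVneq (q u u) 0; last first.
  have [c [c0 [[c1 _] | [c1 _]]]] := unit_vector uu.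
    apply: (spacelike_form frm c1); first by rewrite metricZl u3 mulr0.
    exact: scaled_eigenvector ulam.
  have [|| h [frh h3 hd]] := aligned_form frm c1 (lam := lam).
  - by rewrite metricZl u3 mulr0.
  - exact: scaled_eigenvector ulam.
  by exists h; split=> //; apply: Or31.
have [h [c [frh h3 c0 h0]]] := null_frame frm u0 uu u3.
have grh := nframe_gram frh.
have h0lam x : q x (h 3%N) = 0 -> sig (h 0%N) x = lam * q (h 0%N) x.
  by rewrite h3 => x3; rewrite h0; apply: (scaled_eigenvector c ulam x3).
have s00 : sig (h 0%N) (h 0%N) = 0 by rewrite h0lam ?grh ?mulr0.
have s01 : sig (h 0%N) (h 1%N) = 0 by rewrite h0lam ?grh ?mulr0.
have s02 : sig (h 0%N) (h 2%N) = lam by rewrite h0lam ?grh ?mulr1.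
pose mu := sig (h 1%N) (h 1%N).
have [mul | mul] := eqVneq mu lam; last first.
  (* [w] below is a spacelike eigenvector, of eigenvalue [mu]. *)
  rewrite -subr_eq0 in mul; pose b := sig (h 1%N) (h 2%N) / (mu - lam).
  pose w := h 1%N + b *: h 0%N.
  apply: (@spacelike_form f w mu frm).
  - by rewrite !metricE !grh; ring.
  - by rewrite -h3 !metricE !grh; ring.
  move=> x; rewrite -h3 => x3.
  rewrite (frame_expand dim4 frh x) /sum4 /swap02 /= x3 mulr0 scale0r addr0.
  rewrite !sigE !metricE !grh (sigC (h 1%N) (h 0%N)) s00 s01 s02 -/mu.
  have -> : sig (h 1%N) (h 2%N) = b * (mu - lam) by rewrite divfK.
  by ring.
have [q0 | q0] := eqVneq (sig (h 1%N) (h 2%N)) 0; last first.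
  by exists h; split=> //; apply: Or33; split=> //; split=> //; right; rewrite s02.
have [r0 | r0] := eqVneq (sig (h 2%N) (h 2%N)) 0; last first.
  by exists h; split=> //; apply: Or33; split=> //; split=> //; left.
have scalar x y : q x (f 3%N) = 0 -> q y (f 3%N) = 0 -> sig x y = lam * q x y.
  rewrite -h3 => x3 y3.
  rewrite (frame_expand dim4 frh x) (frame_expand dim4 frh y) /sum4 /swap02 /=.
  rewrite x3 y3 !mulr0 !scale0r !addr0.
  rewrite !sigE !metricE !grh (sigC (h 1%N) (h 0%N)) (sigC (h 2%N) (h 0%N)).
  by rewrite (sigC (h 2%N) (h 1%N)) s00 s01 s02 q0 r0 -/mu mul; ring.
exists f; split=> //; apply: Or31; split=> //.
by split; rewrite scalar ?gr ?mulr0.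
Qed.
End NormalForm.
End Moving.

(** * Almost Abelian normal forms *)

Section Transfer.
Variables (R : realType) (g : lieAlgebra R).
Hypothesis dim4 : \dim {:g} = 4%N.
Variable G : gen_metric g.
Local Notation q := (gm_g G).
Local Notation H := (gm_H G).
Local Notation br := (@lie_br R g).

Lemma span3P (V : vectType R) (e1 e2 e3 x : V) :
  reflect (exists a b c, x = a *: e1 + b *: e2 + c *: e3) (x \in <<[:: e1; e2; e3]>>%VS).
Proof.
apply: (iffP idP) => [|[a [b [c ->]]]]; last first.
  by rewrite !rpredD // memvZ // memv_span // !inE eqxx ?orbT.
rewrite !span_cons span_nil addv0 => /memv_addP[y /vlineP[a ->] [z + ->]].
case/memv_addP=> u /vlineP[b ->] [v /vlineP[c ->] ->].
by exists a, b, c; rewrite addrA.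
Qed.

Lemma basis4P (V : vectType R) (e1 e2 e3 X x : V) :
  basis_of fullv [:: e1; e2; e3; X] ->
  exists a b c d, x = a *: e1 + b *: e2 + c *: e3 + d *: X.
Proof.
move=> /span_basis bas; have : x \in fullv by rewrite memvf.
rewrite -bas !span_cons span_nil addv0 => /memv_addP[y /vlineP[a ->] [z + ->]].
case/memv_addP=> u /vlineP[b ->] [v + ->].
case/memv_addP=> w /vlineP[c ->] [t /vlineP[d ->] ->].
by exists a, b, c, d; rewrite !addrA.
Qed.

Lemma hyperplane_ideal e1 e2 e3 X : basis_of {:g} [:: e1; e2; e3; X] ->
  [/\ br e1 e2 = 0, br e1 e3 = 0 & br e2 e3 = 0] ->
  (forall e, e \in [:: e1; e2; e3] -> br X e \in <<[:: e1; e2; e3]>>%VS) ->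
  codim1_abelian_ideal <<[:: e1; e2; e3]>>%VS /\
  basis_of <<[:: e1; e2; e3]>>%VS [:: e1; e2; e3].
Proof.
move=> bas [b12 b13 b23] bX.
have fr : free [:: e1; e2; e3].
  exact: (@catl_free _ _ [:: X] [:: e1; e2; e3] (basis_free bas)).
have ab x y : x \in <<[:: e1; e2; e3]>>%VS -> y \in <<[:: e1; e2; e3]>>%VS ->
    br x y = 0.
  move=> /span3P[a [b [c ->]]] /span3P[a' [b' [c' ->]]].
  rewrite !brE !brxx (brC e2 e1) (brC e3 e1) (brC e3 e2) b12 b13 b23.
  by rewrite !(oppr0, scaler0, addr0).
split; last by rewrite /basis_of eqxx.
split=> //; first by rewrite dim4 (eqP fr).
move=> x y yn; have [a [b [c [d ->]]]] := basis4P x bas.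
rewrite brDl ab // ?add0r; last by apply/span3P; exists a, b, c.
case/span3P: yn => [a' [b' [c' ->]]].
by rewrite brZl !brDr !brZr memvZ // !rpredD // memvZ // bX // !inE eqxx ?orbT.
Qed.

Lemma acts_by3 (f : g -> g) e1 e2 e3 (a b c a' b' c' a'' b'' c'' : R) :
  acts_by f [:: e1; e2; e3]
    (mx_of_rows 3 3 [:: [:: a; a'; a'']; [:: b; b'; b'']; [:: c; c'; c'']]) <->
  [/\ f e1 = a *: e1 + b *: e2 + c *: e3,
      f e2 = a' *: e1 + b' *: e2 + c' *: e3 &
      f e3 = a'' *: e1 + b'' *: e2 + c'' *: e3].
Proof.
split=> [act | [f1 f2 f3] j].
  by split; [have := act 0 | have := act 1 | have := act (inord 2)];
    rewrite !big_ord_recr big_ord0 /= add0r !mxE /= ?inordK.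
rewrite !big_ord_recr big_ord0 /= add0r !mxE /=.
by case: j => [[|[|[|//]]]].
Qed.

Lemma diag_L1E (a b c : R) : diag_L1 a b c =
  mx_of_rows 3 3 [:: [:: a; - b; 0]; [:: b; a; 0]; [:: 0; 0; c]].
Proof.
apply/matrixP => i j; rewrite /diag_L1 !mxE.
case: splitP => i' ii'; rewrite !mxE; case: splitP => j' jj'; rewrite !mxE ii' jj'.
- by case: i' {ii'} => [[|[|//]]] ?; case: j' {jj'} => [[|[|//]]] ?.
- by rewrite (ord1 j') addn0 /=; case: i' {ii'} => [[|[|//]]].
- by rewrite (ord1 i') addn0 /=; case: j' {jj'} => [[|[|//]]].
by rewrite (ord1 i') (ord1 j') /= mulr1n.
Qed.

Lemma frame_vec4 s eps f : frame G s eps f ->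
  frame G s eps (vec4 (f 0%N) (f 1%N) (f 2%N) (f 3%N)).
Proof.
case=> gt gr; split=> // i j i4 j4; rewrite -gr //.
by case: i i4 => [|[|[|[|//]]]] _; case: j j4 => [|[|[|[|//]]]] _.
Qed.

Section OFrame.
Variables (a b c d : R) (e1 e2 e3 X : g).
Hypothesis frm : frame G id (eps4 a b c d) (vec4 e1 e2 e3 X).
Let n := <<[:: e1; e2; e3]>>%VS.

Lemma oframe_vec :
  [/\ [/\ q e1 e1 = a, q e2 e2 = b, q e3 e3 = c & q X X = d],
      [/\ q e1 e2 = 0, q e1 e3 = 0 & q e1 X = 0],
      [/\ q e2 e3 = 0, q e2 X = 0 & q e3 X = 0] &
      [/\ a = 1 \/ a = -1, b = 1 \/ b = -1, c = 1 \/ c = -1 & d = 1 \/ d = -1]].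
Proof.
have [gt gr] := frm.
have u i : (i < 4)%N -> eps4 a b c d i = 1 \/ eps4 a b c d i = -1.
  move=> i4; case: (gt i i4) => _ _ _ /eqP.
  by rewrite -expr2 sqrf_eq1 => /orP[] /eqP; [left | right].
split; split; do ?[exact: (gr 0%N 0%N) | exact: (gr 1%N 1%N) |
  exact: (gr 2%N 2%N) | exact: (gr 3%N 3%N) | exact: (gr 0%N 1%N) |
  exact: (gr 0%N 2%N) | exact: (gr 0%N 3%N) | exact: (gr 1%N 2%N) |
  exact: (gr 1%N 3%N) | exact: (gr 2%N 3%N)].
- exact: (u 0%N).
- exact: (u 1%N).
- exact: (u 2%N).
- exact: (u 3%N).
Qed.

Lemma oframe_orthonormal : orthonormal_basis_of G {:g} [:: e1; e2; e3; X].
Proof.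
rewrite /orthonormal_basis_of (frame_basis dim4 frm) /pseudo_orthonormal /=.
have [[-> -> -> ->] [-> -> ->] [-> -> ->] [u1 u2 u3 u4]] := oframe_vec.
rewrite !eqxx !andbT; case: u1 => ->; case: u2 => ->; case: u3 => ->;
  by case: u4 => ->; rewrite !eqxx ?orbT.
Qed.

Lemma hyperplane_orthonormal : basis_of n [:: e1; e2; e3] ->
  orthonormal_basis_of G n [:: e1; e2; e3].
Proof.
move=> bas; rewrite /orthonormal_basis_of bas /=.
case/andP: oframe_orthonormal => _; rewrite /pseudo_orthonormal /= !andbT.
by case/andP=> /and4P[-> -> -> _] /and3P[/and3P[-> -> _] /andP[-> _] _].
Qed.

Lemma hyperplane_orthov : X \in orthov q n.
Proof.
have [_ [_ _ x1] [_ x2 x3] _] := oframe_vec.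
apply/mem_orthovP => y /span3P[r [s [t ->]]].
by rewrite metricC !metricE x1 x2 x3 !mulr0 !addr0.
Qed.

Lemma hyperplane_norm r s t :
  q (r *: e1 + s *: e2 + t *: e3) (r *: e1 + s *: e2 + t *: e3) =
  a * r ^+ 2 + b * s ^+ 2 + c * t ^+ 2.
Proof.
have [[n1 n2 n3 _] [o12 o13 _] [o23 _ _] _] := oframe_vec.
rewrite !metricE (metricC _ e2 e1) (metricC _ e3 e1) (metricC _ e3 e2).
by rewrite n1 n2 n3 o12 o13 o23; ring.
Qed.

Lemma hyperplane_positive : [/\ a = 1, b = 1 & c = 1] -> positive_definite_on G n.
Proof.
case=> a1 b1 c1 x /span3P[r [s [t ->]]]; rewrite hyperplane_norm a1 b1 c1 !mul1r.
move=> x0; rewrite lt_def !addr_ge0 ?sqr_ge0 // andbT; apply: contra_neq x0.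
have := sqr_ge0 r; have := sqr_ge0 s; have := sqr_ge0 t => t2 s2 r2 sum0.
have [r0 s0 t0] : [/\ r = 0, s = 0 & t = 0] by split; apply: sqr_le0; lra.
by rewrite r0 s0 t0 !scale0r !addr0.
Qed.

Lemma hyperplane_Lorentzian : basis_of n [:: e1; e2; e3] ->
  [/\ a = -1, b = 1 & c = 1] -> Lorentzian_on G n.
Proof.
move=> bas [a1 b1 c1]; exists [:: e1; e2; e3].
have dimn : \dim n = 3%N by rewrite -(size_basis (X := [tuple e1; e2; e3]) bas).
have [[n1 n2 n3 _] _ _ _] := oframe_vec.
have N1 : (-1 == 1 :> R) = false by apply/negbTE; rewrite lt_eqF // (@lt_trans _ _ 0) ?ltrN10.
split; first exact: hyperplane_orthonormal.
  by rewrite /= dimn n1 n2 n3 a1 b1 c1 eqxx N1.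
by rewrite /= n1 n2 n3 a1 b1 c1 eqxx eq_sym N1.
Qed.

Lemma unit_normal_adP M : basis_of n [:: e1; e2; e3] ->
  acts_by (br X) [:: e1; e2; e3] M -> unit_normal_ad G n [:: e1; e2; e3] M.
Proof.
move=> bas act; have [[_ _ _ XX] _ _ [_ _ _ d1]] := oframe_vec.
exists X; split=> //; first exact: hyperplane_orthov.
  by rewrite XX.
exact: hyperplane_orthonormal.
Qed.

End OFrame.

Hypothesis H0 : forall x y z, H x y z = 0.

Lemma hyperplane_ideal3 e1 e2 e3 X M : basis_of {:g} [:: e1; e2; e3; X] ->
  [/\ br e1 e2 = 0, br e1 e3 = 0 & br e2 e3 = 0] ->
  acts_by (br X) [:: e1; e2; e3] (M : 'M_3) ->
  codim1_abelian_ideal <<[:: e1; e2; e3]>>%VS /\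
  basis_of <<[:: e1; e2; e3]>>%VS [:: e1; e2; e3].
Proof.
move=> bas ab act; apply: hyperplane_ideal bas ab _ => e en.
have je : (index e [:: e1; e2; e3] < 3)%N by rewrite -[3%N]/(size [:: e1; e2; e3]) index_mem.
rewrite -(nth_index 0 en) -[index _ _]/(val (Ordinal je)) act memv_suml // => i _.
by rewrite memvZ // memv_span // mem_nth.
Qed.

Section Cases.
Variables (a d : R) (e1 e2 e3 X : g).
Hypothesis frm : frame G id (eps4 a 1 1 d) (vec4 e1 e2 e3 X).
Hypothesis ab : [/\ br e1 e2 = 0, br e1 e3 = 0 & br e2 e3 = 0].

Lemma case_A1_intro (s : R) : a = 1 ->
  [/\ br X e1 = s *: e2, br X e2 = - s *: e1 & br X e3 = 0] -> case_A G.
Proof.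
move=> a1 [x1 x2 x3].
have act : acts_by (br X) [:: e1; e2; e3] (diag_L1 0 s 0).
  by rewrite diag_L1E; apply/acts_by3; rewrite x1 x2 x3 !scale0r !(addr0, add0r).
have [ideal bas] := hyperplane_ideal3 (frame_basis dim4 frm) ab act.
split=> //; first by exists <<[:: e1; e2; e3]>>%VS.
exists <<[:: e1; e2; e3]>>%VS; split=> //; apply: Or41; split.
  exact: (hyperplane_positive frm).
by exists e1, e2, e3, s; exact: (unit_normal_adP frm bas act).
Qed.

Lemma case_A2_intro (s : R) : a = -1 -> s != 0 ->
  [/\ br X e1 = (-1 + s) *: e3, br X e2 = (1 + s) *: e3 &
      br X e3 = (-1 + s) *: e1 + (-1 - s) *: e2] -> case_A G.
Proof.
move=> a1 s0 [x1 x2 x3].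
have act : acts_by (br X) [:: e1; e2; e3] (M3 s).
  by apply/acts_by3; rewrite x1 x2 x3 !scale0r !(addr0, add0r).
have [ideal bas] := hyperplane_ideal3 (frame_basis dim4 frm) ab act.
split=> //; first by exists <<[:: e1; e2; e3]>>%VS.
exists <<[:: e1; e2; e3]>>%VS; split=> //; apply: Or42; split.
  exact: (hyperplane_Lorentzian frm bas).
exists e1, e2, e3, s; split=> //; first by have [[-> _ _ _] _ _ _] := oframe_vec frm.
exact: (unit_normal_adP frm bas act).
Qed.

Lemma case_A3_intro (al be c : R) : a = -1 -> (al, c) != (0, 0) -> 0 <= be ->
  be ^+ 2 = al ^+ 2 + c ^+ 2 / 2 ->
  [/\ br X e1 = al *: e1 + be *: e2, br X e2 = - be *: e1 + al *: e2 &
      br X e3 = c *: e3] -> case_A G.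
Proof.
move=> a1 ac0 be0 beE [x1 x2 x3].
have act : acts_by (br X) [:: e1; e2; e3]
    (diag_L1 al (Num.sqrt (al ^+ 2 + c ^+ 2 / 2)) c).
  rewrite -beE sqrtr_sqr ger0_norm // diag_L1E.
  by apply/acts_by3; rewrite x1 x2 x3 !scale0r !(addr0, add0r).
have [ideal bas] := hyperplane_ideal3 (frame_basis dim4 frm) ab act.
split=> //; first by exists <<[:: e1; e2; e3]>>%VS.
exists <<[:: e1; e2; e3]>>%VS; split=> //; apply: Or43; split.
  exact: (hyperplane_Lorentzian frm bas).
exists e1, e2, e3, al, c; split=> //; first by have [[-> _ _ _] _ _ _] := oframe_vec frm.
exact: (unit_normal_adP frm bas act).
Qed.
End Cases.

(* The null hyperplane <e1, e2, e3> has normal e3. *)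
Lemma case_A4_intro e1 e2 e3 X (s b1 b2 : R) :
  frame G swap02 (eps4 1 1 1 1) (vec4 e3 e1 X e2) ->
  [/\ br e1 e2 = 0, br e1 e3 = 0 & br e2 e3 = 0] ->
  s != 0 \/ [/\ s = 0, b1 = 0 & b2 = 0] ->
  [/\ br X e1 = s *: e2 + b1 *: e3, br X e2 = - s *: e1 + b2 *: e3 & br X e3 = 0] ->
  case_A G.
Proof.
move=> frm ab s0 [x1 x2 x3].
have act : acts_by (br X) [:: e1; e2; e3] (A4mx s b1 b2).
  by apply/acts_by3; rewrite x1 x2 x3 !scale0r !(addr0, add0r).
have bas4 : basis_of {:g} [:: e1; e2; e3; X].
  rewrite (perm_basis (Y := [:: e3; e1; X; e2])) ?(frame_basis dim4 frm) //.
  apply/permP => P /=; rewrite !addn0; ring.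
have [ideal bas] := hyperplane_ideal3 bas4 ab act.
have [_ gr] := frm.
have [[n1 n2 n3] [n4 n5 n6] [n7 n8] [n9 n10]] : [/\
   [/\ q e1 e1 = 1, q e2 e2 = 1 & q e3 X = 1],
   [/\ q e1 e2 = 0, q e3 e1 = 0 & q e1 X = 0],
   q e3 e2 = 0 /\ q X e2 = 0 & q e3 e3 = 0 /\ q X X = 0].
  split; split; [exact: (gr 1%N 1%N) | exact: (gr 3%N 3%N) | exact: (gr 0%N 2%N)
   | exact: (gr 1%N 3%N) | exact: (gr 0%N 1%N) | exact: (gr 1%N 2%N) |
   exact: (gr 0%N 3%N) | exact: (gr 2%N 3%N) | exact: (gr 0%N 0%N) |
   exact: (gr 2%N 2%N)].
have e3n : e3 \in <<[:: e1; e2; e3]>>%VS by rewrite memv_span // !inE eqxx ?orbT.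
split=> //; first by exists <<[:: e1; e2; e3]>>%VS.
exists <<[:: e1; e2; e3]>>%VS; split=> //; apply: Or44; split.
  move/nondegenerateP/(_ e3 e3n) => e30.
  have := n3; rewrite e30 ?metric0l; first by move/eqP; rewrite eq_sym oner_eq0.
  move=> y /span3P[u [v [w ->]]]; rewrite !metricE n5 n7 n9.
  by rewrite !mulr0 !addr0.
exists e1, e2, e3, X; split=> //; first by rewrite (metricC _ e1 e3) (metricC _ e2 e3) (metricC _ e2 X).
by exists s, b1, b2.
Qed.
End Transfer.

(** * The derived algebra *)

Section Forward.
Variables (R : realType) (g : lieAlgebra R).
Hypothesis dim4 : \dim {:g} = 4%N.
Variable G : gen_metric g.
Local Notation q := (gm_g G).
Local Notation H := (gm_H G).
Local Notation br := (@lie_br R g).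
Local Notation D := (derived g).

Lemma bracket_expand s eps f i j : frame G s eps f ->
  br (f i) (f j) = sum4 (fun k => (eps k * brc G f i j (s k)) *: f k).
Proof. by move=> frm; rewrite {1}(frame_expand dim4 frm (br (f i) (f j))). Qed.

Lemma form_expand s eps f x y z : frame G s eps f -> H x y z =
  sum4 (fun i => eps i * q x (f (s i)) * sum4 (fun j => eps j * q y (f (s j)) *
  sum4 (fun k => eps k * q z (f (s k)) * Hc G f i j k))).
Proof.
move=> frm; rewrite {1}(frame_expand dim4 frm x) /sum4 !form3Dl !form3Zl.
by do 3?congr (_ + _); congr (_ * _);
  rewrite {1}(frame_expand dim4 frm y) /sum4 !form3Dm !form3Zm;
  do 3?congr (_ + _); congr (_ * _);
  rewrite {1}(frame_expand dim4 frm z) /sum4 !form3Dr !form3Zr.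
Qed.

Lemma form_eq0 s eps f : frame G s eps f ->
  [/\ Hc G f 0%N 1%N 2%N = 0, Hc G f 3%N 0%N 1%N = 0, Hc G f 3%N 1%N 2%N = 0 &
      Hc G f 3%N 2%N 0%N = 0] -> forall x y z, H x y z = 0.
Proof.
move=> frm [h012 h301 h312 h320] x y z; rewrite (form_expand _ _ _ frm).
have Hc0 i j k : (i < 4)%N -> (j < 4)%N -> (k < 4)%N -> Hc G f i j k = 0.
  move=> i4 j4 k4; rewrite (alt3E (Hc12 G f) (Hc23 G f)) //.
  by case: i {i4} => [|[|[|[|?]]]] //; case: j {j4} => [|[|[|[|?]]]] //;
    case: k {k4} => [|[|[|[|?]]]] //=; rewrite ?(h012, h301, h312, h320, oppr0).
by rewrite /sum4 !Hc0 // !(mulr0, addr0).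
Qed.

Lemma frame_br_eq0 s eps f : frame G s eps f ->
  (forall i j, (i < 4)%N -> (j < 4)%N -> br (f i) (f j) = 0) ->
  forall x y, br x y = 0.
Proof.
move=> frm f0 x y; rewrite (frame_expand dim4 frm x) (frame_expand dim4 frm y).
by rewrite /sum4 !brE !f0 // !(scaler0, addr0).
Qed.

Hypothesis ndD : nondegenerate_on G D.

Lemma derived_eq0 u : u \in D -> (forall x y, q (br x y) u = 0) -> u = 0.
Proof.
move=> uD u0; move/nondegenerateP: ndD; apply=> // y yD.
have : (D <= orthov q <[u]>)%VS.
  apply/span_subvP => z /allpairsP[[v w] [_ _ ->]] /=.
  by rewrite mem_orthov1 u0.
by move/subvP/(_ y yD); rewrite mem_orthov1 metricC => /eqP.
Qed.

Lemma derived_spanning s eps f k : frame G s eps f -> (k <= 4)%N ->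
  (forall i, (i < k)%N -> f i \in D) -> spanning k (brc G f).
Proof.
move=> frm k4 fD t t0 l lk; pose u := \sum_(i < k) t i *: f i.
have uf i j : (i < 4)%N -> (j < 4)%N -> q (br (f i) (f j)) u = 0.
  move=> i4 j4; rewrite /u metric_sumr -[RHS](t0 i j i4 j4).
  by apply: eq_bigr => m _; rewrite metricZr.
have u0 : u = 0.
  apply: derived_eq0; first by apply: memv_suml => i _; rewrite memvZ ?fD.
  move=> x y; rewrite (frame_expand dim4 frm x) (frame_expand dim4 frm y).
  by rewrite /sum4 !brE !metricE !uf // !(mulr0, addr0).
have l4 : (l < 4)%N by apply: leq_trans k4.
have := congr1 (fun x => q x (eps l *: f (s l))) u0; rewrite metric0l.
rewrite metric_suml (bigD1 (Ordinal lk)) //= metricZl (frame_dual frm) // eqxx.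
rewrite mulr1 big1 ?addr0 // => i il; rewrite metricZl (frame_dual frm) //.
  by rewrite (_ : (i : nat) == l = false) ?mulr0 //; apply/negbTE.
exact: leq_trans (ltn_ord i) k4.
Qed.

Lemma spans_orthogonal k f m : spans G k f D -> (k <= m < 4)%N ->
  forall x y, q (br x y) (f m) = 0.
Proof. by move=> fD km x y; apply: (fD _).1 => //; apply: mem_derived. Qed.

Lemma eq_spans k f h : (forall i, (k <= i < 4)%N -> h i = f i) ->
  spans G k f D -> spans G k h D.
Proof.
move=> hf fD x; rewrite fD.
by split=> x0 i ik; [rewrite hf | rewrite -hf]; rewrite ?x0.
Qed.

Lemma spans_mem k eps f i : frame G id eps f -> spans G k f D ->
  (i < k)%N -> (k <= 4)%N -> f i \in D.
Proof.
move=> [_ gr] fD ik k4; apply/fD => j /andP[kj j4].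
by rewrite gr ?(leq_trans ik) // gtn_eqF // (leq_trans ik).
Qed.

Lemma adapted_spanning k eps f : frame G id eps f -> spans G k f D ->
  (k <= 4)%N -> spanning k (brc G f).
Proof.
by move=> frm fD k4; apply: (derived_spanning frm) => // i ik; apply: spans_mem frm fD ik k4.
Qed.

Lemma derived_abelian eps f k : frame G id eps f -> spans G k f D ->
  (0 < k <= 4)%N -> (forall x y, br x y = 0) -> False.
Proof.
move=> frm fD /andP[k0 k4] ab; have f0D := spans_mem frm fD k0 k4.
have f0 : f 0%N = 0 by apply: derived_eq0 => // x y; rewrite ab metric0l.
have := frame_dual frm (i := 0%N) (j := 0%N) isT isT.
by rewrite f0 metric0l => /eqP; rewrite eq_sym oner_eq0.
Qed.

(* The trace of ad vanishes on brackets, hence on the derived algebra. *)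
Lemma trace_ad_eq0 k eps f m : frame G id eps f -> spans G k f D -> (k <= 4)%N ->
  (m < k)%N -> sum4 (fun l => eps l * brc G f m l l) = 0.
Proof.
move=> frm fD k4 mk; pose T m := sum4 (fun l => eps l * brc G f m l l).
have L0 i j l : (k <= l < 4)%N -> brc G f i j l = 0.
  by move=> kl; apply: spans_orthogonal fD kl _ _.
(* The trace of the adjoint of a bracket, as a contraction of the Jacobi identity. *)
have TL i j : (i < 4)%N -> (j < 4)%N -> sum4 (fun n => eps n * brc G f i j n * T n) = 0.
  move=> i4 j4.
  have J l : (l < 4)%N -> jac id eps (brc G f) i j l l = 0.
    by move=> l4; apply: (jacobiE dim4 frm).
  have : sum4 (fun l => eps l * jac id eps (brc G f) i j l l) = 0.
    by rewrite /sum4 !J // !mulr0 !addr0.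
  have Lii n l : brc G f n n l = 0 by rewrite /brc brxx metric0l.
  have LC := brcC G f; rewrite /jac /T /sum4 ![brc G f _ i _](LC _ i).
  rewrite !(LC 1%N 0%N) !(LC 2%N 0%N) !(LC 2%N 1%N) !(LC 3%N 0%N) !(LC 3%N 1%N).
  rewrite !(LC 3%N 2%N) !Lii => e; apply: oppr_inj; rewrite oppr0 -[RHS]e; ring.
have Ti : eps m * T m = 0.
  apply: (adapted_spanning frm fD k4 (t := fun l => eps l * T l)) mk => i j i4 j4.
  rewrite -[RHS](TL i j i4 j4) -(big_ord4 (fun n => eps n * brc G f i j n * T n)).
  rewrite (big_ord_widen 4 (fun n => eps n * T n * brc G f i j n)) //.
  rewrite big_mkcond; apply: eq_bigr => l _ /=; case: ifP => lk; first by rewrite mulrAC.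
  by rewrite L0 ?mulr0 ?mul0r // ltn_ord andbT leqNgt lk.
have [gt _] := frm; have [_ _ _ e1] := gt m (leq_trans mk k4).
by rewrite -/(T m) -[LHS]mul1r -e1 -mulrA Ti mulr0.
Qed.

Lemma derived_proper : Lorentzian G -> (\dim D < 4)%N.
Proof.
move=> lorG; have D4 : (\dim D <= 4)%N by rewrite -dim4 dimvS ?subvf.
rewrite ltn_neqAle D4 andbT; apply/eqP => dimD.
have [f [fD [[frm _] | [_ //]]]] := adapted_frame dim4 lorG ndD; last by rewrite dimD ltnn.
rewrite dimD in fD.
have [|| t [[k k4 tk] t0]] := @perfect_dim4 _ (brc G f) (brcC G f).
- by move=> i j k l i4 j4 k4 l4; apply: (jacobiE dim4 frm).
- by move=> i i4; apply: trace_ad_eq0 frm fD _ _.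
case/negP: tk; apply/eqP; apply: (adapted_spanning frm fD) => // i j i4 j4.
by rewrite (big_ord4 (fun k => t k * brc G f i j k)) t0.
Qed.

End Forward.

(** * Derived algebras of dimension at most two *)

Section LowDimension.
Variables (R : realType) (g : lieAlgebra R).
Hypothesis dim4 : \dim {:g} = 4%N.
Variable G : gen_metric g.
Local Notation q := (gm_g G).
Local Notation H := (gm_H G).
Local Notation br := (@lie_br R g).
Local Notation D := (derived g).
Hypothesis ndD : nondegenerate_on G D.
Hypothesis Ein : gen_Einstein G 0.

(** With no brackets the curvature equations are quadratic in [H] alone; the frame is transposed to
    bring its timelike vector to index 0, and the result is (A1) with zero action. *)
Lemma derived_zero f : frame G id (eps4 1 1 1 (-1)) f -> spans G 0 f D -> case_A G.
Proof.
move=> frm fD.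
have ab x y : br x y = 0.
  by apply: (frame_ext dim4 frm) => i i4; rewrite metric0l; apply: spans_orthogonal fD _ _ _.
have frm' : frame G id (eps4 (-1) 1 1 1) (fun i => f (transpose 0 3 i)).
  by apply: eq_frame (transpose_frame (a := 0%N) (b := 3%N) isT isT frm) => -[|[|[|[|]]]].
have sys := frame_system dim4 frm' Ein.
have [|h312 h320 h301 h012] := abelian_no_form sys.
  by move=> i j k; rewrite /brc ab metric0l.
have H0 : forall x y z, H x y z = 0.
  apply: (form_eq0 dim4 frm'); split=> //; apply: oppr_inj; by rewrite oppr0.
apply: (@case_A1_intro _ _ dim4 _ H0 _ _ _ _ _ _ (frame_vec4 frm) _ 0) => //.
by rewrite !ab oppr0 !scale0r.
Qed.

Lemma derived_line eps f : frame G id eps f -> spans G 1 f D ->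
  eps =1 eps4 (-1) 1 1 1 \/ eps =1 eps4 1 1 1 (-1) -> False.
Proof.
move=> frm fD epsE.
have L0 m : (1 <= m < 4)%N -> forall i j, brc G f i j m = 0.
  by move=> m14 i j; apply: spans_orthogonal fD m14 _ _.
have LC := brcC G f.
have sp := adapted_spanning dim4 ndD frm fD isT.
have key : [/\ brc G f 1%N 0%N 0%N = 0, brc G f 2%N 0%N 0%N = 0 & brc G f 3%N 0%N 0%N = 0] /\
  [/\ brc G f 2%N 3%N 0%N = 0, brc G f 3%N 1%N 0%N = 0 & brc G f 1%N 2%N 0%N = 0].
  have sys' eps' : eps =1 eps' -> einstein_system id eps' (brc G f) (Hc G f).
    by move=> e; apply: (frame_system dim4 _ Ein); apply: eq_frame frm => i _.
  case: epsE => /sys' sys''.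
    exact: (line_timelike sys'' (L0 1%N isT) (L0 2%N isT) (L0 3%N isT)
      (LC 0%N 1%N) (LC 3%N 2%N)).
  exact: (line_spacelike sys'' (L0 1%N isT) (L0 2%N isT) (L0 3%N isT)
      (LC 0%N 1%N) (LC 3%N 2%N)).
have [[l10 l20 l30] [l23 l31 l12]] := key.
have : (fun=> 1 : R) 0%N = 0.
  apply: (@spanning_pairs _ 1 (brc G f) (fun=> 1) LC sp _ 0%N isT).
  rewrite /= !big_ord1 !mul1r (LC 0%N 1%N) (LC 3%N 2%N).
  by rewrite l10 l20 l30 l23 l31 l12 oppr0.
by move/eqP; rewrite oner_eq0.
Qed.

Section Plane.
Variables (eps : nat -> R) (f : nat -> g).
Hypotheses (frm : frame G id eps f) (fD : spans G 2 f D).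

Lemma plane_br2 i j : brc G f i j 2%N = 0.
Proof. exact: (spans_orthogonal fD (m := 2)). Qed.

Lemma plane_br3 i j : brc G f i j 3%N = 0.
Proof. exact: (spans_orthogonal fD (m := 3)). Qed.

Lemma plane_brE i j : br (f i) (f j) =
  (eps 0%N * brc G f i j 0%N) *: f 0%N + (eps 1%N * brc G f i j 1%N) *: f 1%N.
Proof.
rewrite (bracket_expand dim4 i j frm) /sum4.
by rewrite plane_br2 plane_br3 !mulr0 !scale0r !addr0.
Qed.

Lemma plane_abelian : br (f 0%N) (f 1%N) = 0.
Proof.
have Lii n l : brc G f n n l = 0 by rewrite /brc brxx metric0l.
have T0 := trace_ad_eq0 dim4 ndD frm fD isT (isT : 0 < 2)%N.
have T1 := trace_ad_eq0 dim4 ndD frm fD isT (isT : 1 < 2)%N.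
rewrite /sum4 !plane_br2 !plane_br3 !Lii in T0 T1.
rewrite !mulr0 !(add0r, addr0) in T0 T1.
by rewrite plane_brE T0 brcC mulrN T1 oppr0 !scale0r addr0.
Qed.

Lemma plane_br01 k : brc G f 0%N 1%N k = 0.
Proof. by rewrite /brc plane_abelian metric0l. Qed.
End Plane.

(* The parameter of M_3 is fixed by P^2 - Q^2 = 1 for e1 = P T + Q e and
   e2 = Q T + P e, where ad_X e1 and ad_X e2 are proportional to e3. *)
Lemma case_A_rotation T e e' X r : (forall x y z, H x y z = 0) ->
  frame G id (eps4 (-1) 1 1 1) (vec4 T e e' X) -> r != 0 ->
  [/\ br T e = 0, br T e' = 0 & br e e' = 0] ->
  [/\ br X T = 0, br X e = r *: e' & br X e' = - r *: e] -> case_A G.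
Proof.
move=> H0 frm r0 [b1 b2 b3] [x1 x2 x3].
pose s := r ^+ 2 / 4; pose P := (1 + s) / r; pose Q := (s - 1) / r.
have PQ : P ^+ 2 - Q ^+ 2 = 1 by rewrite /P /Q /s; field.
have Pr : P * r = 1 + s by rewrite /P divfK.
have Qr : Q * r = s - 1 by rewrite /Q divfK.
have gr := oframe_vec frm.
case: gr => [[n1 n2 n3 n4] [o12 o13 o14] [o23 o24 o34] _].
have frm' : frame G id (eps4 (-1) 1 1 1) (vec4 (P *: T + Q *: e) (Q *: T + P *: e) e' X).
  apply: oframe_intro; first by rewrite mulrNN mulr1.
  - by split=> //; rewrite !metricE (metricC _ e T) n1 n2 o12; lra.
  - by split; rewrite !metricE ?(metricC _ e T) ?n1 ?n2 ?o12 ?o13 ?o14 ?o23 ?o24; ring.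
  by split; rewrite ?metricE ?o13 ?o14 ?o23 ?o24 ?o34; ring.
apply: (@case_A2_intro _ _ dim4 _ H0 _ _ _ _ _ _ frm' _ s) => //.
- split; rewrite !brE ?brxx ?(brC e T) ?b1 ?b2 ?b3;
    by rewrite !(oppr0, scaler0, addr0, add0r).
- by rewrite mulf_neq0 // ?invr_eq0 ?pnatr_eq0 // expf_neq0.
split.
- by rewrite !brE x1 x2 scaler0 add0r scalerA Qr addrC.
- by rewrite !brE x1 x2 scaler0 add0r scalerA Pr.
rewrite x3 !scalerDr !scalerA addrACA -!scalerDl.
have -> : (-1 + s) * P + (-1 - s) * Q = 0.
  have -> : -1 + s = Q * r by rewrite Qr; ring.
  have -> : -1 - s = - (P * r) by rewrite Pr; ring.
  by ring.
have -> : (-1 + s) * Q + (-1 - s) * P = - r * (P ^+ 2 - Q ^+ 2).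
  have -> : -1 + s = Q * r by rewrite Qr; ring.
  have -> : -1 - s = - (P * r) by rewrite Pr; ring.
  by ring.
by rewrite PQ mulr1 scale0r add0r.
Qed.

(** The companion for a spacelike kernel vector [e]: the same normalisation now gives a negative
    parameter of [M3]. Thus the sign of the parameter records whether the action is a boost or a
    rotation. *)
Lemma case_A_boost T e e' X r : (forall x y z, H x y z = 0) ->
  frame G id (eps4 (-1) 1 1 1) (vec4 T e e' X) -> r != 0 ->
  [/\ br T e = 0, br T e' = 0 & br e e' = 0] ->
  [/\ br X T = r *: e', br X e = 0 & br X e' = r *: T] -> case_A G.
Proof.
move=> H0 frm r0 [b1 b2 b3] [x1 x2 x3].
pose s := - (r ^+ 2 / 4); pose P := (s - 1) / r; pose Q := (1 + s) / r.
have PQ : P ^+ 2 - Q ^+ 2 = 1 by rewrite /P /Q /s; field.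
have Pr : P * r = s - 1 by rewrite /P divfK.
have Qr : Q * r = 1 + s by rewrite /Q divfK.
have gr := oframe_vec frm.
case: gr => [[n1 n2 n3 n4] [o12 o13 o14] [o23 o24 o34] _].
have frm' : frame G id (eps4 (-1) 1 1 1) (vec4 (P *: T + Q *: e) (Q *: T + P *: e) e' X).
  apply: oframe_intro; first by rewrite mulrNN mulr1.
  - by split=> //; rewrite !metricE (metricC _ e T) n1 n2 o12; lra.
  - by split; rewrite !metricE ?(metricC _ e T) ?n1 ?n2 ?o12 ?o13 ?o14 ?o23 ?o24; ring.
  by split; rewrite ?metricE ?o13 ?o14 ?o23 ?o24 ?o34; ring.
apply: (@case_A2_intro _ _ dim4 _ H0 _ _ _ _ _ _ frm' _ s) => //.
- split; rewrite !brE ?brxx ?(brC e T) ?b1 ?b2 ?b3;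
    by rewrite !(oppr0, scaler0, addr0, add0r).
- by rewrite oppr_eq0 mulf_neq0 // ?invr_eq0 ?pnatr_eq0 // expf_neq0.
split.
- by rewrite !brE x1 x2 scaler0 addr0 scalerA Pr addrC.
- by rewrite !brE x1 x2 scaler0 addr0 scalerA Qr.
rewrite x3 !scalerDr !scalerA addrACA -!scalerDl.
have -> : (-1 + s) * P + (-1 - s) * Q = r * (P ^+ 2 - Q ^+ 2).
  have -> : -1 + s = P * r by rewrite Pr; ring.
  have -> : -1 - s = - (Q * r) by rewrite Qr; ring.
  by ring.
have -> : (-1 + s) * Q + (-1 - s) * P = 0.
  have -> : -1 + s = P * r by rewrite Pr; ring.
  have -> : -1 - s = - (Q * r) by rewrite Qr; ring.
  by ring.
by rewrite PQ mulr1 scale0r addr0.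
Qed.

(** Both normal vectors act by multiples [m2], [m3] of one rotation, so [m3 *: f 2 - m2 *: f 3] acts
    trivially and together with g' spans the Abelian ideal. Its norm is [m3 ^+ 2 - m2 ^+ 2]:
    spacelike gives (A1), timelike (A2), null (A4). *)
Lemma derived_plane_Riemann f : frame G id (eps4 1 1 1 (-1)) f ->
  spans G 2 f D -> case_A G.
Proof.
move=> frm fD; have [c H4 p s] := plane_Riemann (frame_system dim4 frm Ein)
  (plane_br2 fD) (plane_br3 fD) (plane_br01 frm fD)
  (fun k => brcC G f 1%N 2%N k).
have H0 : forall x y z, H x y z = 0.
  by case: H4 => *; apply: (form_eq0 dim4 frm).
have b01 := plane_abelian frm fD.
have bE := plane_brE frm fD.
set m2 := brc G f 2%N 0%N 1%N in p; set m3 := brc G f 3%N 0%N 1%N in s.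
case: c p s => c0 c1 [p0 p1 p2] [s0 s1 s2].
have b32 : br (f 3%N) (f 2%N) = 0 by rewrite bE c0 c1 !mulr0 !scale0r addr0.
have b20 : br (f 2%N) (f 0%N) = m2 *: f 1%N.
  by rewrite bE p0 -/m2 /eps4 /= mulr0 scale0r add0r mul1r.
have b21 : br (f 2%N) (f 1%N) = - m2 *: f 0%N.
  by rewrite bE p1 p2 /eps4 /= mulr0 scale0r addr0 mul1r.
have b30 : br (f 3%N) (f 0%N) = m3 *: f 1%N.
  by rewrite bE s0 -/m3 /eps4 /= mulr0 scale0r add0r mul1r.
have b31 : br (f 3%N) (f 1%N) = - m3 *: f 0%N.
  by rewrite bE s1 s2 /eps4 /= mulr0 scale0r addr0 mul1r.
have b23 : br (f 2%N) (f 3%N) = 0 by rewrite brC b32 oppr0.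
have gr := oframe_gram frm.
have kerE x y : [/\ br (x *: f 2%N + y *: f 3%N) (f 0%N) = (x * m2 + y * m3) *: f 1%N,
    br (x *: f 2%N + y *: f 3%N) (f 1%N) = - (x * m2 + y * m3) *: f 0%N &
    forall x' y', br (x *: f 2%N + y *: f 3%N) (x' *: f 2%N + y' *: f 3%N) = 0].
  split; rewrite ?brE ?b20 ?b30 ?b21 ?b31 ?scalerA ?scalerDl ?mulrN ?opprD ?scalerDl //.
  by move=> x' y'; rewrite !brE !brxx b23 b32 !(scaler0, addr0).
have m0 : (m2 != 0) || (m3 != 0).
  rewrite -negb_and; apply/negP => /andP[/eqP m20 /eqP m30].
  apply: (derived_abelian ndD frm fD isT); apply: (frame_br_eq0 dim4 frm) => i j i4 j4.
  have b10 : br (f 1%N) (f 0%N) = 0 by rewrite brC b01 oppr0.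
  have z0 i' : (i' < 4)%N -> br (f i') (f 0%N) = 0.
    case: i' => [|[|[|[|//]]]] _; rewrite ?brxx ?b10 ?b20 ?b30 ?m20 ?m30 ?scale0r //.
  have z1 i' : (i' < 4)%N -> br (f i') (f 1%N) = 0.
    case: i' => [|[|[|[|//]]]] _; rewrite ?brxx ?b01 ?b21 ?b31 ?m20 ?m30 ?oppr0 ?scale0r //.
  case: j j4 => [|[|j]] j4; [exact: z0 | exact: z1 |].
  case: i i4 => [|[|i]] i4; [by rewrite brC z0 ?oppr0 | by rewrite brC z1 ?oppr0 |].
  by case: i i4 => [|[|//]] _; case: j j4 => [|[|//]] _; rewrite ?brxx ?b23 ?b32.
have ker c : [/\ br (f 0%N) ((m3 / c) *: f 2%N + (- m2 / c) *: f 3%N) = 0,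
    br (f 1%N) ((m3 / c) *: f 2%N + (- m2 / c) *: f 3%N) = 0 &
    forall c', br ((m2 / c') *: f 2%N + (- m3 / c') *: f 3%N)
      ((m3 / c) *: f 2%N + (- m2 / c) *: f 3%N) = 0].
  have [k0 k1 k2] := kerE (m3 / c) (- m2 / c).
  have e0 : m3 / c * m2 + - m2 / c * m3 = 0 by ring.
  split; first by rewrite brC k0 e0 scale0r oppr0.
    by rewrite brC k1 e0 oppr0 scale0r oppr0.
  by move=> c'; have [_ _ ->] := kerE (m2 / c') (- m3 / c').
have [lt | lt | e] := ltrgtP (m2 ^+ 2) (m3 ^+ 2).
- pose r := Num.sqrt (m3 ^+ 2 - m2 ^+ 2).
  have r2 : r ^+ 2 = m3 ^+ 2 - m2 ^+ 2 by rewrite sqr_sqrtr // subr_ge0 ltW.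
  have r0 : r != 0 by rewrite sqrtr_eq0 -ltNge subr_gt0.
  have e1 : (m3 ^+ 2 - m2 ^+ 2) / r ^+ 2 = 1 by rewrite -r2 divff // expf_neq0.
  have [k0 k1 k2] := ker r.
  have [x0 x1 _] := kerE (m2 / r) (- m3 / r).
  have frm' : frame G id (eps4 1 1 1 (-1)) (vec4 (f 0%N) (f 1%N)
      ((m3 / r) *: f 2%N + (- m2 / r) *: f 3%N) ((m2 / r) *: f 2%N + (- m3 / r) *: f 3%N)).
    apply: oframe_intro; first by rewrite mulrNN mulr1.
    + split; rewrite ?metricE !gr //.
        by apply: (eq_trans _ e1); field.
      by apply: (eq_trans _ (congr1 -%R e1)); field.
    + by split; rewrite ?metricE !gr; ring.
    by split; rewrite ?metricE !gr; ring.
  by apply: (@case_A1_intro _ _ dim4 _ H0 _ _ _ _ _ _ frm' _ (m2 / r * m2 + - m3 / r * m3)).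
- pose r := Num.sqrt (m2 ^+ 2 - m3 ^+ 2).
  have r2 : r ^+ 2 = m2 ^+ 2 - m3 ^+ 2 by rewrite sqr_sqrtr // subr_ge0 ltW.
  have r0 : r != 0 by rewrite sqrtr_eq0 -ltNge subr_gt0.
  have e1 : (m2 ^+ 2 - m3 ^+ 2) / r ^+ 2 = 1 by rewrite -r2 divff // expf_neq0.
  have [k0 k1 k2] := ker r.
  have [x0 x1 _] := kerE (m2 / r) (- m3 / r).
  have frm' : frame G id (eps4 (-1) 1 1 1) (vec4
      ((m3 / r) *: f 2%N + (- m2 / r) *: f 3%N) (f 0%N) (f 1%N)
      ((m2 / r) *: f 2%N + (- m3 / r) *: f 3%N)).
    apply: oframe_intro; first by rewrite mulrNN mulr1.
    + split; rewrite ?metricE !gr //.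
        by apply: (eq_trans _ (congr1 -%R e1)); field.
      by apply: (eq_trans _ e1); field.
    + by split; rewrite ?metricE !gr; ring.
    by split; rewrite ?metricE !gr; ring.
  apply: (case_A_rotation H0 frm' r0).
    by split=> //; rewrite brC ?k0 ?k1 oppr0.
  have e : m2 / r * m2 + - m3 / r * m3 = r.
    apply: (mulIf r0); rewrite -[RHS]expr2 r2; field; exact: r0.
  by split=> //; rewrite ?x0 ?x1 e.
have m30 : m3 != 0.
  by apply: contraTneq m0 => m30; move: e; rewrite m30 eqxx expr0n /= => /eqP; rewrite sqrf_eq0 => ->.
have m20 : m2 != 0 by rewrite -sqrf_eq0 e sqrf_eq0.
pose K := m3 *: f 2%N + (- m2) *: f 3%N.
have [k0 k1 k2] := kerE m3 (- m2).
have e0 : m3 * m2 + - m2 * m3 = 0 by ring.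
rewrite e0 scale0r in k0; rewrite e0 oppr0 scale0r in k1.
(* These coefficients make the vector null, since [m2] and [m3] have equal squares, with product one
   with [K]. *)
have [x0 x1 x2] := kerE ((2 * m3)^-1) ((2 * m2)^-1).
apply: (@case_A4_intro _ _ dim4 _ H0 (f 0%N) (f 1%N) K
  ((2 * m3)^-1 *: f 2%N + (2 * m2)^-1 *: f 3%N) ((2 * m3)^-1 * m2 + (2 * m2)^-1 * m3) 0 0).
- apply: nframe_intro.
  + split; rewrite ?metricE !gr //.
      by transitivity (m3 ^+ 2 - m2 ^+ 2); [ring | rewrite e subrr].
    transitivity ((m2 ^+ 2 - m3 ^+ 2) / (2 * m2 * m3) ^+ 2); last by rewrite e subrr mul0r.
    by field; rewrite m20 m30.
  + split; rewrite ?metricE !gr; try by ring.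
    by field; rewrite m20 m30.
  by split; rewrite ?metricE !gr; ring.
- by split; rewrite // brC ?k0 ?k1 oppr0.
- left; have -> : (2 * m3)^-1 * m2 + (2 * m2)^-1 * m3 = m2 / m3.
    transitivity ((m2 ^+ 2 + m3 ^+ 2) / (2 * m2 * m3)); first by field; rewrite m20 m30.
    by rewrite -e; field; rewrite m20 m30.
  by rewrite mulf_neq0 // invr_eq0.
by rewrite x0 x1 x2 scale0r !addr0.
Qed.

(* H(f3, f2, -) is the metric dual of a vector of the derived plane. *)
Lemma plane_form_eq0 f : frame G id (eps4 (-1) 1 1 1) f -> spans G 2 f D ->
  Hc G f 3%N 1%N 2%N = 0 /\ Hc G f 3%N 2%N 0%N = 0.
Proof.
move=> frm fD.
have gr := oframe_gram frm.
set x0 := Hc G f 3%N 2%N 0%N; set x1 := Hc G f 3%N 1%N 2%N.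
pose xi := - x0 *: f 0%N - x1 *: f 1%N.
have xiE y : q y (f 2%N) = 0 -> q y (f 3%N) = 0 -> H (f 3%N) (f 2%N) y = q xi y.
  move=> y2 y3; rewrite (frame_expand dim4 frm y) /sum4 y2 y3 !mulr0 !scale0r !addr0.
  rewrite !form3E -!/(Hc G f _ _ _) (Hc23 G f 3%N 2%N 1%N) -/x0 -/x1.
  by rewrite !metricE !gr /eps4 /=; ring.
have no_frame h : frame G id (eps4 (-1) 1 1 1) h -> h 2%N = f 2%N -> h 3%N = f 3%N ->
    spans G 2 h D.
  by move=> _ h2 h3; apply: eq_spans fD => -[|[|[|[|]]]].
have xi2 : q xi (f 2%N) = 0 by rewrite !metricE !gr; ring.
have xi3 : q xi (f 3%N) = 0 by rewrite !metricE !gr; ring.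
have xixi : q xi xi = x1 ^+ 2 - x0 ^+ 2 by rewrite !metricE !gr; ring.
have sys h (frh : frame G id (eps4 (-1) 1 1 1) h) := frame_system dim4 frh Ein.
(* A vector [xi] of nonzero norm is moved to a frame vector of the plane by a reflection fixing
   [f 2] and [f 3], so that one component of [H] remains; a null one has components of equal
   absolute value already. *)
have [xi0 | xi0] := eqVneq (q xi xi) 0; last first.
  have [c [c0 [[c1 _] | [c1 _]]]] := unit_vector xi0.
    have [||h [frh hu hfix]] := @move_frame _ _ G _ _ f 1%N (c *: xi) frm isT.
    - by rewrite gr oner_eq0.
    - by rewrite gr.
    have h2 : h 2%N = f 2%N by apply: hfix; rewrite ?gr // metricZr metricC xi2 mulr0.
    have h3 : h 3%N = f 3%N by apply: hfix; rewrite ?gr // metricZr metricC xi3 mulr0.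
    have hD := no_frame h frh h2 h3; have grh := oframe_gram frh.
    have hE i : (i < 2)%N -> Hc G h 3%N 2%N i = q xi (h i).
      by case: i => [|[|//]] _; rewrite /Hc h2 h3 xiE // -?h2 -?h3 grh.
    have hxi : exists2 c', c' != 0 & xi = c' *: h 1%N.
      have xc : xi = c^-1 *: (c *: xi) by rewrite scalerA mulVf // scale1r.
      case: hu => hu; rewrite xc; first by exists c^-1; rewrite ?invr_eq0 ?hu.
      by exists (- c^-1); rewrite ?oppr_eq0 ?invr_eq0 // hu scalerN scaleNr opprK.
    case: hxi => c' c'0 xiE'.
    exfalso; apply: (plane_spacelike (sys h frh) (plane_br2 hD) (plane_br3 hD)
      (plane_br01 frh hD) (brcC G h 1%N 2%N)).
      by rewrite hE // xiE' metricZl grh mulr0.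
    by rewrite Hc23 hE // xiE' metricZl grh mulr1 oppr_eq0.
  have [||h [frh hu hfix]] := @move_frame _ _ G _ _ f 0%N (c *: xi) frm isT.
  - by rewrite gr oppr_eq0 oner_eq0.
  - by rewrite gr.
  have h2 : h 2%N = f 2%N by apply: hfix; rewrite ?gr // metricZr metricC xi2 mulr0.
  have h3 : h 3%N = f 3%N by apply: hfix; rewrite ?gr // metricZr metricC xi3 mulr0.
  have hD := no_frame h frh h2 h3; have grh := oframe_gram frh.
  have hE i : (i < 2)%N -> Hc G h 3%N 2%N i = q xi (h i).
    by case: i => [|[|//]] _; rewrite /Hc h2 h3 xiE // -?h2 -?h3 grh.
  have hxi : exists2 c', c' != 0 & xi = c' *: h 0%N.
    have xc : xi = c^-1 *: (c *: xi) by rewrite scalerA mulVf // scale1r.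
    case: hu => hu; rewrite xc; first by exists c^-1; rewrite ?invr_eq0 ?hu.
    by exists (- c^-1); rewrite ?oppr_eq0 ?invr_eq0 // hu scalerN scaleNr opprK.
  case: hxi => c' c'0 xiE'.
  exfalso; apply: (plane_timelike (sys h frh) (plane_br2 hD) (plane_br3 hD)
    (plane_br01 frh hD) (brcC G h 1%N 2%N)).
    by rewrite Hc23 hE // xiE' metricZl grh mulr0 oppr0.
  by rewrite hE // xiE' metricZl grh mulrN mulr1 oppr_eq0.
have [x00 | x00] := eqVneq x0 0.
  split=> //; apply: sqr_le0.
  by move: xi0; rewrite xixi x00; lra.
exfalso; apply: (@plane_null _ (brc G f) (Hc G f) (sys f frm) (plane_br2 fD) (plane_br3 fD)
  (plane_br01 frm fD) (brcC G f 1%N 2%N) x00 (adapted_spanning dim4 ndD frm fD isT) (x1 / x0)).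
  have e : (x1 / x0 - 1) * (x1 / x0 + 1) = 0.
    transitivity ((x1 ^+ 2 - x0 ^+ 2) / x0 ^+ 2); first by field.
    by rewrite -xixi xi0 mul0r.
  by move/eqP: e; rewrite mulf_eq0 subr_eq0 addr_eq0 => /orP[] /eqP ->; [left | right].
by rewrite divfK.
Qed.

Section LorentzPlane.
Variable f : nat -> g.
Hypotheses (frm : frame G id (eps4 (-1) 1 1 1) f) (fD : spans G 2 f D).

Lemma plane_flat : (forall x y z, H x y z = 0) /\ br (f 3%N) (f 2%N) = 0.
Proof.
have [x1 x0] := plane_form_eq0 frm fD.
have [c0 c1 n2 n3] := plane_closed (frame_system dim4 frm Ein) (plane_br2 fD)
  (plane_br3 fD) (plane_br01 frm fD) (brcC G f 1%N 2%N) x1 x0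
  (adapted_spanning dim4 ndD frm fD isT).
split; first by apply: (form_eq0 dim4 frm).
by rewrite (plane_brE frm fD) c0 c1 !mulr0 !scale0r addr0.
Qed.

Lemma rotate_plane u v : u ^+ 2 + v ^+ 2 = 1 ->
  let h := vec4 (f 0%N) (f 1%N) (u *: f 2%N + v *: f 3%N) (- v *: f 2%N + u *: f 3%N) in
  frame G id (eps4 (-1) 1 1 1) h /\ spans G 2 h D.
Proof.
move=> uv h; have gr := oframe_gram frm; split.
  apply: oframe_intro; first by rewrite mulrNN mulr1.
  - by split; rewrite ?metricE !gr // -?[RHS]uv; ring.
  - by split; rewrite ?metricE !gr; ring.
  by split; rewrite ?metricE !gr; ring.
move=> x; rewrite fD; split=> x0 [|[|[|[|//]]]] //= _.
- by rewrite metricDr !metricZr !x0 // !mulr0 addr0.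
- by rewrite metricDr !metricZr !x0 // !mulr0 addr0.
- transitivity (u * q x (h 2%N) - v * q x (h 3%N)); last by rewrite !x0 // !mulr0 subr0.
  rewrite /h /= !metricE; transitivity ((u ^+ 2 + v ^+ 2) * q x (f 2%N)); last by ring.
  by rewrite uv mul1r.
transitivity (v * q x (h 2%N) + u * q x (h 3%N)); last by rewrite !x0 // !mulr0 addr0.
rewrite /h /= !metricE; transitivity ((u ^+ 2 + v ^+ 2) * q x (f 3%N)); last by ring.
by rewrite uv mul1r.
Qed.

Lemma plane_ad_neq0 : (forall i, br (f 2%N) (f i) = 0) ->
  br (f 3%N) (f 0%N) = 0 -> br (f 3%N) (f 1%N) = 0 -> False.
Proof.
move=> b2 b30 b31; apply: (derived_abelian ndD frm fD isT).
have b01 := plane_abelian frm fD; have [_ b32] := plane_flat.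
apply: (frame_br_eq0 dim4 frm) => i j.
by case: i => [|[|[|[|//]]]] _; case: j => [|[|[|[|//]]]] _; rewrite ?brxx //;
  rewrite brC ?(b01, b2, b30, b31, b32) oppr0.
Qed.

Lemma plane_system : [/\ einstein_system id (eps4 (-1) 1 1 1) (brc G f) (Hc G f),
  forall i j, brc G f i j 2%N = 0, forall i j, brc G f i j 3%N = 0,
  forall k, brc G f 0%N 1%N k = 0 & forall k, brc G f 3%N 2%N k = 0].
Proof.
have [_ b32] := plane_flat.
split; [exact: (frame_system dim4 frm Ein) | exact: (plane_br2 fD) |
  exact: (plane_br3 fD) | exact: (plane_br01 frm fD) | ].
by move=> k; rewrite /brc b32 metric0l.
Qed.
End LorentzPlane.

(** Two rotations of the normal plane. After the first, [h 2] acts by a skew endomorphism; if that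
    is not zero, the action of [h 3] is skew as well by [plane_skew], and since skew endomorphisms
    of a plane form a line, a second rotation makes one normal vector act trivially. *)
Lemma plane_kernel f : frame G id (eps4 (-1) 1 1 1) f -> spans G 2 f D ->
  exists h, [/\ frame G id (eps4 (-1) 1 1 1) h, spans G 2 h D &
    forall i, br (h 2%N) (h i) = 0].
Proof.
move=> frm fD; have [H0 b32] := plane_flat frm fD.
have Hc0 h i j k : Hc G h i j k = 0 by apply: H0.
have [sys L2 L3 L01 L32] := plane_system frm fD.
have [u [v [uv p0 p1 p01]]] := plane_rotation sys L2 L3 L01 (brcC G f 1%N 2%N)
  (Hc0 _ _ _ _) (Hc0 _ _ _ _) (Hc0 _ _ _ _) (Hc0 _ _ _ _) L32.
have [] := rotate_plane frm fD uv; set h := vec4 _ _ _ _ => frh hD.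
have {}p0 : brc G h 2%N 0%N 0%N = 0 by rewrite /brc /h /= !brE !metricE.
have {}p1 : brc G h 2%N 1%N 1%N = 0 by rewrite /brc /h /= !brE !metricE.
have {}p01 : brc G h 2%N 1%N 0%N = - brc G h 2%N 0%N 1%N.
  by apply/eqP; rewrite -addr_eq0 -[X in _ == X]p01 /brc /h /= !brE !metricE; apply/eqP; ring.
have h4 i : h i.+4 = 0 by apply: nth_nil.
clearbody h; have [_ h32] := plane_flat frh hD.
have bE := plane_brE frh hD; rewrite /eps4 /= in bE.
have [p | p] := eqVneq (brc G h 2%N 0%N 1%N) 0.
  exists h; split=> // i; case: i => [|[|[|[|i]]]].
  - by rewrite bE p0 p !mulr0 !scale0r addr0.
  - by rewrite bE p1 p01 p oppr0 !mulr0 !scale0r addr0.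
  - exact: brxx.
  - by rewrite brC h32 oppr0.
  by rewrite h4 br0r.
have [sys' L2' L3' L01' L32'] := plane_system frh hD.
have [s0 s1 s01] := plane_skew sys' L2' L3' L01' (brcC G h 1%N 2%N)
  (Hc0 _ _ _ _) (Hc0 _ _ _ _) (Hc0 _ _ _ _) (Hc0 _ _ _ _) L32' p0 p1 p01 p.
set pp := brc G h 2%N 0%N 1%N in p p01; set ss := brc G h 3%N 0%N 1%N in s01.
have psgt0 : 0 < ss ^+ 2 + pp ^+ 2.
  by rewrite ltr_wpDl ?sqr_ge0 // lt_def sqr_ge0 sqrf_eq0 p.
pose r := Num.sqrt (ss ^+ 2 + pp ^+ 2).
have r2 : r ^+ 2 = ss ^+ 2 + pp ^+ 2 by rewrite sqr_sqrtr // ltW.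
have r0 : r != 0 by rewrite sqrtr_eq0 -ltNge.
have uv' : (ss / r) ^+ 2 + (- pp / r) ^+ 2 = 1.
  by apply: (mulIf (expf_neq0 2 r0)); rewrite mul1r {2}r2; field.
have [] := rotate_plane frh hD uv'; set k := vec4 _ _ _ _ => frk kD.
have [_ k32] := plane_flat frk kD.
have [k0 k1] : k 0%N = h 0%N /\ k 1%N = h 1%N by [].
have k2 : k 2%N = (ss / r) *: h 2%N + (- pp / r) *: h 3%N by [].
have k4 i : k i.+4 = 0 by apply: nth_nil.
exists k; split=> // i; case: i => [|[|[|[|i]]]].
- rewrite k2 k0 !brE !bE p0 s0 -/pp -/ss !mulr0 !scale0r !add0r !scalerA -scalerDl.
  by rewrite (_ : _ + _ = 0) ?scale0r //; ring.
- rewrite k2 k1 !brE !bE p1 s1 p01 s01 !mulr0 !scale0r !addr0 !scalerA -scalerDl.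
  by rewrite (_ : _ + _ = 0) ?scale0r //; ring.
- exact: brxx.
- by rewrite brC k32 oppr0.
by rewrite k4 br0r.
Qed.

Lemma case_A_skew h : frame G id (eps4 (-1) 1 1 1) h -> spans G 2 h D ->
  (forall i, br (h 2%N) (h i) = 0) ->
  [/\ brc G h 3%N 0%N 0%N = 0, brc G h 3%N 1%N 1%N = 0 &
      brc G h 3%N 1%N 0%N = - brc G h 3%N 0%N 1%N] -> case_A G.
Proof.
move=> frh hD h2 [s0 s1 s01]; have [H0 _] := plane_flat frh hD.
have gr := oframe_gram frh.
have frh' : frame G id (eps4 (-1) 1 1 1) (vec4 (h 0%N) (h 2%N) (h 1%N) (h 3%N)).
  by apply: oframe_intro; split; rewrite ?gr ?mulrNN ?mulr1.
have b30 : br (h 3%N) (h 0%N) = brc G h 3%N 0%N 1%N *: h 1%N.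
  by rewrite (plane_brE frh hD) s0 mulr0 scale0r add0r /eps4 /= mul1r.
have b31 : br (h 3%N) (h 1%N) = brc G h 3%N 0%N 1%N *: h 0%N.
  by rewrite (plane_brE frh hD) s1 s01 mulr0 scale0r addr0 /eps4 /= mulrNN mul1r.
have [r0 | r0] := eqVneq (brc G h 3%N 0%N 1%N) 0.
  by exfalso; apply: (plane_ad_neq0 frh hD h2); rewrite ?b30 ?b31 r0 scale0r.
apply: (case_A_boost H0 frh' r0).
  by split; rewrite ?(plane_abelian frh hD) // brC h2 oppr0.
by split=> //; rewrite brC h2 oppr0.
Qed.

(** A skew action gives (A2). A symmetric one is normalised by a boost, and [plane_ad], applied anew
    in the boosted frame, rejects the diagonal outcome; the nonreal outcome is (A3) with [a = 0],
    and the null outcome contradicts the inequality of the diagonal entries. *)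
Lemma derived_plane_Lorentz f : frame G id (eps4 (-1) 1 1 1) f ->
  spans G 2 f D -> case_A G.
Proof.
move=> frm fD; have [h [frh hD h2]] := plane_kernel frm fD.
have [H0 _] := plane_flat frh hD.
have Hc0 k i j l : Hc G k i j l = 0 by apply: H0.
have alt k : frame G id (eps4 (-1) 1 1 1) k -> spans G 2 k D ->
    (forall i, br (k 2%N) (k i) = 0) -> case_A G \/
    [/\ brc G k 3%N 1%N 0%N = brc G k 3%N 0%N 1%N,
      brc G k 3%N 0%N 0%N ^+ 2 + brc G k 3%N 1%N 1%N ^+ 2 = 2 * brc G k 3%N 0%N 1%N ^+ 2 &
      brc G k 3%N 0%N 0%N != brc G k 3%N 1%N 1%N].
  move=> frk kD k2; have [sys L2 L3 L01 L32] := plane_system frk kD.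
  have [||] := plane_ad sys L2 L3 L01 (brcC G k 1%N 2%N)
   (Hc0 _ _ _ _) (Hc0 _ _ _ _) (Hc0 _ _ _ _) (Hc0 _ _ _ _) L32 _
   (adapted_spanning dim4 ndD frk kD isT).
  - by move=> i j; rewrite /brc k2 metric0l.
  - by move=> skew; left; apply: case_A_skew frk kD k2 skew.
  by right.
have [// | [sym sqr ne]] := alt h frh hD h2.
pose sig x y := q (br (h 3%N) x) y + q (br (h 3%N) y) x.
have [|||[p [r [pr frk key]]] | [de [de1 s01 s00]]] := @boost_form _ _ _ sig _ _ _ _ _ _ frh.
- by move=> x y; rewrite /sig addrC.
- by move=> x y z; rewrite /sig !brE !metricE; ring.
- by move=> x y z; rewrite /sig !brE !metricE; ring.
- move: frk key; set k := vec4 _ _ _ _ => frk key.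
  have kD : spans G 2 k D by apply: eq_spans hD => -[|[|[|[|]]]].
  have k2 i : br (k 2%N) (k i) = 0.
    have k4 j : k j.+4 = 0 by apply: nth_nil.
    by case: i => [|[|[|[|i]]]]; rewrite ?k4 /k /= ?brE ?h2 ?scaler0 ?addr0.
  have [// | [sym' sqr' ne']] := alt k frk kD k2.
  have [H0' _] := plane_flat frk kD.
  have bE := plane_brE frk kD; rewrite /eps4 /= in bE.
  have s2 i j : sig (k i) (k j) = brc G k 3%N i j + brc G k 3%N j i by [].
  rewrite -[_ + _]/(k 0%N) -[r *: _ + _]/(k 1%N) !s2 sym' in key.
  clearbody k.
  set A := brc G k 3%N 0%N 0%N in key sqr' ne'; set C := brc G k 3%N 1%N 1%N in key sqr' ne'.
  set B := brc G k 3%N 0%N 1%N in key sqr' sym'.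
  case: key => [B0 | [AC B0]].
    have {}B0 : B = 0 by lra.
    rewrite B0 expr0n mulr0 /= in sqr'.
    have pA := sqr_ge0 A; have pC := sqr_ge0 C.
    have A0 : A = 0 by apply: sqr_le0; lra.
    have C0 : C = 0 by apply: sqr_le0; lra.
    by rewrite A0 C0 eqxx in ne'.
  have {}B0 : B != 0 by apply: contra_neq B0 => ->; rewrite addr0.
  have CA : C = - A by lra.
  have AB : A ^+ 2 = B ^+ 2 by rewrite CA sqrrN in sqr'; lra.
  have gr := oframe_gram frk.
  (* The second vector is reversed if necessary, because the off-diagonal entry in (A3) is a
     nonnegative root. *)
  have sg2 : Num.sg B ^+ 2 = 1 by rewrite sqr_sg B0.
  have Bs : B = Num.sg B * `|B| by rewrite -numEsg.
  have frk' : frame G id (eps4 (-1) 1 1 1) (vec4 (k 0%N) (Num.sg B *: k 1%N) (k 2%N) (k 3%N)).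
    by apply: oframe_intro; split; rewrite ?metricE ?gr ?mulrNN ?mulr1 ?mulr0 -?expr2.
  apply: (@case_A3_intro _ _ dim4 _ H0 _ _ _ _ _ _ frk' _ (- A) `|B| 0) => //.
  - by split; rewrite ?brE ?(plane_abelian frk kD) ?scaler0 // brC k2 oppr0 ?scaler0.
  - rewrite xpair_eqE eqxx andbT oppr_eq0; apply: contra_neq B0 => A0.
    by apply: sqr_le0; rewrite -AB A0 expr0n.
  - by rewrite real_normK ?num_real // -AB; ring.
  rewrite brE (brC _ (k 2%N)) k2 oppr0 scale0r !bE -/A -/C -/B sym' CA.
  split=> //; rewrite ?scalerA.
    by rewrite mulN1r mul1r {1}Bs mulrC.
  rewrite scalerDr !scalerA mul1r mulN1r [- A * _]mulrC; congr (_ *: _ + _).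
  by rewrite {2}Bs mulrN mulrA -expr2 sg2 mul1r.
have s2 i j : sig (h i) (h j) = brc G h 3%N i j + brc G h 3%N j i by [].
rewrite !s2 sym in s00; move/eqP: ne; case.
apply/eqP; rewrite -subr_eq0 -sqrf_eq0; apply/eqP.
set A := brc G h 3%N 0%N 0%N in s00 sqr *; set C := brc G h 3%N 1%N 1%N in s00 sqr *.
set B := brc G h 3%N 0%N 1%N in s00 sqr.
have {}s00 : A + C = - (2 * de * B) by lra.
have e : (A + C) ^+ 2 = 4 * B ^+ 2.
  by rewrite s00; transitivity ((de * de) * (4 * B ^+ 2)); [ring | rewrite de1 mul1r].
transitivity (2 * (A ^+ 2 + C ^+ 2) - (A + C) ^+ 2); first by ring.
by rewrite sqr e; ring.
Qed.

End LowDimension.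

(** * Derived algebras of dimension three *)

Section CodimensionOne.
Variables (R : realType) (g : lieAlgebra R).
Hypothesis dim4 : \dim {:g} = 4%N.
Variable G : gen_metric g.
Local Notation q := (gm_g G).
Local Notation H := (gm_H G).
Local Notation br := (@lie_br R g).
Local Notation D := (derived g).
Hypothesis ndD : nondegenerate_on G D.
Hypothesis Ein : gen_Einstein G 0.

Lemma spans3 f h : h 3%N = f 3%N -> spans G 3 f D -> spans G 3 h D.
Proof. by move=> h3; apply: eq_spans => -[|[|[|[|]]]]. Qed.

Lemma spans3_out f : spans G 3 f D -> forall i j, brc G f i j 3%N = 0.
Proof. by move=> fD i j; apply: (spans_orthogonal fD (m := 3)). Qed.

Section Cross.
Variables (e0 d : R) (f : nat -> g).
Hypotheses (frm : frame G id (eps4 e0 1 1 d) f) (fD : spans G 3 f D).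

Let e01 : e0 * e0 = 1.
Proof. by case: frm => /(_ 0%N isT) []. Qed.

(* On the derived algebra [x, y] = e0 S(x x y): the bracket of a unimodular
   three-dimensional Lie algebra is a symmetric endomorphism composed with the
   cross product. *)
Definition cross x y :=
  (q x (f 1%N) * q y (f 2%N) - q x (f 2%N) * q y (f 1%N)) *: f 0%N +
  (q x (f 2%N) * q y (f 0%N) - q x (f 0%N) * q y (f 2%N)) *: f 1%N +
  (q x (f 0%N) * q y (f 1%N) - q x (f 1%N) * q y (f 0%N)) *: f 2%N.

Definition bracket_endo x :=
  q x (f 0%N) *: br (f 1%N) (f 2%N) + q x (f 1%N) *: br (f 2%N) (f 0%N) +
  q x (f 2%N) *: br (f 0%N) (f 1%N).

Definition bracket_form x y := q (bracket_endo x) y.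

Lemma bracket_endoZ a x : bracket_endo (a *: x) = a *: bracket_endo x.
Proof. by rewrite /bracket_endo !metricZl !scalerDr !scalerA. Qed.

Lemma bracket_formDl x y z :
  bracket_form (x + y) z = bracket_form x z + bracket_form y z.
Proof. by rewrite /bracket_form /bracket_endo !metricE; ring. Qed.

Lemma bracket_formZl a x z : bracket_form (a *: x) z = a * bracket_form x z.
Proof. by rewrite /bracket_form bracket_endoZ metricZl. Qed.

(** The skew part of the bracket endomorphism is dual to the trace of the adjoint action, which
    vanishes on g'. *)
Lemma bracket_formC x y : bracket_form x y = bracket_form y x.
Proof.
have L3 := spans3_out fD; have LC := brcC G f.
have Lii n l : brc G f n n l = 0 by rewrite /brc brxx metric0l.
have T m : (m < 3)%N -> sum4 (fun l => eps4 e0 1 1 d l * brc G f m l l) = 0.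
  by move=> m3; apply: (trace_ad_eq0 dim4 ndD frm fD _ m3).
have [T0 T1 T2] := And3 (T 0%N isT) (T 1%N isT) (T 2%N isT).
rewrite /sum4 /eps4 /= !L3 !Lii (LC 0%N 2%N) in T0.
rewrite /sum4 /eps4 /= !L3 !Lii (LC 1%N 0%N) in T1.
rewrite /sum4 /eps4 /= !L3 !Lii (LC 2%N 1%N) in T2.
have qE u v : q u v = e0 * q u (f 0%N) * q v (f 0%N) + q u (f 1%N) * q v (f 1%N)
   + q u (f 2%N) * q v (f 2%N) + d * q u (f 3%N) * q v (f 3%N).
  by rewrite (frame_norm dim4 u v frm) /sum4 /eps4 /= !mul1r.
rewrite /bracket_form /bracket_endo !metricE ![q (br _ _) x]qE ![q (br _ _) y]qE.
rewrite -!/(brc G f _ _ _) !L3.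
have -> : brc G f 0%N 1%N 1%N = brc G f 2%N 0%N 2%N by lra.
have -> : brc G f 1%N 2%N 2%N = e0 * brc G f 0%N 1%N 0%N by lra.
have E : e0 * (e0 * brc G f 2%N 0%N 0%N - brc G f 1%N 2%N 1%N) = 0.
  by rewrite (_ : _ - _ = 0) ?mulr0 //; lra.
have -> : brc G f 1%N 2%N 1%N = e0 * brc G f 2%N 0%N 0%N by lra.
transitivity (q x (f 0%N) * (e0 * brc G f 1%N 2%N 0%N * q y (f 0%N)
    + e0 * brc G f 2%N 0%N 0%N * q y (f 1%N) + e0 * brc G f 0%N 1%N 0%N * q y (f 2%N))
  + q x (f 1%N) * (e0 * brc G f 2%N 0%N 0%N * q y (f 0%N)
    + brc G f 2%N 0%N 1%N * q y (f 1%N) + brc G f 2%N 0%N 2%N * q y (f 2%N))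
  + q x (f 2%N) * (e0 * brc G f 0%N 1%N 0%N * q y (f 0%N)
    + brc G f 2%N 0%N 2%N * q y (f 1%N) + brc G f 0%N 1%N 2%N * q y (f 2%N))); ring.
Qed.

Lemma bracket_cross x y : q x (f 3%N) = 0 -> q y (f 3%N) = 0 ->
  br x y = e0 *: bracket_endo (cross x y).
Proof.
move=> x3 y3; have gr := oframe_gram frm; apply: (frame_ext dim4 frm) => i _.
rewrite {1}(frame_expand dim4 frm x) {1}(frame_expand dim4 frm y).
rewrite /sum4 x3 y3 !mulr0 !scale0r !addr0 /eps4 /= !mul1r.
rewrite /bracket_endo /cross !metricE !gr !brE !brxx (brC (f 1%N) (f 0%N)).
rewrite (brC (f 2%N) (f 1%N)) (brC (f 0%N) (f 2%N)) !metricE.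
transitivity (e0 * (e0 * (q x (f 1%N) * q y (f 2%N) - q x (f 2%N) * q y (f 1%N)))
  * q (br (f 1%N) (f 2%N)) (f i) +
  e0 * (q x (f 2%N) * q y (f 0%N) - q x (f 0%N) * q y (f 2%N))
  * q (br (f 2%N) (f 0%N)) (f i) +
  e0 * (q x (f 0%N) * q y (f 1%N) - q x (f 1%N) * q y (f 0%N))
  * q (br (f 0%N) (f 1%N)) (f i)); last by ring.
by rewrite mulrA e01; ring.
Qed.

Lemma cross_metric x y z : q (cross x y) z =
  (q x (f 1%N) * q y (f 2%N) - q x (f 2%N) * q y (f 1%N)) * q z (f 0%N) +
  (q x (f 2%N) * q y (f 0%N) - q x (f 0%N) * q y (f 2%N)) * q z (f 1%N) +
  (q x (f 0%N) * q y (f 1%N) - q x (f 1%N) * q y (f 0%N)) * q z (f 2%N).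
Proof. by rewrite /cross !metricE !(metricC _ (f _) z). Qed.

Lemma cross_out x y : q (cross x y) (f 3%N) = 0.
Proof. by rewrite cross_metric !(oframe_gram frm); ring. Qed.

Lemma cross_perpl x y : q (cross x y) x = 0.
Proof. by rewrite cross_metric; ring. Qed.

Lemma cross_perpr x y : q (cross x y) y = 0.
Proof. by rewrite cross_metric; ring. Qed.

Lemma cross_rot x y z : q (cross x y) z = q (cross z x) y.
Proof. by rewrite !cross_metric; ring. Qed.

(* The next two lemmas express the brackets of an adapted frame, orthonormal or
   null, through the bracket form; t is the sign of the change of frame. *)
Lemma oframe_brackets h : frame G id (eps4 e0 1 1 d) h -> h 3%N = f 3%N ->
  exists t, forall k,
    [/\ brc G h 0%N 1%N k = t * bracket_form (h 2%N) (h k),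
        brc G h 1%N 2%N k = e0 * (t * bracket_form (h 0%N) (h k)) &
        brc G h 2%N 0%N k = t * bracket_form (h 1%N) (h k)].
Proof.
move=> frh h3; have gr := oframe_gram frh.
pose t := q (cross (h 0%N) (h 1%N)) (h 2%N).
have out i : (i < 3)%N -> q (h i) (f 3%N) = 0.
  by case: i => [|[|[|//]]] _; rewrite -h3 gr.
have cE x y : cross x y = (e0 * q (cross x y) (h 0%N)) *: h 0%N +
    q (cross x y) (h 1%N) *: h 1%N + q (cross x y) (h 2%N) *: h 2%N.
  rewrite {1}(frame_expand dim4 frh (cross x y)) /sum4 h3 cross_out /eps4 /= !mul1r.
  by rewrite mulr0 scale0r addr0.
have c01 : cross (h 0%N) (h 1%N) = t *: h 2%N.
  by rewrite cE cross_perpl cross_perpr mulr0 !scale0r !add0r.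
have c12 : cross (h 1%N) (h 2%N) = (e0 * t) *: h 0%N.
  by rewrite cE cross_perpl cross_perpr cross_rot !scale0r !addr0.
have c20 : cross (h 2%N) (h 0%N) = t *: h 1%N.
  by rewrite cE cross_perpl cross_perpr -cross_rot mulr0 !scale0r addr0 add0r.
exists (e0 * t) => k; rewrite /brc !bracket_cross ?out // c01 c12 c20.
rewrite !bracket_endoZ !metricZl -!/(bracket_form _ _).
by split; ring.
Qed.

Lemma nframe_brackets h : frame G swap02 (eps4 1 1 1 1) h -> h 3%N = f 3%N ->
  exists t, forall k,
    [/\ brc G h 0%N 1%N k = t * bracket_form (h 0%N) (h k),
        brc G h 1%N 2%N k = t * bracket_form (h 2%N) (h k) &
        brc G h 2%N 0%N k = t * bracket_form (h 1%N) (h k)].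
Proof.
move=> frh h3; have gr := nframe_gram frh.
pose t := q (cross (h 0%N) (h 1%N)) (h 2%N).
have out i : (i < 3)%N -> q (h i) (f 3%N) = 0.
  by case: i => [|[|[|//]]] _; rewrite -h3 gr.
have cE x y : cross x y = q (cross x y) (h 2%N) *: h 0%N +
    q (cross x y) (h 1%N) *: h 1%N + q (cross x y) (h 0%N) *: h 2%N.
  rewrite {1}(frame_expand dim4 frh (cross x y)) /sum4 /swap02 /= h3 cross_out /eps4 /= !mul1r.
  by rewrite scale0r addr0.
have c01 : cross (h 0%N) (h 1%N) = t *: h 0%N.
  by rewrite cE cross_perpl cross_perpr !scale0r !addr0.
have c12 : cross (h 1%N) (h 2%N) = t *: h 2%N.
  by rewrite cE cross_perpl cross_perpr cross_rot !scale0r !add0r.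
have c20 : cross (h 2%N) (h 0%N) = t *: h 1%N.
  by rewrite cE cross_perpl cross_perpr -cross_rot !scale0r addr0 add0r.
exists (e0 * t) => k; rewrite /brc !bracket_cross ?out // c01 c12 c20.
rewrite !bracket_endoZ !metricZl -!/(bracket_form _ _).
by split; ring.
Qed.
End Cross.

Lemma space_br_eq0 s eps k : frame G s eps k -> s 3%N = 3%N ->
  [/\ br (k 0%N) (k 1%N) = 0, br (k 1%N) (k 2%N) = 0 & br (k 2%N) (k 0%N) = 0] ->
  forall x y, q x (k 3%N) = 0 -> q y (k 3%N) = 0 -> br x y = 0.
Proof.
move=> frk s3 [b01 b12 b20] x y x3 y3.
rewrite (frame_expand dim4 frk x) (frame_expand dim4 frk y) /sum4 s3 x3 y3.
rewrite !mulr0 !scale0r !addr0 !brE !brxx (brC (k 1%N) (k 0%N)).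
by rewrite (brC (k 2%N) (k 1%N)) (brC (k 0%N) (k 2%N)) b01 b12 b20
  !(oppr0, scaler0, addr0).
Qed.

Lemma brc_eq0 s eps k i j : frame G s eps k ->
  (forall l, (l < 4)%N -> brc G k i j l = 0) -> br (k i) (k j) = 0.
Proof.
by move=> frk L0; apply: (frame_ext dim4 frk) => l l4; rewrite metric0l; apply: L0.
Qed.

(* For round frames the bracket of the derived algebra is a multiple of the
   cross product and the complement acts by skew endomorphisms. *)
Definition round_frame e0 d k :=
  [/\ frame G id (eps4 e0 1 1 d) k, spans G 3 k D,
    (let L := brc G k in
     [/\ L 0%N 1%N 0%N = 0 /\ L 0%N 1%N 1%N = 0,
        L 1%N 2%N 1%N = 0 /\ L 1%N 2%N 2%N = 0 &
        L 2%N 0%N 0%N = 0 /\ L 2%N 0%N 2%N = 0]) &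
    let L := brc G k in let h := Hc G k in
    [/\ L 1%N 2%N 0%N != 0,
      L 2%N 0%N 1%N = L 1%N 2%N 0%N /\ L 0%N 1%N 2%N = L 1%N 2%N 0%N,
      h 0%N 1%N 2%N ^+ 2 = L 1%N 2%N 0%N ^+ 2,
      [/\ h 3%N 1%N 2%N = 0, h 3%N 2%N 0%N = 0 & h 3%N 0%N 1%N = 0] &
      [/\ L 3%N 0%N 0%N = 0, L 3%N 1%N 1%N = 0, L 3%N 2%N 2%N = 0 &
      [/\ L 3%N 1%N 0%N = - L 3%N 0%N 1%N, L 3%N 2%N 0%N = - L 3%N 0%N 2%N &
          L 3%N 2%N 1%N = - L 3%N 1%N 2%N]]]].

(** A consequence of roundness that mentions no frame of g', used to carry roundness to other
    frames. *)
Lemma round_perp e0 d k x y : round_frame e0 d k ->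
  q x (k 3%N) = 0 -> q y (k 3%N) = 0 -> q (br x y) x = 0.
Proof.
case=> frk kD [[l1 l2] [l3 l4] [l5 l6]] [_ [l7 l8] _ _ _] x3 y3.
rewrite (frame_expand dim4 frk x) (frame_expand dim4 frk y) /sum4 x3 y3.
rewrite !mulr0 !scale0r !addr0 !brE !brxx (brC (k 1%N) (k 0%N)).
rewrite (brC (k 2%N) (k 1%N)) (brC (k 0%N) (k 2%N)) !metricE.
by rewrite -!/(brc G k _ _ _) l1 l2 l3 l4 l5 l6 l7 l8; ring.
Qed.

Lemma spanning_frame s eps k : frame G s eps k -> spans G 3 k D ->
  (forall i, (i < 3)%N -> q (k i) (k 3%N) = 0) -> spanning 3 (brc G k).
Proof.
move=> frk kD k3; apply: (derived_spanning dim4 ndD frk) => // i i3.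
by apply/kD => -[|[|[|[|//]]]] // _; apply: k3.
Qed.

(** In the new frame [round_perp] removes the off-diagonal constants, so the diagonal classification
    applies again; vanishing brackets on g' would be inherited by the old frame. *)
Lemma round_reframe e0 d k k' :
  (e0, d) = (-1, 1) \/ (e0, d) = (1, -1) -> round_frame e0 d k ->
  frame G id (eps4 e0 1 1 d) k' -> k' 3%N = k 3%N -> round_frame e0 d k'.
Proof.
move=> ed rk frk' k'3; have [frk kD _ [l0 _ _ _ _]] := rk.
have kD' : spans G 3 k' D by apply: spans3 kD.
have gr := oframe_gram frk'.
have perp i j : (i < 3)%N -> (j < 3)%N -> brc G k' i j i = 0.
  move=> i3 j3; apply: (round_perp rk); rewrite -k'3.
    by case: i i3 => [|[|[|//]]] _; rewrite gr.
  by case: j j3 => [|[|[|//]]] _; rewrite gr.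
have perp' i j : (i < 3)%N -> (j < 3)%N -> brc G k' i j j = 0.
  by move=> i3 j3; rewrite brcC perp ?oppr0.
have sys := frame_system dim4 frk' Ein.
have sp := adapted_spanning dim4 ndD frk' kD' isT.
have L3 := spans3_out kD'.
split=> //; first by split; split; rewrite ?perp ?perp'.
case: ed => -[e0E dE]; rewrite e0E dE in sys; last first.
  by apply: diagonal_Riemann sys L3 _ _ _ _ _ _ sp; rewrite ?perp ?perp'.
have [||||||[z0 z1 z2]|//] := diagonal_Lorentz sys L3 _ _ _ _ _ _ sp;
  rewrite ?perp ?perp' //.
case/eqP: l0; rewrite /brc (@space_br_eq0 id _ k' frk' erefl) ?metric0l //.
- split; apply: (brc_eq0 frk') => -[|[|[|[|//]]]] _ //; rewrite ?L3 ?perp ?perp' //.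
- by rewrite k'3 (oframe_gram frk).
by rewrite k'3 (oframe_gram frk).
Qed.

Lemma space_round f : frame G id (eps4 1 1 1 (-1)) f -> spans G 3 f D ->
  exists k, round_frame 1 (-1) k.
Proof.
move=> frm fD.
have [k [frk k3 [s01 s02 s12]]] := Riemann_normal_form dim4 (bracket_formC frm fD)
  (@bracket_formDl f) (@bracket_formZl f) frm.
have kD := spans3 k3 fD.
have [t tE] := oframe_brackets frm frk k3.
have sC := bracket_formC frm fD.
have sys := frame_system dim4 frk Ein.
have sp := adapted_spanning dim4 ndD frk kD isT.
have [t0 t1 t2] := And3 (tE 0%N) (tE 1%N) (tE 2%N).
case: t0 t1 t2 => [a0 b0 c0] [a1 b1 c1] [a2 b2 c2].
rewrite (sC (k 2%N)) s02 mulr0 in a0; rewrite (sC (k 2%N)) s12 mulr0 in a1.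
rewrite s01 !mulr0 in b1; rewrite s02 !mulr0 in b2.
rewrite (sC (k 1%N)) s01 mulr0 in c0; rewrite s12 mulr0 in c2.
exists k; split=> //.
exact: (diagonal_Riemann sys (spans3_out kD) a0 a1 b1 b2 c0 c2 sp).
Qed.

(** Only the diagonal normal form of the bracket survives with nonzero brackets on g'; the nonreal
    and null forms contradict the system. *)
Lemma space_alternative f : frame G id (eps4 (-1) 1 1 1) f -> spans G 3 f D ->
  (exists2 k, round_frame (-1) 1 k & k 3%N = f 3%N) \/
  forall x y, q x (f 3%N) = 0 -> q y (f 3%N) = 0 -> br x y = 0.
Proof.
move=> frm fD; have sC := bracket_formC frm fD.
have [k [k3 nf]] := Lorentz_normal_form dim4 sC
  (@bracket_formDl f) (@bracket_formZl f) frm.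
have kD := spans3 k3 fD; have L3 := spans3_out kD.
case: nf => -[frk].
- case=> s01 s02 s12.
  have sys := frame_system dim4 frk Ein.
  have sp := adapted_spanning dim4 ndD frk kD isT.
  have [t tE] := oframe_brackets frm frk k3.
  have [t0 t1 t2] := And3 (tE 0%N) (tE 1%N) (tE 2%N).
  case: t0 t1 t2 => [a0 b0 c0] [a1 b1 c1] [a2 b2 c2].
  rewrite (sC (k 2%N)) s02 mulr0 in a0; rewrite (sC (k 2%N)) s12 mulr0 in a1.
  rewrite s01 !mulr0 in b1; rewrite s02 !mulr0 in b2.
  rewrite (sC (k 1%N)) s01 mulr0 in c0; rewrite s12 mulr0 in c2.
  have [[z0 z1 z2] | rd] := diagonal_Lorentz sys L3 a0 a1 b1 b2 c0 c2 sp.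
    right; rewrite -k3; apply: (@space_br_eq0 id _ k frk erefl).
    by split; apply: (brc_eq0 frk) => -[|[|[|[|//]]]] _; rewrite ?L3.
  by left; exists k.
- case=> s02 s12 s00 s01; right.
  have sys := frame_system dim4 frk Ein.
  have sp := adapted_spanning dim4 ndD frk kD isT.
  have [t tE] := oframe_brackets frm frk k3.
  (* If the factor [t] were zero, the brackets on g' would vanish, which is the second alternative
     anyway. *)
  have [tz | tz] := eqVneq t 0.
    rewrite -k3; apply: (@space_br_eq0 id _ k frk erefl).
    by split; apply: (brc_eq0 frk) => l _; have [a b c] := tE l; rewrite ?a ?b ?c tz !mul0r ?mulr0.
  have [t0 t1 t2] := And3 (tE 0%N) (tE 1%N) (tE 2%N).
  case: t0 t1 t2 => [a0 b0 c0] [a1 b1 c1] [a2 b2 c2].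
  exfalso; apply: (complex_no_system sys L3 _ _ _ _ _ _ _ sp).
  + by rewrite a0 sC s02 mulr0.
  + by rewrite a1 sC s12 mulr0.
  + by rewrite b2 s02 !mulr0.
  + by rewrite c2 s12 mulr0.
  + by rewrite c0 b1 sC mulN1r opprK.
  + by rewrite c1 b0 s00; ring.
  by rewrite b1 mulN1r oppr_eq0 mulf_neq0.
case=> s00 s01 alt; right.
have sys := frame_system dim4 frk Ein.
have grk := nframe_gram frk.
have sp : spanning 3 (brc G k).
  by apply: (spanning_frame frk kD) => -[|[|[|//]]] _; rewrite grk.
have [t tE] := nframe_brackets frm frk k3.
have [tz | tz] := eqVneq t 0.
  rewrite -k3; apply: (@space_br_eq0 swap02 _ k frk erefl).
  by split; apply: (brc_eq0 frk) => l _; have [a b c] := tE l; rewrite ?a ?b ?c tz !mul0r.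
have [t0 t1 t2] := And3 (tE 0%N) (tE 1%N) (tE 2%N).
case: t0 t1 t2 => [a0 b0 c0] [a1 b1 c1] [a2 b2 c2]; exfalso.
case: alt => -[s1 s2].
  apply: (null_no_system1 sys L3 _ _ _ _ _ _ _ sp).
  - by rewrite a0 s00 mulr0.
  - by rewrite a1 s01 mulr0.
  - by rewrite b1 sC s1 mulr0.
  - by rewrite c0 sC s01 mulr0.
  - by rewrite c2 s1 mulr0.
  - by rewrite b0 a2 sC.
  by rewrite b2 mulf_neq0.
apply: (null_no_system2 sys L3 _ _ _ _ _ _ _ sp).
- by rewrite a0 s00 mulr0.
- by rewrite a1 s01 mulr0.
- by rewrite c0 sC s01 mulr0.
- by rewrite b0 a2 sC.
- by rewrite c1 a2 s1.
- by rewrite c2 b1 sC.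
by rewrite b1 sC mulf_neq0.
Qed.

Lemma adjoint_expand e0 d k i : frame G id (eps4 e0 1 1 d) k -> spans G 3 k D ->
  br (k 3%N) (k i) = (e0 * brc G k 3%N i 0%N) *: k 0%N +
    brc G k 3%N i 1%N *: k 1%N + brc G k 3%N i 2%N *: k 2%N.
Proof.
move=> frk kD; rewrite {1}(bracket_expand dim4 3 i frk) /sum4 /eps4 /= !mul1r.
by rewrite (spans3_out kD) mulr0 scale0r addr0.
Qed.

(** The null vector permitted by [abelian_form] is excluded in a null frame, which gives [H = 0].
    Among the normal forms of the symmetric part of the action, the diagonal and null ones would
    make g' too small, and the nonreal one is (A3). *)
Lemma derived_space_abelian f : frame G id (eps4 (-1) 1 1 1) f -> spans G 3 f D ->
  (forall x y, q x (f 3%N) = 0 -> q y (f 3%N) = 0 -> br x y = 0) -> case_A G.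
Proof.
move=> frm fD ab.
have abk k : (forall i, (i < 3)%N -> q (k i) (k 3%N) = 0) -> k 3%N = f 3%N ->
    [/\ forall l, brc G k 0%N 1%N l = 0, forall l, brc G k 1%N 2%N l = 0 &
      forall l, brc G k 2%N 0%N l = 0].
  by move=> k0 k3; split=> l; rewrite /brc ab ?metric0l // -?k3 k0.
have ok h a b c d (fr : frame G id (eps4 a b c d) h) i : (i < 3)%N -> q (h i) (h 3%N) = 0.
  by have gr := oframe_gram fr; case: i => [|[|[|//]]] _; rewrite gr.
have nk h (fr : frame G swap02 (eps4 1 1 1 1) h) i : (i < 3)%N -> q (h i) (h 3%N) = 0.
  by have gr := nframe_gram fr; case: i => [|[|[|//]]] _; rewrite gr.
have [f01 f12 f20] := abk f (ok _ _ _ _ _ frm) erefl.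
have sp := adapted_spanning dim4 ndD frm fD isT.
have [h012] := abelian_form (frame_system dim4 frm Ein) (spans3_out fD) f01 f12 f20 sp.
set b0 := Hc G f 3%N 1%N 2%N; set b1 := Hc G f 3%N 2%N 0%N.
set b2 := Hc G f 3%N 0%N 1%N => bE.
have gr := oframe_gram frm.
have b00 : b0 = 0.
  have [// | b00] := eqVneq b0 0; exfalso.
  (* The kernel of the two-form H(f3, -, -) on the derived algebra. *)
  pose u := b0 *: f 0%N + b1 *: f 1%N + b2 *: f 2%N.
  have u0 : u != 0.
    apply: contra_neq b00 => u0; have : q u (f 0%N) = 0 by rewrite u0 metric0l.
    by rewrite !metricE !gr; lra.
  have uu : q u u = 0 by rewrite !metricE !gr; lra.
  have u3 : q u (f 3%N) = 0 by rewrite !metricE !gr; ring.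
  have kerH x : q x (f 3%N) = 0 -> H (f 3%N) u x = 0.
    move=> x3; rewrite (frame_expand dim4 frm x) /sum4 x3 mulr0 scale0r addr0.
    rewrite /u !form3E -!/(Hc G f _ _ _) (Hc23 G f 3 1 0) (Hc23 G f 3 2 1) (Hc23 G f 3 0 2).
    have Hii i : Hc G f 3%N i i = 0 by apply: form3_alt23.
    by rewrite !Hii -/b0 -/b1 -/b2; ring.
  have [k' [c [frk' k'3 c0 k'0]]] := null_frame dim4 frm u0 uu u3.
  (* The null vectors are exchanged to put the kernel vector at index 2, so that only the component
     of [H] on [k 3], [k 0], [k 1] can survive. *)
  pose k := vec4 (k' 2%N) (k' 1%N) (k' 0%N) (k' 3%N).
  have grk' := nframe_gram frk'.
  have frk : frame G swap02 (eps4 1 1 1 1) k by apply: nframe_intro; rewrite !grk'.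
  have k3 : k 3%N = f 3%N by [].
  have k2 : k 2%N = c *: u by [].
  clearbody k; have [k01 k12 k20] := abk k (nk _ frk) k3.
  have kD := spans3 k3 fD; have grk := nframe_gram frk.
  have h2 x : q x (f 3%N) = 0 -> Hc G k 3%N 2%N 0%N = 0 /\ Hc G k 3%N 1%N 2%N = 0.
    move=> _; rewrite (Hc23 G k 3 1 2) /Hc k2 k3 !form3Zm !kerH ?mulr0 ?oppr0 //;
      by rewrite -k3 grk.
  have [h320 h312] := h2 0 (metric0l _ _).
  have [h301 | h301] := eqVneq (Hc G k 3%N 0%N 1%N) 0; last first.
    apply: (abelian_null_form (frame_system dim4 frk Ein) (spans3_out kD) k01 k12 k20
      h312 h320 h301); exact: (spanning_frame frk kD (nk _ frk)).
  case/eqP: b00; rewrite /b0 /Hc (form_expand dim4 _ _ _ frk) -k3 /sum4 /swap02 /= !grk.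
  have Hc0 j l : (j < 4)%N -> (l < 4)%N -> Hc G k 3%N j l = 0.
    move=> j4 l4; rewrite (alt3E (Hc12 G k) (Hc23 G k)) //.
    by case: j {j4} => [|[|[|[|?]]]] //; case: l {l4} => [|[|[|[|?]]]] //=;
      rewrite ?(h301, h312, h320, oppr0).
  by rewrite !Hc0 //; ring.
have [b10 b20] : b1 = 0 /\ b2 = 0.
  rewrite b00 expr0n /= in bE; have p1 := sqr_ge0 b1; have p2 := sqr_ge0 b2.
  by split; apply: sqr_le0; lra.
have H0 : forall x y z, H x y z = 0 by apply: (form_eq0 dim4 frm).
have Hc0 h i j k : Hc G h i j k = 0 by apply: H0.
pose sig x y := q (br (f 3%N) x) y + q (br (f 3%N) y) x.
have [|||h [h3 nf]] := @Lorentz_normal_form _ _ G dim4 sig _ _ _ f frm.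
- by move=> x y; rewrite /sig addrC.
- by move=> x y z; rewrite /sig !brE !metricE; ring.
- by move=> x y z; rewrite /sig !brE !metricE; ring.
have sE i j : sig (h i) (h j) = brc G h 3%N i j + brc G h 3%N j i by rewrite /sig -h3.
have hD := spans3 h3 fD.
case: nf => -[frh].
- case=> s01 s02 s12; exfalso; rewrite !sE in s01 s02 s12.
  have [h01 h12 h20] := abk h (ok _ _ _ _ _ frh) h3.
  apply: (abelian_diagonal_ad (frame_system dim4 frh Ein) (spans3_out hD) h01 h12 h20
    (Hc0 _ _ _ _) (Hc0 _ _ _ _) (Hc0 _ _ _ _) (Hc0 _ _ _ _) _ _ _
    (adapted_spanning dim4 ndD frh hD isT)); lra.
- case=> s02 s12 s00 s01; rewrite !sE in s02 s12 s00 s01.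
  have [h01 h12 h20] := abk h (ok _ _ _ _ _ frh) h3.
  have [||||m02 m12 m10 mE] := abelian_complex_ad (frame_system dim4 frh Ein)
    (spans3_out hD) h01 h12 h20 (Hc0 _ _ _ _) (Hc0 _ _ _ _) (Hc0 _ _ _ _) (Hc0 _ _ _ _)
    _ _ _ _ (adapted_spanning dim4 ndD frh hD isT).
  + by lra.
  + by lra.
  + by lra.
  + by apply: contra_neq s01 => e; lra.
  have m20 : brc G h 3%N 2%N 0%N = 0 by lra.
  have m21 : brc G h 3%N 2%N 1%N = 0 by lra.
  have m11 : brc G h 3%N 1%N 1%N = - brc G h 3%N 0%N 0%N by lra.
  have ae i := adjoint_expand i frh hD.
  have [a0 a1 a2] := And3 (ae 0%N) (ae 1%N) (ae 2%N).
  rewrite m02 scale0r addr0 in a0; rewrite m10 m11 m12 scale0r addr0 in a1.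
  rewrite m20 m21 mulr0 !scale0r !add0r in a2.
  set A := brc G h 3%N 0%N 0%N in mE a0 a1; set B := brc G h 3%N 0%N 1%N in mE a0 a1 m10 s01.
  set C := brc G h 3%N 2%N 2%N in mE a2.
  (* As for derived planes, the sign of [B] is absorbed into the second vector to obtain a
     nonnegative entry. *)
  have B0 : B != 0 by apply: contra_neq s01; rewrite m10 => ->; rewrite addr0.
  have sg2 : Num.sg B ^+ 2 = 1 by rewrite sqr_sg B0.
  have Bs : B = Num.sg B * `|B| by rewrite -numEsg.
  have grh := oframe_gram frh.
  have frh' : frame G id (eps4 (-1) 1 1 1) (vec4 (h 0%N) (Num.sg B *: h 1%N) (h 2%N) (h 3%N)).
    by apply: oframe_intro; split; rewrite ?metricE ?grh ?mulrNN ?mulr1 ?mulr0 -?expr2.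
  have b12 : br (h 1%N) (h 2%N) = 0 by apply: (brc_eq0 frh).
  have b01 : br (h 0%N) (h 1%N) = 0 by apply: (brc_eq0 frh).
  have b02 : br (h 0%N) (h 2%N) = 0 by rewrite brC (brc_eq0 frh) ?oppr0.
  apply: (@case_A3_intro _ _ dim4 _ H0 _ _ _ _ _ _ frh' _ (- A) `|B| C) => //.
  + by rewrite !brE b12 b01 b02 !scaler0.
  + rewrite xpair_eqE oppr_eq0; apply/negP => /andP[/eqP A0 /eqP C0].
    by case/eqP: B0; apply: sqr_le0; rewrite mE A0 C0; lra.
  + by rewrite real_normK ?num_real // mE; ring.
  rewrite brZr a0 a1 a2; split=> //; rewrite ?scalerA ?mulN1r.
    by rewrite {1}Bs mulrC.
  rewrite scalerDr !scalerA [- A * _]mulrC; congr (_ *: _ + _).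
  by rewrite {2}Bs mulrN mulrA -expr2 sg2 mul1r.
case=> s00 s01 _; exfalso; rewrite !sE in s00 s01.
have [h01 h12 h20] := abk h (nk _ frh) h3.
apply: (abelian_null_ad (frame_system dim4 frh Ein) (spans3_out hD) h01 h12 h20
    (Hc0 _ _ _ _) (Hc0 _ _ _ _) (Hc0 _ _ _ _) (Hc0 _ _ _ _) _ _
    (spanning_frame frh hD (nk _ frh))); lra.
Qed.

Section RoundAxis.
Variables (e0 d : R) (k : nat -> g).
Hypothesis ed : (e0, d) = (-1, 1) \/ (e0, d) = (1, -1).
Hypothesis rk : round_frame e0 d k.

Lemma round_adjoint :
  [/\ br (k 3%N) (k 0%N) = brc G k 3%N 0%N 1%N *: k 1%N + brc G k 3%N 0%N 2%N *: k 2%N,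
    br (k 3%N) (k 1%N) =
      (- e0 * brc G k 3%N 0%N 1%N) *: k 0%N + brc G k 3%N 1%N 2%N *: k 2%N &
    br (k 3%N) (k 2%N) =
      (- e0 * brc G k 3%N 0%N 2%N) *: k 0%N - brc G k 3%N 1%N 2%N *: k 1%N].
Proof.
have [frk kD _ [_ _ _ _ [m00 m11 m22 [m10 m20 m21]]]] := rk.
split; rewrite (adjoint_expand _ frk kD).
- by rewrite m00 mulr0 scale0r add0r.
- by rewrite m11 m10 scale0r addr0 mulrN mulNr.
by rewrite m22 m20 m21 scale0r addr0 mulrN mulNr !scaleNr.
Qed.

(** The axis of the skew action of the normal on g', as for a rotation in space; its formula is the
    same in both signatures. *)
Definition axis := brc G k 3%N 1%N 2%N *: k 0%N - brc G k 3%N 0%N 2%N *: k 1%N +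
  brc G k 3%N 0%N 1%N *: k 2%N.

Lemma axis_adjoint : br (k 3%N) axis = 0.
Proof.
have [frk _ _ _] := rk; have [a0 a1 a2] := round_adjoint.
rewrite /axis !brE a0 a1 a2; apply: (frame_ext dim4 frk) => i _.
by rewrite !metricE; ring.
Qed.

Lemma axis_out : q axis (k 3%N) = 0.
Proof. by have [frk _ _ _] := rk; rewrite !metricE !(oframe_gram frk); ring. Qed.

Lemma axis_eq0 : axis = 0 -> forall i, (i < 4)%N -> br (k 3%N) (k i) = 0.
Proof.
have [frk _ _ _] := rk; have [a0 a1 a2] := round_adjoint => z0.
have gr := oframe_gram frk.
have [e1 _] : e0 * e0 = 1 /\ d * d = 1.
  by case: ed => -[-> ->]; rewrite ?mulrNN mulr1.
have zk j : q axis (k j) = 0 by rewrite z0 metric0l.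
have m12 : brc G k 3%N 1%N 2%N = 0.
  have := zk 0%N; rewrite !metricE !gr => e; rewrite -[LHS]mul1r -e1 -mulrA.
  rewrite [e0 * brc _ _ _ _ _](_ : _ = 0) ?mulr0 //; rewrite -[RHS]e; ring.
have m02 : brc G k 3%N 0%N 2%N = 0 by have := zk 1%N; rewrite !metricE !gr; lra.
have m01 : brc G k 3%N 0%N 1%N = 0 by have := zk 2%N; rewrite !metricE !gr; lra.
case=> [|[|[|[|//]]]] _; rewrite ?brxx ?a0 ?a1 ?a2 ?m01 ?m02 ?m12;
  by rewrite ?(mulr0, scale0r, addr0, oppr0).
Qed.

Lemma round_align i u : (i < 3)%N -> q u u = q (k i) (k i) -> q u (k 3%N) = 0 ->
  br (k 3%N) u = 0 -> exists h, round_frame e0 d h /\ br (h 3%N) (h i) = 0.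
Proof.
have [frk _ _ _] := rk => i3 uu u3 bu; have gr := oframe_gram frk.
have i4 : (i < 4)%N by apply: ltnW.
have ki : q (k i) (k i) != 0.
  have [gt grk] := frk; have [_ _ _ e1] := gt i i4; rewrite grk //= eqxx.
  by apply: contra_eq_neq e1 => ->; rewrite mulr0 eq_sym oner_eq0.
have [h [frh hu hfix]] := move_frame frk i4 ki uu.
have h3 : h 3%N = k 3%N.
  apply: hfix; last by rewrite metricC.
  by case: i i3 {uu bu i4 ki hu} => [|[|[|//]]] _; rewrite gr.
exists h; split; first exact: round_reframe ed rk frh h3.
by rewrite h3; case: hu => ->; rewrite ?brNr bu ?oppr0.
Qed.
End RoundAxis.

Lemma round_Riemann k : round_frame 1 (-1) k ->
  exists h, round_frame 1 (-1) h /\ br (h 3%N) (h 0%N) = 0.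
Proof.
move=> rk; have ed : (1, -1) = (-1, 1) :> R * R \/ (1, -1) = (1, -1) :> R * R by right.
have [frk _ _ _] := rk; have gr := oframe_gram frk.
have [z0 | z0] := eqVneq (axis k) 0; first by exists k; rewrite (axis_eq0 ed rk z0).
have zz : q (axis k) (axis k) != 0.
  rewrite (frame_norm dim4 _ _ frk) /sum4 /eps4 /= (axis_out rk) mulr0 addr0 !mul1r -!expr2.
  apply: contra_neq z0 => e.
  have p0 := sqr_ge0 (q (axis k) (k 0%N)); have p1 := sqr_ge0 (q (axis k) (k 1%N)).
  have p2 := sqr_ge0 (q (axis k) (k 2%N)).
  apply: (frame_ext dim4 frk) => -[|[|[|[|//]]]] _; rewrite metric0l ?(axis_out rk) //;
    apply: sqr_le0; lra.
have [c [_ [[c1 _] | [_ neg]]]] := unit_vector zz; last first.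
  have : 0 <= q (axis k) (axis k).
    rewrite (frame_norm dim4 _ _ frk) /sum4 /eps4 /= (axis_out rk) mulr0 addr0 !mul1r -!expr2.
    by rewrite !addr_ge0 ?sqr_ge0.
  by rewrite leNgt neg.
apply: (@round_align 1 (-1) k ed rk 0%N (c *: axis k)) => //.
- by rewrite gr.
- by rewrite metricZl (axis_out rk) mulr0.
by rewrite brZr (axis_adjoint rk) scaler0.
Qed.

(** The causal character of the axis decides: a timelike axis becomes [h 0], a spacelike one [h 2],
    and a null one [h 0 + h 2] up to a factor, where a boost removes the remaining parameter. These
    are the sources of the three subcases of (B2). *)
Lemma round_Lorentz k : round_frame (-1) 1 k -> exists h, round_frame (-1) 1 h /\
  [\/ br (h 3%N) (h 0%N) = 0, br (h 3%N) (h 2%N) = 0 |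
    [/\ br (h 3%N) (h 0%N) = h 1%N, br (h 3%N) (h 1%N) = h 0%N + h 2%N &
        br (h 3%N) (h 2%N) = - h 1%N]].
Proof.
move=> rk; have ed : (-1, 1) = (-1, 1) :> R * R \/ (-1, 1) = (1, -1) :> R * R by left.
have [frk _ _ _] := rk; have gr := oframe_gram frk.
have [z0 | z0] := eqVneq (axis k) 0.
  by exists k; split=> //; apply: Or31; rewrite (axis_eq0 ed rk z0).
have zu c : q (c *: axis k) (k 3%N) = 0 by rewrite metricZl (axis_out rk) mulr0.
have bu c : br (k 3%N) (c *: axis k) = 0 by rewrite brZr (axis_adjoint rk) scaler0.
have [zz | zz] := eqVneq (q (axis k) (axis k)) 0; last first.
  have [c [_ [[c1 _] | [c1 _]]]] := unit_vector zz.
    have [|h [rh h2]] := @round_align _ _ _ ed rk 2%N _ isT _ (zu c) (bu c).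
      by rewrite gr.
    by exists h; split=> //; apply: Or32.
  have [|h [rh h2]] := @round_align _ _ _ ed rk 0%N _ isT _ (zu c) (bu c).
    by rewrite gr.
  by exists h; split=> //; apply: Or31.
set m0 := brc G k 3%N 1%N 2%N; set m1 := brc G k 3%N 0%N 2%N.
set m2 := brc G k 3%N 0%N 1%N.
have mE : m1 ^+ 2 + m2 ^+ 2 = m0 ^+ 2.
  by move: zz; rewrite !metricE !gr -/m0 -/m1 -/m2; lra.
have m00 : m0 != 0.
  apply: contra_neq z0 => m00; rewrite m00 expr0n /= in mE.
  have p1 := sqr_ge0 m1; have p2 := sqr_ge0 m2.
  have m10 : m1 = 0 by apply: sqr_le0; lra.
  have m20 : m2 = 0 by apply: sqr_le0; lra.
  by rewrite /axis -/m0 -/m1 -/m2 m00 m10 m20 !scale0r oppr0 !addr0.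
(* Up to the factor [m0] the null axis is [k 0] plus this unit spacelike vector, which is then moved
   to index 2. *)
pose w := (- m1 / m0) *: k 1%N + (m2 / m0) *: k 2%N.
have ww : q w w = q (k 2%N) (k 2%N).
  rewrite !metricE !gr; transitivity ((m1 ^+ 2 + m2 ^+ 2) / m0 ^+ 2); first by field.
  by rewrite mE divff // expf_neq0.
have zw : m0^-1 *: axis k = k 0%N + w.
  rewrite /axis -/m0 -/m1 -/m2 !scalerDr scalerN !scalerA mulVf // scale1r -addrA.
  by rewrite -scaleNr /w; congr (_ + (_ *: _ + _ *: _)); rewrite ?mulNr mulrC.
have [||h [frh hw hfix]] := @move_frame _ _ G _ _ k 2%N w frk isT.
- by rewrite gr oner_eq0.
- by [].
have h0 : h 0%N = k 0%N by apply: hfix; rewrite ?metricE !gr //; ring.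
have h3 : h 3%N = k 3%N by apply: hfix; rewrite ?metricE !gr //; ring.
have [e [e1 we]] : exists e, e * e = 1 /\ w = e *: h 2%N.
  case: hw => hw; first by exists 1; rewrite mulr1 scale1r.
  by exists (-1); rewrite mulrNN mulr1 scaleN1r hw opprK.
have grh := oframe_gram frh.
pose l := vec4 (h 0%N) (h 1%N) (e *: h 2%N) (h 3%N).
have frl : frame G id (eps4 (-1) 1 1 1) l.
  by apply: oframe_intro; split; rewrite ?metricE ?grh ?mulrNN ?mulr1 ?mulr0.
have rl : round_frame (-1) 1 l by apply: round_reframe ed rk frl h3.
have bl : br (l 3%N) (l 0%N + l 2%N) = 0 by rewrite /l /= h0 h3 -we -zw bu.
have grl := oframe_gram frl.
clearbody l; have [a0 a1 a2] := round_adjoint rl.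
move: bl; rewrite brDr a0 a2.
set b := brc G l 3%N 0%N 1%N in a0 a1 *; set b' := brc G l 3%N 0%N 2%N in a0 a2 *.
set b'' := brc G l 3%N 1%N 2%N in a1 a2 * => bl.
have b'0 : b' = 0.
  have := congr1 (fun x => q x (l 2%N)) bl; rewrite metric0l !metricE !grl; lra.
have b''E : b'' = b.
  have := congr1 (fun x => q x (l 1%N)) bl; rewrite metric0l !metricE !grl; lra.
rewrite b'0 !(mulr0, scale0r, addr0, add0r) in a0 a2; rewrite b''E opprK mul1r in a1 a2.
have [bz | bz] := eqVneq b 0.
  by exists l; split=> //; apply: Or31; rewrite a0 bz scale0r.
(* Since [p + r = b] and [p - r = b^-1], this boost multiplies the null vector [l 0 + l 2] by [b]
   and normalises the action to parameter one. *)
pose p := (b + b^-1) / 2; pose r := (b - b^-1) / 2.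
have pr : p ^+ 2 - r ^+ 2 = 1 by rewrite /p /r; field.
pose n := vec4 (p *: l 0%N + r *: l 2%N) (l 1%N) (r *: l 0%N + p *: l 2%N) (l 3%N).
have frn : frame G id (eps4 (-1) 1 1 1) n.
  apply: oframe_intro; first by rewrite mulrNN mulr1.
  - by split; rewrite ?metricE !grl //; lra.
  - by split; rewrite ?metricE !grl; ring.
  by split; rewrite ?metricE !grl; ring.
exists n; split; first exact: round_reframe ed rl frn erefl.
apply: Or33; rewrite /n /= !brE a0 a1 a2; split.
- rewrite scalerN !scalerA -scalerBl (_ : _ - _ = 1) ?scale1r //.
  by rewrite /p /r; field.
- have prb : p + r = b by rewrite /p /r; field.
  by rewrite addrACA -!scalerDl (addrC r) prb.
rewrite scalerN !scalerA -scalerBl (_ : _ - _ = -1) ?scaleN1r //.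
by rewrite /p /r; field.
Qed.

End CodimensionOne.

(** * Isomorphisms and adapted bases *)

Section IsoBasis.
Variable R : fieldType.

Lemma lie_br_sum (g : lieAlgebra R) n m (u : 'I_n -> R) (v : 'I_m -> R)
    (x : 'I_n -> g) (y : 'I_m -> g) :
  lie_br (\sum_i u i *: x i) (\sum_j v j *: y j) =
  \sum_i \sum_j u i *: (v j *: lie_br (x i) (y j)).
Proof.
rewrite linear_sumlz; apply: eq_bigr => i _.
rewrite linear_sumr; apply: eq_bigr => j _.
by rewrite linearZl_LR linearZr_LR.
Qed.

(** Structure constants are prescribed only for increasing pairs, the others being determined by
    antisymmetry. Two algebras sharing them are isomorphic, so isomorphisms reduce to bases. *)
Definition lie_structure n (g : lieAlgebra R) (b : n.-tuple g) (s : 'I_n -> 'I_n -> 'I_n -> R) :=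
  basis_of fullv b /\ forall i j : 'I_n, (i < j)%N ->
    lie_br b`_i b`_j = \sum_k s i j k *: b`_k.

Lemma lie_structure_iso n (g h : lieAlgebra R) (b : n.-tuple g) (c : n.-tuple h) s :
  lie_structure b s -> lie_structure c s -> lie_iso g h.
Proof.
pose s' (i j k : 'I_n) := if (i < j)%N then s i j k else if (j < i)%N then - s j i k else 0.
have ext (l : lieAlgebra R) (d : n.-tuple l) : lie_structure d s ->
    forall i j : 'I_n, lie_br d`_i d`_j = \sum_k s' i j k *: d`_k.
  case=> _ dE i j; rewrite /s'; case: ltngtP => ij; first exact: dE.
    by rewrite brC dE // -sumrN; apply: eq_bigr => k _; rewrite scaleNr.
  by rewrite ij brxx big1 // => k _; rewrite scale0r.
move=> bS cS; have bE := ext _ _ bS; have cE := ext _ _ cS.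
have [bb _] := bS; have [cb _] := cS.
have coordE (l : lieAlgebra R) (d : n.-tuple l) (db : basis_of fullv d) (k : 'I_n -> R) i :
    coord d i (\sum_j k j *: d`_j) = k i.
  by rewrite coord_sum_free // (basis_free db).
pose f x := \sum_i coord b i x *: c`_i.
have f_lin : linear f.
  move=> a x y; rewrite /f scaler_sumr -big_split /=; apply: eq_bigr => i _.
  by rewrite linearP scalerDl scalerA.
pose F : {linear g -> h} := HB.pack f (GRing.isLinear.Build _ _ _ _ _ f_lin).
have FE x : F x = f x by [].
have Fb (i : 'I_n) : F b`_i = c`_i.
  rewrite FE /f (bigD1 i) //= (coord_free i i (basis_free bb)) eqxx scale1r big1 ?addr0 //.
  by move=> j ji; rewrite (coord_free i j (basis_free bb)) eq_sym (negPf ji) scale0r.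
exists F; split.
  exists (fun y => \sum_i coord c i y *: b`_i) => [x|y]; rewrite FE /f.
    rewrite [RHS](coord_basis bb (memvf x)); apply: eq_bigr => i _.
    by rewrite coordE.
  by under eq_bigr do rewrite coordE //; rewrite -(coord_basis cb (memvf y)).
move=> x y; rewrite (coord_basis bb (memvf x)) (coord_basis bb (memvf y)).
have FZ a z : F (a *: z) = a *: F z by apply: linearZ.
have FS (k : 'I_n -> R) : F (\sum_i k i *: b`_i) = \sum_i k i *: c`_i.
  by rewrite linear_sum; apply: eq_bigr => i _; rewrite FZ Fb.
rewrite !FS !lie_br_sum linear_sum; apply: eq_bigr => i _.
rewrite linear_sum; apply: eq_bigr => j _.
by rewrite !FZ bE FS cE.
Qed.

Lemma lie_iso_structure n (g h : lieAlgebra R) (c : n.-tuple h) s :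
  lie_iso g h -> lie_structure c s -> exists b : n.-tuple g, lie_structure b s.
Proof.
case=> f [[f' fK f'K] fbr] [cb cE].
have f'_lin : linear f'.
  by move=> a x y; apply: (can_inj fK); rewrite linearP !f'K.
pose F : {linear h -> g} := HB.pack f' (GRing.isLinear.Build _ _ _ _ _ f'_lin).
have FE x : F x = f' x by [].
have F0 : F 0 = 0 by rewrite linear0.
have nthF (i : 'I_n) : [tuple of map F c]`_i = F c`_i.
  by rewrite (nth_map 0) // size_tuple.
exists [tuple of map F c]; split=> [|i j ij]; last first.
  rewrite !nthF !FE; apply: (can_inj fK); rewrite fbr !f'K cE // linear_sum.
  by apply: eq_bigr => k _; rewrite nthF FE linearZ f'K.
have dimE : \dim {:g} = n.
  have f0 : lker (linfun f) == 0%VS.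
    by apply/lker0P => x y; rewrite !lfunE => /(can_inj fK).
  have := limg_ker_dim (linfun f) fullv; rewrite (eqP f0) capv0 dimv0 add0n => <-.
  suff -> : (linfun f @: fullv)%VS = fullv by rewrite -(size_basis cb).
  apply/eqP; rewrite eqEsubv subvf /=; apply/subvP => y _.
  by rewrite -[y]f'K -[f (f' y)]lfunE memv_img ?memvf.
rewrite basisEfree subvf andTb; apply/andP; split; last by rewrite dimE /= size_map size_tuple.
apply/freeP => k k0 i.
have e0 : \sum_j k j *: c`_j = 0.
  rewrite -[LHS]f'K -FE; have -> : F (\sum_j k j *: c`_j) = 0; last exact: linear0.
  rewrite linear_sum -[RHS]k0; apply: eq_bigr => j _.
  by rewrite nthF linearZ.
by move/freeP: (basis_free cb); apply.
Qed.

End IsoBasis.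

Section Bases.
Variable R : realType.
Implicit Types g h : lieAlgebra R.

Definition ad_basis g (e1 e2 e3 X : g) (rows : seq (seq R)) :=
  [/\ basis_of fullv [:: e1; e2; e3; X],
      [/\ lie_br e1 e2 = 0, lie_br e1 e3 = 0 & lie_br e2 e3 = 0] &
      acts_by (lie_br X) [:: e1; e2; e3] (mx_of_rows 3 3 rows)].

(** The minus sign arises because the increasing pair is [(e_i, X)], whose bracket is minus the
    adjoint action of [X]. *)
Definition ad_coef (rows : seq (seq R)) (i j k : 'I_4) : R :=
  if (j == 3%N :> nat) && (k < 3)%N then - (nth [::] rows k)`_i else 0.

Lemma ad_basisP g (e1 e2 e3 X : g) rows : ad_basis e1 e2 e3 X rows <->
  lie_structure [tuple e1; e2; e3; X] (ad_coef rows).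
Proof.
have sumE (i : 'I_3) : \sum_(k < 4) ad_coef rows (widen_ord (leqnSn 3) i) ord_max k *:
    [tuple e1; e2; e3; X]`_k =
    - \sum_(k < 3) (mx_of_rows 3 3 rows : 'M[R]_3) k i *: [:: e1; e2; e3]`_k.
  rewrite !big_ord_recl !big_ord0 /ad_coef !mxE /= scale0r !scaleNr.
  by rewrite !opprD oppr0 !addr0.
split=> [[bas [b12 b13 b23] act] | [bas brs]].
  split=> // i j; have z k l : (l < 3)%N -> ad_coef rows k (inord l) = fun=> 0.
    by move=> l3; rewrite /ad_coef inordK ?ltn_eqF // ltnW.
  have zero (k l : 'I_4) : (l < 3)%N ->
      \sum_m ad_coef rows k l m *: [tuple e1; e2; e3; X]`_m = 0.
    by move=> l3; rewrite big1 // => m _; rewrite /ad_coef ltn_eqF //= scale0r.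
  case: (ltnP j 3) => j3.
    rewrite zero //; case: i => [[|[|[|[|//]]]] i4]; case: j j3 => [[|[|[|[|//]]]] j4] //= _ _.
  have -> : j = ord_max by apply: val_inj; apply/eqP; rewrite eqn_leq j3 -ltnS ltn_ord.
  move=> /= i3; have -> : i = widen_ord (leqnSn 3) (Ordinal i3) by apply: val_inj.
  rewrite sumE /= brC -act.
  by case: i i3 => [[|[|[|//]]] ? ?].
split=> // [|j].
  have br0 (i j : 'I_4) : (i < j)%N -> (j < 3)%N ->
      lie_br [tuple e1; e2; e3; X]`_i [tuple e1; e2; e3; X]`_j = 0.
    by move=> ij j3; rewrite brs // big1 // => k _; rewrite /ad_coef ltn_eqF //= scale0r.
  by split; [have := br0 (inord 0) (inord 1) | have := br0 (inord 0) (inord 2) |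
    have := br0 (inord 1) (inord 2)]; rewrite !inordK //=; apply.
have := brs (widen_ord (leqnSn 3) j) ord_max (ltn_ord j).
rewrite sumE /= brC => /oppr_inj <-.
by case: j => [[|[|[|//]]] ?].
Qed.

Lemma ad_basis_iso g h (e1 e2 e3 X : g) (f1 f2 f3 Y : h) rows :
  ad_basis e1 e2 e3 X rows -> ad_basis f1 f2 f3 Y rows -> lie_iso g h.
Proof. by move=> /ad_basisP gS /ad_basisP hS; apply: lie_structure_iso gS hS. Qed.

Lemma tuple4E (V : Type) (t : 4.-tuple V) : exists x y z w, t = [tuple x; y; z; w].
Proof.
case: t => -[|x [|y [|z [|w [|//]]]]] // sz.
by exists x, y, z, w; apply: val_inj.
Qed.

Lemma ad_basis_pullback g h (f1 f2 f3 Y : h) rows : lie_iso g h ->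
  ad_basis f1 f2 f3 Y rows -> exists e1 e2 e3 X : g, ad_basis e1 e2 e3 X rows.
Proof.
move=> iso /ad_basisP /(lie_iso_structure iso)[b bS].
have [e1 [e2 [e3 [X bE]]]] := tuple4E b; exists e1, e2, e3, X.
by apply/ad_basisP; rewrite -bE.
Qed.

(* The structure constants of so(3) and so(2, 1), for ka = 1 and ka = -1. *)
Definition so_coef n (ka : R) (i j k : 'I_n) : R :=
  match (i : nat), (j : nat), (k : nat) with
  | 0%N, 1%N, 2%N => 1 | 1%N, 2%N, 0%N => ka | 0%N, 2%N, 1%N => -1 | _, _, _ => 0
  end.

Definition so_brackets g ka (e1 e2 e3 : g) :=
  [/\ lie_br e1 e2 = e3, lie_br e2 e3 = ka *: e1 & lie_br e3 e1 = e2].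

Definition so_basis g ka (e1 e2 e3 : g) :=
  basis_of fullv [:: e1; e2; e3] /\ so_brackets ka e1 e2 e3.

Definition so_sum_basis g ka (e1 e2 e3 Z : g) :=
  [/\ basis_of fullv [:: e1; e2; e3; Z], so_brackets ka e1 e2 e3 &
      [/\ lie_br e1 Z = 0, lie_br e2 Z = 0 & lie_br e3 Z = 0]].

Lemma so_basisP g ka (e1 e2 e3 : g) : so_basis ka e1 e2 e3 ->
  lie_structure [tuple e1; e2; e3] (@so_coef 3 ka).
Proof.
case=> bas [b12 b23 b31]; split=> // -[[|[|[|//]]] ?] [[|[|[|//]]] ?] //= _;
  rewrite !big_ord_recl big_ord0 /so_coef /= ?scale0r ?scale1r ?addr0 ?add0r //.
by rewrite brC b31 scaleN1r.
Qed.

Lemma so_sum_basisP g ka (e1 e2 e3 Z : g) : so_sum_basis ka e1 e2 e3 Z <->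
  lie_structure [tuple e1; e2; e3; Z] (@so_coef 4 ka).
Proof.
split=> [[bas [b12 b23 b31] [z1 z2 z3]] | [bas brs]].
  split=> // -[[|[|[|[|//]]]] ?] [[|[|[|[|//]]]] ?] //= _;
    rewrite !big_ord_recl big_ord0 /so_coef /= ?scale0r ?scale1r ?addr0 ?add0r //.
  by rewrite brC b31 scaleN1r.
have o (m : nat) : (m < 4)%N -> (inord m : 'I_4) = m :> nat by move=> ?; rewrite inordK.
have b i j : (i < j)%N -> (j < 4)%N -> lie_br [:: e1; e2; e3; Z]`_i [:: e1; e2; e3; Z]`_j =
    \sum_(k < 4) so_coef ka (inord i : 'I_4) (inord j) k *: [:: e1; e2; e3; Z]`_k.
  move=> ij j4; have i4 : (i < 4)%N by apply: ltn_trans j4.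
  by have := brs (inord i) (inord j); rewrite /= !o //; apply.
split=> //; split.
- rewrite [LHS](b 0%N 1%N) // !big_ord_recl big_ord0 /so_coef !o //=.
  by rewrite !scale0r scale1r !add0r !addr0.
- rewrite [LHS](b 1%N 2%N) // !big_ord_recl big_ord0 /so_coef !o //=.
  by rewrite !scale0r !addr0.
- rewrite brC [X in - X](b 0%N 2%N) // !big_ord_recl big_ord0 /so_coef !o //=.
  by rewrite !scale0r !addr0 add0r scaleN1r opprK.
- rewrite [LHS](b 0%N 3%N) // !big_ord_recl big_ord0 /so_coef !o //=.
  by rewrite !scale0r !addr0.
- rewrite [LHS](b 1%N 3%N) // !big_ord_recl big_ord0 /so_coef !o //=.
  by rewrite !scale0r !addr0.
rewrite [LHS](b 2%N 3%N) // !big_ord_recl big_ord0 /so_coef !o //=.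
by rewrite !scale0r !addr0.
Qed.

Lemma so_basis_iso g h ka (e1 e2 e3 : g) (f1 f2 f3 : h) :
  so_basis ka e1 e2 e3 -> so_basis ka f1 f2 f3 -> lie_iso g h.
Proof. by move=> /so_basisP gS /so_basisP hS; apply: lie_structure_iso gS hS. Qed.

Lemma so_sum_basis_iso g h ka (e1 e2 e3 Z : g) (f1 f2 f3 Y : h) :
  so_sum_basis ka e1 e2 e3 Z -> so_sum_basis ka f1 f2 f3 Y -> lie_iso g h.
Proof. by move=> /so_sum_basisP gS /so_sum_basisP hS; apply: lie_structure_iso gS hS. Qed.

Lemma so_sum_basis_pullback g h ka (f1 f2 f3 Y : h) : lie_iso g h ->
  so_sum_basis ka f1 f2 f3 Y -> exists e1 e2 e3 Z : g, so_sum_basis ka e1 e2 e3 Z.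
Proof.
move=> iso /so_sum_basisP /(lie_iso_structure iso)[b bS].
have [e1 [e2 [e3 [X bE]]]] := tuple4E b; exists e1, e2, e3, X.
by apply/so_sum_basisP; rewrite -bE.
Qed.

Lemma span4P (V : vectType R) (e1 e2 e3 e4 x : V) :
  reflect (exists a b c d, x = a *: e1 + b *: e2 + c *: e3 + d *: e4)
    (x \in <<[:: e1; e2; e3; e4]>>%VS).
Proof.
apply: (iffP idP) => [|[a [b [c [d ->]]]]]; last first.
  by rewrite !rpredD // memvZ // memv_span // !inE eqxx ?orbT.
rewrite !span_cons span_nil addv0 => /memv_addP[y /vlineP[a ->] [z + ->]].
case/memv_addP=> u /vlineP[b ->] [v + ->].
case/memv_addP=> w /vlineP[c ->] [t /vlineP[d ->] ->].
by exists a, b, c, d; rewrite !addrA.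
Qed.

Lemma basis4_intro (V : vectType R) (e1 e2 e3 e4 : V) :
  (forall a b c d, a *: e1 + b *: e2 + c *: e3 + d *: e4 = 0 ->
    [/\ a = 0, b = 0, c = 0 & d = 0]) ->
  (forall x, exists a b c d, x = a *: e1 + b *: e2 + c *: e3 + d *: e4) ->
  basis_of fullv [:: e1; e2; e3; e4].
Proof.
move=> fr sp; apply/andP; split.
  by rewrite eqEsubv subvf; apply/subvP => x _; apply/span4P.
apply/(@freeP _ _ _ [tuple e1; e2; e3; e4]) => k.
rewrite !big_ord_recl big_ord0 /= addr0 !addrA => /fr[k0 k1 k2 k3] i.
case: i => [[|[|[|[|//]]]] i4]; [rewrite -k0 | rewrite -k1 | rewrite -k2 | rewrite -k3];
  by congr k; apply: val_inj.
Qed.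

Lemma basis3_intro (V : vectType R) (e1 e2 e3 : V) :
  (forall a b c, a *: e1 + b *: e2 + c *: e3 = 0 -> [/\ a = 0, b = 0 & c = 0]) ->
  (forall x, exists a b c, x = a *: e1 + b *: e2 + c *: e3) ->
  basis_of fullv [:: e1; e2; e3].
Proof.
move=> fr sp; apply/andP; split.
  by rewrite eqEsubv subvf; apply/subvP => x _; apply/span3P.
apply/(@freeP _ _ _ [tuple e1; e2; e3]) => k.
rewrite !big_ord_recl big_ord0 /= addr0 !addrA => /fr[k0 k1 k2] i.
case: i => [[|[|[|//]]] i4]; [rewrite -k0 | rewrite -k1 | rewrite -k2];
  by congr k; apply: val_inj.
Qed.

Lemma free3 (V : vectType R) (e1 e2 e3 : V) a b c : free [:: e1; e2; e3] ->
  a *: e1 + b *: e2 + c *: e3 = 0 -> [/\ a = 0, b = 0 & c = 0].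
Proof.
move/(@freeP _ _ _ [tuple e1; e2; e3]) => fr e.
have := fr (fun i => [:: a; b; c]`_i); rewrite !big_ord_recl big_ord0 /= addr0 addrA.
move=> /(_ e) k0; split; [exact: (k0 0) | exact: (k0 1) | ].
by have := k0 (inord 2); rewrite inordK.
Qed.

Lemma so_sum_basis_sum g ka (e1 e2 e3 : g) : so_basis ka e1 e2 e3 ->
  so_sum_basis (g := sum_lie g (ab_lie R^o)) ka (e1, 0) (e2, 0) (e3, 0) (0, 1).
Proof.
case=> bas [b12 b23 b31]; split.
- apply: basis4_intro => [a b c d [/= eg eR]|[x y]].
    have [||-> -> ->] := @free3 _ e1 e2 e3 a b c; first exact: basis_free bas.
      by rewrite scaler0 addr0 in eg.
    by split=> //; move: eR; rewrite !scaler0 !add0r /GRing.scale /= mulr1.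
  have : x \in <<[:: e1; e2; e3]>>%VS by rewrite (span_basis bas) memvf.
  case/span3P=> a [b [c ->]]; exists a, b, c, y.
  by congr pair; rewrite /= !scaler0 ?addr0 // !add0r /GRing.scale /= mulr1.
- by split; rewrite /lie_br /= /sum_br /= ?b12 ?b23 ?b31 //; congr pair; rewrite /= scaler0.
by split; rewrite /lie_br /= /sum_br /= linear0r.
Qed.

Section SoModel.
Variable (ka : R).
Hypothesis ka1 : ka * ka = 1.
Let J : 'M[R]_3 := diag_mx (\row_(i < 3) [:: 1; 1; ka]`_i).

(** The general element of the orthogonal algebra of the form with signs [1, 1, ka], in coordinates
    whose unit vectors satisfy [so_brackets]. *)
Definition so_elt (a b c : R) : 'M[R]_3 := mx_of_rows 3 3
  [:: [:: 0; - a; c * ka]; [:: a; 0; - b * ka]; [:: - c; b; 0]].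

Lemma so_eltP (A : 'M[R]_3) : A^T *m J + J *m A = 0 ->
  exists a b c, A = so_elt a b c.
Proof.
move=> AJ; have e i j : A j i * J j j + J i i * A i j = 0.
  have := congr1 (fun B : 'M_3 => B i j) AJ; rewrite !mxE.
  rewrite (bigD1 j) //= big1 ?addr0; last first.
    by move=> k kj; rewrite !mxE (negPf kj) mulr0n mulr0.
  rewrite (bigD1 i) //= big1 ?addr0; last first.
    by move=> k ki; rewrite !mxE eq_sym (negPf ki) mulr0n mul0r.
  by rewrite !mxE.
have Jk (i : nat) (i3 : (i < 3)%N) : J (inord i) (inord i) = [:: 1; 1; ka]`_i.
  by rewrite !mxE eqxx mulr1n inordK.
have {}e i j : (i < 3)%N -> (j < 3)%N -> A (inord j) (inord i) * [:: 1; 1; ka]`_j +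
    [:: 1; 1; ka]`_i * A (inord i) (inord j) = 0.
  by move=> i3 j3; rewrite -!Jk.
exists (A (inord 1) (inord 0)), (A (inord 2) (inord 1)), (- A (inord 2) (inord 0)).
have ka0 : ka != 0 by apply: contra_eq_neq ka1 => ->; rewrite mulr0 eq_sym oner_eq0.
have := e 0%N 0%N isT isT; have := e 1%N 1%N isT isT; have := e 2%N 2%N isT isT.
have := e 0%N 1%N isT isT; have := e 0%N 2%N isT isT; have := e 1%N 2%N isT isT.
rewrite /= => e12 e02 e01 e22 e11 e00.
apply/matrixP => i j; rewrite -[i]inord_val -[j]inord_val.
case: i => [[|[|[|//]]] ?]; case: j => [[|[|[|//]]] ?]; rewrite !mxE !inordK //=; try lra.
have : 2 * (ka * A (inord 2) (inord 2)) = 0 by rewrite -[RHS]e22; ring.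
by move/eqP; rewrite mulf_eq0 pnatr_eq0 mulf_eq0 (negPf ka0) /= => /eqP.
Qed.

Lemma so_elt_mem a b c : so_elt a b c \in so_space J.
Proof.
rewrite mem_so /J mul_mx_diag mul_diag_mx; apply/eqP/matrixP => i j.
by case: i => [[|[|[|//]]] ?]; case: j => [[|[|[|//]]] ?]; rewrite !mxE /=; ring.
Qed.

Lemma so_eltE a b c :
  so_elt a b c = a *: so_elt 1 0 0 + b *: so_elt 0 1 0 + c *: so_elt 0 0 1.
Proof.
apply/matrixP => i j.
by case: i => [[|[|[|//]]] ?]; case: j => [[|[|[|//]]] ?]; rewrite !mxE /=; ring.
Qed.

Lemma so_lie_basis : exists e1 e2 e3 : so_lie J, so_basis ka e1 e2 e3.
Proof.
pose P a b c : so_lie J := vsproj (so_space J) (so_elt a b c).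
have PK a b c : vsval (P a b c) = so_elt a b c by rewrite vsprojK ?so_elt_mem.
have PE a b c : a *: P 1 0 0 + b *: P 0 1 0 + c *: P 0 0 1 = P a b c.
  by apply: subvs_inj; rewrite !linearD !linearZ /= !PK -so_eltE.
exists (P 1 0 0), (P 0 1 0), (P 0 0 1); split.
  apply: basis3_intro => [a b c | x].
    rewrite PE => /(congr1 vsval); rewrite PK linear0 => e.
    have [e1 [e2 e3]] := conj (congr1 (fun A : 'M_3 => A (inord 1) (inord 0)) e)
      (conj (congr1 (fun A : 'M_3 => A (inord 2) (inord 1)) e)
      (congr1 (fun A : 'M_3 => A (inord 2) (inord 0)) e)).
    rewrite /so_elt !mxE !inordK //= in e1 e2 e3.
    by split=> //; apply/eqP; rewrite -oppr_eq0 e3.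
  have := subvsP x; rewrite mem_so => /eqP /so_eltP[a [b [c xE]]].
  by exists a, b, c; rewrite PE; apply: subvs_inj; rewrite PK.
have brP (A B C : so_lie J) : gl_br (vsval A) (vsval B) = vsval C -> lie_br A B = C.
  by move=> e; apply: subvs_inj; exact: etrans (vsval_sub_br (@so_subalgebra _ _ J) A B) e.
split; apply: brP; rewrite ?linearZ /= !PK; apply/matrixP => i j;
  case: i => [[|[|[|//]]] ?]; case: j => [[|[|[|//]]] ?];
  rewrite /gl_br !mxE !big_ord_recl !big_ord0 !mxE /=.
all: try by ring.
all: by rewrite -[RHS]ka1; ring.
Qed.
End SoModel.

Lemma so3_basis : exists e1 e2 e3 : so3 R, so_basis 1 e1 e2 e3.
Proof.
rewrite /so3; have -> : (1%:M : 'M[R]_3) = diag_mx (\row_(i < 3) [:: 1; 1; 1]`_i).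
  apply/matrixP => i j; rewrite !mxE.
  by case: i => [[|[|[|//]]] ?].
exact: (so_lie_basis (mulr1 1)).
Qed.

Lemma so21_basis : exists e1 e2 e3 : so21 R, so_basis (-1) e1 e2 e3.
Proof. by apply: so_lie_basis; rewrite mulrNN mulr1. Qed.

Lemma basis4_change (V : vectType R) (e1 e2 e3 e4 f1 f2 f3 f4 : V) :
  basis_of fullv [:: e1; e2; e3; e4] ->
  (let U := <<[:: f1; f2; f3; f4]>>%VS in
   [/\ e1 \in U, e2 \in U, e3 \in U & e4 \in U]) ->
  basis_of fullv [:: f1; f2; f3; f4].
Proof.
move=> bas [m1 m2 m3 m4]; rewrite basisEdim; apply/andP; split; last first.
  by rewrite (size_basis (X := [tuple e1; e2; e3; e4]) bas).
rewrite -(span_basis bas); apply/span_subvP => x.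
by rewrite !inE => /or4P[] /eqP ->.
Qed.

(** Derivations of the simple ideal are inner: if [X] acts on it like its element [z], then [X - z]
    commutes with it and spans the central summand. Division by [c] normalises the brackets. *)
Lemma so_sum_basis_intro g ka (e1 e2 e3 X z : g) c : c != 0 ->
  basis_of fullv [:: e1; e2; e3; X] ->
  [/\ lie_br e1 e2 = c *: e3, lie_br e2 e3 = (ka * c) *: e1 & lie_br e3 e1 = c *: e2] ->
  z \in <<[:: e1; e2; e3]>>%VS ->
  [/\ lie_br X e1 = lie_br z e1, lie_br X e2 = lie_br z e2 & lie_br X e3 = lie_br z e3] ->
  so_sum_basis ka (c^-1 *: e1) (c^-1 *: e2) (c^-1 *: e3) (X - z).
Proof.
move=> c0 bas [b12 b23 b31] zU [z1 z2 z3].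
have mem e (s : seq g) : c^-1 *: e \in s -> e \in <<s>>%VS.
  by move=> es; rewrite -[e]scale1r -(mulfV c0) -scalerA memvZ // memv_span.
split.
- apply: basis4_change bas _ => U.
  have [m1 m2 m3] : [/\ e1 \in U, e2 \in U & e3 \in U].
    by split; apply: mem; rewrite !inE eqxx ?orbT.
  split=> //; suff: (X - z) + z \in U by rewrite subrK.
  apply: memvD; first by rewrite memv_span // !inE eqxx ?orbT.
  by case/span3P: zU => x [y [w ->]]; rewrite !rpredD // memvZ.
- by split; rewrite linearZl_LR linearZr_LR /= ?b12 ?b23 ?b31 !scalerA;
    congr (_ *: _); field.
by split; rewrite linearZl_LR /= brC linearBl /= ?z1 ?z2 ?z3 subrr oppr0 scaler0.
Qed.

Lemma derived_so_basis g ka (e1 e2 e3 : g) c : c != 0 ->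
  basis_of (derived g) [:: e1; e2; e3] ->
  [/\ lie_br e1 e2 = c *: e3, lie_br e2 e3 = (ka * c) *: e1 & lie_br e3 e1 = c *: e2] ->
  exists f1 f2 f3 : derived_lie g, so_basis ka f1 f2 f3.
Proof.
move=> c0 bas [b12 b23 b31]; pose P x : derived_lie g := vsproj (derived g) (c^-1 *: x).
have [m1 m2 m3] : [/\ e1 \in derived g, e2 \in derived g & e3 \in derived g].
  by split; apply: (basis_mem bas); rewrite !inE eqxx ?orbT.
have PK x : x \in derived g -> vsval (P x) = c^-1 *: x.
  by move=> xD; rewrite vsprojK // memvZ.
have PE x y z : vsval (x *: P e1 + y *: P e2 + z *: P e3) =
    (x / c) *: e1 + (y / c) *: e2 + (z / c) *: e3.
  by rewrite !linearD !linearZ /= !PK // !scalerA.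
exists (P e1), (P e2), (P e3); split.
  apply: basis3_intro => [x y z | v].
    move=> /(congr1 vsval); rewrite PE linear0 => /(free3 (basis_free bas))[x0 y0 z0].
    have div0 t : t / c = 0 -> t = 0.
      by move/eqP; rewrite mulf_eq0 invr_eq0 (negPf c0) orbF => /eqP.
    by split; apply: div0.
  have : vsval v \in <<[:: e1; e2; e3]>>%VS by rewrite (span_basis bas); apply: subvsP.
  case/span3P=> x [y [z vE]].
  exists (x * c), (y * c), (z * c); apply: subvs_inj.
  by rewrite PE !mulfK.
have brP (x y z : derived_lie g) : lie_br (vsval x) (vsval y) = vsval z -> lie_br x y = z.
  move=> e; apply: subvs_inj; exact: etrans (vsval_sub_br (@derived_subalgebra _ g) x y) e.
by split; apply: brP; rewrite ?linearZ /= !PK // linearZl_LR linearZr_LR /= ?b12 ?b23 ?b31 !scalerA;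
  congr (_ *: _); field.
Qed.

End Bases.

(** * The simple cases *)

Lemma det_mx3 (R : comNzRingType) (M : 'M[R]_3) : let m i j := M (inord i) (inord j) in
  \det M = m 0%N 0%N * (m 1%N 1%N * m 2%N 2%N - m 1%N 2%N * m 2%N 1%N) -
    m 0%N 1%N * (m 1%N 0%N * m 2%N 2%N - m 1%N 2%N * m 2%N 0%N) +
    m 0%N 2%N * (m 1%N 0%N * m 2%N 1%N - m 1%N 1%N * m 2%N 0%N).
Proof.
move=> m; have mE i j : M i j = m i j by rewrite /m !inord_val.
rewrite (expand_det_row _ ord0) !big_ord_recl big_ord0 /cofactor.
rewrite !(expand_det_row _ (ord0 : 'I_2)) !big_ord_recl !big_ord0 /cofactor !det_mx11.
by rewrite !mxE !mE /=; ring.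
Qed.

Section CaseB.
Variables (R : realType) (g : lieAlgebra R).
Hypothesis dim4 : \dim {:g} = 4%N.
Variable G : gen_metric g.
Local Notation q := (gm_g G).
Local Notation H := (gm_H G).
Local Notation br := (@lie_br R g).
Local Notation D := (derived g).

Lemma frame_coord s eps e1 e2 e3 e4 x (i : 'I_4) :
  frame G s eps (vec4 e1 e2 e3 e4) ->
  coord [tuple e1; e2; e3; e4] i x = eps i * q x (vec4 e1 e2 e3 e4 (s i)).
Proof.
move=> frm; rewrite {1}(frame_expand dim4 frm x) -big_ord4.
exact: (coord_sum_free (fun i : 'I_4 => _) i (basis_free (frame_basis dim4 frm))).
Qed.

Lemma H_is_e123P a eps e1 e2 e3 e4 : frame G id eps (vec4 e1 e2 e3 e4) ->
  let h := Hc G (vec4 e1 e2 e3 e4) in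
  H_is_e123 G a e1 e2 e3 e4 <-> [/\ h 0%N 1%N 2%N = a, h 3%N 1%N 2%N = 0,
    h 3%N 2%N 0%N = 0 & h 3%N 0%N 1%N = 0].
Proof.
move=> frm h; have h12 := Hc12 G (vec4 e1 e2 e3 e4); have h23 := Hc23 G (vec4 e1 e2 e3 e4).
split=> [He | [h012 h312 h320 h301] b x y z].
  have [gt gr] := frm.
  have hE i j k : h i j k = a * \det (\matrix_(i' < 3, j' < 3)
      (eps i' * q [:: vec4 e1 e2 e3 e4 i; vec4 e1 e2 e3 e4 j; vec4 e1 e2 e3 e4 k]`_j'
        (vec4 e1 e2 e3 e4 i'))).
    rewrite /h /Hc He; congr (_ * \det _); apply/matrixP => i' j'.
    by rewrite !mxE (frame_coord _ _ frm).
  have ee i : (i < 4)%N -> eps i * eps i = 1 by move=> /gt[].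
  split; rewrite hE det_mx3 !mxE !inordK //= !gr //=.
  - transitivity (a * ((eps 0%N * eps 0%N) * (eps 1%N * eps 1%N) * (eps 2%N * eps 2%N))).
      by ring.
    by rewrite !ee // !mulr1.
  - by ring.
  - by ring.
  by ring.
rewrite (form_expand dim4 x y z frm).
have -> : sum4 (fun i => eps i * q x (vec4 e1 e2 e3 e4 i) * sum4 (fun j =>
    eps j * q y (vec4 e1 e2 e3 e4 j) * sum4 (fun k =>
    eps k * q z (vec4 e1 e2 e3 e4 k) * Hc G (vec4 e1 e2 e3 e4) i j k))) =
  sum4 (fun i => eps i * q x (vec4 e1 e2 e3 e4 i) * sum4 (fun j =>
    eps j * q y (vec4 e1 e2 e3 e4 j) * sum4 (fun k =>
    eps k * q z (vec4 e1 e2 e3 e4 k) * alt3 h i j k))).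
  apply: eq_sum4 => i i4; congr (_ * _); apply: eq_sum4 => j j4; congr (_ * _).
  by apply: eq_sum4 => k k4; rewrite (alt3E h12 h23).
rewrite det_mx3 !mxE !(frame_coord _ _ frm) /= !inordK //.
rewrite /alt3 /sum4 h012 h312 h320 h301 /=; ring.
Qed.

Hypothesis ndD : nondegenerate_on G D.

Lemma round_brackets e0 d k : round_frame G e0 d k -> let c := brc G k 1%N 2%N 0%N in
  [/\ br (k 0%N) (k 1%N) = c *: k 2%N, br (k 1%N) (k 2%N) = (e0 * c) *: k 0%N &
      br (k 2%N) (k 0%N) = c *: k 1%N].
Proof.
case=> frk kD [[l1 l2] [l3 l4] [l5 l6]] [_ [l7 l8] _ _ _] c.
have L3 := spans3_out kD.
split; rewrite (bracket_expand dim4 _ _ frk) /sum4 /eps4 /= !L3.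
- by rewrite l1 l2 l8 !(mulr0, scale0r, add0r, addr0) mul1r.
- by rewrite l3 l4 !(mulr0, scale0r, add0r, addr0).
by rewrite l5 l6 l7 !(mulr0, scale0r, add0r, addr0) mul1r.
Qed.

Lemma derived_basis e0 d k : \dim D = 3%N -> round_frame G e0 d k ->
  basis_of D [:: k 0%N; k 1%N; k 2%N].
Proof.
move=> dimD [frk kD _ _]; rewrite basisEfree dimD leqnn andbT.
rewrite (@catl_free _ _ [:: k 3%N] [:: k 0%N; k 1%N; k 2%N]); last first.
  exact: (basis_free (frame_basis dim4 frk)).
apply/span_subvP => x; rewrite !inE => /or3P[] /eqP ->; exact: (spans_mem frk kD).
Qed.

Lemma round_iso e0 d k z (so : lieAlgebra R) : \dim D = 3%N -> round_frame G e0 d k ->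
  (exists e1 e2 e3 : so, so_basis e0 e1 e2 e3) -> z \in D ->
  [/\ br (k 3%N) (k 0%N) = br z (k 0%N), br (k 3%N) (k 1%N) = br z (k 1%N) &
      br (k 3%N) (k 2%N) = br z (k 2%N)] ->
  lie_iso g (sum_lie so (ab_lie R^o)) /\ lie_iso (derived_lie g) so.
Proof.
move=> dimD rk [f1 [f2 [f3 fB]]] zD kz; have brk := round_brackets rk.
have [frk _ _ [c0 _ _ _ _]] := rk; have bas := derived_basis dimD rk.
split.
  apply: so_sum_basis_iso (so_sum_basis_sum fB); apply: so_sum_basis_intro c0 _ brk _ kz.
    exact: (frame_basis dim4 frk).
  by rewrite (span_basis bas).
by have [h1 [h2 [h3 hB]]] := derived_so_basis c0 bas brk; apply: so_basis_iso hB fB.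
Qed.

Lemma round_form e0 d k : round_frame G e0 d k ->
  H_is_e123 G (Hc G k 0%N 1%N 2%N) (k 0%N) (k 1%N) (k 2%N) (k 3%N).
Proof.
by case=> frk _ _ [_ _ _ [h312 h320 h301] _]; apply/(H_is_e123P _ (frame_vec4 frk)).
Qed.

Lemma round_ratio e0 d k : round_frame G e0 d k -> exists a eps : R,
  [/\ a = Hc G k 0%N 1%N 2%N, a != 0, eps = 1 \/ eps = -1 & brc G k 1%N 2%N 0%N = eps * a].
Proof.
case=> _ _ _ [c0 _ e _ _]; set a := Hc G k 0%N 1%N 2%N in e; set c := brc G k _ _ _ in c0 e *.
have a0 : a != 0 by rewrite -sqrf_eq0 e sqrf_eq0.
exists a, (c / a); split=> //; last by rewrite divfK.
have : (c / a) ^+ 2 == 1 by rewrite exprMn exprVn e divff // sqrf_eq0.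
by rewrite sqrf_eq1 => /orP[] /eqP; [left | right].
Qed.

Lemma round_case_B1 k : \dim D = 3%N -> round_frame G 1 (-1) k ->
  br (k 3%N) (k 0%N) = 0 -> case_B1 G.
Proof.
move=> dimD rk bk; have [frk kD _ _] := rk.
have [a [eps [aE a0 epsE cE]]] := round_ratio rk.
have bas := derived_basis dimD rk.
have brk := round_brackets rk; rewrite /= cE mul1r in brk.
have [a0' a1 a2] := round_adjoint dim4 rk; set b := brc G k 3%N 1%N 2%N in a1 a2.
have [m01 m02] : brc G k 3%N 0%N 1%N = 0 /\ brc G k 3%N 0%N 2%N = 0.
  by rewrite /brc bk !metric0l.
rewrite m01 m02 mulr0 !scale0r !add0r in a1 a2.
have c0 : eps * a != 0 by rewrite -cE; case: rk => _ _ _ [].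
(* The rotation with axis [k 0] is the inner derivation of a multiple of [k 0]. *)
have zD : (b / (eps * a)) *: k 0%N \in D by rewrite memvZ // (spans_mem frk kD).
have [b01 b12 b20] := brk.
have [iso1 iso2] : lie_iso g (sum_lie (so3 R) (ab_lie R^o)) /\ lie_iso (derived_lie g) (so3 R).
  apply: (round_iso dimD rk (so3_basis R) zD).
  rewrite !brE brxx bk a1 a2 b01 (brC (k 0%N)) b20 scaler0 !scalerA scalerN scalerA.
  by rewrite divfK.
split=> //.
  by rewrite -(span_basis bas); apply: (hyperplane_positive (frame_vec4 frk)).
exists a, b, eps, (k 0%N), (k 1%N), (k 2%N), (k 3%N); split=> //.
- exact: (oframe_orthonormal dim4 (frame_vec4 frk)).
- by rewrite aE; apply: round_form rk.
by split=> //; split=> //; rewrite (brC (k 2%N)) a2 opprK.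
Qed.

Lemma round_case_B2 k : \dim D = 3%N -> round_frame G (-1) 1 k ->
  [\/ br (k 3%N) (k 0%N) = 0, br (k 3%N) (k 2%N) = 0 |
    [/\ br (k 3%N) (k 0%N) = k 1%N, br (k 3%N) (k 1%N) = k 0%N + k 2%N &
        br (k 3%N) (k 2%N) = - k 1%N]] -> case_B2 G.
Proof.
move=> dimD rk bk; have [frk kD _ _] := rk.
have [a [eps [aE a0 epsE cE]]] := round_ratio rk.
have bas := derived_basis dimD rk.
have [b01 b12 b20] := round_brackets rk; rewrite cE mulN1r in b01 b12 b20.
have [a0' a1 a2] := round_adjoint dim4 rk; rewrite opprK !mul1r in a1 a2.
set m12 := brc G k 3%N 1%N 2%N in a1 a2; set m01 := brc G k 3%N 0%N 1%N in a0' a1.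
set m02 := brc G k 3%N 0%N 2%N in a0' a2.
have c0 : eps * a != 0 by rewrite -cE; case: rk => _ _ _ [].
have kD' i : (i < 3)%N -> k i \in D by move=> i3; apply: (spans_mem frk kD).
pose c := eps * a.
have b10 : br (k 1%N) (k 0%N) = - (c *: k 2%N) by rewrite brC b01.
have b21 : br (k 2%N) (k 1%N) = c *: k 0%N by rewrite brC b12 scaleNr opprK.
have b02 : br (k 0%N) (k 2%N) = - (c *: k 1%N) by rewrite brC b20.
have zc : exists2 z, z \in D & [/\ br (k 3%N) (k 0%N) = br z (k 0%N),
    br (k 3%N) (k 1%N) = br z (k 1%N) & br (k 3%N) (k 2%N) = br z (k 2%N)].
  (* The bracket of g' is [c] times a cross product, so the skew action is inner, generated by the
     axis divided by [c]. *)
  exists (c^-1 *: (m12 *: k 0%N - m02 *: k 1%N + m01 *: k 2%N)).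
    by rewrite memvZ // !rpredD ?rpredN ?memvZ ?kD'.
  rewrite !brE !brxx a0' a1 a2 b01 b02 b10 b12 b20 b21 -/c.
  split; apply: (frame_ext dim4 frk) => i _; rewrite !metricE; field; exact: c0.
have [z zD kz] := zc.
have [iso1 iso2] := round_iso dimD rk (so21_basis R) zD kz.
split=> //.
  rewrite -(span_basis bas); apply: (hyperplane_Lorentzian dim4 (frame_vec4 frk)) => //.
  by rewrite (span_basis bas).
exists a, eps, (k 0%N), (k 1%N), (k 2%N), (k 3%N); split=> //.
- split; first exact: (oframe_orthonormal dim4 (frame_vec4 frk)).
  by rewrite (oframe_gram frk).
- by rewrite aE; apply: round_form rk.
split=> //.
have gr := oframe_gram frk.
case: bk => [bk | bk | [bk0 bk1 bk2]]; last by apply: Or33; split.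
  have [z01 z02] : m01 = 0 /\ m02 = 0 by rewrite /m01 /m02 /brc bk !metric0l.
  apply: Or31; exists m12; rewrite a1 a2 z01 z02 !scale0r !add0r scaleNr.
  by split.
have [z02 z12] : m02 = 0 /\ m12 = 0.
  rewrite bk in a2; have e0 := congr1 (fun x => q x (k 0%N)) a2.
  have e1 := congr1 (fun x => q x (k 1%N)) a2.
  rewrite /= !metricE !gr in e0 e1; split; lra.
rewrite z02 scale0r addr0 in a0'; rewrite z12 scale0r addr0 in a1.
(* The case (beta) demands a nonzero parameter; a vanishing action is counted under (alpha). *)
have [z01 | z01] := eqVneq m01 0; last by apply: Or32; exists m01.
by apply: Or31; exists 0; rewrite a0' a1 bk z01 oppr0 !scale0r.
Qed.

End CaseB.

(** * The listed algebras *)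

Lemma Einstein_cases (R : realType) (g : lieAlgebra R) (dim4 : \dim {:g} = 4%N)
    (G : gen_metric g) : Lorentzian G -> nondegenerate_on G (derived g) ->
  gen_Einstein G 0 -> case_A G \/ case_B G.
Proof.
move=> lorG ndD Ein; have [f [fD frm]] := adapted_frame dim4 lorG ndD.
have := derived_proper dim4 ndD lorG; move: fD frm.
case dimD: (\dim (derived g)) => [|[|[|[|//]]]] fD frm _.
- by left; case: frm => [[_ //] | [frm _]]; apply: derived_zero frm fD.
- by exfalso; case: frm => -[frm _]; apply: (derived_line dim4 ndD Ein frm fD); [left | right].
- left; case: frm => -[frm _]; first exact: (derived_plane_Lorentz dim4 ndD Ein frm fD).
  exact: (derived_plane_Riemann dim4 ndD Ein frm fD).
case: frm => -[frm _]; last first.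
  have [k rk] := space_round dim4 ndD Ein frm fD.
  have [h [rh bh]] := round_Riemann dim4 ndD Ein rk.
  by right; left; apply: round_case_B1 rh bh.
case: (space_alternative dim4 ndD Ein frm fD) => [[k rk _] | ab].
  have [h [rh bh]] := round_Lorentz dim4 ndD Ein rk.
  by right; right; apply: round_case_B2 rh bh.
by left; apply: (derived_space_abelian dim4 ndD Ein frm fD).
Qed.

Section ModelBases.
Variable R : realType.

Local Notation u1 := (row4 1 0 0 0 : 'rV[R]_4).
Local Notation u2 := (row4 0 1 0 0 : 'rV[R]_4).
Local Notation u3 := (row4 0 0 1 0 : 'rV[R]_4).
Local Notation u4 := (row4 0 0 0 1 : 'rV[R]_4).

Local Ltac row4_ring := apply/rowP; case; do 4?[case=> //]; move=> ?;
  rewrite !mxE /=; ring.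

Lemma row4_basis : basis_of fullv [:: u1; u2; u3; u4].
Proof.
apply: basis4_intro => [a b c d e | x]; last first.
  exists (cd 1 x), (cd 2 x), (cd 3 x), (cd 4 x).
  apply/rowP => i; rewrite !mxE /cd.
  by case: i => [[|[|[|[|//]]]] i4] /=;
    rewrite ?(mulr0, mulr1, addr0, add0r); congr (x _ _);
    apply: val_inj; rewrite /= inordK.
have e' i : (a *: u1 + b *: u2 + c *: u3 + d *: u4) 0 i = 0 by rewrite e mxE.
split; [have := e' (inord 0) | have := e' (inord 1) | have := e' (inord 2) |
  have := e' (inord 3)]; by rewrite !mxE !inordK //= ?(mulr0, mulr1, addr0, add0r).
Qed.

Lemma row4_basis_perm (e1 e2 e3 e4 : 'rV[R]_4) :
  [/\ u1 \in <<[:: e1; e2; e3; e4]>>%VS, u2 \in <<[:: e1; e2; e3; e4]>>%VS,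
    u3 \in <<[:: e1; e2; e3; e4]>>%VS & u4 \in <<[:: e1; e2; e3; e4]>>%VS] ->
  basis_of fullv [:: e1; e2; e3; e4].
Proof. exact: basis4_change row4_basis. Qed.

Lemma ab_ad_basis : @ad_basis R (ab_lie 'rV[R]_4) u1 u2 u3 u4
  [:: [:: 0; - 0; 0]; [:: 0; 0; 0]; [:: 0; 0; 0]].
Proof.
split=> //; first exact: row4_basis.
by apply/acts_by3; rewrite oppr0 !scale0r !addr0.
Qed.

Lemma e2R_ad_basis : @ad_basis R (e2R R) u1 u2 u4 (- u3)
  [:: [:: 0; - 1; 0]; [:: 1; 0; 0]; [:: 0; 0; 0]].
Proof.
split.
- apply: row4_basis_perm; split; try by rewrite memv_span // !inE eqxx ?orbT.
  by rewrite -[X in X \in _]opprK memvN memv_span // !inE eqxx ?orbT.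
- by split; rewrite /= /e2R_br /ed !cd_row4; row4_ring.
by apply/acts_by3; split; rewrite /= /e2R_br /ed !cdN !cd_row4; row4_ring.
Qed.

Lemma e11R_ad_basis : @ad_basis R (e11R R) u1 u2 u4 u3
  [:: [:: 0; 1; 0]; [:: 1; 0; 0]; [:: 0; 0; 0]].
Proof.
split.
- by apply: row4_basis_perm; split; rewrite memv_span // !inE eqxx ?orbT.
- by split; rewrite /= /e11R_br /ed !cd_row4; row4_ring.
by apply/acts_by3; split; rewrite /= /e11R_br /ed !cd_row4; row4_ring.
Qed.

Lemma A46_ad_basis (al be : R) : @ad_basis R (A46 al be) u3 u2 u1 u4
  [:: [:: be; - 1; 0]; [:: 1; be; 0]; [:: 0; 0; al]].
Proof.
split.
- by apply: row4_basis_perm; split; rewrite memv_span // !inE eqxx ?orbT.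
- by split; rewrite /= /A46_br /ed !cd_row4; row4_ring.
by apply/acts_by3; split; rewrite /= /A46_br /ed !cd_row4; row4_ring.
Qed.

Lemma r31R_ad_basis : @ad_basis R (r31R R) u2 u1 u3 u4
  [:: [:: 1; - 1; 0]; [:: 1; 1; 0]; [:: 0; 0; 0]].
Proof.
split.
- by apply: row4_basis_perm; split; rewrite memv_span // !inE eqxx ?orbT.
- by split; rewrite /= /r31R_br /ed !cd_row4; row4_ring.
by apply/acts_by3; split; rewrite /= /r31R_br /ed !cd_row4; row4_ring.
Qed.

Lemma circle_param (x y : R) : x ^+ 2 + y ^+ 2 = 1 ->
  exists phi, cos phi = x /\ sin phi = y.
Proof.
move=> xy; have x1 : -1 <= x <= 1.
  have : x ^+ 2 <= 1 by rewrite -xy lerDl sqr_ge0.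
  by rewrite -real_normK ?num_real // -[X in _ <= X](expr1n _ 2) ler_sqr ?nnegrE // ler_norml.
have sE : Num.sqrt (1 - x ^+ 2) = `|y| by rewrite -xy addrC addKr sqrtr_sqr.
(* The sine of [acos x] is nonnegative, so a negative [y] requires the opposite angle. *)
have [y0 | y0] := leP 0 y.
  by exists (acos x); rewrite acosK // sin_acos // sE ger0_norm.
by exists (- acos x); rewrite cosN sinN acosK // sin_acos // sE ltr0_norm ?opprK.
Qed.
End ModelBases.

Section CaseIso.
Variables (R : realType) (g : lieAlgebra R).
Local Notation br := (@lie_br R g).
Variables e1 e2 e3 X : g.
Hypothesis bas : basis_of fullv [:: e1; e2; e3; X].
Hypothesis ab : [/\ br e1 e2 = 0, br e1 e3 = 0 & br e2 e3 = 0].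

Lemma iso_rotation (a : R) :
  [/\ br X e1 = a *: e2, br X e2 = - a *: e1 & br X e3 = 0] -> iso_to_listed g.
Proof.
case=> x1 x2 x3; have [a0 | a0] := eqVneq a 0.
  left; apply: ad_basis_iso (ab_ad_basis R); split; [exact: bas | exact: ab |].
  by apply/acts_by3; rewrite x1 x2 x3 a0 oppr0 !scale0r !addr0.
right; left; apply: ad_basis_iso (e2R_ad_basis R).
apply: (_ : @ad_basis R g e1 e2 e3 (a^-1 *: X) _); split=> //.
  apply: basis4_change bas _ => U; split; try by rewrite memv_span // !inE eqxx ?orbT.
  by rewrite -[X in X \in _]scale1r -(mulfV a0) -scalerA memvZ // memv_span // !inE eqxx ?orbT.
apply/acts_by3; rewrite !brZl x1 x2 x3 !scalerA mulrN mulVf // scaler0.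
by rewrite !scale0r !(addr0, add0r).
Qed.

(** The vector [k] spans the kernel of the action, and the square of the action multiplies [e3] by
    [- (4 * s)]. Hence, after rescaling, the action on the plane of [e3] and [u] is a rotation for
    positive [s] and a boost for negative [s]. *)
Lemma iso_M3 (s : R) : s != 0 ->
  [/\ br X e1 = (-1 + s) *: e3, br X e2 = (1 + s) *: e3 &
      br X e3 = (-1 + s) *: e1 + (-1 - s) *: e2] -> iso_to_listed g.
Proof.
move=> s0 [x1 x2 x3].
pose u := (-1 + s) *: e1 + (-1 - s) *: e2; pose k := (1 + s) *: e1 + (1 - s) *: e2.
have Xu : br X u = (- (4 * s)) *: e3.
  by rewrite /u brDr !brZr x1 x2 !scalerA -scalerDl; congr (_ *: _); ring.
have Xk : br X k = 0.
  by rewrite /k brDr !brZr x1 x2 !scalerA -scalerDl (_ : _ + _ = 0) ?scale0r //; ring.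
have [b12 b13 b23] := ab.
have ab' r : [/\ br e3 (r *: u) = 0, br e3 k = 0 & br (r *: u) k = 0].
  by split; rewrite /u /k !brE ?brxx ?(brC e3 e1) ?(brC e3 e2) ?(brC e2 e1) ?b12 ?b13 ?b23
    !(oppr0, scaler0, addr0).
have bas' r : r != 0 -> basis_of fullv [:: e3; r^-1 *: u; k; r^-1 *: X].
  move=> r0; apply: basis4_change bas _ => U.
  have mr x : r^-1 *: x \in U -> x \in U.
    by move=> xU; rewrite -[x]scale1r -(mulfV r0) -scalerA memvZ.
  have uU : u \in U by apply: mr; rewrite memv_span // !inE eqxx ?orbT.
  have kU : k \in U by rewrite memv_span // !inE eqxx ?orbT.
  have e1E : e1 = (4 * s)^-1 *: ((1 - s) *: u + (1 + s) *: k).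
    rewrite /u /k !scalerDr !scalerA addrACA -!scalerDl.
    rewrite [X in _ = X *: _ + _](_ : _ = 1) ?[X in _ = _ + X *: _](_ : _ = 0).
    - by rewrite scale1r scale0r addr0.
    - by field.
    by field.
  have e2E : e2 = (4 * s)^-1 *: ((-1 + s) *: k - (1 + s) *: u).
    rewrite /u /k scalerBr !scalerDr !scalerA opprD addrACA -!scaleNr -!scalerDl.
    rewrite [X in _ = X *: _ + _](_ : _ = 0) ?[X in _ = _ + X *: _](_ : _ = 1).
    - by rewrite scale1r scale0r add0r.
    - by field.
    by field.
  split; last by apply: mr; rewrite memv_span // !inE eqxx ?orbT.
  - by rewrite e1E memvZ // memvD // memvZ.
  - by rewrite e2E memvZ // memvB // memvZ.
  by rewrite memv_span // !inE eqxx ?orbT.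
have [sp | sn | /eqP] := ltrgtP s 0; last by rewrite (negPf s0).
  pose r := Num.sqrt (- (4 * s)).
  have r2 : r ^+ 2 = - (4 * s) by rewrite sqr_sqrtr //; lra.
  have r0 : r != 0 by rewrite sqrtr_eq0 -ltNge; lra.
  do 2!right; left; apply: ad_basis_iso (e11R_ad_basis R).
  apply: (_ : @ad_basis R g e3 (r^-1 *: u) k (r^-1 *: X) _); split; [exact: bas' | exact: ab' |].
  apply/acts_by3; rewrite !brZl !brZr x3 -/u Xu Xk.
  rewrite !(scale0r, scale1r, addr0, add0r) !scalerA -r2 scaler0; split=> //.
  by rewrite (_ : _ * _ = 1 :> R) ?scale1r //; field.
pose r := Num.sqrt (4 * s).
have r2 : r ^+ 2 = 4 * s by rewrite sqr_sqrtr //; lra.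
have r0 : r != 0 by rewrite sqrtr_eq0 -ltNge; lra.
right; left; apply: ad_basis_iso (e2R_ad_basis R).
apply: (_ : @ad_basis R g e3 (r^-1 *: u) k (r^-1 *: X) _); split; [exact: bas' | exact: ab' |].
apply/acts_by3; rewrite !brZl !brZr x3 -/u Xu Xk.
rewrite !(scale0r, scale1r, addr0, add0r) !scalerA -r2 scaler0; split=> //.
by rewrite (_ : _ * _ = - 1 :> R) //; field.
Qed.

(** Dividing [X] by [be] puts the action in the form of [A46], and the relation between [al], [be],
    [c] places [(c / be / Num.sqrt 2, al / be)] on the unit circle; [phi] is its angle. *)
Lemma iso_spiral (al be c : R) : 0 < be -> be ^+ 2 = al ^+ 2 + c ^+ 2 / 2 ->
  [/\ br X e1 = al *: e1 + be *: e2, br X e2 = - be *: e1 + al *: e2 &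
      br X e3 = c *: e3] -> iso_to_listed g.
Proof.
move=> be0 beE [x1 x2 x3]; have b0 : be != 0 by rewrite gt_eqF.
have s2 : Num.sqrt 2 ^+ 2 = 2 :> R by rewrite sqr_sqrtr.
have s0 : Num.sqrt 2 != 0 :> R by rewrite sqrtr_eq0 -ltNge.
have [|phi [cphi sphi]] := @circle_param R (c / be / Num.sqrt 2) (al / be).
  rewrite exprMn exprVn s2; transitivity ((al ^+ 2 + c ^+ 2 / 2) / be ^+ 2); first by field.
  by rewrite -beE divff // expf_neq0.
do 3!right; left; exists phi; rewrite cphi sphi mulrC divfK //.
apply: ad_basis_iso (A46_ad_basis _ _).
apply: (_ : @ad_basis R g e1 e2 e3 (be^-1 *: X) _); split=> //.
  apply: basis4_change bas _ => U; split; try by rewrite memv_span // !inE eqxx ?orbT.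
  by rewrite -[X in X \in _]scale1r -(mulfV b0) -scalerA memvZ // memv_span // !inE eqxx ?orbT.
apply/acts_by3; rewrite !brZl x1 x2 x3 !scalerDr !scalerA mulrN mulVf //.
by rewrite !scale0r !(addr0, add0r) ![_ / be]mulrC.
Qed.
End CaseIso.

(** For nonzero [a], shifting [e1] and [e2] by multiples of the central vector [e3] removes [b1] and
    [b2], and a plain rotation remains. *)
Lemma iso_null (R : realType) (g : lieAlgebra R) (e1 e2 e3 X : g) (a b1 b2 : R) :
  basis_of fullv [:: e1; e2; e3; X] ->
  [/\ lie_br e1 e2 = 0, lie_br e1 e3 = 0 & lie_br e2 e3 = 0] ->
  a != 0 \/ [/\ a = 0, b1 = 0 & b2 = 0] ->
  [/\ lie_br X e1 = a *: e2 + b1 *: e3, lie_br X e2 = - a *: e1 + b2 *: e3 &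
      lie_br X e3 = 0] -> iso_to_listed g.
Proof.
move=> bas ab alt [x1 x2 x3].
have [a0 | [a0 b10 b20]] := alt; last first.
  apply: (iso_rotation bas ab (a := 0)).
  by rewrite x1 x2 x3 a0 b10 b20 !oppr0 !scale0r !addr0.
pose f1 := e1 - (b2 / a) *: e3; pose f2 := e2 + (b1 / a) *: e3.
have [b12 b13 b23] := ab.
apply: (@iso_rotation R g f1 f2 e3 X _ _ a).
- apply: basis4_change bas _ => U.
  have e3U : e3 \in U by rewrite memv_span // !inE eqxx ?orbT.
  split=> //; last by rewrite memv_span // !inE eqxx ?orbT.
    rewrite -[e1](subrK ((b2 / a) *: e3)) memvD ?memvZ // memv_span // !inE eqxx ?orbT //.
  rewrite -[e2](addrK ((b1 / a) *: e3)) memvB ?memvZ // memv_span // !inE eqxx ?orbT //.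
- by rewrite /f1 /f2 !brE !brxx (brC e3 e2) b12 b13 b23 !(oppr0, scaler0, addr0).
rewrite /f1 /f2 !brE x1 x2 x3 !scaler0 oppr0 !addr0 scalerDr scalerBr !scalerA.
have e b : a * (b / a) = b by rewrite mulrC divfK.
by rewrite mulNr !e !scaleNr opprK.
Qed.

(** * From the normal forms back to the Einstein condition *)

(** Each row lists coordinates of a bracket; missing entries read as zero, so [[::]] is the zero
    bracket. *)
Definition bracket_table (R : nzRingType) (r01 r12 r20 r30 r31 r32 : seq R) i j : seq R :=
  match i, j with
  | 0%N, 1%N => r01 | 1%N, 2%N => r12 | 2%N, 0%N => r20
  | 3%N, 0%N => r30 | 3%N, 1%N => r31 | 3%N, 2%N => r32 | _, _ => [::]
  end.

Ltac ein_cases := case=> [|[|[|[|//]]]] [|[|[|[|//]]]] _ _;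
  rewrite /ein /sum4 /eps4 /=.

Section Backward.
Variables (R : realType) (g : lieAlgebra R).
Hypothesis dim4 : \dim {:g} = 4%N.
Variable G : gen_metric g.
Local Notation q := (gm_g G).
Local Notation H := (gm_H G).
Local Notation br := (@lie_br R g).
Local Notation D := (derived g).

Definition combine4 (k : nat -> g) (r : seq R) : g :=
  r`_0 *: k 0%N + r`_1 *: k 1%N + r`_2 *: k 2%N + r`_3 *: k 3%N.

Lemma metric_combine4 s eps k r m : frame G s eps k -> (m < 4)%N ->
  q (combine4 k r) (k m) = eps m * r`_(s m).
Proof.
move=> [gt gr] m4; rewrite /combine4 !metricE; have [sm4 ssm esm _] := gt m m4.
have E i : (i < 4)%N -> q (k i) (k m) = if i == s m then eps m else 0.
  by move=> i4; rewrite metricC gr.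
rewrite !E //; case: (s m) sm4 => [|[|[|[|//]]]] _ /=; ring.
Qed.

(** Once the brackets are tabulated and [H] is [a] times the volume form of the first three vectors,
    the Einstein condition consists of sixteen explicit polynomial identities. *)
Lemma Einstein_table s eps k r01 r12 r20 r30 r31 r32 a : frame G s eps k ->
  [/\ br (k 0%N) (k 1%N) = combine4 k r01, br (k 1%N) (k 2%N) = combine4 k r12 &
      br (k 2%N) (k 0%N) = combine4 k r20] ->
  [/\ br (k 3%N) (k 0%N) = combine4 k r30, br (k 3%N) (k 1%N) = combine4 k r31 &
      br (k 3%N) (k 2%N) = combine4 k r32] ->
  [/\ Hc G k 0%N 1%N 2%N = a, Hc G k 3%N 1%N 2%N = 0, Hc G k 3%N 2%N 0%N = 0 &
      Hc G k 3%N 0%N 1%N = 0] ->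
  (forall x y, (x < 4)%N -> (y < 4)%N -> ein s eps
    (alt2 (fun i j m => eps m * (bracket_table r01 r12 r20 r30 r31 r32 i j)`_(s m)))
    (alt3 (fun i _ _ => if i == 0%N then a else 0)) x y = 0) ->
  gen_Einstein G 0.
Proof.
move=> frm [b01 b12 b20] [b30 b31 b32] [h012 h312 h320 h301] E.
apply/(EinsteinP dim4 frm) => x y x4 y4; rewrite -[RHS](E x y x4 y4).
have [gt _] := frm; have s4 i : (i < 4)%N -> (s i < 4)%N by move=> /gt[].
set L := fun i j m => _; set h := fun i _ _ => _.
have LE i j m : (i < 4)%N -> (j < 4)%N -> (m < 4)%N -> brc G k i j m = alt2 L i j m.
  move=> i4 j4 m4; rewrite (alt2E _ (brcC G k)) //.
  by case: i i4 => [|[|[|[|//]]]] _; case: j j4 => [|[|[|[|//]]]] _ //=;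
    rewrite /brc ?(b01, b12, b20, b30, b31, b32) (metric_combine4 _ frm).
have hE i j m : (i < 4)%N -> (j < 4)%N -> (m < 4)%N -> Hc G k i j m = alt3 h i j m.
  move=> i4 j4 m4; rewrite (alt3E (Hc12 G k) (Hc23 G k)) //.
  by case: i i4 => [|[|[|[|//]]]] _; case: j j4 => [|[|[|[|//]]]] _;
    case: m m4 => [|[|[|[|//]]]] _ //=; rewrite ?(h012, h312, h320, h301).
apply: eq_sum4 => i i4; apply: eq_sum4 => j j4.
by rewrite !LE ?s4 // !hE ?s4.
Qed.

Lemma hyperplane_basis n e1 e2 e3 X : codim1_abelian_ideal n ->
  basis_of n [:: e1; e2; e3] -> X \notin n -> basis_of {:g} [:: e1; e2; e3; X].
Proof.
move=> _ bas Xn; rewrite basisEfree subvf dim4 andbT.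
rewrite (@perm_free _ _ _ [:: X; e1; e2; e3]); last by apply/permP => P /=; ring.
by rewrite free_cons (span_basis bas) Xn (basis_free bas).
Qed.

Lemma ideal_abelian n e1 e2 e3 : codim1_abelian_ideal n ->
  basis_of n [:: e1; e2; e3] ->
  [/\ br e1 e2 = 0, br e1 e3 = 0 & br e2 e3 = 0].
Proof.
case=> _ _ ab bas; have m e : e \in [:: e1; e2; e3] -> e \in n by apply: (basis_mem bas).
by split; apply: ab; apply: m; rewrite !inE eqxx ?orbT.
Qed.

Lemma unit_normal_frame n e1 e2 e3 M : codim1_abelian_ideal n ->
  unit_normal_ad G n [:: e1; e2; e3] M -> exists X,
  [/\ frame G id (eps4 (q e1 e1) (q e2 e2) (q e3 e3) (q X X)) (vec4 e1 e2 e3 X),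
    [/\ br e1 e2 = 0, br e1 e3 = 0 & br e2 e3 = 0] &
    acts_by (br X) [:: e1; e2; e3] M].
Proof.
move=> ideal [X [/mem_orthovP Xn X1 /andP[bas on] act]]; exists X; split=> //.
  have m e : e \in [:: e1; e2; e3] -> q X e = 0.
    by move=> es; apply: Xn; exact: (basis_mem bas es).
  have [x1 x2 x3] : [/\ q X e1 = 0, q X e2 = 0 & q X e3 = 0].
    by split; apply: m; rewrite !inE eqxx ?orbT.
  have sq x : (q x x == 1) || (q x x == -1) -> q x x * q x x = 1.
    by case/orP=> /eqP ->; rewrite ?mulrNN mulr1.
  move: on; rewrite /pseudo_orthonormal /= !andbT.
  case/andP=> /and3P[n1 n2 n3] /andP[/andP[/eqP o12 /eqP o13] /eqP o23].
  apply: oframe_intro => //.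
  - by split; apply: sq => //; case: X1 => ->; rewrite eqxx ?orbT.
  - by rewrite (metricC _ e1 X).
  by rewrite (metricC _ e2 X) (metricC _ e3 X).
exact: ideal_abelian ideal bas.
Qed.

Hypothesis lorG : Lorentzian G.

(** The Lorentzian signature leaves room for a single negative sign, so the other three norms are
    determined. *)
Lemma timelike_first a b c d e1 e2 e3 X : frame G id (eps4 a b c d) (vec4 e1 e2 e3 X) ->
  a = -1 -> frame G id (eps4 (-1) 1 1 1) (vec4 e1 e2 e3 X).
Proof.
move=> frm a1; have [i i4 [ei ej]] := frame_sign dim4 lorG frm.
have i0 : i = 0%N.
  apply/eqP; apply: contraT => i0; have := ej 0%N isT; rewrite eq_sym i0 => /(_ isT).
  by rewrite /eps4 /= a1 => e; exfalso; lra.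
rewrite i0 in ei ej; apply: eq_frame frm => -[|[|[|[|//]]]] j4; first exact: ei.
all: by rewrite ej.
Qed.

Lemma timelike_last a b c d e1 e2 e3 X : frame G id (eps4 a b c d) (vec4 e1 e2 e3 X) ->
  [/\ 0 < a, 0 < b & 0 < c] -> frame G id (eps4 1 1 1 (-1)) (vec4 e1 e2 e3 X).
Proof.
move=> frm [a0 b0 c0]; have [i i4 [ei ej]] := frame_sign dim4 lorG frm.
have i3 : i = 3%N.
  by case: i i4 ei {ej} => [|[|[|[|//]]]] _; rewrite /eps4 /= // => e; exfalso; lra.
rewrite i3 in ei ej; apply: eq_frame frm => -[|[|[|[|//]]]] j4; last exact: ei.
all: by rewrite ej.
Qed.

Lemma positive_basis n e1 e2 e3 : positive_definite_on G n ->
  basis_of n [:: e1; e2; e3] -> [/\ 0 < q e1 e1, 0 < q e2 e2 & 0 < q e3 e3].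
Proof.
move=> pos bas; have m e : e \in [:: e1; e2; e3] -> 0 < q e e.
  move=> es; apply: pos; first exact: basis_mem bas es.
  apply: contraTneq (basis_free bas) => e0; rewrite e0 in es.
  by apply/negP => /free_not0/(_ es); rewrite eqxx.
by split; apply: m; rewrite !inE eqxx ?orbT.
Qed.

Hypothesis H0 : forall x y z, H x y z = 0.

Let Hc0 k : [/\ Hc G k 0%N 1%N 2%N = 0, Hc G k 3%N 1%N 2%N = 0, Hc G k 3%N 2%N 0%N = 0 &
      Hc G k 3%N 0%N 1%N = 0].
Proof. by split; apply: H0. Qed.

Lemma case_A1_Einstein n : codim1_abelian_ideal n -> case_A1 G n -> gen_Einstein G 0.
Proof.
move=> ideal [pos [e1 [e2 [e3 [a una]]]]].
have bas : basis_of n [:: e1; e2; e3] by case: una => X [_ _ /andP[]].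
have [X [frm [b12 b13 b23] act]] := unit_normal_frame ideal una.
have {}frm := timelike_last frm (positive_basis pos bas).
move: act; rewrite diag_L1E => /acts_by3[x1 x2 x3].
apply: (Einstein_table (r01 := [::]) (r12 := [::]) (r20 := [::]) (r30 := [:: 0; a])
  (r31 := [:: - a]) (r32 := [::]) frm _ _ (Hc0 _)).
- by split; rewrite /combine4 /= ?(brC e3) ?b12 ?b13 ?b23 ?oppr0 !scale0r !addr0.
- by split; rewrite /combine4 /= ?x1 ?x2 ?x3 !scale0r !addr0 ?add0r.
by ein_cases; ring.
Qed.

Lemma case_A2_Einstein n : codim1_abelian_ideal n -> case_A2 G n -> gen_Einstein G 0.
Proof.
move=> ideal [_ [e1 [e2 [e3 [s [s0 n1 una]]]]]].
have [X [frm [b12 b13 b23] act]] := unit_normal_frame ideal una.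
have {}frm := timelike_first frm n1.
move: act => /acts_by3[x1 x2 x3].
apply: (Einstein_table (r01 := [::]) (r12 := [::]) (r20 := [::]) (r30 := [:: 0; 0; -1 + s])
  (r31 := [:: 0; 0; 1 + s]) (r32 := [:: -1 + s; -1 - s]) frm _ _ (Hc0 _)).
- by split; rewrite /combine4 /= ?(brC e3) ?b12 ?b13 ?b23 ?oppr0 !scale0r !addr0.
- by split; rewrite /combine4 /= ?x1 ?x2 ?x3 !scale0r !addr0 ?add0r.
by ein_cases; ring.
Qed.

Lemma case_A3_Einstein n : codim1_abelian_ideal n -> case_A3 G n -> gen_Einstein G 0.
Proof.
move=> ideal [_ [e1 [e2 [e3 [al [a [ac0 n1 una]]]]]]].
have [X [frm [b12 b13 b23] act]] := unit_normal_frame ideal una.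
have {}frm := timelike_first frm n1.
move: act; rewrite diag_L1E; set be := Num.sqrt _ => /acts_by3[x1 x2 x3].
have beE : be ^+ 2 = al ^+ 2 + a ^+ 2 / 2.
  by rewrite sqr_sqrtr // addr_ge0 ?divr_ge0 ?sqr_ge0.
apply: (Einstein_table (r01 := [::]) (r12 := [::]) (r20 := [::]) (r30 := [:: al; be])
  (r31 := [:: - be; al]) (r32 := [:: 0; 0; a]) frm _ _ (Hc0 _)).
- by split; rewrite /combine4 /= ?(brC e3) ?b12 ?b13 ?b23 ?oppr0 !scale0r !addr0.
- by split; rewrite /combine4 /= ?x1 ?x2 ?x3 !scale0r !addr0 ?add0r.
by ein_cases; lra.
Qed.

Lemma case_A4_Einstein n : codim1_abelian_ideal n -> case_A4 G n -> gen_Einstein G 0.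
Proof.
move=> ideal [_ [e1 [e2 [e3 [X [bas [n1 n2 n3] [n4 n5 n6 n7 n8] [n9 n10] act]]]]]].
have {act} [a [b1 [b2 [_ /acts_by3[x1 x2 x3]]]]] := act.
have [b12 b13 b23] := ideal_abelian ideal bas.
(* The null vectors [e3] and [X] must occupy the paired indices 0 and 2. *)
have frm : frame G swap02 (eps4 1 1 1 1) (vec4 e3 e1 X e2).
  by apply: nframe_intro; split; rewrite // metricC.
rewrite !scale0r ?(add0r, addr0) in x1 x2 x3.
apply: (Einstein_table (r01 := [::]) (r12 := [:: - b1; 0; 0; - a]) (r20 := [::])
  (r30 := [::]) (r31 := [::]) (r32 := [:: - b2; a]) frm _ _ (Hc0 _)).
- split; rewrite /combine4 /= ?(brC e3 e1) ?(brC e1 X) ?b13 ?x1 ?x3 ?oppr0 ?opprD ?scaleNr !scale0r ?addr0 //.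
  by rewrite addrC.
- split; rewrite /combine4 /= ?b23 ?(brC e2 e1) ?(brC e2 X) ?b12 ?x2 ?oppr0 ?opprD ?scaleNr ?opprK !scale0r ?addr0 //.
  by rewrite addrC.
by ein_cases; ring.
Qed.

End Backward.

Section Converse.
Variables (R : realType) (g : lieAlgebra R).
Hypothesis dim4 : \dim {:g} = 4%N.
Variable G : gen_metric g.
Hypothesis lorG : Lorentzian G.
Local Notation q := (gm_g G).
Local Notation br := (@lie_br R g).

Lemma orthonormal_basis_frame e1 e2 e3 e4 : orthonormal_basis_of G {:g} [:: e1; e2; e3; e4] ->
  frame G id (eps4 (q e1 e1) (q e2 e2) (q e3 e3) (q e4 e4)) (vec4 e1 e2 e3 e4).
Proof.
case/andP=> _ on.
by apply: eq_frame (orthonormal_frame (f := vec4 e1 e2 e3 e4) on) => -[|[|[|[|]]]].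
Qed.

Lemma case_A_Einstein : case_A G -> gen_Einstein G 0.
Proof.
case=> _ H0 [n [ideal [c | c | c | c]]].
- exact: (case_A1_Einstein dim4 lorG H0 ideal c).
- exact: (case_A2_Einstein dim4 lorG H0 ideal c).
- exact: (case_A3_Einstein dim4 lorG H0 ideal c).
exact: (case_A4_Einstein dim4 H0 ideal c).
Qed.

Lemma case_B1_Einstein : case_B1 G -> gen_Einstein G 0.
Proof.
case=> _ _ pos [a [b [eps [e1 [e2 [e3 [e4 [[a0 epsE] on bas HE [br1 br2]]]]]]]]].
have frm := timelike_last dim4 lorG (orthonormal_basis_frame on) (positive_basis pos bas).
have hE := (H_is_e123P dim4 a frm).1 HE.
case: br1 => b12 b23 b31; case: br2 => b34 b42 b41.
have ca : (eps * a) ^+ 2 = a ^+ 2 by case: epsE => ->; ring.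
set c := eps * a in b12 b23 b31 ca.
apply: (Einstein_table dim4 (r01 := [:: 0; 0; c]) (r12 := [:: c]) (r20 := [:: 0; c])
  (r30 := [::]) (r31 := [:: 0; 0; b])
  (r32 := [:: 0; - b]) frm _ _ hE).
- by split; rewrite /combine4 /= ?b12 ?b23 ?b31 !scale0r ?addr0 ?add0r.
- split; rewrite /combine4 /= ?b41 ?b42 ?(brC e4 e3) ?b34 !scale0r ?addr0 ?add0r //.
  by rewrite scaleNr.
by move: c ca {b12 b23 b31} => c ca; ein_cases; lra.
Qed.

Lemma case_B2_Einstein : case_B2 G -> gen_Einstein G 0.
Proof.
case=> _ _ _ [a [eps [e1 [e2 [e3 [e4 [[a0 epsE] [on n1] bas HE [br1 alt]]]]]]]].
have frm := timelike_first dim4 lorG (orthonormal_basis_frame on) n1.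
have hE := (H_is_e123P dim4 a frm).1 HE.
case: br1 => b12 b23 b31.
have ca : (eps * a) ^+ 2 = a ^+ 2 by case: epsE => ->; ring.
set c := eps * a in b12 b23 b31 ca.
have br1 : [/\ br e1 e2 = combine4 (vec4 e1 e2 e3 e4) [:: 0; 0; c],
   br e2 e3 = combine4 (vec4 e1 e2 e3 e4) [:: - c] &
   br e3 e1 = combine4 (vec4 e1 e2 e3 e4) [:: 0; c]].
  by split; rewrite /combine4 /= ?b12 ?b23 ?b31 !scale0r ?addr0 ?add0r.
case: alt => [[b [b41 b42 b43]] | [b [_ [b41 b42 b43]]] | [b41 b42 b43]].
- apply: (Einstein_table dim4 (r30 := [::]) (r31 := [:: 0; 0; b])
    (r32 := [:: 0; - b]) frm br1 _ hE).
    by split; rewrite /combine4 /= ?b41 ?b42 ?b43 !scale0r ?addr0 ?add0r.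
  by move: c ca {b12 b23 b31 br1} => c ca; ein_cases; lra.
- apply: (Einstein_table dim4 (r30 := [:: 0; b]) (r31 := [:: b])
    (r32 := [::]) frm br1 _ hE).
    by split; rewrite /combine4 /= ?b41 ?b42 ?b43 !scale0r ?addr0 ?add0r.
  by move: c ca {b12 b23 b31 br1} => c ca; ein_cases; lra.
apply: (Einstein_table dim4 (r30 := [:: 0; 1]) (r31 := [:: 1; 0; 1])
    (r32 := [:: 0; -1]) frm br1 _ hE).
  by split; rewrite /combine4 /= ?b41 ?b42 ?b43 !scale0r ?scale1r ?scaleN1r ?addr0 ?add0r.
by move: c ca {b12 b23 b31 br1} => c ca; ein_cases; lra.
Qed.

Lemma case_A_listed : case_A G -> iso_to_listed g.
Proof.
case=> _ _ [n [ideal [[pos una] | [_ una] | [_ una] | [_ una]]]].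
- case: una => e1 [e2 [e3 [a una]]].
  have [X [frm ab]] := unit_normal_frame ideal una.
  rewrite diag_L1E => /acts_by3; rewrite !scale0r !(add0r, addr0).
  exact: (iso_rotation (frame_basis dim4 frm) ab).
- case: una => e1 [e2 [e3 [s [s0 _ una]]]].
  have [X [frm ab]] := unit_normal_frame ideal una.
  move=> /acts_by3; rewrite !scale0r !(add0r, addr0).
  exact: (iso_M3 (frame_basis dim4 frm) ab s0).
- case: una => e1 [e2 [e3 [al [c [ac0 _ una]]]]].
  have [X [frm ab]] := unit_normal_frame ideal una.
  rewrite diag_L1E; set be := Num.sqrt _ => /acts_by3; rewrite !scale0r !(add0r, addr0).
  have p0 : 0 < al ^+ 2 + c ^+ 2 / 2.
    have pa := sqr_ge0 al; have pc := sqr_ge0 c.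
    rewrite lt_def addr_ge0 ?divr_ge0 // andbT; apply: contra_neq ac0 => e.
    by congr pair; apply: sqr_le0; lra.
  apply: (iso_spiral (frame_basis dim4 frm) ab); first by rewrite sqrtr_gt0.
  by rewrite sqr_sqrtr // ltW.
case: una => e1 [e2 [e3 [X [bas [_ _ n3] [_ n5 _ n7 _] [n9 _] act]]]].
have {act} [a [b1 [b2 [alt /acts_by3]]]] := act; rewrite !scale0r !(add0r, addr0).
have ab := ideal_abelian ideal bas.
apply: (iso_null _ ab alt); apply: (hyperplane_basis dim4 ideal bas).
apply/negP; rewrite -(span_basis bas) => /span3P[x [y [z XE]]].
move: n3; rewrite XE !metricE (metricC _ e3 e1) (metricC _ e3 e2) n5 n7 n9.
by rewrite !mulr0 !addr0 => /eqP; rewrite eq_sym oner_eq0.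
Qed.

End Converse.

(** * Metrics on the listed algebras *)

Section DiagonalMetric.
Variables (R : realType) (g : lieAlgebra R) (b : 4.-tuple g) (eps : nat -> R) (a : R).
Local Notation x_ i x := (coord b (inord i) x).

Definition diagonal_metric (x y : g) : R := \sum_(i < 4) eps i * coord b i x * coord b i y.

Lemma diagonal_metricC x y : diagonal_metric x y = diagonal_metric y x.
Proof. by apply: eq_bigr => i _; rewrite mulrAC. Qed.

Lemma diagonal_metricP c x x' y :
  diagonal_metric (c *: x + x') y = c * diagonal_metric x y + diagonal_metric x' y.
Proof.
rewrite mulr_sumr -big_split; apply: eq_bigr => i _.
by rewrite linearP /=; ring.
Qed.

Lemma diagonal_metric_bilinear : bilinear_for
  (GRing.Scale.Law.clone _ _ *%R _) (GRing.Scale.Law.clone _ _ (idfun \; *%R) _)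
  diagonal_metric.
Proof.
split=> [y|y] c x x'; first exact: diagonal_metricP.
by rewrite !(diagonal_metricC y) diagonal_metricP.
Qed.

Lemma diagonal_metric_hermitian x y :
  diagonal_metric x y = (-1) ^+ false * idfun (diagonal_metric y x).
Proof. by rewrite expr0 mul1r diagonal_metricC. Qed.

Definition diagonal_symmetric : {symmetric g} := HB.pack diagonal_metric
  (bilinear_isBilinear.Build R g g R _ _ diagonal_metric diagonal_metric_bilinear)
  (isHermitianSesquilinear.Build R g false idfun diagonal_metric
     diagonal_metric_hermitian).

(** The form [a] times [e^{123}], with its determinant expanded so that closedness can be checked by
    [ring]. *)
Definition volume_form (x y z : g) : R :=
  a * (x_ 0 x * (x_ 1 y * x_ 2 z - x_ 2 y * x_ 1 z) -
       x_ 1 x * (x_ 0 y * x_ 2 z - x_ 2 y * x_ 0 z) +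
       x_ 2 x * (x_ 0 y * x_ 1 z - x_ 1 y * x_ 0 z)).

Definition volume_form3 : form3 g.
Proof.
by refine (@Form3 R g volume_form _ _ _ _ _) => [y z c x x' | x z c y y' | x y c z z' | x z | x z];
  rewrite /volume_form ?linearP /=; ring.
Defined.

End DiagonalMetric.

Section Models.
Variables (R : realType) (g : lieAlgebra R).
Hypothesis dim4 : \dim {:g} = 4%N.
Local Notation br := (@lie_br R g).
Local Notation D := (derived g).

Lemma diagonal_metric_exists (e1 e2 e3 e4 : g) (eps : nat -> R) a :
  basis_of {:g} [:: e1; e2; e3; e4] ->
  (forall i, (i < 4)%N -> eps i * eps i = 1) ->
  (forall x0 x1 x2 x3,
    ce_d3 (volume_form3 [tuple e1; e2; e3; e4] a) x0 x1 x2 x3 = 0) ->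
  exists G : gen_metric g, frame G id eps (vec4 e1 e2 e3 e4) /\
    [/\ Hc G (vec4 e1 e2 e3 e4) 0%N 1%N 2%N = a,
      Hc G (vec4 e1 e2 e3 e4) 3%N 1%N 2%N = 0,
      Hc G (vec4 e1 e2 e3 e4) 3%N 2%N 0%N = 0 &
      Hc G (vec4 e1 e2 e3 e4) 3%N 0%N 1%N = 0].
Proof.
set b := [tuple e1; e2; e3; e4] => bas ee closed.
have cb (i j : 'I_4) : coord b i (vec4 e1 e2 e3 e4 j) = (i == j)%:R.
  rewrite -[vec4 _ _ _ _ _]/(b`_j) (coord_free j i (basis_free bas)) eq_sym.
  by [].
have qb x (i : 'I_4) : diagonal_metric b eps x (vec4 e1 e2 e3 e4 i) = eps i * coord b i x.
  rewrite /diagonal_metric (bigD1 i) //= cb eqxx mulr1 big1 ?addr0 // => j ji.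
  by rewrite cb (negPf ji) mulr0.
have nd : nondegenerate (diagonal_symmetric b eps).
  rewrite /nondegenerate -subv0; apply/subvP => x /mem_orthovP x0; rewrite memv0.
  rewrite (coord_basis (X := b) bas (memvf x)) big1 ?eqxx // => i _.
  have := x0 (vec4 e1 e2 e3 e4 i) (memvf _); rewrite [LHS]qb => e.
  by rewrite -[coord b i x]mul1r -(ee i (ltn_ord i)) -mulrA e mulr0 scale0r.
pose G := GenMetric closed nd; exists G; split.
  split=> [i i4 | i j i4 j4]; first by split=> //; apply: ee.
  rewrite [LHS](qb _ (Ordinal j4)) -[vec4 _ _ _ _ i]/(vec4 e1 e2 e3 e4 (Ordinal i4)) cb.
  rewrite -val_eqE /=; case: eqP => [->|_]; first by rewrite mulr1.
  by rewrite mulr0.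
have c i j : (i < 4)%N -> (j < 4)%N ->
    coord b (inord i) (vec4 e1 e2 e3 e4 j) = (i == j)%:R.
  move=> i4 j4; rewrite -[j in LHS]/(nat_of_ord (Ordinal j4)) cb -val_eqE /=.
  by rewrite inordK.
split; rewrite /Hc /G /= /volume_form !c //=; ring.
Qed.

Lemma oframe_Lorentzian (G : gen_metric g) e0 d (e1 e2 e3 e4 : g) :
  (e0, d) = (-1, 1) :> R * R \/ (e0, d) = (1, -1) :> R * R ->
  frame G id (eps4 e0 1 1 d) (vec4 e1 e2 e3 e4) -> Lorentzian G.
Proof.
move=> ed frm; exists [:: e1; e2; e3; e4].
have [[n1 n2 n3 n4] _ _ _] := oframe_vec frm.
have N1 : (-1 == 1 :> R) = false by apply/negbTE; rewrite lt_eqF // (@lt_trans _ _ 0) ?ltrN10.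
split; first exact: (oframe_orthonormal dim4 frm).
  by rewrite /= dim4 n1 n2 n3 n4; case: ed => -[-> ->]; rewrite !eqxx N1.
by rewrite /= n1 n2 n3 n4; case: ed => -[-> ->]; rewrite !eqxx (eq_sym 1 (-1)) N1.
Qed.

(** The mask [m] marks the frame vectors that lie in g'; the others are orthogonal to all brackets.
    So g' is spanned by part of an orthonormal frame. *)
Lemma derived_nondegenerate (G : gen_metric g) eps k (m : nat -> bool) :
  frame G id eps k ->
  (forall i, (i < 4)%N -> m i -> k i \in D) ->
  (forall i j l, (i < 4)%N -> (j < 4)%N -> (l < 4)%N -> ~~ m l -> brc G k i j l = 0) ->
  nondegenerate_on G D.
Proof.
move=> frm mD mL; apply/nondegenerateP => x xD x0.
apply: (frame_ext dim4 frm) => l l4; rewrite metric0l.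
case ml: (m l); first exact/x0/mD.
have : (D <= orthov (gm_g G) <[k l]>)%VS.
  apply/span_subvP => z /allpairsP[[v w] [_ _ ->]] /=; rewrite mem_orthov1.
  rewrite (frame_expand dim4 frm v) (frame_expand dim4 frm w) /sum4 !brE !metricE.
  by rewrite -!/(brc G k _ _ _) !mL ?ml // !(mulr0, addr0).
by move/subvP/(_ x xD); rewrite mem_orthov1 => /eqP.
Qed.

Definition good_metric (G : gen_metric g) :=
  [/\ Lorentzian G, nondegenerate_on G D & gen_Einstein G 0].

(** The metric making the given basis orthonormal, with [H = 0]; [e0] and [d] choose between a
    timelike [e1] and a timelike [X]. The conditional with two zero branches is the three-form of
    [Einstein_table] at the value zero. *)
Lemma flat_model e1 e2 e3 X (e0 d : R) r0 r1 r2 (m : nat -> bool) :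
  (e0, d) = (-1, 1) :> R * R \/ (e0, d) = (1, -1) :> R * R ->
  basis_of {:g} [:: e1; e2; e3; X] ->
  [/\ br e1 e2 = 0, br e1 e3 = 0 & br e2 e3 = 0] ->
  let k := vec4 e1 e2 e3 X in
  [/\ br X e1 = combine4 k r0, br X e2 = combine4 k r1 & br X e3 = combine4 k r2] ->
  (forall i, (i < 4)%N -> m i -> k i \in D) ->
  (forall l, (l < 4)%N -> ~~ m l -> [/\ r0`_l = 0, r1`_l = 0 & r2`_l = 0]) ->
  (forall x y, (x < 4)%N -> (y < 4)%N -> ein id (eps4 e0 1 1 d)
    (alt2 (fun i j l => eps4 e0 1 1 d l * (bracket_table [::] [::] [::] r0 r1 r2 i j)`_l))
    (alt3 (fun i _ _ => if i == 0%N then 0 else 0)) x y = 0) ->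
  exists G, good_metric G.
Proof.
move=> ed bas [b12 b13 b23] k bX mD mr E.
have [||G [frm hG]] := @diagonal_metric_exists _ _ _ _ (eps4 e0 1 1 d) 0 bas.
- by move=> [|[|[|[|//]]]] _ /=; case: ed => -[-> ->]; rewrite ?mulrNN mulr1.
- by move=> *; rewrite /ce_d3 /= /volume_form !mul0r; ring.
exists G; split; first exact: oframe_Lorentzian ed frm.
  apply: (derived_nondegenerate frm mD) => i j l i4 j4 l4 ml.
  have [z0 z1 z2] := mr l l4 ml.
  have [bX0 bX1 bX2] := bX.
  rewrite (alt2E _ (brcC G k)) //.
  have c r : gm_g G (combine4 k r) (k l) = eps4 e0 1 1 d l * r`_l.
    exact: metric_combine4 frm l4.
  case: i i4 => [|[|[|[|//]]]] _; case: j j4 => [|[|[|[|//]]]] _ //=;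
   rewrite /brc -?[k 0%N]/e1 -?[k 1%N]/e2 -?[k 2%N]/e3 -?[k 3%N]/X;
   rewrite ?bX0 ?bX1 ?bX2 ?c ?z0 ?z1 ?z2 ?b12 ?b23 ?(brC e3 e1) ?b13;
   by rewrite ?oppr0 ?mulr0 ?metric0l ?oppr0.
apply: (Einstein_table dim4 frm _ bX hG E).
rewrite /= b12 b23 (brC e3) b13 oppr0 /combine4 /= !scale0r !addr0.
by split.
Qed.

Let timelike0 : (-1, 1) = (-1, 1) :> R * R \/ (-1, 1) = (1, -1) :> R * R.
Proof. by left. Qed.

Let timelike3 : (1, -1) = (-1, 1) :> R * R \/ (1, -1) = (1, -1) :> R * R.
Proof. by right. Qed.

Lemma abelian_model (e1 e2 e3 X : g) :
  ad_basis e1 e2 e3 X [:: [:: 0; - 0; 0]; [:: 0; 0; 0]; [:: 0; 0; 0]] ->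
  exists G, good_metric G.
Proof.
case=> bas ab /acts_by3[x1 x2 x3].
apply: (@flat_model e1 e2 e3 X 1 (-1) [::] [::] [::] (fun=> false) timelike3 bas ab).
- by rewrite /combine4 /= x1 x2 x3 oppr0 !scale0r !addr0.
- by [].
- by move=> l _ _; rewrite nth_nil.
by ein_cases; ring.
Qed.

Lemma rotation_model (e1 e2 e3 X : g) :
  ad_basis e1 e2 e3 X [:: [:: 0; - 1; 0]; [:: 1; 0; 0]; [:: 0; 0; 0]] ->
  exists G, good_metric G.
Proof.
case=> bas ab /acts_by3[]; rewrite !scale0r !(addr0, add0r) scale1r => x1 x2 x3.
apply: (@flat_model e1 e2 e3 X 1 (-1) [:: 0; 1] [:: -1] [::] (fun i => i < 2)%N
  timelike3 bas ab).
- by rewrite /combine4 /= x1 x2 x3 !scale0r !(addr0, add0r) !scale1r.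
- case=> [|[|//]] _ _ /=; last by rewrite -x1 mem_derived.
  by rewrite -memvN -scaleN1r -x2 mem_derived.
- by case=> [|[|[|[|//]]]].
by ein_cases; ring.
Qed.

Lemma boost_model (e1 e2 e3 X : g) :
  ad_basis e1 e2 e3 X [:: [:: 0; 1; 0]; [:: 1; 0; 0]; [:: 0; 0; 0]] ->
  exists G, good_metric G.
Proof.
case=> bas ab /acts_by3[]; rewrite !scale0r !(addr0, add0r) !scale1r => x1 x2 x3.
apply: (@flat_model e1 e2 e3 X (-1) 1 [:: 0; 1] [:: 1] [::] (fun i => i < 2)%N
  timelike0 bas ab).
- by rewrite /combine4 /= x1 x2 x3 !scale0r !(addr0, add0r) !scale1r.
- by case=> [|[|//]] _ _ /=; [rewrite -x2 | rewrite -x1]; apply: mem_derived.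
- by case=> [|[|[|[|//]]]].
by ein_cases; ring.
Qed.

(** The hypothesis is the relation of (A3) after scaling the off-diagonal entry to one. It serves
    the family [A46] and, with [be = 1] and [al = 0], also [r31R]. *)
Lemma spiral_model (e1 e2 e3 X : g) (be al : R) : be ^+ 2 + al ^+ 2 / 2 = 1 ->
  ad_basis e1 e2 e3 X [:: [:: be; - 1; 0]; [:: 1; be; 0]; [:: 0; 0; al]] ->
  exists G, good_metric G.
Proof.
move=> ba [bas ab /acts_by3[]]; rewrite !scale0r !(addr0, add0r) !scale1r => x1 x2 x3.
have b1 : be ^+ 2 + 1 != 0 by rewrite gt_eqF // ltr_wpDl ?sqr_ge0.
apply: (@flat_model e1 e2 e3 X (-1) 1 [:: be; 1] [:: -1; be] [:: 0; 0; al]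
  (fun i => (i < 2)%N || (i == 2%N) && (al != 0)) timelike0 bas ab).
- by rewrite /combine4 /= x1 x2 x3 !scale0r !(addr0, add0r) !scale1r.
- case=> [|[|[|[|//]]]] _ /=.
  (* The block acting on [e1] and [e2] has determinant [be ^+ 2 + 1], so both vectors are
     combinations of brackets; [e3] is one exactly when [al] is nonzero. *)
  + move=> _; have e : be *: br X e1 - br X e2 = (be ^+ 2 + 1) *: e1.
      by rewrite x1 x2 scalerDr scaleN1r opprD opprK addrACA subrr addr0 scalerA
        -expr2 scalerDl scale1r.
    rewrite -[e1]scale1r -(mulVf b1) -scalerA -e.
    by rewrite memvZ // memvB ?memvZ // mem_derived.
  + move=> _; have e : br X e1 + be *: br X e2 = (be ^+ 2 + 1) *: e2.
      by rewrite x1 x2 scalerDr scaleN1r scalerN addrACA subrr add0r scalerA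
        -expr2 addrC scalerDl scale1r.
    rewrite -[e2]scale1r -(mulVf b1) -scalerA -e.
    by rewrite memvZ // memvD ?memvZ // mem_derived.
  + move=> al0; rewrite -[e3]scale1r -(mulVf al0) -scalerA -x3.
    by rewrite memvZ // mem_derived.
  by [].
- by case=> [|[|[|[|//]]]] //= _; rewrite negbK => /eqP.
by ein_cases; lra.
Qed.

(** The bracket in coordinates is a cross product with one sign changed; this form lets [ring]
    verify that the volume form of the simple factor is closed. *)
Lemma so_coord ka (e1 e2 e3 Z : g) : so_sum_basis ka e1 e2 e3 Z ->
  let c (i : nat) x := coord [tuple e1; e2; e3; Z] (inord i) x in
  forall x y, [/\ c 0%N (br x y) = ka * (c 1%N x * c 2%N y - c 2%N x * c 1%N y),
    c 1%N (br x y) = c 2%N x * c 0%N y - c 0%N x * c 2%N y &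
    c 2%N (br x y) = c 0%N x * c 1%N y - c 1%N x * c 0%N y].
Proof.
case=> bas [b12 b23 b31] [z1 z2 z3] c x y.
have fr := basis_free bas.
have xE v : v = c 0%N v *: e1 + c 1%N v *: e2 + c 2%N v *: e3 + c 3%N v *: Z.
  rewrite {1}(coord_basis (X := [tuple e1; e2; e3; Z]) bas (memvf v)).
  rewrite !big_ord_recl big_ord0 /= addr0 !addrA /c.
  by do 3?congr (_ + _); congr (coord _ _ _ *: _); apply: val_inj; rewrite /= inordK.
have ce (i : 'I_4) (j : nat) (j4 : (j < 4)%N) :
    coord [tuple e1; e2; e3; Z] i [:: e1; e2; e3; Z]`_j = (j == i)%:R.
  exact: (coord_free (Ordinal j4) i fr).
have c1 i : coord [tuple e1; e2; e3; Z] i e1 = (0%N == i)%:R by apply: (ce i 0%N).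
have c2 i : coord [tuple e1; e2; e3; Z] i e2 = (1%N == i)%:R by apply: (ce i 1%N).
have c3 i : coord [tuple e1; e2; e3; Z] i e3 = (2%N == i)%:R by apply: (ce i 2%N).
have cD i u v : c i (u + v) = c i u + c i v by apply: linearD.
have cZ i t v : c i (t *: v) = t * c i v by apply: linearZ.
have cN i v : c i (- v) = - c i v by apply: linearN.
have c0 i : c i 0 = 0 by apply: linear0.
have -> : br x y =
    br (c 0%N x *: e1 + c 1%N x *: e2 + c 2%N x *: e3 + c 3%N x *: Z)
       (c 0%N y *: e1 + c 1%N y *: e2 + c 2%N y *: e3 + c 3%N y *: Z) by rewrite -!xE.
rewrite !brE !brxx (brC e2 e1) (brC e3 e2) (brC e1 e3).
rewrite (brC Z e1) (brC Z e2) (brC Z e3) b12 b23 b31 z1 z2 z3 oppr0.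
rewrite !(cD, cZ, cN, c0) -!/(c _ _).
have [u0 u1 u2] : [/\ c 0%N e1 = 1, c 1%N e1 = 0 & c 2%N e1 = 0].
  by rewrite /c !c1 !inordK.
have [v0 v1 v2] : [/\ c 0%N e2 = 0, c 1%N e2 = 1 & c 2%N e2 = 0].
  by rewrite /c !c2 !inordK.
have [w0 w1 w2] : [/\ c 0%N e3 = 0, c 1%N e3 = 0 & c 2%N e3 = 1].
  by rewrite /c !c3 !inordK.
by rewrite u0 u1 u2 v0 v1 v2 w0 w1 w2; split; ring.
Qed.

(** The case (B) with [a = 1], [eps = 1] and trivial action of the central vector [Z], which is
    timelike for [ka = 1]; for [ka = -1] the timelike vector is [e1]. *)
Lemma so_model ka (e1 e2 e3 Z : g) : ka = 1 \/ ka = -1 -> so_sum_basis ka e1 e2 e3 Z ->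
  exists G, good_metric G.
Proof.
move=> kaE bas'; have [bas [b12 b23 b31] [z1 z2 z3]] := bas'.
have [e0 [d [ed e0ka]]] : exists e0 d, ((e0, d) = (-1, 1) :> R * R \/
    (e0, d) = (1, -1) :> R * R) /\ e0 = ka.
  by case: kaE => ->; [exists 1, (-1) | exists (-1), 1]; split=> //.
have [||G [frm hG]] := @diagonal_metric_exists _ _ _ _ (eps4 e0 1 1 d) 1 bas.
- by move=> [|[|[|[|//]]]] _ /=; case: ed => -[-> ->]; rewrite ?mulrNN mulr1.
- move=> x0 x1 x2 x3; rewrite /ce_d3 /= /volume_form.
  have cb x y := so_coord bas' x y.
  do ![match goal with |- context [lie_br ?x ?y] => have [-> -> ->] := cb x y end].
  ring.
have br1 : [/\ br e1 e2 = combine4 (vec4 e1 e2 e3 Z) [:: 0; 0; 1],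
   br e2 e3 = combine4 (vec4 e1 e2 e3 Z) [:: ka] &
   br e3 e1 = combine4 (vec4 e1 e2 e3 Z) [:: 0; 1]].
  by rewrite /combine4 /= b12 b23 b31 !scale0r !(addr0, add0r) !scale1r.
have br2 : [/\ br Z e1 = combine4 (vec4 e1 e2 e3 Z) [::],
   br Z e2 = combine4 (vec4 e1 e2 e3 Z) [::] &
   br Z e3 = combine4 (vec4 e1 e2 e3 Z) [::]].
  by rewrite /combine4 /= (brC Z e1) (brC Z e2) (brC Z e3) z1 z2 z3 !scale0r !addr0 oppr0.
exists G; split; first exact: oframe_Lorentzian ed frm.
  apply: (@derived_nondegenerate G _ _ (fun i => i < 3)%N frm).
    have ka0 : ka != 0 by case: kaE => ->; rewrite ?oppr_eq0 oner_eq0.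
    case=> [|[|[|//]]] _ _ /=; [ | by rewrite -b31 mem_derived | by rewrite -b12 mem_derived].
    by rewrite -[e1]scale1r -(mulVf ka0) -scalerA -b23 memvZ // mem_derived.
  move=> i j l i4 j4 l4 l3; rewrite (alt2E _ (brcC G _)) //.
  have c r : gm_g G (combine4 (vec4 e1 e2 e3 Z) r) (vec4 e1 e2 e3 Z l) = eps4 e0 1 1 d l * r`_l.
    exact: metric_combine4 frm l4.
  case: br1 => B1 B2 B3; case: br2 => B4 B5 B6.
  case: l l4 l3 c => [|[|[|[|//]]]] _ // _ c.
  by case: i i4 => [|[|[|[|//]]]] _; case: j j4 => [|[|[|[|//]]]] _ //=;
    rewrite /brc /= ?B1 ?B2 ?B3 ?B4 ?B5 ?B6 c mulr0 ?oppr0.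
apply: (Einstein_table dim4 frm br1 br2 hG); rewrite e0ka.
have dE : d = - ka by case: ed => -[e0E ->]; rewrite -e0ka e0E ?opprK.
by rewrite dE; case: kaE => ->; ein_cases; ring.
Qed.

End Models.

Theorem theorem5p1 (R : realType) (g : lieAlgebra R) (dim4 : \dim {:g} = 4%N) :
  (forall G : gen_metric g,
     Lorentzian G -> nondegenerate_on G (derived g) ->
     (gen_Einstein G 0 <-> case_A G \/ case_B G)) /\
  ((exists G : gen_metric g,
     [/\ Lorentzian G, nondegenerate_on G (derived g) & gen_Einstein G 0]) <->
   iso_to_listed g).
Proof.
split=> [G lorG ndD | ].
  split; first exact: Einstein_cases.
  by case=> [|[]]; [apply: case_A_Einstein | apply: case_B1_Einstein | apply: case_B2_Einstein].
split=> [[G [lorG ndD Ein]] | ].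
  have [cA | [[iso _ _ _] | [iso _ _ _]]] := Einstein_cases dim4 lorG ndD Ein.
  - exact: case_A_listed cA.
  - by do 5!right; left.
  by do 6!right.
case=> [iso | [iso | [iso | [[phi iso] | [iso | [iso | iso]]]]]].
- have [e1 [e2 [e3 [X bas]]]] := ad_basis_pullback iso (ab_ad_basis R).
  exact: abelian_model bas.
- have [e1 [e2 [e3 [X bas]]]] := ad_basis_pullback iso (e2R_ad_basis R).
  exact: rotation_model bas.
- have [e1 [e2 [e3 [X bas]]]] := ad_basis_pullback iso (e11R_ad_basis R).
  exact: boost_model bas.
- have [e1 [e2 [e3 [X bas]]]] := ad_basis_pullback iso (A46_ad_basis _ _).
  apply: spiral_model bas => //.
  (* The factor [Num.sqrt 2] in the parameter of [A46] turns the relation required by the model into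
     the identity for sine and cosine. *)
  by rewrite exprMn sqr_sqrtr // mulrAC divff ?pnatr_eq0 // mul1r addrC cos2Dsin2.
- have [e1 [e2 [e3 [X bas]]]] := ad_basis_pullback iso (r31R_ad_basis R).
  by apply: spiral_model bas => //; rewrite expr1n expr0n mul0r addr0.
- have [f1 [f2 [f3 fB]]] := so3_basis R.
  have [e1 [e2 [e3 [Z bas]]]] := so_sum_basis_pullback iso (so_sum_basis_sum fB).
  by apply: so_model bas => //; left.
have [f1 [f2 [f3 fB]]] := so21_basis R.
have [e1 [e2 [e3 [Z bas]]]] := so_sum_basis_pullback iso (so_sum_basis_sum fB).
by apply: so_model bas => //; right.
Qed.
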